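(* Let $f:\mathbb D\to\mathbb D$ be analytic with factorization $f=EBS_\nu$, where $E$ is outer, $B$ is a Blaschke product and $S_\nu$ is the singular inner function associated to the positive singular measure $\nu$ on $\partial\mathbb D$ (unimodular constants absorbed). Define the positive measure on $\overline{\mathbb D}$ $$\mu=\sum_{z\in\mathbb D: f(z)=0}(1-|z|^2)\delta_z+2\nu+2\log|f|^{-1}\,dm,$$ (zeros counted with multiplicity, $|f|$ on $\partial\mathbb D$ denoting the modulus of the radial boundary values), and $$P[\mu](z)=\int_{\overline{\mathbb D}}\frac{1-|z|^2}{|1-\overline w z|^2}\,d\mu(w),\qquad z\in\mathbb D.$$ The following are equivalent: (a) $f$ is contractive. (b) There is a constant $C>0$ such that for every Carleson box $Q$ with $P[\mu](z_Q)\le C$ one has $\dfrac{\mu(\overline Q)}{l(Q)}\ge C\,P[\mu](z_Q)$.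
   Context: $\mathbb D$ is the open unit disc, $m$ normalized Lebesgue measure on $\partial\mathbb D$, $|I|=m(I)$ for arcs $I$. The Carleson box of an arc $I$ is $Q=Q(I)=\{z\in\mathbb D:1-|z|\le|I|,\ z/|z|\in I\}$, with $l(Q)=|I|$; $\overline Q$ is its closure in $\overline{\mathbb D}$; $\xi_Q$ is the center of the arc $\overline Q\cap\partial\mathbb D$ and $z_Q=(1-l(Q))\xi_Q$. For analytic $f:\mathbb D\to\mathbb D$, $D_h(f)(z)=\frac{(1-|z|^2)|f'(z)|}{1-|f(z)|^2}$, and $f$ is contractive if $\sup_{z\in\mathbb D}D_h(f)(z)<1$. *)

(* Defs.v *)
From HB Require Import structures.
From mathcomp Require Import all_boot all_order all_algebra.
From mathcomp Require Import all_classical all_reals all_analysis.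
From mathcomp Require Import complex.
Import Order.TTheory GRing.Theory Num.Theory.
Import numFieldNormedType.Exports.

Set Implicit Arguments.
Unset Strict Implicit.
Unset Printing Implicit Defensive.

Local Open Scope ring_scope.
Local Open Scope complex_scope.
Local Open Scope classical_set_scope.

Definition CC (R : realType) : numClosedFieldType := R[i].
Notation Cx R := (Num.ClosedField.sort (CC R)).

Section defs.
Context {R : realType}.
Local Notation C := (Cx R).
Local Notation leb := (@lebesgue_measure R).

Definition I01 : set R := `[0, 1[.

Definition modc (z : C) : R := complex.Re `|z|.

(* the point e^{2 pi i t} of the unit circle; the circle is parametrized by
   t in [0,1[, so that normalized arc length m is Lebesgue measure on [0,1[ *)
Definition expi (t : R) : C := (cos (2 * pi * t)) +i* (sin (2 * pi * t)).

Definition cexp (w : C) : C :=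
  (expR (complex.Re w) * cos (complex.Im w)) +i* (expR (complex.Re w) * sin (complex.Im w)).

Definition cint (mu : {measure set (measurableTypeR R) -> \bar R})
    (g : R -> C) : C :=
  (\int[mu]_(t in I01) complex.Re (g t)) +i* (\int[mu]_(t in I01) complex.Im (g t)).

Definition herglotz (z : C) (t : R) : C := (expi t + z) / (expi t - z).

Definition analytic_self_map (f : C -> C) : Prop :=
  forall z : C, `|z| < 1 -> derivable f z 1 /\ `|f z| < 1.

Definition Dh (f : C -> C) (z : C) : R :=
  (1 - modc z ^+ 2) * modc (derive1 f z) / (1 - modc (f z) ^+ 2).

Definition contractive (f : C -> C) : Prop :=
  (ereal_sup [set (Dh f z)%:E | z in [set z : C | (`|z| < 1)%R]] < 1)%E.

(* outer function: E = c exp( int (xi+z)/(xi-z) h(xi) dm(xi) ), |c| = 1,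
   h (= log of the modulus) real and integrable on the circle *)
Definition is_outer (E : C -> C) : Prop :=
  exists (c : C) (h : R -> R),
    `|c| = 1 /\ leb.-integrable I01 (EFin \o h) /\
    forall z : C, `|z| < 1 ->
      E z = c * cexp (cint leb (fun t => herglotz z t * (h t)%:C)).

(* Blaschke factor for a zero a != 0; the value a = 0 is used as padding
   (factor 1), zeros at the origin being accounted for by z^k *)
Definition bfactor (a z : C) : C :=
  if a == 0 then 1 else (`|a| / a) * ((a - z) / (1 - a^* * z)).

Definition is_blaschke (B : C -> C) : Prop :=
  exists (c : C) (k : nat) (a : nat -> C),
    `|c| = 1 /\ (forall n, `|a n| < 1) /\
    (\sum_(0 <= n <oo) (if a n == 0 then 0 else 1 - modc (a n))%:E < +oo)%E /\
    forall z : C, `|z| < 1 ->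
      (fun N : nat => c * z ^+ k * \prod_(n < N) bfactor (a n) z) @ \oo
        --> B z.

(* positive (finite) singular Borel measure on the circle, transported to
   the parameter t in [0,1[ *)
Definition singular_circle_measure
    (nu : {measure set (measurableTypeR R) -> \bar R}) : Prop :=
  (nu setT < +oo)%E /\ nu (~` I01) = 0%E /\
  exists A : set (measurableTypeR R),
    measurable A /\ leb A = 0%E /\ nu (~` A) = 0%E.

Definition sing_inner (nu : {measure set (measurableTypeR R) -> \bar R})
    (z : C) : C :=
  cexp (- cint nu (herglotz z)).

Definition fstar (f : C -> C) (t : R) : C :=
  lim ((fun r : R => f (r%:C * expi t)) @ at_left 1).

Definition zmult (f : C -> C) (z : C) : \bar R :=
  esum [set k : nat | forall j : nat, (j <= k)%N -> iter j (fun g : C -> C => derive1 g) f z = 0]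
       (fun _ => 1%E).

Definition zero_part (f : C -> C) (g : C -> R) : \bar R :=
  esum [set z : C | `|z| < 1 /\ f z = 0]
    (fun z => (zmult f z * ((1 - modc z ^+ 2) * g z)%:E)%E).

Definition mu (f : C -> C) (nu : {measure set (measurableTypeR R) -> \bar R})
    (A : set C) : \bar R :=
  (zero_part f (\1_A)
   + 2%:E * nu (I01 `&` (expi @^-1` A))
   + 2%:E * \int[leb]_(t in I01 `&` (expi @^-1` A))
              (- ln (modc (fstar f t)))%:E)%E.

Definition pkernel (z w : C) : R :=
  (1 - modc z ^+ 2) / (modc (1 - w^* * z)) ^+ 2.

Definition Pmu (f : C -> C) (nu : {measure set (measurableTypeR R) -> \bar R})
    (z : C) : \bar R :=
  (zero_part f (pkernel z)
   + 2%:E * \int[nu]_(t in I01) (pkernel z (expi t))%:E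
   + 2%:E * \int[leb]_(t in I01)
              (pkernel z (expi t) * - ln (modc (fstar f t)))%:E)%E.

Definition arc (t0 l : R) : set C :=
  [set expi t | t in `[t0 - l / 2, t0 + l / 2]].

Definition cbox (t0 l : R) : set C :=
  [set z : C | `|z| < 1 /\ z != 0 /\ 1 - modc z <= l /\ arc t0 l (z / `|z|)].

Definition cbox_closure (t0 l : R) : set C := closure (cbox t0 l).

Definition zQ (t0 l : R) : C := (1 - l)%:C * expi t0.

End defs.

(* Main.v *)
(** Write [f = c b exp (- H)] with [b] the Blaschke product and [H] the Herglotz transform of
    [nu + log (1/|f|) dm], and let [P = P[mu]].  Then [1 - P <= |f|^2 <= exp (- P)], and
    [(1 - |z|^2) f'(z) / f(z)] is minus the [mu]-integral of [pkernel z w * rho z w], where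
    [rho z w = (1 - w z^* ) / (w - z)] has modulus [1] on the circle and modulus close to [1] at the
    zeros that are pseudo-hyperbolically far from [z].

    (a) => (b): if a box [Q] with small [P (z_Q)] carries too little mass, take [z] on the radius of
    [z_Q] much closer to the circle.  Outside [Q] the numbers [rho z w] all point in nearly the same
    direction, so [(1 - |z|^2) |f'(z)|] is almost [|f(z)| P(z)], which is almost [1 - |f(z)|^2].

    (b) => (a): if [z] is close to a zero [a], the box condition at a small box below [a] shows that
    the remaining mass is not negligible near [a]; hence [f] divided by the Blaschke factor of [a] is
    bounded away from [1] at [z], and the Schwarz-Pick inequality gains for the product.  If all zeros
    are far from [z], then [D_h f (z) <= (1 + o(1)) P exp (- P/2) / (1 - exp (- P))], which is enough
    when [P(z)] is bounded below; when it is small, two separated boxes below [z] carry a fixed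
    proportion of the mass, and [rho] takes separated values on them, so that there is cancellation.

    The measure in the definition of [P] involves the radial limits of [f]; their modulus is
    [exp h] for the datum [h] of the outer factor, because Poisson integrals converge radially at
    Lebesgue points and the mean of the inner factor over circles tends to [1]. *)

(* In (b) => (a) the Schwarz-Pick inequality is nearly sharp in two different regimes: close to a
   zero, where [f] may look like a disc automorphism, and where P is small, where 2j exp(-j) and 1 -
   exp(-2j) at j = P/2 agree to leading order. No single source of gain covers both, whence three
   cases: the remaining mass near a zero, the strict inequality for sinh when P is bounded below,
   the cancellation of [rho] when P is small. Zeros that are only moderately far cost a factor 1 +
   s, because [rho] is then bounded by 1 + s. The threshold on P and the two gains are therefore
   fixed first and s last; a zero counts as close when its share of P is at least s.

   In (a) => (b) the test point lies at depth e l below a box of size l, with e proportional to q,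
   one minus the contraction bound. Each comparison of the two points by Harnack costs 1/e, so the
   constant obtained is of order q^3.

   After [canonical_form] the measure survives only as a sequence of zeros and a positive functional
   on the circle. All analytic facts are proved for finite products and passed to the limit. *)
Require Import Defs.
From HB Require Import structures.
From mathcomp Require Import all_boot all_order all_algebra.
From mathcomp Require Import all_classical all_reals all_analysis.
From mathcomp Require Import measurable_realfun complex.
From mathcomp Require Import ring lra zify.
Import Order.TTheory GRing.Theory Num.Theory.
Import numFieldNormedType.Exports.
Set Implicit Arguments.
Unset Strict Implicit.
Unset Printing Implicit Defensive.
Local Open Scope ring_scope.
Local Open Scope complex_scope.
Local Open Scope classical_set_scope.

(** * The real-valued modulus on [C] *)

Section modulus.
Context {R : realType}.
Local Notation C := (Cx R).
Implicit Types (z w : C) (x y : R).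

Lemma modcE x y : modc (x +i* y : C) = Num.sqrt (x ^+ 2 + y ^+ 2).
Proof. by []. Qed.

Lemma norm_modc z : `|z| = (modc z)%:C.
Proof. by case: z. Qed.

Lemma modc_normc z : modc z = ComplexField.Normc.normc z.
Proof. by case: z. Qed.

Lemma modc_ge0 z : 0 <= modc z.
Proof. by case: z => a b; rewrite modcE sqrtr_ge0. Qed.

Lemma sqr_modc z : modc z ^+ 2 = complex.Re z ^+ 2 + complex.Im z ^+ 2.
Proof. by case: z => a b; rewrite modcE sqr_sqrtr //= addr_ge0 ?sqr_ge0. Qed.

Lemma modcM z w : modc (z * w) = modc z * modc w.
Proof. by rewrite !modc_normc ComplexField.Normc.normcM. Qed.

Lemma modcV z : modc z^-1 = (modc z)^-1.
Proof. by rewrite !modc_normc ComplexField.Normc.normcV. Qed.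

Lemma modc_div z w : modc (z / w) = modc z / modc w.
Proof. by rewrite modcM modcV. Qed.

Lemma modc_real x : modc (x%:C : C) = `|x|.
Proof. by rewrite modcE expr0n addr0 sqrtr_sqr. Qed.

Lemma modc0 : modc (0 : C) = 0.
Proof. by rewrite (modc_real 0) normr0. Qed.

Lemma modc1 : modc (1 : C) = 1.
Proof. by rewrite (modc_real 1) normr1. Qed.

Lemma modcN z : modc (- z) = modc z.
Proof. by rewrite /modc normrN. Qed.

Lemma modc_eq0 z : (modc z == 0) = (z == 0).
Proof. by rewrite -(normr_eq0 z) norm_modc eq_complex /= eqxx andbT. Qed.

Lemma modc_gt0 z : (0 < modc z) = (z != 0).
Proof. by rewrite lt_neqAle modc_ge0 andbT eq_sym modc_eq0. Qed.

Lemma modcX z n : modc (z ^+ n) = modc z ^+ n.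
Proof. by elim: n => [|n IH]; rewrite ?expr0 ?modc1 // !exprS modcM IH. Qed.

Lemma modc_conj z : modc z^*%C = modc z.
Proof. by case: z => a b; rewrite !modcE sqrrN. Qed.

Lemma ler_modcD z w : modc (z + w) <= modc z + modc w.
Proof.
have := ler_normD z w; rewrite !norm_modc -[X in _ <= X]rmorphD lecR //.
Qed.

Lemma ler_modcB z w : modc (z - w) <= modc z + modc w.
Proof. by rewrite -(modcN w) ler_modcD. Qed.

Lemma ler_modc_sub z w : modc z - modc w <= modc (z - w).
Proof. by rewrite lerBlDr (le_trans _ (ler_modcD _ _)) // subrK. Qed.

Lemma modc_distC z w : modc (z - w) = modc (w - z).
Proof. by rewrite -modcN opprB. Qed.

Lemma modc_sum I (s : seq I) (P : pred I) (F : I -> C) :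
  modc (\sum_(i <- s | P i) F i) <= \sum_(i <- s | P i) modc (F i).
Proof.
elim/big_rec2 : _ => [|i x z _ H]; first by rewrite modc0.
by apply: le_trans (ler_modcD _ _) _; rewrite lerD2l.
Qed.

Lemma ler_Re_modc z : complex.Re z <= modc z.
Proof.
case: z => a b; rewrite modcE /=; apply: le_trans (ler_norm _) _.
by rewrite -sqrtr_sqr ler_sqrt ?lerDl ?sqr_ge0 // addr_ge0 ?sqr_ge0.
Qed.

Lemma cReN z : complex.Re (- z) = - complex.Re z. Proof. by case: z. Qed.
Lemma cImN z : complex.Im (- z) = - complex.Im z. Proof. by case: z. Qed.
Lemma cReD z w : complex.Re (z + w) = complex.Re z + complex.Re w.
Proof. by case: z; case: w. Qed.
Lemma cImD z w : complex.Im (z + w) = complex.Im z + complex.Im w.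
Proof. by case: z; case: w. Qed.
Lemma cReM z w : complex.Re (z * w) =
  complex.Re z * complex.Re w - complex.Im z * complex.Im w.
Proof. by case: z; case: w. Qed.
Lemma cImM z w : complex.Im (z * w) =
  complex.Re z * complex.Im w + complex.Im z * complex.Re w.
Proof. by case: z; case: w. Qed.

Lemma ler_normRe_modc z : `|complex.Re z| <= modc z.
Proof. by rewrite ler_norml lerNl -cReN -{1}modcN !ler_Re_modc. Qed.

Lemma ler_normIm_modc z : `|complex.Im z| <= modc z.
Proof.
have := ler_normRe_modc (z * 'i%C); rewrite ReiNIm normrN modcM.
by rewrite (_ : modc 'i%C = 1) ?mulr1 // modcE expr0n add0r expr1n sqrtr1.
Qed.

Lemma ler_modc_ReIm z : modc z <= `|complex.Re z| + `|complex.Im z|.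
Proof.
rewrite -(ler_pXn2r (n := 2)) // ?nnegrE ?modc_ge0 ?addr_ge0 //.
rewrite sqr_modc sqrrD !real_normK ?num_real //.
by rewrite -addrA [X in _ <= _ + X]addrC lerD2l lerDl mulrn_wge0 // mulr_ge0.
Qed.

Lemma norm_lt1 z : (`|z| < 1) = (modc z < 1).
Proof. by rewrite norm_modc (ltcR _ 1). Qed.

Lemma norm_eq1 z : `|z| = 1 -> modc z = 1.
Proof. by rewrite norm_modc => -[]. Qed.

Lemma mul_conjc z : z * z^*%C = ((modc z ^+ 2)%:C : C).
Proof. by rewrite sqr_modc; case: z => a b; simpc; congr (_ +i* _); ring. Qed.

(* The topology of C is generated by balls of radius in C; the modulus lets us work with real radii. *)
Lemma cvgCP (T : Type) (F : set_system T) (FF : Filter F) (g : T -> C) (l : C) :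
  g @ F --> l <-> forall e : R, 0 < e -> \forall x \near F, modc (l - g x) < e.
Proof.
split=> [/cvgrPdist_lt H e e0|H].
  have := H e%:C; rewrite (ltcR 0) => /(_ e0).
  by apply: filterS => x; rewrite norm_modc ltcR.
apply/cvgrPdist_lt => -[e e'] /=; rewrite ltcE /= => /andP[/eqP -> e0].
have := H e e0; apply: filterS => x.
by rewrite norm_modc => h; rewrite ltcE /= eqxx.
Qed.

End modulus.

(** * Quantitative bounds for sine, cosine and the real exponential *)

Section trigonometry.
Context {R : realType}.
Implicit Types x y t : R.

Lemma sin_MVT x : 0 <= x -> exists2 c, 0 <= c <= x & sin x = cos c * x.
Proof.
move=> x0; have [|c] := @MVT_segment R sin cos 0 x x0 (fun y _ => is_derive_sin y).
  by apply/continuous_subspaceT => y; exact: continuous_sin.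
by rewrite in_itv /= subr0 sin0 subr0 => cx ->; exists c.
Qed.

Lemma ler_norm_sin x : `|sin x| <= `|x|.
Proof.
wlog x0 : x / 0 <= x => [H|].
  have [/H//|/ltW x0] := leP 0 x.
  by have := H (- x); rewrite sinN !normrN oppr_ge0; apply.
have [c _ ->] := sin_MVT x0.
by rewrite normrM ler_piMl // cos_max.
Qed.

Lemma one_sub_cos x : 1 - cos x = 2 * sin (x / 2) ^+ 2.
Proof.
have := cos_mulr2n (x / 2); rewrite [x / 2 *+ 2]mulr2n -splitr => ->.
by have := cos2Dsin2 (x / 2); lra.
Qed.

Lemma one_sub_cos_le x : 0 <= 1 - cos x <= x ^+ 2 / 2.
Proof.
rewrite subr_ge0 cos_le1 one_sub_cos /=.
have : sin (x / 2) ^+ 2 <= (x / 2) ^+ 2.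
  rewrite -real_normK ?num_real // -[leRHS]real_normK ?num_real //.
  by rewrite lerXn2r ?nnegrE // ler_norm_sin.
by move=> h; rewrite -ler_pdivlMl // (le_trans h) // expr_div_n; lra.
Qed.

Lemma sin_sub_id x : `|x| <= 1 -> `|sin x - x| <= x ^+ 2.
Proof.
wlog x0 : x / 0 <= x => [H|].
  have [/H//|/ltW x0] := leP 0 x; rewrite -normrN => h.
  by have := H (- x); rewrite sinN -opprD !normrN sqrrN oppr_ge0; apply; rewrite // -normrN.
rewrite ger0_norm // => x1.
have [c /andP[c0 cx] ->] := sin_MVT x0.
rewrite -[X in _ - X]mul1r -mulrBl -normrN -mulNr opprB normrM (ger0_norm x0).
have /andP[h1 h2] := one_sub_cos_le c.
rewrite ger0_norm //.
have cx2 : c ^+ 2 <= x ^+ 2 by rewrite lerXn2r ?nnegrE.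
nra.
Qed.

(** Since sin x = 2 sin(x/2) cos(x/2) and sin(x/2) = (x/2) cos c with c <= x/2, one gets sin x >= x
    cos(x/2)^2 = x (1 + cos x)/2, and cos x >= 0 on this interval. *)
Lemma sin_ge_half x : 0 <= x <= pi / 2 -> x / 2 <= sin x.
Proof.
move=> /andP[x0 xpi].
have x20 : 0 <= x / 2 by lra.
have xb : - (pi / 2) <= x <= pi / 2 by have := @pi_ge0 R; lra.
have := sin_mulr2n (x / 2); rewrite [x / 2 *+ 2]mulr2n -splitr => ->.
have [c /andP[c0 cx] ->] := sin_MVT x20.
have cosx : 0 <= cos x by apply: cos_ge0_pihalf.
have h : 1 / 2 <= cos (x / 2) ^+ 2.
  by have := one_sub_cos x; rewrite sin2cos2; lra.
have cx2 : 0 <= cos (x / 2).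
  by apply: cos_ge0_pihalf; lra.
have hc : cos (x / 2) <= cos c.
  by rewrite leNgt ltr_cos ?in_itv /= -?leNgt //; lra.
have : 1 / 2 <= cos (x / 2) * cos c.
  by apply: le_trans h _; rewrite expr2 ler_wpM2l.
move=> h3; have := ler_wpM2r x20 h3; rewrite -[X in _ -> _ <= X]mulr_natr; lra.
Qed.

(** The tangent bound at -x gives exp x <= 1/(1 - x). The product of 1 - x and 1 + x + 2x^2 exceeds
    1 by x^2 (1 - 2x), whence the restriction on x. *)
Lemma expR_sub_le x : `|x| <= 1 / 2 -> 0 <= expR x - 1 - x <= 2 * x ^+ 2.
Proof.
rewrite ler_norml => /andP[x1 x2].
have h1 := expR_ge1Dx x; have h2 := expR_ge1Dx (- x).
rewrite subr_ge0 lerBrDr addrC h1 /=.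
have e0 := expR_gt0 x.
have h3 : expR x * expR (- x) = 1 by rewrite expRxMexpNx_1.
have h4 : expR x * (1 - x) <= 1 by rewrite -[leRHS]h3 ler_wpM2l // ltW.
have : (1 - x) * expR x <= (1 - x) * (1 + x + 2 * x ^+ 2) by nra.
rewrite ler_pM2l; last by lra.
lra.
Qed.

Lemma expR_ge_quad x : 0 <= x -> 1 + x + x ^+ 2 / 2 <= expR x.
Proof.
move=> x0.
have := @nondecreasing_cvgn_le R (series (exp_coeff x)) _ (is_cvg_series_exp_coeff x) 3%N.
rewrite /series /= !big_nat_recr //= big_geq // add0r /exp_coeff /=.
rewrite expr0 fact0 expr1 !factS fact0 !muln1 !divr1 => -> //.
apply/nondecreasing_seqP => n; rewrite /series /= big_nat_recr //= lerDl.
by rewrite exp_coeff_ge0.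
Qed.

(** With A = 1 + x + x^2/2 <= exp x, the difference is at least A - 1/A, which equals 2x + x^4/(4A)
    exactly. The excess over 2x is the source of the gain in the case of large mass. *)
Lemma sinh_ge x : 0 <= x ->
  2 * x + x ^+ 4 / (4 * (1 + x + x ^+ 2 / 2)) <= expR x - expR (- x).
Proof.
move=> x0; set A := 1 + x + x ^+ 2 / 2.
have A1 : 1 <= A by rewrite /A; nra.
have A0 : 0 < A by lra.
have h := expR_ge_quad x0; rewrite -/A in h.
have h2 : expR (- x) <= A^-1 by rewrite expRN lef_pV2 ?posrE ?expR_gt0.
suff -> : 2 * x + x ^+ 4 / (4 * A) = A - A^-1 by lra.
by rewrite /A; field; rewrite -/A; apply/lt0r_neq0; nra.
Qed.

End trigonometry.

(** * The parametrised unit circle *)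

Section circle.
Context {R : realType}.
Local Notation C := (Cx R).
Implicit Types (t s : R) (z w : C).

Lemma modc_expi t : modc (expi t) = 1.
Proof. by rewrite /expi modcE cos2Dsin2 sqrtr1. Qed.

Lemma expi_neq0 t : expi t != 0 :> C.
Proof. by rewrite -modc_eq0 modc_expi oner_eq0. Qed.

Lemma expiD t s : expi (t + s) = expi t * expi s.
Proof.
rewrite /expi mulrDr cosD sinD; simpc; congr (_ +i* _).
by rewrite addrC mulrC [X in _ + X]mulrC [X in X + _]mulrC addrC.
Qed.

Lemma expi0 : expi 0 = 1 :> C.
Proof. by rewrite /expi mulr0 cos0 sin0. Qed.

Lemma expiN t : expi (- t) = (expi t)^*%C.
Proof. by rewrite /expi mulrN cosN sinN. Qed.

Lemma expi_conjM t : (expi t)^*%C * expi t = 1.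
Proof. by rewrite -expiN -expiD addNr expi0. Qed.

Lemma expiV t : (expi t)^-1 = (expi t)^*%C.
Proof. by apply: (mulIf (expi_neq0 t)); rewrite expi_conjM mulVf ?expi_neq0. Qed.

Lemma expiX t n : expi t ^+ n = expi (n%:R * t).
Proof.
elim: n => [|n IH]; first by rewrite mul0r expi0.
by rewrite exprS IH -expiD -[X in X + _]mul1r -mulrDl nat1r.
Qed.

Lemma expi_periodic t n : expi (t + n%:R) = expi t.
Proof.
elim: n => [|n IH]; first by rewrite addr0.
rewrite -natr1 addrA expiD IH -[RHS]mulr1; congr (_ * _).
by rewrite /expi mulr1 mulr_natl cos2pi sin2pi.
Qed.

Lemma expi_floor t : exists2 s, s \in `[0, 1[%R & expi s = expi t.
Proof.
exists (t - (Num.floor t)%:~R).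
  by rewrite in_itv /= subr_ge0 Num.Theory.floor_le_tmp ltrBlDr addrC -intrD1 Num.Theory.floorD1_gt.
have : (Num.floor t)%:~R = (Num.floor t)%:~R :> R by [].
case: (Num.floor t) => n _.
  by rewrite -(expi_periodic (t - n%:~R) n) subrK.
by rewrite NegzE mulrNz opprK expi_periodic.
Qed.

Lemma expi_surj w : modc w = 1 -> exists2 t, t \in `[0, 1[%R & w = expi t.
Proof.
case: w => a b; rewrite modcE => ab.
have {}ab : a ^+ 2 + b ^+ 2 = 1.
  by rewrite -[LHS]sqr_sqrtr ?ab ?expr1n // addr_ge0 ?sqr_ge0.
suff [t wt] : exists t, (a +i* b : C) = expi t.
  by have [s s01 st] := expi_floor t; exists s => //; rewrite st.
have a1 : -1 <= a <= 1 by rewrite -ler_norml -(expr_le1 (n := 2)) // real_normK ?num_real //; nra.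
have pi0 : 2 * pi != 0 :> R by rewrite mulf_neq0 ?pnatr_eq0 // gt_eqF // pi_gt0.
have ca : cos (acos a) = a by rewrite acosK.
have := sin_acos a1.
have -> : 1 - a ^+ 2 = b ^+ 2 by lra.
rewrite sqrtr_sqr => sa.
have [b0|b0] := leP 0 b.
  exists (acos a / (2 * pi)); rewrite /expi mulrC divfK // ca sa ger0_norm //.
exists (- acos a / (2 * pi)).
by rewrite /expi mulrC divfK // cosN sinN ca sa ltr0_norm // opprK.
Qed.

Lemma modc_expi_sub1 t : modc (expi t - 1) = 2 * `|sin (pi * t)|.
Proof.
apply: (@pexpIrn _ 2) => //; rewrite ?nnegrE ?modc_ge0 ?mulr_ge0 //.
rewrite sqr_modc exprMn real_normK ?num_real //.
rewrite /expi cReD cImD /= oppr0 addr0.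
have h : cos (2 * pi * t) = 1 - 2 * sin (pi * t) ^+ 2.
  have := one_sub_cos (2 * pi * t); have -> : 2 * pi * t / 2 = pi * t by field.
  lra.
have := cos2Dsin2 (2 * pi * t); nra.
Qed.

Lemma modc_expi_sub t s : modc (expi t - expi s) = 2 * `|sin (pi * (t - s))|.
Proof.
rewrite -modc_expi_sub1; have -> : expi t - expi s = (expi (t - s) - 1) * expi s :> C.
  by rewrite mulrBl -expiD subrK mul1r.
by rewrite modcM modc_expi mulr1.
Qed.

Lemma expi_lipschitz t s : modc (expi t - expi s) <= 8 * `|t - s|.
Proof.
rewrite modc_expi_sub; apply: (@le_trans _ _ (2 * `|pi * (t - s)|)).
  by rewrite ler_pM2l ?ler_norm_sin.
rewrite normrM (ger0_norm (pi_ge0 R)) mulrA ler_wpM2r //.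
by have := @pihalf_lt2 R; lra.
Qed.

(** The chord is 2 sin(pi |t - s|), and [sin_ge_half] applies as long as the two parameters are at
    most half a turn apart; then pi >= 2 gives the constant. *)
Lemma expi_sub_ge t s : `|t - s| <= 1 / 2 -> 2 * `|t - s| <= modc (expi t - expi s).
Proof.
wlog h : t s / s <= t => [H|].
  have [/H//|/ltW h] := leP s t.
  by rewrite distrC modc_distC; exact: H.
rewrite modc_expi_sub ger0_norm ?subr_ge0 // => ts.
rewrite ler_pM2l //; apply: le_trans (ler_norm _).
have p2 := @pi_ge2 R.
apply: le_trans (_ : pi * (t - s) / 2 <= _); first nra.
by apply: sin_ge_half; apply/andP; split; nra.
Qed.

End circle.

(** * The complex exponential and its second-order remainder *)

Section complex_exponential.
Context {R : realType}.
Local Notation C := (Cx R).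
Implicit Types (z w : C).

Lemma modc_cexp w : modc (cexp w) = expR (complex.Re w).
Proof.
rewrite /cexp modcE !exprMn -mulrDr cos2Dsin2 mulr1 sqrtr_sqr ger0_norm // expR_ge0.
Qed.

Lemma cexp_neq0 w : cexp w != 0.
Proof. by rewrite -modc_gt0 modc_cexp expR_gt0. Qed.

Lemma cexpD z w : cexp (z + w) = cexp z * cexp w.
Proof.
by rewrite /cexp cReD cImD expRD cosD sinD; simpc; congr (_ +i* _); ring.
Qed.

Lemma cexp0 : cexp 0 = 1 :> C.
Proof. by rewrite /cexp /= expR0 cos0 sin0; simpc. Qed.

Lemma cexpMn w n : cexp (w *+ n) = cexp w ^+ n.
Proof. by elim: n => [|n IH]; rewrite ?mulr0n ?cexp0 // mulrS cexpD IH exprS. Qed.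

Lemma cexp_sub1 w : modc w <= 1 / 2 -> modc (cexp w - 1 - w) <= 8 * modc w ^+ 2.
Proof.
move=> w2.
apply: le_trans (ler_modc_ReIm _) _; move: w2.
have := ler_normRe_modc w; have := ler_normIm_modc w; have := sqr_modc w; move: (modc w) => m.
case: w => x y /=; set X := `|_| + `|_| => hm ym xm m2.
have /andP[e1 e2] := @expR_sub_le _ x (le_trans xm m2).
have /andP[c1 c2] := @one_sub_cos_le _ y.
have s1 : `|sin y - y| <= y ^+ 2 by apply: sin_sub_id; lra.
have /andP[xa xb] : - m <= x <= m by rewrite -ler_norml.
have /andP[ya yb] : - m <= y <= m by rewrite -ler_norml.
have eb : expR x <= 2 by nra.
have e0 := expR_gt0 x.
have h1 : `|expR x * cos y - 1 - x| <= 2 * x ^+ 2 + y ^+ 2.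
  rewrite ler_norml; apply/andP; split; nra.
have h2 : `|expR x * sin y - 0 - y| <= 4 * m ^+ 2.
  have -> : expR x * sin y - 0 - y = (expR x - 1) * sin y + (sin y - y) by ring.
  apply: le_trans (ler_normD _ _) _; rewrite normrM.
  have := ler_norm_sin y.
  have : `|expR x - 1| <= 2 * `|x|.
    have -> : expR x - 1 = (expR x - 1 - x) + x by ring.
    apply: le_trans (ler_normD _ _) _; rewrite (ger0_norm e1).
    have : x ^+ 2 = `|x| ^+ 2 by rewrite real_normK ?num_real.
    have := normr_ge0 x; nra.
  have y2 : y ^+ 2 <= m ^+ 2 by have := sqr_ge0 x; lra.
  have := normr_ge0 x; have := normr_ge0 y; have := normr_ge0 (sin y); have := normr_ge0 (expR x - 1).
  move: `|expR x - 1| `|sin y| `|y| `|x| ym xm => a b c d cm dm a0 b0 c0 d0 ad bc.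
  have : a * b <= 2 * d * c by rewrite ler_pM.
  nra.
rewrite /X; apply: le_trans (lerD h1 h2) _.
have := sqr_ge0 x; have := sqr_ge0 y; nra.
Qed.

End complex_exponential.

(** * Measures on the circle as bounded functionals *)

Section functionals.
Context {R : realType}.
Local Notation C := (Cx R).
Local Notation borelR := (measurableTypeR R).
Implicit Types (g : R -> R) (J : (R -> R) -> R).

Definition adm g := measurable_fun (I01 : set borelR) g /\
  exists b : R, forall t, I01 t -> `|g t| <= b.

(** Stands for integration against a signed measure on the circle whose total variation is at most
    [M]. Keeping only the functional lets one theory of Cauchy and Herglotz transforms serve [nu],
    the weight of the outer factor and their sums. *)
Definition bounded_functional J (M : R) := [/\
  forall g1 g2, adm g1 -> adm g2 -> J (fun t => g1 t + g2 t) = J g1 + J g2,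
  forall a g, adm g -> J (fun t => a * g t) = a * J g &
  forall g b, adm g -> (forall t, I01 t -> `|g t| <= b) -> `|J g| <= M * b].

Definition positive_functional J :=
  forall g, adm g -> (forall t, I01 t -> 0 <= g t) -> 0 <= J g.

Lemma measurable_I01 : measurable (I01 : set borelR).
Proof. exact: measurable_itv. Qed.

Lemma I01_0 : I01 (0 : R).
Proof. by rewrite /I01 /= in_itv /= lexx ltr01. Qed.

Lemma admD g1 g2 : adm g1 -> adm g2 -> adm (fun t => g1 t + g2 t).
Proof.
move=> [m1 [b1 h1]] [m2 [b2 h2]]; split; first exact: measurable_funD.
exists (b1 + b2) => t It; apply: le_trans (ler_normD _ _) _.
by rewrite lerD ?h1 ?h2.
Qed.

Lemma admM g1 g2 : adm g1 -> adm g2 -> adm (fun t => g1 t * g2 t).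
Proof.
move=> [m1 [b1 h1]] [m2 [b2 h2]]; split; first exact: measurable_funM.
by exists (b1 * b2) => t It; rewrite normrM ler_pM ?h1 ?h2.
Qed.

Lemma adm_cst a : adm (fun=> a).
Proof. by split; [exact: measurable_cst | exists `|a|]. Qed.

Lemma admZ a g : adm g -> adm (fun t => a * g t).
Proof. by move=> ag; apply: (admM (adm_cst a) ag). Qed.

Lemma admN g : adm g -> adm (fun t => - g t).
Proof. by move=> /(admZ (-1)); congr adm; apply/funext => t; rewrite mulN1r. Qed.

Lemma adm_indic (A : set R) : measurable (I01 `&` A : set borelR) -> adm (\1_A).
Proof.
move=> mA; split; last first.
  by exists 1 => t _; rewrite indicE; case: (_ \in _) => /=; rewrite ?normr1 ?normr0.
apply: (@eq_measurable_fun _ _ borelR R I01 (\1_(I01 `&` A))).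
  by move=> t tI; rewrite !indicE in_setI tI.
exact: measurable_indic.
Qed.

Lemma adm_continuous g : continuous g -> (exists b, forall t, I01 t -> `|g t| <= b) -> adm g.
Proof.
by move=> cg bg; split => //; apply: measurable_funTS; exact: continuous_measurable_fun.
Qed.

Lemma bounded_functionalB J M g1 g2 : bounded_functional J M ->
  adm g1 -> adm g2 -> J (fun t => g1 t - g2 t) = J g1 - J g2.
Proof.
move=> [JD JZ JM] a1 a2; rewrite -[X in _ = _ + X]mulN1r -JZ // -JD //; last exact: admZ.
by congr J; apply/funext => t; rewrite mulN1r.
Qed.

Lemma positive_functional_le J M g1 g2 : bounded_functional J M -> positive_functional J ->
  adm g1 -> adm g2 -> (forall t, I01 t -> g1 t <= g2 t) -> J g1 <= J g2.
Proof.
move=> bJ pJ a1 a2 h; rewrite -subr_ge0 -(bounded_functionalB bJ) //.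
apply: pJ; first by apply: admD => //; exact: admN.
by move=> t It; rewrite subr_ge0 h.
Qed.

Lemma bounded_functionalD J1 J2 M1 M2 : bounded_functional J1 M1 ->
  bounded_functional J2 M2 -> bounded_functional (fun g => J1 g + J2 g) (M1 + M2).
Proof.
move=> [D1 Z1 B1] [D2 Z2 B2]; split.
- by move=> g1 g2 a1 a2; rewrite D1 // D2 // addrACA.
- by move=> a g ag; rewrite Z1 // Z2 // mulrDr.
- move=> g b ag gb; apply: le_trans (ler_normD _ _) _.
  by rewrite mulrDl lerD ?B1 ?B2.
Qed.

Definition weighted_int (m : {measure set borelR -> \bar R}) (D : set R) (k : R -> R) g : R :=
  \int[m]_(t in D) (g t * k t).

Section weighted_int.
Variables (m : {measure set borelR -> \bar R}) (D : set R) (k : R -> R).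
Hypotheses (mD : measurable (D : set borelR)) (DI : D `<=` I01).
Hypothesis (ik : m.-integrable (D : set borelR) (EFin \o k)).

Lemma integrable_weighted g : adm g -> m.-integrable (D : set borelR) (fun t => (g t * k t)%:E).
Proof.
move=> [mg [b hb]].
have mk : measurable_fun (D : set borelR) k.
  by apply/measurable_EFinP; exact: measurable_int ik.
have mgD : measurable_fun (D : set borelR) g.
  exact: (measurable_funS measurable_I01 DI mg).
apply: (le_integrable mD _ _ (integrableZl mD b ik)).
  by apply/measurable_EFinP; exact: measurable_funM.
move=> t Dt /=; rewrite lee_fin !normrM ler_wpM2r //.
by apply: le_trans (hb _ (DI Dt)) (ler_norm _).
Qed.

Lemma bounded_weighted_int :
  bounded_functional (weighted_int m D k) (\int[m]_(t in D) `|k t|).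
Proof.
split.
- move=> g1 g2 a1 a2; rewrite -RintegralD //; try exact: integrable_weighted.
  by apply: eq_Rintegral => t _; rewrite mulrDl.
- move=> a g ag; rewrite -RintegralZl //; last exact: integrable_weighted.
  by apply: eq_Rintegral => t _; rewrite mulrA.
- move=> g b ag gb; apply: le_trans (le_normr_Rintegral _ _) _ => //.
    exact: integrable_weighted.
  have ink : m.-integrable (D : set borelR) (EFin \o (fun t => `|k t|)).
    by have := integrable_norm ik; apply: eq_integrable.
  rewrite mulrC -RintegralZl //; apply: le_Rintegral => //.
  + by have := integrable_norm (integrable_weighted ag).
  + by have := integrableZl mD b ink.
  + by move=> t Dt; rewrite normrM ler_wpM2r // gb //; exact: DI.
Qed.

Lemma positive_weighted_int : (forall t, D t -> 0 <= k t) ->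
  positive_functional (weighted_int m D k).
Proof.
by move=> k0 g ag g0; apply: Rintegral_ge0 => t Dt; rewrite mulr_ge0 ?k0 ?g0 //; exact: DI.
Qed.

End weighted_int.

End functionals.

(** * Functionals on complex-valued functions *)

Section complex_functionals.
Context {R : realType}.
Local Notation C := (Cx R).
Local Notation borelR := (measurableTypeR R).
Implicit Types (g : R -> C) (J : (R -> R) -> R).

Definition cadm g := adm (fun t => complex.Re (g t)) /\ adm (fun t => complex.Im (g t)).

Definition cfun J g : C := J (fun t => complex.Re (g t)) +i* J (fun t => complex.Im (g t)).

Lemma cadmD g1 g2 : cadm g1 -> cadm g2 -> cadm (fun t => g1 t + g2 t).
Proof.
move=> [r1 i1] [r2 i2]; split; under [X in adm X]eq_fun do rewrite ?cReD ?cImD; exact: admD.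
Qed.

Lemma cadmM g1 g2 : cadm g1 -> cadm g2 -> cadm (fun t => g1 t * g2 t).
Proof.
move=> [r1 i1] [r2 i2]; split; rewrite /cadm.
  under [X in adm X]eq_fun do rewrite cReM.
  by apply: admD; [exact: admM | apply: admN; exact: admM].
under [X in adm X]eq_fun do rewrite cImM.
by apply: admD; exact: admM.
Qed.

Lemma cadm_cst (a : C) : cadm (fun=> a).
Proof. by split; exact: adm_cst. Qed.

Lemma cadmZ (a : C) g : cadm g -> cadm (fun t => a * g t).
Proof. exact/cadmM/cadm_cst. Qed.

Lemma cadm_conj g : cadm g -> cadm (fun t => (g t)^*%C).
Proof.
move=> [r i]; split.
  by rewrite (_ : (fun _ => _) = fun t => complex.Re (g t)) //; apply/funext => t; case: (g t).
by rewrite (_ : (fun _ => _) = fun t => - complex.Im (g t)); [exact: admN | apply/funext => t; case: (g t)].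
Qed.

Lemma continuous_Re : continuous (fun z : C => complex.Re z).
Proof.
move=> z; apply/(@cvgrPdist_lt _ _ _ _ (nbhs_filter z)) => e e0.
have /cvgCP/(_ e e0) : (fun w : C => w) @ z --> z by exact: cvg_id.
by apply: filterS => w; apply: le_lt_trans; rewrite -cReN -cReD ler_normRe_modc.
Qed.

Lemma continuous_Im : continuous (fun z : C => complex.Im z).
Proof.
move=> z; apply/(@cvgrPdist_lt _ _ _ _ (nbhs_filter z)) => e e0.
have /cvgCP/(_ e e0) : (fun w : C => w) @ z --> z by exact: cvg_id.
by apply: filterS => w; apply: le_lt_trans; rewrite -cImN -cImD ler_normIm_modc.
Qed.

Lemma cadm_continuous g : continuous g ->
  (exists b, forall t, I01 t -> modc (g t) <= b) -> cadm g.
Proof.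
move=> cg [b gb]; split; apply: adm_continuous.
- by move=> t; apply: continuous_comp; [exact: cg | exact: continuous_Re].
- by exists b => t /gb; apply: le_trans; exact: ler_normRe_modc.
- by move=> t; apply: continuous_comp; [exact: cg | exact: continuous_Im].
- by exists b => t /gb; apply: le_trans; exact: ler_normIm_modc.
Qed.

Lemma cadm_bounded g : cadm g -> exists b, forall t, I01 t -> modc (g t) <= b.
Proof.
move=> [[_ [b1 h1]] [_ [b2 h2]]]; exists (b1 + b2) => t It.
by apply: le_trans (ler_modc_ReIm _) _; rewrite lerD ?h1 ?h2.
Qed.

Lemma measurable_modc g : cadm g -> measurable_fun (I01 : set borelR) (fun t => modc (g t)).
Proof.
move=> [[r _] [i _]].
rewrite (_ : (fun _ => _) = Num.sqrt \o (fun t => complex.Re (g t) ^+ 2 + complex.Im (g t) ^+ 2)).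
  have ms : measurable_fun setT (Num.sqrt : R -> R) := continuous_measurable_fun (@sqrt_continuous R).
  apply: (measurableT_comp ms).
  by apply: measurable_funD; exact: measurable_funX.
by apply/funext => t /=; rewrite -sqr_modc sqrtr_sqr ger0_norm // modc_ge0.
Qed.

Lemma adm_modc g : cadm g -> adm (fun t => modc (g t)).
Proof.
move=> cg; split; first exact: measurable_modc.
by have [b hb] := cadm_bounded cg; exists b => t It; rewrite ger0_norm ?modc_ge0 ?hb.
Qed.

Lemma continuous_expi : continuous (expi : R -> C).
Proof.
move=> t; apply/cvgCP => e e0; near=> s.
apply: le_lt_trans (expi_lipschitz _ _) _; rewrite -ltr_pdivlMl //.
by near: s; apply: cvgr_dist_lt => //; rewrite mulr_gt0 // invr_gt0.
Unshelve. all: by end_near. Qed.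

Lemma cadm_expi : cadm (expi : R -> C).
Proof.
by apply: cadm_continuous; [exact: continuous_expi | exists 1 => t _; rewrite modc_expi].
Qed.

Lemma cadm_expiX n : cadm (fun t : R => expi t ^+ n).
Proof.
elim: n => [|n IH]; first exact: cadm_cst.
by under [X in cadm X]eq_fun do rewrite exprS; exact: cadmM cadm_expi IH.
Qed.

Section functional.
Variables (J : (R -> R) -> R) (M : R).
Hypothesis bJ : bounded_functional J M.

Lemma cfunD g1 g2 : cadm g1 -> cadm g2 ->
  cfun J (fun t => g1 t + g2 t) = cfun J g1 + cfun J g2.
Proof.
move=> [r1 i1] [r2 i2]; have [JD _ _] := bJ; rewrite /cfun; simpc.
by rewrite -!JD //; congr (J _ +i* J _); apply/funext => t; rewrite ?cReD ?cImD.
Qed.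

Lemma cfunZ (a : C) g : cadm g -> cfun J (fun t => a * g t) = a * cfun J g.
Proof.
move=> [r i]; have [JD JZ _] := bJ; case: a => x y; rewrite /cfun; simpc.
rewrite -!JZ // -JD ?(bounded_functionalB bJ) -?(bounded_functionalB bJ) //; try exact: admZ.
by congr (J _ +i* J _); apply/funext => t; case: (g t).
Qed.

Lemma cfunN g : cadm g -> cfun J (fun t => - g t) = - cfun J g.
Proof.
move=> cg; rewrite -mulN1r -cfunZ //; congr (cfun J _).
by apply/funext => t; rewrite mulN1r.
Qed.

Lemma cfunB g1 g2 : cadm g1 -> cadm g2 ->
  cfun J (fun t => g1 t - g2 t) = cfun J g1 - cfun J g2.
Proof.
move=> c1 c2; rewrite -cfunN // -cfunD //.
by under [X in cadm X]eq_fun do rewrite -mulN1r; exact: cadmZ.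
Qed.

Lemma cadm_sum n (g : nat -> R -> C) : (forall i, cadm (g i)) ->
  cadm (fun t => \sum_(i < n) g i t).
Proof.
move=> cg; elim: n => [|n IH].
  by under [X in cadm X]eq_fun do rewrite big_ord0; exact: cadm_cst.
by under [X in cadm X]eq_fun do rewrite big_ord_recr; exact: cadmD.
Qed.

Lemma cfun_sum n (g : nat -> R -> C) : (forall i, cadm (g i)) ->
  cfun J (fun t => \sum_(i < n) g i t) = \sum_(i < n) cfun J (g i).
Proof.
move=> cg; elim: n => [|n IH].
  rewrite big_ord0 -[RHS](mul0r (cfun J (fun=> 1))) -cfunZ; last exact: cadm_cst.
  by congr (cfun J _); apply/funext => t; rewrite big_ord0 mul0r.
rewrite big_ord_recr /= -IH -cfunD //; last exact: cadm_sum.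
by congr (cfun J _); apply/funext => t; rewrite big_ord_recr.
Qed.

(** The factor 2 comes from bounding real and imaginary parts separately, which works for signed
    functionals; [modc_cfun_le] avoids the loss when the functional is positive. *)
Lemma cfun_le g b : cadm g -> (forall t, I01 t -> modc (g t) <= b) ->
  modc (cfun J g) <= 2 * M * b.
Proof.
move=> [r i] gb; have [_ _ JM] := bJ; apply: le_trans (ler_modc_ReIm _) _.
rewrite -mulrA mulr2n mulrDl !mul1r lerD //; apply: JM => // t It.
  exact: le_trans (ler_normRe_modc _) (gb t It).
exact: le_trans (ler_normIm_modc _) (gb t It).
Qed.

Lemma modc_cfun_le g : positive_functional J -> cadm g ->
  modc (cfun J g) <= J (fun t => modc (g t)).
Proof.
move=> pJ cg; have [->|nz] := eqVneq (cfun J g) 0.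
  rewrite modc0; apply: pJ => [|t _]; [exact: adm_modc | exact: modc_ge0].
(* Multiplying by this unimodular number makes the value real and nonnegative, so its modulus is [J]
   of a real part, where positivity applies. *)
set w := (cfun J g)^*%C / (modc (cfun J g))%:C.
have mw : modc w = 1.
  by rewrite modc_div modc_conj modc_real ger0_norm ?modc_ge0 // divff // modc_eq0.
have hw : (modc (cfun J g))%:C = w * cfun J g.
  rewrite mulrAC [X in X / _]mulrC mul_conjc rmorphXn /= expr2 mulfK //.
  by rewrite eq_complex /= eqxx andbT modc_eq0.
have -> : modc (cfun J g) = complex.Re ((modc (cfun J g))%:C) by [].
rewrite hw -cfunZ //= ; apply: (positive_functional_le bJ pJ).
- by have [] := cadmZ w cg.
- exact: adm_modc.
- by move=> t It; apply: le_trans (ler_Re_modc _) _; rewrite modcM mw mul1r.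
Qed.

End functional.

End complex_functionals.

(** * Means over the circle and orthogonality of the powers of [expi] *)

Section circle_mean.
Context {R : realType}.
Local Notation C := (Cx R).
Local Notation leb := (@lebesgue_measure R).

Definition mean01 : (R -> R) -> R := weighted_int leb I01 (fun=> 1).

Definition cmean : (R -> C) -> C := cfun mean01.

Lemma lebesgue_I01 : leb I01 = 1%E.
Proof. by rewrite /I01 lebesgue_measure_itv /= lte_fin ltr01 oppr0 adde0. Qed.

Lemma integrable_cst1 : leb.-integrable I01 (EFin \o (fun=> 1)).
Proof.
apply: measurable_bounded_integrable.
- exact: measurable_I01.
- by rewrite [ltLHS]lebesgue_I01 ltry.
- exact: measurable_cst.
- exact: bounded_cst.
Qed.

Lemma mean01E (g : R -> R) : mean01 g = \int[leb]_(t in I01) g t.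
Proof. by apply: eq_Rintegral => t _; rewrite mulr1. Qed.

Lemma mean01_cst a : mean01 (fun=> a) = a.
Proof.
have mI := @measurable_I01 R; rewrite mean01E Rintegral_cst //.
by rewrite -[RHS]mulr1; congr (_ * _); exact: (congr1 fine lebesgue_I01).
Qed.

Lemma bounded_mean01 : bounded_functional mean01 1.
Proof.
have := bounded_weighted_int measurable_I01 (@subset_refl _ _) integrable_cst1.
rewrite (_ : (\int[leb]_(t in I01) `|1|) = 1) //.
by rewrite -[LHS]mean01E mean01_cst normr1.
Qed.

Lemma positive_mean01 : positive_functional mean01.
Proof. by apply: positive_weighted_int. Qed.

Lemma cmean_cst (a : C) : cmean (fun=> a) = a.
Proof. by case: a => x y; rewrite /cmean /cfun /= !mean01_cst. Qed.

Lemma cfun_conj (J : (R -> R) -> R) M (g : R -> C) : bounded_functional J M ->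
  cadm g -> cfun J (fun t => (g t)^*%C) = (cfun J g)^*%C.
Proof.
move=> [_ JZ _] [r i]; rewrite /cfun /= -mulN1r -JZ //.
by congr (J _ +i* J _); apply/funext => t; case: (g t) => //= x y; rewrite mulN1r.
Qed.

Lemma is_derive_continuous (F f : R -> R) :
  (forall x, is_derive (x : R) 1 F (f x)) -> continuous F.
Proof.
move=> dF x; apply: differentiable_continuous; apply/derivable1_diffP.
by have [] := dF x.
Qed.

Lemma Rintegral_FTC (F f : R -> R) : (forall x, is_derive (x : R) 1 F (f x)) -> continuous f ->
  \int[leb]_(t in I01) f t = F 1 - F 0.
Proof.
move=> dF cf; have h01 : (0 : R) < 1 by [].
have cw : {within `[0, 1], continuous f} by apply: continuous_subspaceT.
have cF : continuous F.
  exact: is_derive_continuous dF.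
rewrite /I01 Rintegral_itv_bndo_bndc.
  rewrite /Rintegral (@continuous_FTC2 _ f F 0 1) //.
  - split; first by move=> x _; exact: ex_derive.
    + by apply: cvg_at_right_filter; exact: cF.
    + by apply: cvg_at_left_filter; exact: cF.
  - by move=> x _; rewrite derive1E; exact: derive_val.
apply: integrableS (continuous_compact_integrable _ cw) => //.
- exact: subset_itv_co_cc.
- exact: segment_compact.
Qed.

Lemma cmean_expiX n : cmean (fun t => expi t ^+ n.+1) = 0.
Proof.
have k0 : 2 * pi * n.+1%:R != 0 :> R.
  by rewrite !mulf_neq0 // ?pnatr_eq0 // gt_eqF // pi_gt0.
set k := 2 * pi * n.+1%:R in k0.
rewrite /cmean /cfun !mean01E.
have lin (x : R) : is_derive x 1 (fun t : R => k * t) k.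
  by apply: is_derive_eq; rewrite /GRing.scale /= mulr1.
have cl : continuous (fun t : R => k * t).
  exact: is_derive_continuous lin.
have kE (t : R) : 2 * pi * (n.+1%:R * t) = k * t by rewrite mulrA.
have e1 : \int[leb]_(t in I01) complex.Re (expi t ^+ n.+1) = 0.
  transitivity (\int[leb]_(t in I01) cos (k * t)).
    by apply: eq_Rintegral => t _; rewrite expiX /expi /= kE.
  have -> : \int[leb]_(t in I01) cos (k * t) = k^-1 * sin (k * 1) - k^-1 * sin (k * 0).
    apply: (@Rintegral_FTC (fun t => k^-1 * sin (k * t))).
    - move=> x; apply: is_derive_eq.
      rewrite /GRing.scale /=.
      by rewrite mulrC mulfK.
    - by move=> x; apply: continuous_comp; [exact: cl | exact: continuous_cos].
  rewrite mulr1 mulr0 sin0 mulr0 subr0.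
    have := congr1 (@complex.Im R) (expi_periodic (0 : R) n.+1); rewrite add0r expi0 /=.
  by rewrite -/k => ->; rewrite mulr0.
have e2 : \int[leb]_(t in I01) complex.Im (expi t ^+ n.+1) = 0.
  transitivity (\int[leb]_(t in I01) sin (k * t)).
    by apply: eq_Rintegral => t _; rewrite expiX /expi /= kE.
  have -> : \int[leb]_(t in I01) sin (k * t) = - k^-1 * cos (k * 1) - - k^-1 * cos (k * 0).
    apply: (@Rintegral_FTC (fun t => - k^-1 * cos (k * t))).
    - move=> x; apply: is_derive_eq.
      rewrite /GRing.scale /=.
      by rewrite [- sin _ * _]mulNr mulrNN mulrC mulfK.
    - by move=> x; apply: continuous_comp; [exact: cl | exact: continuous_sin].
  rewrite mulr1 mulr0 cos0.
    have := congr1 (@complex.Re R) (expi_periodic (0 : R) n.+1); rewrite add0r expi0 /=.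
  by rewrite -/k => ->; rewrite subrr.
by rewrite e1 e2.
Qed.

Lemma cmean_conj_expiX n : cmean (fun t => (expi t)^*%C ^+ n.+1) = 0.
Proof.
rewrite -[RHS]conjc0 -(cmean_expiX n) /cmean -(cfun_conj bounded_mean01).
  by congr (cfun _ _); apply/funext => t; rewrite rmorphXn.
exact: cadm_expiX.
Qed.

End circle_mean.

(** * Uniform limits of polynomials and their closure properties *)

Section disc_algebra.
Context {R : realType}.
Local Notation C := (Cx R).
Implicit Types (g : C -> C) (z w : C) (e r : R).

Definition disc_alg g := forall e, 0 < e ->
  exists p : {poly C}, forall z, modc z <= 1 -> modc (g z - p.[z]) <= e.

(* Analyticity is encoded as approximation by polynomials, uniformly on each smaller disc: Cauchy's
   formula then reduces to the orthogonality of the functions [expi t ^+ n]. *)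
Definition hol g := forall r, 0 < r < 1 -> disc_alg (fun z => g (r%:C * z)).

Lemma disc_alg_poly (p : {poly C}) : disc_alg (fun z => p.[z]).
Proof. by move=> e e0; exists p => z _; rewrite subrr modc0 ltW. Qed.

Lemma poly_bounded (p : {poly C}) : exists b, forall z, modc z <= 1 -> modc p.[z] <= b.
Proof.
exists (\sum_(i < size p) modc p`_i) => z z1; rewrite horner_coef.
apply: le_trans (modc_sum _ _ _) _; apply: ler_sum => i _.
by rewrite modcM modcX ler_piMr ?modc_ge0 // exprn_ile1 ?modc_ge0.
Qed.

Lemma disc_alg_bounded g : disc_alg g -> exists2 b, 0 <= b & forall z, modc z <= 1 -> modc (g z) <= b.
Proof.
move=> /(_ 1 ltr01)[p hp]; have [b hb] := poly_bounded p.
have h z : modc z <= 1 -> modc (g z) <= 1 + b.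
  move=> z1; rewrite -(subrK p.[z] (g z)); apply: le_trans (ler_modcD _ _) _.
  by rewrite lerD ?hp ?hb.
by exists (1 + b) => //; apply: le_trans (h 0 _); rewrite ?modc_ge0 ?modc0.
Qed.

Lemma disc_alg_ext g1 g2 : (forall z, modc z <= 1 -> g1 z = g2 z) ->
  disc_alg g1 -> disc_alg g2.
Proof. by move=> h d1 e /d1[p hp]; exists p => z z1; rewrite -h ?hp. Qed.

Lemma disc_alg_lim g : (forall e, 0 < e -> exists2 g', disc_alg g' &
  forall z, modc z <= 1 -> modc (g z - g' z) <= e) -> disc_alg g.
Proof.
move=> h e e0; have e20 : 0 < e / 2 by rewrite divr_gt0.
have [g' dg' hg] := h _ e20; have [p hp] := dg' _ e20.
exists p => z z1; rewrite -(subrK (g' z) (g z)) -addrA [e]splitr.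
by apply: le_trans (ler_modcD _ _) _; rewrite lerD ?hg ?hp.
Qed.

Lemma disc_algD g1 g2 : disc_alg g1 -> disc_alg g2 -> disc_alg (fun z => g1 z + g2 z).
Proof.
move=> d1 d2 e e0; have e20 : 0 < e / 2 by rewrite divr_gt0.
have [p hp] := d1 _ e20; have [q hq] := d2 _ e20.
exists (p + q) => z z1; rewrite hornerD opprD addrACA [e]splitr.
by apply: le_trans (ler_modcD _ _) _; rewrite lerD ?hp ?hq.
Qed.

(** The two factors are approximated one after the other: [g2] by [q] with a precision relative to
    the bound of [g1], then [g1] with a precision relative to the bound of [q], which is known only
    once [q] is chosen. *)
Lemma disc_algM g1 g2 : disc_alg g1 -> disc_alg g2 -> disc_alg (fun z => g1 z * g2 z).
Proof.
move=> d1 d2; have [b1 b10 h1] := disc_alg_bounded d1.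
apply: disc_alg_lim => e e0.
have [q hq] := d2 (e / (b1 + 1)) ltac:(by rewrite divr_gt0 // ltr_wpDl).
have [b2 h2] := poly_bounded q.
have b20 : 0 <= b2 by apply: le_trans (h2 0 _); rewrite ?modc_ge0 ?modc0.
exists (fun z => g1 z * q.[z]).
  move=> e' e0'; have [p hp] := d1 (e' / (b2 + 1)) ltac:(by rewrite divr_gt0 // ltr_wpDl).
  exists (p * q) => z z1; rewrite hornerM -mulrBl modcM.
  apply: le_trans (_ : e' / (b2 + 1) * b2 <= _).
    by rewrite ler_pM ?modc_ge0 ?hp ?h2.
  by rewrite mulrAC ler_pdivrMr ?ltr_wpDl // ler_pM2l // lerDl.
move=> z z1; rewrite -mulrBr modcM; apply: le_trans (_ : b1 * (e / (b1 + 1)) <= _).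
  by rewrite ler_pM ?modc_ge0 ?hq ?h1.
by rewrite mulrA ler_pdivrMr ?ltr_wpDl // mulrC ler_pM2l // lerDl.
Qed.

Lemma disc_alg_cst a : disc_alg (fun=> a).
Proof. by apply: disc_alg_ext (disc_alg_poly a%:P) => z _; rewrite hornerC. Qed.

Lemma disc_alg_id : disc_alg id.
Proof. by apply: disc_alg_ext (disc_alg_poly 'X) => z _; rewrite hornerX. Qed.

Lemma disc_algX g n : disc_alg g -> disc_alg (fun z => g z ^+ n).
Proof.
move=> dg; elim: n => [|n IH]; first exact: disc_alg_cst.
by apply: disc_alg_ext (disc_algM dg IH) => z _; rewrite exprS.
Qed.

Lemma disc_alg_sum n (g : nat -> C -> C) : (forall i, disc_alg (g i)) ->
  disc_alg (fun z => \sum_(i < n) g i z).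
Proof.
move=> dg; elim: n => [|n IH].
  by apply: disc_alg_ext (disc_alg_cst 0) => z _; rewrite big_ord0.
by apply: disc_alg_ext (disc_algD IH (dg n)) => z _; rewrite big_ord_recr.
Qed.

Lemma disc_alg_prod n (g : nat -> C -> C) : (forall i, disc_alg (g i)) ->
  disc_alg (fun z => \prod_(i < n) g i z).
Proof.
move=> dg; elim: n => [|n IH].
  by apply: disc_alg_ext (disc_alg_cst 1) => z _; rewrite big_ord0.
by apply: disc_alg_ext (disc_algM IH (dg n)) => z _; rewrite big_ord_recr.
Qed.

Lemma geometric_remainder (x : C) n : 1 - x != 0 ->
  (1 - x)^-1 - \sum_(i < n) x ^+ i = x ^+ n / (1 - x).
Proof.
move=> x1; apply: (mulIf x1); rewrite mulrBl mulVf // divfK //.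
by rewrite -[RHS](subrK 1) subrX1; ring.
Qed.

Lemma ler_modc_XB (x y : C) b n : modc x <= b -> modc y <= b ->
  modc (x ^+ n - y ^+ n) <= n%:R * b ^+ n.-1 * modc (x - y).
Proof.
move=> xb yb; rewrite subrXX modcM mulrC ler_wpM2r ?modc_ge0 //.
apply: le_trans (modc_sum _ _ _) _.
apply: (@le_trans _ _ (\sum_(i < n) b ^+ n.-1)); last first.
  by rewrite sumr_const card_ord mulr_natl.
apply: ler_sum => i _; rewrite modcM !modcX.
have -> : b ^+ n.-1 = b ^+ (n.-1 - i) * b ^+ i.
  by rewrite -exprD subnK //; have := ltn_ord i; lia.
have b0 : 0 <= b by apply: le_trans (modc_ge0 x) xb.
by rewrite ler_pM ?exprn_ge0 ?modc_ge0 // lerXn2r ?nnegrE ?modc_ge0.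
Qed.

Lemma nat_gt (x : R) : exists n : nat, x < n%:R.
Proof.
by exists (Num.truncn x).+1; exact: truncnS_gt.
Qed.

(** With v = w/n, both exp v and 1 + v have modulus at most exp(b'/n), so their n-th powers differ
    by at most n exp(b') |exp v - 1 - v|, which is O(1/n). The approximant is a polynomial in w, so
    [cexp] preserves [disc_alg]. *)
Lemma cexp_approx (b e : R) : 0 < e -> exists n : nat,
  forall w, modc w <= b -> modc (cexp w - (1 + w / n%:R) ^+ n) <= e.
Proof.
move=> e0; pose b' := `|b| + 1.
have b'0 : 0 < b' by rewrite ltr_wpDl.
pose c := 8 * b' ^+ 2 * expR b'.
(* The first summand gives |v| <= 1/2, as [cexp_sub1] requires; the second makes the error c/n at
   most e. *)
have [n hn] : exists n : nat, b' * 2 + c / e < n%:R.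
  exact: nat_gt.
have c0 : 0 <= c by rewrite !mulr_ge0 ?expR_ge0 ?exprn_ge0 // ltW.
have n0 : 0 < n%:R :> R by apply: le_lt_trans hn; rewrite addr_ge0 ?divr_ge0 ?mulr_ge0 ?(ltW b'0) ?(ltW e0).
have nC0 : n%:R != 0 :> C by rewrite pnatr_eq0 -lt0n; move: n0; rewrite ltr0n.
exists n => w wb.
have wb' : modc w <= b' by apply: le_trans wb _; rewrite (le_trans (ler_norm b)) // lerDl.
have mn : modc (n%:R : C) = n%:R.
  have -> : (n%:R : C) = (n%:R : R)%:C by rewrite rmorph_nat.
  by rewrite modc_real ger0_norm // ltW.
set v := w / n%:R.
have mv : modc v = modc w / n%:R by rewrite modc_div mn.
have vb : modc v <= b' / n%:R by rewrite mv ler_pM2r ?invr_gt0.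
have v2 : modc v <= 1 / 2.
  apply: le_trans vb _; rewrite ler_pdivrMr // mulrC mulrA mulr1 ler_pdivlMr //.
  by apply: ltW; apply: le_lt_trans hn; rewrite lerDl divr_ge0 // ltW.
have -> : cexp w = cexp v ^+ n by rewrite -cexpMn -mulr_natr divfK.
have e1 : modc (cexp v) <= expR (b' / n%:R).
  by rewrite modc_cexp ler_expR (le_trans (ler_Re_modc _)).
have e2 : modc (1 + v) <= expR (b' / n%:R).
  apply: le_trans (ler_modcD _ _) _; rewrite modc1.
  by apply: le_trans (expR_ge1Dx _); rewrite lerD2l.
apply: le_trans (ler_modc_XB _ e1 e2) _.
have -> : cexp v - (1 + v) = cexp v - 1 - v by ring.
have h3 : modc (cexp v - 1 - v) <= 8 * (b' / n%:R) ^+ 2.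
  apply: le_trans (cexp_sub1 v2) _; rewrite ler_pM2l // lerXn2r ?nnegrE ?modc_ge0 //.
  by rewrite divr_ge0 // ltW.
have h4 : expR (b' / n%:R) ^+ n.-1 <= expR b'.
  rewrite -expRM_natl ler_expR mulrCA ger_pMr // ler_pdivrMr // mul1r ler_nat leq_pred //.
apply: le_trans (_ : n%:R * expR b' * (8 * (b' / n%:R) ^+ 2) <= _).
  by rewrite ler_pM ?modc_ge0 ?mulr_ge0 ?exprn_ge0 ?expR_ge0 // ler_pM2l.
have -> : n%:R * expR b' * (8 * (b' / n%:R) ^+ 2) = c / n%:R.
  by rewrite /c; field; rewrite gt_eqF.
rewrite ler_pdivrMr // mulrC -ler_pdivrMr //; apply: ltW; apply: le_lt_trans hn.
by rewrite lerDr mulr_ge0 // ltW.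
Qed.

Lemma disc_alg_cexp g : disc_alg g -> disc_alg (fun z => cexp (g z)).
Proof.
move=> dg; have [b b0 hb] := disc_alg_bounded dg.
apply: disc_alg_lim => e e0; have [n hn] := cexp_approx b e0.
exists (fun z => (1 + g z * n%:R^-1) ^+ n); last by move=> z z1; apply: hn; exact: hb.
apply: disc_algX; apply: disc_algD; first exact: disc_alg_cst.
by apply: disc_algM => //; exact: disc_alg_cst.
Qed.

Lemma exprn_small (r e : R) : 0 <= r < 1 -> 0 < e -> exists n, r ^+ n <= e.
Proof.
move=> /andP[r0 r1] e0; have : (fun n => r ^+ n) @ \oo --> 0.
  by apply: cvg_expr; rewrite ger0_norm.
move=> /cvgrPdist_lt/(_ _ e0) [N _ /(_ N (leqnn N))] /=.
by rewrite sub0r normrN => /ltW h; exists N; apply: le_trans (ler_norm _) h.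
Qed.

Lemma modc_sub_ge (x : C) (r : R) : modc x <= r -> 1 - r <= modc (1 - x).
Proof.
by move=> xr; apply: le_trans (ler_modc_sub _ _); rewrite modc1 lerD2l lerN2.
Qed.

Lemma one_sub_neq0 (x : C) : modc x < 1 -> 1 - x != 0.
Proof.
by move=> x1; rewrite -modc_gt0 (lt_le_trans _ (modc_sub_ge (lexx _))) // subr_gt0.
Qed.

(* Cauchy transforms are approximated by truncating the geometric series. *)
Lemma hol_cauchy_transform (J : (R -> R) -> R) M (G : R -> C) :
  bounded_functional J M -> cadm G ->
  hol (fun z => cfun J (fun t => G t / (1 - z * (expi t)^*%C))).
Proof.
move=> bJ cG r /andP[r0 r1] e e0.
have [b hb] := cadm_bounded cG.
have b0 : 0 <= b by apply: le_trans (hb _ I01_0); exact: modc_ge0.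
pose K := 2 * `|M| * b / (1 - r) + 1.
have K0 : 0 < K by rewrite ltr_wpDl // divr_ge0 ?mulr_ge0 // subr_ge0 ltW.
have [n hn] := @exprn_small r (e / K) ltac:(by rewrite (ltW r0)) ltac:(by rewrite divr_gt0).
pose F i t := G t * (expi t)^*%C ^+ i.
have cF i : cadm (F i).
  apply: cadmM => //; rewrite (_ : (fun _ => _) = fun t => (expi t ^+ i)^*%C).
    exact/cadm_conj/cadm_expiX.
  by apply/funext => t; rewrite rmorphXn.
exists (\poly_(i < n) (r%:C ^+ i * cfun J (F i))) => z z1.
have mx t : modc (r%:C * z * (expi t)^*%C) <= r.
  by rewrite !modcM modc_conj modc_expi mulr1 modc_real ger0_norm ?(ltW r0) // ler_piMr // ltW.
have nx t : 1 - r%:C * z * (expi t)^*%C != 0.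
  by apply: one_sub_neq0; apply: le_lt_trans (mx t) r1.
have -> : (\poly_(i < n) (r%:C ^+ i * cfun J (F i))).[z] =
    cfun J (fun t => \sum_(i < n) ((r%:C * z) ^+ i * F i t)).
  rewrite horner_poly (@cfun_sum _ _ _ bJ n (fun i t => (r%:C * z) ^+ i * F i t)) //; last first.
    by move=> i; exact: cadmZ.
  by apply: eq_bigr => i _; rewrite (cfunZ bJ) // exprMn mulrAC.
have cH : cadm (fun t => G t / (1 - r%:C * z * (expi t)^*%C)).
  apply: cadmM => //; apply: cadm_continuous.
    move=> t; apply: cvgV => //; apply: cvgB; first exact: cvg_cst.
    apply: cvgM; first exact: cvg_cst.
    rewrite -expiN (_ : (fun _ => _) = expi \o -%R); last by apply/funext => s /=; rewrite expiN.
    by apply: continuous_comp; [exact: opp_continuous | exact: continuous_expi].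
  exists (1 - r)^-1 => t _; rewrite modcV lef_pV2 ?posrE ?subr_gt0 ?modc_gt0 //.
  exact: modc_sub_ge.
have cS : cadm (fun t => \sum_(i < n) ((r%:C * z) ^+ i * F i t)).
  by apply: (@cadm_sum _ n (fun i t => (r%:C * z) ^+ i * F i t)) => i; exact: cadmZ.
rewrite -(cfunB bJ) //.
apply: le_trans (_ : 2 * `|M| * (b * (r ^+ n / (1 - r))) <= _); last first.
  have -> : 2 * `|M| * (b * (r ^+ n / (1 - r))) = (K - 1) * r ^+ n by rewrite /K; ring.
  apply: le_trans (_ : K * (e / K) <= _); last by rewrite mulrCA divff ?mulr1 // gt_eqF.
  apply: ler_pM => //; rewrite ?exprn_ge0 ?(ltW r0) // ?gerBl //.
  by rewrite /K addrK divr_ge0 ?mulr_ge0 // subr_ge0 ltW.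
(* The sign of [M] is not prescribed, and the estimates below multiply by it. *)
have bJ' : bounded_functional J `|M|.
  have [JD JZ JM] := bJ; split => // g b' ag gb; apply: le_trans (JM _ _ ag gb) _.
  by rewrite ler_wpM2r ?ler_norm // (le_trans _ (gb _ I01_0)).
apply: (cfun_le bJ').
  rewrite (_ : (fun _ => _) = fun t => G t / (1 - r%:C * z * (expi t)^*%C) +
    -1 * \sum_(i < n) ((r%:C * z) ^+ i * F i t)); first by apply: cadmD => //; exact: cadmZ.
  by apply/funext => t; rewrite mulN1r.
move=> t It.
have -> : G t / (1 - r%:C * z * (expi t)^*%C) - \sum_(i < n) ((r%:C * z) ^+ i * F i t) =
   G t * ((r%:C * z * (expi t)^*%C) ^+ n / (1 - r%:C * z * (expi t)^*%C)).
  rewrite -geometric_remainder // mulrBr; congr (_ - _).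
  by rewrite mulr_sumr; apply: eq_bigr => i _; rewrite /F [in RHS]exprMn mulrCA.
rewrite modcM ler_pM ?modc_ge0 ?hb // modc_div modcX.
by rewrite ler_pM ?exprn_ge0 ?invr_ge0 ?modc_ge0 // ?lerXn2r ?nnegrE ?modc_ge0 ?(ltW r0) //
  lef_pV2 ?posrE ?subr_gt0 ?modc_gt0 // modc_sub_ge.
Qed.

End disc_algebra.

(** * Differentiation with a quadratic remainder *)

Section quadratic_derivative.
Context {R : realType}.
Local Notation C := (Cx R).
Implicit Types (f g : C -> C) (z w h d : C).

(* All functions below are analytic, so their first-order Taylor remainder is quadratic; this
   form of differentiability avoids limits. *)
Definition qd f z d := exists (delta K : R), 0 < delta /\
  forall h, modc h < delta -> modc (f (z + h) - f z - h * d) <= K * modc h ^+ 2.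

(** Normal form for using [qd]: with a nonnegative constant and increments of modulus at most 1, the
    quadratic remainder also yields a Lipschitz bound, needed for products and compositions. *)
Lemma qd_near f z d : qd f z d -> exists2 delta : R, 0 < delta &
  exists2 K : R, 0 <= K & delta <= 1 /\ forall h, modc h < delta ->
    modc (f (z + h) - f z - h * d) <= K * modc h ^+ 2 /\
    modc (f (z + h) - f z) <= K * modc h.
Proof.
move=> [dl [K [dl0 H]]].
exists (Num.min dl 1); first by rewrite lt_min dl0 ltr01.
have K0 : 0 <= `|K| + modc d by rewrite addr_ge0 ?modc_ge0.
exists (`|K| + modc d) => //; split; first by rewrite ge_min lexx orbT.
move=> h; rewrite lt_min => /andP[h1 h2].
have h3 : modc (f (z + h) - f z - h * d) <= `|K| * modc h ^+ 2.
  by apply: le_trans (H h h1) _; rewrite ler_wpM2r ?exprn_ge0 ?modc_ge0 // ler_norm.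
split.
  by apply: le_trans h3 _; rewrite ler_wpM2r ?exprn_ge0 ?modc_ge0 // lerDl modc_ge0.
rewrite -(subrK (h * d) (f (z + h) - f z)); apply: le_trans (ler_modcD _ _) _.
rewrite modcM mulrDl [modc d * _]mulrC lerD2r; apply: le_trans h3 _.
by rewrite ler_wpM2l // expr2 ler_piMr ?modc_ge0 // ltW.
Qed.

Lemma qd_is_derive f z d : qd f z d -> is_derive (z : C) 1 f d.
Proof.
move=> /qd_near[dl dl0 [K K0 [_ H]]].
have cv : h^-1 *: ((f \o shift z) (h *: (1 : C)) - f z) @[h --> (0 : C)^'] --> d.
  apply/cvgCP => e e0.
  have rr : 0 < Num.min dl (e / (K + 1)) by rewrite lt_min dl0 divr_gt0 // ltr_wpDl.
  exists (Num.min dl (e / (K + 1)))%:C; first by rewrite /= (ltcR 0).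
  move=> h /=; rewrite sub0r normrN norm_modc ltcR lt_min => /andP[h1 h2] h0.
  have mh : 0 < modc h by rewrite modc_gt0.
  rewrite /GRing.scale /= mulr1 [h + z]addrC.
  have -> : d - h^-1 * (f (z + h) - f z) = - (h^-1 * (f (z + h) - f z - h * d)).
    by field.
  rewrite modcN modcM modcV ltr_pdivrMl //.
  have [h3 _] := H h h1; apply: le_lt_trans h3 _.
  rewrite expr2 mulrA [ltRHS]mulrC ltr_pM2r //.
  move: h2; rewrite ltr_pdivlMr ?ltr_wpDl //; apply: le_lt_trans.
  by rewrite mulrC ler_pM2l // lerDl.
by apply: DeriveDef; [apply/cvg_ex; exists d | exact: cvg_lim cv].
Qed.

Lemma qd_derive1 f z d : qd f z d -> derive1 f z = d.
Proof. by move=> /qd_is_derive[_ <-]; rewrite derive1E. Qed.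

Lemma qd_eq f g z d (r : R) : 0 < r -> (forall w, modc (w - z) < r -> f w = g w) ->
  qd f z d -> qd g z d.
Proof.
move=> r0 fg [dl [K [dl0 H]]]; exists (Num.min dl r), K.
split; first by rewrite lt_min dl0.
move=> h; rewrite lt_min => /andP[h1 h2]; rewrite -!fg ?H //; first by rewrite subrr modc0.
by rewrite addrC addrA addNr add0r.
Qed.

Lemma qd_cst (a : C) z : qd (fun=> a) z 0.
Proof.
exists 1, 0; split=> // h _.
by rewrite subrr mulr0 subrr modc0 mul0r.
Qed.

Lemma qd_id z : qd id z 1.
Proof.
exists 1, 0; split=> // h _.
by rewrite mul0r /= (_ : z + h - z - h * 1 = 0) ?modc0 //; ring.
Qed.

Lemma qdD f g z d1 d2 : qd f z d1 -> qd g z d2 -> qd (fun w => f w + g w) z (d1 + d2).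
Proof.
move=> [dl1 [K1 [dl10 H1]]] [dl2 [K2 [dl20 H2]]].
exists (Num.min dl1 dl2), (K1 + K2); split; first by rewrite lt_min dl10.
move=> h; rewrite lt_min => /andP[h1 h2].
have -> : f (z + h) + g (z + h) - (f z + g z) - h * (d1 + d2) =
  (f (z + h) - f z - h * d1) + (g (z + h) - g z - h * d2) by ring.
by apply: le_trans (ler_modcD _ _) _; rewrite mulrDl lerD ?H1 ?H2.
Qed.

Lemma qdM f g z d1 d2 : qd f z d1 -> qd g z d2 ->
  qd (fun w => f w * g w) z (d1 * g z + f z * d2).
Proof.
move=> /qd_near[dl1 dl10 [K1 K10 [_ H1]]] /qd_near[dl2 dl20 [K2 K20 [_ H2]]].
exists (Num.min dl1 dl2), (K1 * modc (g z) + modc (f z) * K2 + K1 * K2).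
split; first by rewrite lt_min dl10.
move=> h; rewrite lt_min => /andP[h1 h2].
have -> : f (z + h) * g (z + h) - f z * g z - h * (d1 * g z + f z * d2) =
  (f (z + h) - f z - h * d1) * g z + f z * (g (z + h) - g z - h * d2) +
  (f (z + h) - f z) * (g (z + h) - g z) by ring.
apply: le_trans (ler_modcD _ _) _; rewrite [leRHS]mulrDl; apply: lerD.
  apply: le_trans (ler_modcD _ _) _; rewrite [leRHS]mulrDl !modcM; apply: lerD.
    by rewrite mulrAC ler_wpM2r ?modc_ge0 //; case: (H1 h h1).
  by rewrite -mulrA ler_wpM2l ?modc_ge0 //; case: (H2 h h2).
rewrite modcM expr2 mulrACA ler_pM ?modc_ge0 //.
- by case: (H1 h h1).
- by case: (H2 h h2).
Qed.

Lemma qdZ (a : C) f z d : qd f z d -> qd (fun w => a * f w) z (a * d).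
Proof.
move=> H; have := qdM (qd_cst a z) H.
by rewrite mul0r add0r.
Qed.

Lemma qd_poly (p : {poly C}) z : qd (fun w => p.[w]) z (p^`()).[z].
Proof.
elim/poly_ind: p => [|p c IH].
  rewrite deriv0 horner0 (_ : (fun _ => _) = (fun=> 0)); first exact: qd_cst.
  by apply/funext => w; rewrite horner0.
rewrite (_ : (fun _ => _) = fun w => p.[w] * id w + c).
  have := qdD (qdM IH (qd_id z)) (qd_cst c z).
  by rewrite derivD derivC derivM derivX !mulr1 !addr0 hornerD hornerMX.
by apply/funext => w; rewrite hornerMXaddC.
Qed.

Lemma qd_cexp g z d : qd g z d -> qd (fun w => cexp (g w)) z (cexp (g z) * d).
Proof.
move=> /qd_near[dl dl0 [K K0 [_ H]]].
have rr : 0 < Num.min dl (1 / 2 / (K + 1)) by rewrite lt_min dl0 !divr_gt0 // ltr_wpDl.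
exists (Num.min dl (1 / 2 / (K + 1))), (modc (cexp (g z)) * (8 * K ^+ 2 + K)).
split=> // h; rewrite lt_min => /andP[h1 h2].
have [h3 h4] := H h h1; set v := g (z + h) - g z in h3 h4.
have -> : cexp (g (z + h)) - cexp (g z) - h * (cexp (g z) * d) =
   cexp (g z) * ((cexp v - 1 - v) + (v - h * d)).
  have -> : g (z + h) = g z + v by rewrite /v; ring.
  by rewrite cexpD; ring.
rewrite modcM -[leRHS]mulrA; apply: ler_wpM2l; first exact: modc_ge0.
apply: le_trans (ler_modcD _ _) _; rewrite [leRHS]mulrDl lerD //.
apply: le_trans (cexp_sub1 _) _.
  apply: le_trans h4 _; move: h2; rewrite ltr_pdivlMr ?ltr_wpDl // mulrC mulrDl => h2.
  by have := modc_ge0 h; lra.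
by rewrite -mulrA ler_pM2l // -exprMn lerXn2r ?nnegrE ?modc_ge0 ?mulr_ge0 ?modc_ge0.
Qed.

End quadratic_derivative.

(** * Cauchy's formula by orthogonality *)

Section cauchy_formula.
Context {R : realType}.
Local Notation C := (Cx R).
Implicit Types (g f : C -> C) (z w : C) (e r : R).

(** The Cauchy kernel xi / (xi - z) at the circle point xi, written with the conjugate of xi so that
    it expands as a geometric series in z. *)
Definition ck z (t : R) : C := (1 - z * (expi t)^*%C)^-1.

Lemma modc_conj_expi (t : R) : modc ((expi t)^*%C : C) = 1.
Proof. by rewrite modc_conj modc_expi. Qed.

Lemma ck_neq0 z t : modc z < 1 -> 1 - z * (expi t)^*%C != 0.
Proof. by move=> z1; apply: one_sub_neq0; rewrite modcM modc_conj_expi mulr1. Qed.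

Lemma modc_ck z t : modc z < 1 -> modc (ck z t) <= (1 - modc z)^-1.
Proof.
move=> z1; rewrite modcV lef_pV2 ?posrE ?subr_gt0 ?modc_gt0 ?ck_neq0 //.
by apply: modc_sub_ge; rewrite modcM modc_conj_expi mulr1.
Qed.

Lemma continuous_conj_expi : continuous (fun t : R => (expi t)^*%C : C).
Proof.
rewrite (_ : (fun _ => _) = expi \o -%R); last by apply/funext => s /=; rewrite expiN.
by move=> t; apply: continuous_comp; [exact: opp_continuous | exact: continuous_expi].
Qed.

Lemma cadm_ck z : modc z < 1 -> cadm (ck z).
Proof.
move=> z1; apply: cadm_continuous; last by exists (1 - modc z)^-1 => t _; exact: modc_ck.
move=> t; apply: cvgV; first exact: ck_neq0.
apply: cvgB; first exact: cvg_cst.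
by apply: cvgM; [exact: cvg_cst | exact: continuous_conj_expi].
Qed.

Lemma cadm_ck_sqr z : modc z < 1 -> cadm (fun t => (expi t)^*%C * ck z t ^+ 2).
Proof.
move=> z1; have c2 := cadmM (cadm_ck z1) (cadm_ck z1).
have -> : (fun t => (expi t)^*%C * ck z t ^+ 2) = fun t => (expi t)^*%C * (ck z t * ck z t) by [].
exact: (cadmM (cadm_conj (@cadm_expi R)) c2).
Qed.

Lemma continuous_poly_expi (p : {poly C}) : continuous (fun t : R => p.[expi t]).
Proof.
move=> t; elim/poly_ind: p => [|p c IH].
  rewrite (_ : (fun _ => _) = (fun=> 0)); first exact: cvg_cst.
  by apply/funext => w; rewrite horner0.
rewrite (_ : (fun _ => _) = fun t => p.[expi t] * expi t + c); last first.
  by apply/funext => w; rewrite hornerMXaddC.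
apply: cvgD; last exact: cvg_cst.
by apply: cvgM; [exact: IH | exact: continuous_expi].
Qed.

Lemma cadm_disc_alg g : disc_alg g -> cadm (fun t => g (expi t)).
Proof.
move=> dg; apply: cadm_continuous; last first.
  by have [b _ hb] := disc_alg_bounded dg; exists b => t _; rewrite hb // modc_expi.
move=> t; apply/cvgCP => e e0; have e4 : 0 < e / 4 by rewrite divr_gt0.
have [p hp] := dg _ e4.
have /cvgCP/(_ _ e4) := @continuous_poly_expi p t.
apply: filterS => s h.
have -> : g (expi t) - g (expi s) = (g (expi t) - p.[expi t]) + (p.[expi t] - p.[expi s])
   - (g (expi s) - p.[expi s]) by ring.
apply: le_lt_trans (ler_modcB _ _) _.
have h1 := hp (expi t); have h2 := hp (expi s); rewrite !modc_expi in h1 h2.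
have := ler_modcD (g (expi t) - p.[expi t]) (p.[expi t] - p.[expi s]).
by have := h1 (lexx _); have := h2 (lexx _); lra.
Qed.

Lemma disc_algS g r : hol g -> 0 <= r < 1 -> disc_alg (fun z => g (r%:C * z)).
Proof.
move=> hg /andP[r0 r1]; have [r00|rn0] := eqVneq r 0; last by apply: hg; rewrite lt0r rn0 r0.
apply: disc_alg_ext (disc_alg_cst (g 0)) => z _.
by rewrite r00 mul0r.
Qed.

Lemma cadm_hol g r : hol g -> 0 <= r < 1 -> cadm (fun t => g (r%:C * expi t)).
Proof. by move=> hg r01; apply: cadm_disc_alg (disc_algS hg r01). Qed.

Lemma cmean_orth n i : cmean (fun t : R => expi t ^+ n * (expi t)^*%C ^+ i) = (n == i)%:R :> C.
Proof.
have cexpi (t : R) k : expi t ^+ k * (expi t)^*%C ^+ k = 1 :> C.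
  by rewrite -exprMn mulrC expi_conjM expr1n.
have [ni|] := leqP n i.
  have -> : (fun t : R => expi t ^+ n * (expi t)^*%C ^+ i : C) = fun t => (expi t)^*%C ^+ (i - n).
    by apply/funext => t; rewrite -{1}(subnKC ni) exprD mulrA cexpi mul1r.
  case: (eqVneq n i) => [->|nin].
    by rewrite subnn -[RHS](cmean_cst 1); congr cmean; apply/funext => t; rewrite expr0.
  have : (0 < i - n)%N by rewrite subn_gt0 ltn_neqAle nin.
  by case: (i - n)%N => // k _; exact: cmean_conj_expiX.
move=> ni; have -> : (fun t : R => expi t ^+ n * (expi t)^*%C ^+ i : C) = fun t => expi t ^+ (n - i).
  by apply/funext => t; rewrite -{1}(subnK (ltnW ni)) exprD -mulrA cexpi mulr1.
have : (0 < n - i)%N by rewrite subn_gt0.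
by rewrite (gtn_eqF ni); case: (n - i)%N => // k _; exact: cmean_expiX.
Qed.

Lemma cadm_orth n i : cadm (fun t : R => expi t ^+ n * (expi t)^*%C ^+ i : C).
Proof.
apply: cadmM; first exact: cadm_expiX.
rewrite (_ : (fun _ => _) = fun t => (expi t ^+ i)^*%C); first exact/cadm_conj/cadm_expiX.
by apply/funext => t; rewrite rmorphXn.
Qed.

Lemma le0_of_small (x K : R) : (forall e, 0 < e -> x <= K * e) -> x <= 0.
Proof.
move=> h; rewrite leNgt; apply/negP => x0.
have := h (x / (2 * (`|K| + 1))) ltac:(by rewrite divr_gt0 // mulr_gt0 // ltr_wpDl).
apply/negP; rewrite -ltNge mulrCA gtr_pMr // ltr_pdivrMr ?mulr_gt0 ?ltr_wpDl // mul1r.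
by have := ler_norm K; have := normr_ge0 K; lra.
Qed.

Lemma cauchy_monomial n z : modc z < 1 -> cmean (fun t => expi t ^+ n * ck z t) = z ^+ n.
Proof.
move=> z1; apply/eqP; rewrite -subr_eq0 -modc_eq0 eq_le modc_ge0 andbT.
have b1 := @bounded_mean01 R.
apply: (@le0_of_small _ (2 / (1 - modc z))) => e e0.
have [m0 hm0] := @exprn_small _ (modc z) e ltac:(by rewrite modc_ge0) e0.
(* Long enough for the remainder to be small, and larger than [n] so that the one term surviving
   orthogonality is among those summed. *)
set m := (m0 + n.+1)%N.
have hm : modc z ^+ m <= e.
  by apply: le_trans hm0; rewrite exprD ler_piMr ?exprn_ge0 ?modc_ge0 // exprn_ile1 ?modc_ge0 // ltW.
pose S t : C := \sum_(i < m) (z ^+ i * (expi t ^+ n * (expi t)^*%C ^+ i)).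
have cS : cadm S.
  by apply: (@cadm_sum _ m (fun i t => z ^+ i * (expi t ^+ n * (expi t)^*%C ^+ i))) => i;
    exact/cadmZ/cadm_orth.
have -> : z ^+ n = cmean S.
  rewrite /cmean (@cfun_sum _ _ _ b1 m (fun i t => z ^+ i * (expi t ^+ n * (expi t)^*%C ^+ i))); last first.
    by move=> i; exact/cadmZ/cadm_orth.
  have nm : (n < m)%N by rewrite /m addnS ltnS leq_addl.
  rewrite (bigD1 (Ordinal nm)) //= (cfunZ b1); last exact: cadm_orth.
  rewrite [cfun _ _]cmean_orth eqxx mulr1 big1 ?addr0 // => i ni.
  rewrite (cfunZ b1); last exact: cadm_orth.
  rewrite [cfun _ _]cmean_orth; case: eqP => [ni'|_]; last by rewrite mulr0.
  by move/eqP: ni; case; apply/val_inj.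
have cE : cadm (fun t => expi t ^+ n * ck z t) by apply: cadmM; [exact: cadm_expiX | exact: cadm_ck].
rewrite /cmean -(cfunB b1) //.
have -> : 2 / (1 - modc z) * e = 2 * 1 * (e * (1 - modc z)^-1) by ring.
apply: (cfun_le b1).
  rewrite (_ : (fun _ => _) = fun t => expi t ^+ n * ck z t + -1 * S t).
    by apply: cadmD => //; exact: cadmZ.
  by apply/funext => t; rewrite mulN1r.
move=> t _.
have -> : expi t ^+ n * ck z t - S t = expi t ^+ n * ((z * (expi t)^*%C) ^+ m * ck z t).
  rewrite -[_ ^+ m * _](geometric_remainder _ (ck_neq0 t z1)) mulrBr; congr (_ - _).
  rewrite mulr_sumr; apply: eq_bigr => i _; rewrite exprMn; ring.
rewrite !modcM !modcX modc_expi expr1n mul1r modcM modc_conj_expi mulr1.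
by rewrite ler_pM ?exprn_ge0 ?modc_ge0 // modc_ck.
Qed.

Lemma cauchy_poly (p : {poly C}) z : modc z < 1 -> p.[z] = cmean (fun t => p.[expi t] * ck z t).
Proof.
move=> z1; have b1 := @bounded_mean01 R.
have -> : (fun t => p.[expi t] * ck z t) =
   fun t => \sum_(i < size p) (p`_i * (expi t ^+ i * ck z t)).
  by apply/funext => t; rewrite horner_coef mulr_suml; apply: eq_bigr => i _; rewrite mulrA.
have cE i : cadm (fun t => expi t ^+ i * ck z t) by apply: cadmM; [exact: cadm_expiX | exact: cadm_ck].
rewrite /cmean (@cfun_sum _ _ _ b1 _ (fun i t => p`_i * (expi t ^+ i * ck z t))); last first.
  by move=> i; exact: cadmZ.
rewrite horner_coef; apply: eq_bigr => i _.
by rewrite (cfunZ b1) // [cfun _ _]cauchy_monomial.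
Qed.

Lemma cauchy_formula g z : disc_alg g -> modc z < 1 ->
  g z = cmean (fun t => g (expi t) * ck z t).
Proof.
move=> dg z1; apply/eqP; rewrite -subr_eq0 -modc_eq0 eq_le modc_ge0 andbT.
have b1 := @bounded_mean01 R.
apply: (@le0_of_small _ (1 + 2 / (1 - modc z))) => e e0.
have [p hp] := dg _ e0.
have -> : g z - cmean (fun t => g (expi t) * ck z t) = (g z - p.[z]) -
    (cmean (fun t => g (expi t) * ck z t) - cmean (fun t => p.[expi t] * ck z t)).
  by rewrite -cauchy_poly //; ring.
apply: le_trans (ler_modcB _ _) _; rewrite mulrDl mul1r; apply: lerD.
  by apply: hp; exact: ltW.
have cg : cadm (fun t => g (expi t) * ck z t).
  by apply: cadmM; [exact: cadm_disc_alg | exact: cadm_ck].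
have cp : cadm (fun t => p.[expi t] * ck z t).
  by apply: cadmM; [exact: cadm_disc_alg (disc_alg_poly p) | exact: cadm_ck].
rewrite /cmean -(cfunB b1) //.
have -> : 2 / (1 - modc z) * e = 2 * 1 * (e * (1 - modc z)^-1) by ring.
apply: (cfun_le b1).
  rewrite (_ : (fun _ => _) = fun t => g (expi t) * ck z t + -1 * (p.[expi t] * ck z t)).
    by apply: cadmD => //; exact: cadmZ.
  by apply/funext => t; rewrite mulN1r.
move=> t _; rewrite -mulrBl modcM ler_pM ?modc_ge0 // ?modc_ck //.
by apply: hp; rewrite modc_expi.
Qed.

End cauchy_formula.

(** * Derivatives, Cauchy estimates and the Poisson formula *)

Section holomorphic_functions.
Context {R : realType}.
Local Notation C := (Cx R).
Implicit Types (g f : C -> C) (z w : C) (e r : R).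

(** The first-order remainder of the kernel factors exactly: with x the conjugate circle point, it
    is h^2 x^2 times [ck] at z + h times the square of [ck] at z. Keeping h below half the distance
    to the circle bounds all three kernels uniformly in t. *)
Lemma qd_cauchy_transform (J : (R -> R) -> R) M (G : R -> C) z :
  bounded_functional J M -> cadm G -> modc z < 1 ->
  qd (fun w => cfun J (fun t => G t * ck w t)) z
     (cfun J (fun t => G t * ((expi t)^*%C * ck z t ^+ 2))).
Proof.
move=> bJ cG z1; have [b hb] := cadm_bounded cG.
have b0 : 0 <= b by apply: le_trans (hb _ I01_0); exact: modc_ge0.
have m0 := modc_ge0 z.
set q := 1 - modc z; have q0 : 0 < q by rewrite subr_gt0.
have bJ' : bounded_functional J `|M|.
  have [JD JZ JM] := bJ; split => // g b' ag gb; apply: le_trans (JM _ _ ag gb) _.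
  by rewrite ler_wpM2r ?ler_norm // (le_trans _ (gb _ I01_0)).
exists (q / 2), (2 * `|M| * (b * (2 / q * q^-1 ^+ 2))); split; first by rewrite divr_gt0.
move=> h hq.
have zh1 : modc (z + h) <= 1 - q / 2.
  by apply: le_trans (ler_modcD _ _) _; rewrite /q; move: hq; rewrite /q; lra.
have zh : modc (z + h) < 1 by apply: le_lt_trans zh1 _; rewrite gtrBl divr_gt0.
have c1 := cadm_ck zh; have c2 := cadm_ck z1.
have cc : cadm (fun t : R => (expi t)^*%C : C) by apply: cadm_conj; exact: cadm_expi.
have c3 : cadm (fun t => G t * ck (z + h) t) by exact: (cadmM cG c1).
have c4 : cadm (fun t => G t * ck z t) by exact: (cadmM cG c2).
have c5 : cadm (fun t => G t * ((expi t)^*%C * ck z t ^+ 2)).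
  exact: (cadmM cG (cadm_ck_sqr z1)).
have cN (F : R -> C) : cadm F -> cadm (fun t => - F t).
  move=> cF; rewrite (_ : (fun _ => _) = fun t => -1 * F t); first exact: cadmZ.
  by apply/funext => t; rewrite mulN1r.
rewrite -(cfunB bJ) // -(cfunZ bJ) // -(cfunB bJ) //; last 2 first.
- by apply: cadmD => //; exact: cN.
- exact: cadmZ.
rewrite -mulrA; apply: le_trans (_ : 2 * `|M| * (b * (2 / q * q^-1 ^+ 2) * modc h ^+ 2) <= _); last first.
  by rewrite !mulrA.
apply: (cfun_le bJ').
  apply: cadmD; first by apply: cadmD => //; exact: cN.
  by apply: cN; exact: cadmZ.
move=> t It.
have -> : G t * ck (z + h) t - G t * ck z t - h * (G t * ((expi t)^*%C * ck z t ^+ 2)) =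
    G t * (h ^+ 2 * ((expi t)^*%C ^+ 2 * (ck (z + h) t * ck z t ^+ 2))).
  have := ck_neq0 t z1; have := ck_neq0 t zh; rewrite /ck.
  by move: (expi t)^*%C => x; move=> h1 h2; field; rewrite h1 h2.
rewrite modcM -mulrA ler_pM ?modc_ge0 ?hb //.
rewrite modcM modcX mulrC ler_wpM2r ?exprn_ge0 ?modc_ge0 //.
rewrite modcM modcX modc_conj_expi expr1n mul1r modcM modcX.
apply: ler_pM; rewrite ?exprn_ge0 ?modc_ge0 //.
  apply: le_trans (modc_ck t zh) _; rewrite -invf_div lef_pV2 ?posrE ?divr_gt0 ?subr_gt0 //.
  by move: zh1; lra.
by rewrite lerXn2r ?nnegrE ?modc_ge0 ?invr_ge0 ?(ltW q0) // modc_ck.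
Qed.

Lemma qd_disc_alg g z : disc_alg g -> modc z < 1 ->
  qd g z (cmean (fun t => g (expi t) * ((expi t)^*%C * ck z t ^+ 2))).
Proof.
move=> dg z1; have q0 : 0 < 1 - modc z by rewrite subr_gt0.
apply: (qd_eq q0 (f := fun w => cmean (fun t => g (expi t) * ck w t))).
  move=> w wz; rewrite -cauchy_formula //.
  by rewrite -(subrK z w); apply: le_lt_trans (ler_modcD _ _) _; rewrite -ltrBrDr.
exact: qd_cauchy_transform bounded_mean01 (cadm_disc_alg dg) z1.
Qed.

Lemma qd_scale g z d r : 0 < r -> qd (fun w => g (r%:C * w)) (z / r%:C) d ->
  qd g z (d / r%:C).
Proof.
move=> r0 [dl [K [dl0 H]]].
have rC : r%:C != 0 :> C by rewrite eq_complex /= eqxx andbT gt_eqF.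
have mr (w : C) : modc (w / r%:C) = modc w / r by rewrite modc_div modc_real gtr0_norm.
exists (dl * r), (K / r ^+ 2); split; first by rewrite mulr_gt0.
move=> h hh; have := H (h / r%:C); rewrite mr ltr_pdivrMr // => /(_ hh).
have -> : r%:C * (z / r%:C + h / r%:C) = z + h by field.
have -> : r%:C * (z / r%:C) = z by field.
by rewrite expr_div_n [K * _]mulrA [K * _ / _]mulrAC [h / _ * _]mulrAC -[h * _ / _]mulrA.
Qed.

Lemma hol_qd g z : hol g -> modc z < 1 -> qd g z (derive1 g z).
Proof.
move=> hg z1; have m0 := modc_ge0 z.
pose r := (1 + modc z) / 2.
have r0 : 0 < r by rewrite /r; lra.
have r1 : r < 1 by rewrite /r; lra.
have zr : modc z < r by rewrite /r; lra.
have rC : r%:C != 0 :> C by rewrite eq_complex /= eqxx andbT gt_eqF.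
have dg : disc_alg (fun w => g (r%:C * w)) by apply: hg; rewrite r0.
have mr (w : C) : modc (w / r%:C) = modc w / r by rewrite modc_div modc_real gtr0_norm.
have zr1 : modc (z / r%:C) < 1 by rewrite mr ltr_pdivrMr // mul1r.
have q := qd_scale r0 (qd_disc_alg dg zr1).
by have := q; rewrite -(qd_derive1 q).
Qed.

Lemma hol_ext g1 g2 : (forall z, modc z < 1 -> g1 z = g2 z) -> hol g1 -> hol g2.
Proof.
move=> h h1 r /[dup] r01 /h1; apply: disc_alg_ext => z z1; rewrite h //.
move: r01 => /andP[r0 r1]; rewrite modcM modc_real (gtr0_norm r0).
by apply: le_lt_trans r1; rewrite ler_piMr // ltW.
Qed.

Lemma holD g1 g2 : hol g1 -> hol g2 -> hol (fun z => g1 z + g2 z).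
Proof. by move=> h1 h2 r r01; apply: disc_algD; [exact: h1 | exact: h2]. Qed.

Lemma holM g1 g2 : hol g1 -> hol g2 -> hol (fun z => g1 z * g2 z).
Proof. by move=> h1 h2 r r01; apply: disc_algM; [exact: h1 | exact: h2]. Qed.

Lemma hol_cst (a : C) : hol (fun=> a).
Proof. by move=> r r01; exact: disc_alg_cst. Qed.

Lemma holZ a g : hol g -> hol (fun z => a * g z).
Proof. exact/holM/hol_cst. Qed.

Lemma hol_poly (p : {poly C}) : hol (fun z => p.[z]).
Proof.
move=> r r01; apply: disc_alg_ext (disc_alg_poly (p \Po (r%:C *: 'X))) => z _.
by rewrite horner_comp hornerZ hornerX.
Qed.

Lemma hol_id : hol (@id C).
Proof. by apply: hol_ext (hol_poly 'X) => z _; rewrite hornerX. Qed.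

Lemma hol_cexp g : hol g -> hol (fun z => cexp (g z)).
Proof. by move=> h r r01; apply: disc_alg_cexp; exact: h. Qed.

Lemma hol_prod n (g : nat -> C -> C) : (forall i, hol (g i)) ->
  hol (fun z => \prod_(i < n) g i z).
Proof.
move=> h r r01; apply: (@disc_alg_prod _ n (fun i z => g i (r%:C * z))) => i.
exact: h.
Qed.

Lemma hol_lim g : (forall r e, 0 < r < 1 -> 0 < e -> exists2 g', hol g' &
  forall z, modc z <= r -> modc (g z - g' z) <= e) -> hol g.
Proof.
move=> H r r01; apply: disc_alg_lim => e e0.
have [g' hg' H'] := H r e r01 e0; exists (fun z => g' (r%:C * z)); first exact: hg'.
move=> z z1; apply: H'; move: r01 => /andP[r0 r1].
by rewrite modcM modc_real (gtr0_norm r0) ler_piMr // ltW.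
Qed.

Lemma disc_alg_geometric a : modc a < 1 -> disc_alg (fun z => (1 - a * z)^-1).
Proof.
move=> a1; apply: disc_alg_lim => e e0.
have q0 : 0 < 1 - modc a by rewrite subr_gt0.
have [n hn] := @exprn_small _ (modc a) (e * (1 - modc a))
  ltac:(by rewrite modc_ge0) ltac:(by rewrite mulr_gt0).
exists (fun z => \sum_(i < n) (a * z) ^+ i).
  apply: (@disc_alg_sum _ n (fun i z => (a * z) ^+ i)) => i; apply: disc_algX.
  by apply: disc_algM; [exact: disc_alg_cst | exact: disc_alg_id].
move=> z z1; have az : modc (a * z) <= modc a by rewrite modcM ler_piMr ?modc_ge0.
have n0 : 1 - a * z != 0 by apply: one_sub_neq0; exact: le_lt_trans az a1.
rewrite geometric_remainder // modc_div ler_pdivrMr ?modc_gt0 //.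
apply: le_trans (_ : e * (1 - modc a) <= _); last by rewrite ler_pM2l // modc_sub_ge.
by apply: le_trans hn; rewrite modcX lerXn2r ?nnegrE ?modc_ge0.
Qed.

Lemma hol_geometric a : modc a <= 1 -> hol (fun z => (1 - a * z)^-1).
Proof.
move=> a1 r /andP[r0 r1].
apply: disc_alg_ext (disc_alg_geometric (a := a * r%:C) _) => [z _|]; first by rewrite mulrA.
by rewrite modcM modc_real gtr0_norm // (le_lt_trans _ r1) // ler_piMl // ltW.
Qed.

(** The constant and the larger radius depend on [rho] alone, not on the function: this is what
    turns uniform convergence on smaller discs into convergence of derivatives. *)
Lemma cauchy_estimate (rho : R) : rho < 1 -> exists (K r : R), 0 <= K /\ 0 < r < 1 /\
  forall g b z, hol g -> (forall w, modc w <= r -> modc (g w) <= b) -> modc z <= rho ->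
  modc (derive1 g z) <= K * b.
Proof.
(* [rho] may be negative; the maximum keeps the radius r = (1 + s)/2 positive. *)
move=> rho1; pose s := Num.max rho 0.
have s0 : 0 <= s by rewrite le_max lexx orbT.
have s1 : s < 1 by rewrite gt_max rho1 ltr01.
pose r := (1 + s) / 2.
have r0 : 0 < r by rewrite /r; lra.
have r1 : r < 1 by rewrite /r; lra.
have q0 : 0 < 1 - s / r by rewrite subr_gt0 ltr_pdivrMr // mul1r /r; lra.
have rC : r%:C != 0 :> C by rewrite eq_complex /= eqxx andbT gt_eqF.
exists (2 * 1 * (1 - s / r)^-1 ^+ 2 / r), r; split.
  by rewrite divr_ge0 ?(ltW r0) // mulr_ge0 // exprn_ge0 // invr_ge0 ltW.
split; first by rewrite r0.
move=> g b z hg gb zr.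
have zs : modc z <= s by rewrite le_max zr.
have dg : disc_alg (fun w => g (r%:C * w)) by apply: hg; rewrite r0.
have mr (w : C) : modc (w / r%:C) = modc w / r by rewrite modc_div modc_real gtr0_norm.
have zq : modc (z / r%:C) <= s / r by rewrite mr ler_pM2r ?invr_gt0.
have zr1 : modc (z / r%:C) < 1 by apply: le_lt_trans zq _; rewrite -subr_gt0.
have z1 : modc z < 1 by apply: le_lt_trans zs s1.
rewrite (qd_derive1 (qd_scale r0 (qd_disc_alg dg zr1))).
rewrite modc_div modc_real (gtr0_norm r0) mulrAC ler_pM2r ?invr_gt0 //.
set X := (1 - s / r)^-1 ^+ 2.
have -> : 2 * 1 * X * b = 2 * 1 * (b * X) by ring.
apply: (cfun_le (@bounded_mean01 R)).
  exact: (cadmM (cadm_disc_alg dg) (cadm_ck_sqr zr1)).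
move=> t _; rewrite modcM [modc ((expi t)^*%C * _)]modcM modc_conj_expi mul1r modcX.
apply: ler_pM; rewrite ?exprn_ge0 ?modc_ge0 //.
  by apply: gb; rewrite modcM modc_real modc_expi mulr1 gtr0_norm.
rewrite lerXn2r ?nnegrE ?modc_ge0 ?invr_ge0 ?(ltW q0) //.
apply: le_trans (modc_ck t zr1) _; rewrite lef_pV2 ?posrE ?subr_gt0 //; last first.
  by rewrite -subr_gt0.
by rewrite lerD2l lerN2.
Qed.

Lemma derive1_sub g1 g2 z : hol g1 -> hol g2 -> modc z < 1 ->
  derive1 (fun z => g1 z - g2 z) z = derive1 g1 z - derive1 g2 z.
Proof.
move=> h1 h2 z1; apply: qd_derive1.
have := qdD (hol_qd h1 z1) (qdZ (-1) (hol_qd h2 z1)).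
rewrite mulN1r; congr qd; apply/funext => w; by rewrite mulN1r.
Qed.

Lemma holB g1 g2 : hol g1 -> hol g2 -> hol (fun z => g1 z - g2 z).
Proof.
move=> h1 h2; apply: hol_ext (holD h1 (holZ (-1) h2)) => z _.
by rewrite mulN1r.
Qed.

(** If a polynomial is uniformly close to [g] on a larger disc, the Cauchy estimate applied to the
    difference makes its derivative close to that of [g]. *)
Lemma hol_derive1 g : hol g -> hol (derive1 g).
Proof.
move=> hg; apply: hol_lim => rho e /andP[rho0 rho1] e0.
have [K [r [K0 [/andP[r0 r1] H]]]] := cauchy_estimate rho1.
have rC : r%:C != 0 :> C by rewrite eq_complex /= eqxx andbT gt_eqF.
have [p hp] := hg r ltac:(by rewrite r0) (e / (K + 1)) ltac:(by rewrite divr_gt0 // ltr_wpDl).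
pose q : {poly C} := p \Po (r%:C^-1 *: 'X).
exists (fun z => q^`().[z]); first exact: hol_poly.
move=> z zr; have z1 := le_lt_trans zr rho1.
have -> : q^`().[z] = derive1 (horner q : C -> C) z by rewrite (qd_derive1 (qd_poly q z)).
rewrite -derive1_sub //; last exact: hol_poly.
apply: le_trans (H _ (e / (K + 1)) _ _ _ zr) _.
- by apply: holB => //; exact: hol_poly.
- move=> w wr; have := hp (r%:C^-1 * w).
  rewrite mulrA mulfV // mul1r /q horner_comp hornerZ hornerX; apply.
  by rewrite modcM modcV modc_real gtr0_norm // ler_pdivrMl // mulr1.
- by rewrite mulrCA ler_piMr ?(ltW e0) // ler_pdivrMr ?ltr_wpDl // mul1r lerDl.
Qed.

Lemma derive1_cvg (g_ : nat -> C -> C) g z : (forall n, hol (g_ n)) -> hol g ->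
  (forall r e, 0 < r < 1 -> 0 < e -> exists N, forall n, (N <= n)%N ->
    forall w, modc w <= r -> modc (g_ n w - g w) <= e) ->
  modc z < 1 -> (fun n => derive1 (g_ n) z) @ \oo --> derive1 g z.
Proof.
move=> hn hg H z1; have [K [r [K0 [r01 HK]]]] := cauchy_estimate z1.
apply/cvgCP => e e0.
have [N HN] := H r (e / 2 / (K + 1)) r01 ltac:(by rewrite !divr_gt0 // ltr_wpDl).
exists N => // n /= Nn; rewrite modc_distC -derive1_sub //.
apply: le_lt_trans (HK _ _ _ (holB (hn n) hg) (HN n Nn) (lexx _)) _.
rewrite mulrCA; apply: (@le_lt_trans _ _ (e / 2)); last by rewrite ltr_pdivrMr // ltr_pMr // ltr1n.
by rewrite ler_piMr ?divr_ge0 ?(ltW e0) // ler_pdivrMr ?ltr_wpDl // mul1r lerDl.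
Qed.

Lemma mean_value g r : hol g -> 0 <= r < 1 -> g 0 = cmean (fun t => g (r%:C * expi t)).
Proof.
move=> hg r01; have := cauchy_formula (disc_algS hg r01) (z := 0).
rewrite mulr0 modc0 => -> //; congr cmean; apply/funext => t.
by rewrite /ck mul0r subr0 invr1 mulr1.
Qed.

Lemma conjcM z w : (z * w)^*%C = z^*%C * w^*%C.
Proof. by case: z => a b; case: w => c d; simpc; congr (_ +i* _); ring. Qed.

Lemma conjcB z w : (z - w)^*%C = z^*%C - w^*%C.
Proof. by case: z => a b; case: w => c d; simpc; congr (_ +i* _); ring. Qed.

Lemma pkernel_expi z (t : R) : modc z < 1 ->
  (pkernel z (expi t))%:C = (1 - modc z ^+ 2)%:C * (1 - z^*%C * expi t)^-1 * ck z t.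
Proof.
move=> z1; rewrite /pkernel /ck.
have -> : 1 - z^*%C * expi t = (1 - z * (expi t)^*%C)^*%C.
  by rewrite conjcB conjcM conjcK conjc1.
rewrite [(expi t)^*%C * z]mulrC; set w := 1 - z * (expi t)^*%C.
by rewrite rmorphM fmorphV -[RHS]mulrA -invfM; congr (_ * _^-1); rewrite mulrC mul_conjc.
Qed.

(** Cauchy's formula is applied to g(w) (1 - |z|^2) / (1 - z^* w): the extra factor equals 1 at w =
    z, and on the circle it completes the Cauchy kernel to the Poisson kernel. *)
Lemma poisson_formula g z : disc_alg g -> modc z < 1 ->
  g z = cmean (fun t => g (expi t) * (pkernel z (expi t))%:C).
Proof.
move=> dg z1.
have dF : disc_alg (fun w => (1 - modc z ^+ 2)%:C * (g w * (1 - z^*%C * w)^-1)).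
  apply: disc_algM; first exact: disc_alg_cst.
  by apply: disc_algM => //; apply: disc_alg_geometric; rewrite modc_conj.
have := cauchy_formula dF z1.
have -> : 1 - z^*%C * z = (1 - modc z ^+ 2)%:C by rewrite mulrC mul_conjc rmorphB.
rewrite mulrCA divff ?mulr1; last first.
  rewrite eq_complex /= eqxx andbT subr_eq0 eq_sym lt_eqF //.
  by rewrite expr_lt1 ?modc_ge0.
move=> ->; congr cmean; apply/funext => t.
by rewrite pkernel_expi // !mulrA [_ * g _]mulrC.
Qed.

End holomorphic_functions.

(** * Blaschke factors and their logarithmic derivatives *)

Section blaschke_factors.
Context {R : realType}.
Local Notation C := (Cx R).
Implicit Types (a z w : C).

Lemma realcD (x y : R) : ((x + y)%:C : C) = x%:C + y%:C.
Proof. by rewrite rmorphD. Qed.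

Lemma realcB (x y : R) : ((x - y)%:C : C) = x%:C - y%:C.
Proof. by rewrite rmorphB. Qed.

Lemma realcM (x y : R) : ((x * y)%:C : C) = x%:C * y%:C.
Proof. by rewrite rmorphM. Qed.

Lemma realcV (x : R) : ((x^-1)%:C : C) = (x%:C)^-1.
Proof. by rewrite fmorphV. Qed.

Lemma realc_neq0 (x : R) : x != 0 -> x%:C != 0 :> C.
Proof. by move=> x0; rewrite eq_complex /= eqxx andbT. Qed.

(* Normalised Blaschke factor. A zero on the unit circle contributes the constant factor 1 when
   it is the point 1, so 1 serves as padding in sequences of zeros. *)
Definition bfac a z : C := (if a == 0 then -1 else `|a| / a) * ((a - z) / (1 - a^*%C * z)).

(** Common kernel of all logarithmic derivatives, scaled by 1 - |z|^2. For w in the disc, 1 - |w|^2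
    times it is minus that of the Blaschke factor of w; for w on the circle, twice it is the scaled
    z-derivative of the Herglotz kernel. *)
Definition kap z w : C := (1 - modc z ^+ 2)%:C / ((w - z) * (1 - w^*%C * z)).

Lemma den_neq0 a z : modc a <= 1 -> modc z < 1 -> 1 - a^*%C * z != 0.
Proof.
move=> a1 z1; apply: one_sub_neq0; rewrite modcM modc_conj.
by apply: le_lt_trans z1; rewrite ler_piMl ?modc_ge0.
Qed.

Lemma bfac_bfactor a z : a != 0 -> bfac a z = bfactor a z.
Proof. by move=> a0; rewrite /bfac /bfactor (negbTE a0). Qed.

Lemma bfac0 z : bfac 0 z = z.
Proof. by rewrite /bfac eqxx conjc0 mul0r subr0 divr1 sub0r mulN1r opprK. Qed.

Lemma bfac1 z : modc z < 1 -> bfac 1 z = 1.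
Proof.
move=> z1; have := @den_neq0 1 z; rewrite modc1 => /(_ (lexx _) z1).
by rewrite /bfac oner_eq0 conjc1 mul1r normr1 divr1 mul1r => h; rewrite divff.
Qed.

Lemma modc_bcoef a : modc (if a == 0 then -1 else `|a| / a) = 1.
Proof.
case: eqP => [_|/eqP a0]; first by rewrite modcN modc1.
by rewrite modc_div norm_modc modc_real ger0_norm ?modc_ge0 // divff // modc_eq0.
Qed.

Lemma pick_identity a z :
  modc (1 - a^*%C * z) ^+ 2 - modc (a - z) ^+ 2 = (1 - modc a ^+ 2) * (1 - modc z ^+ 2).
Proof. by rewrite !sqr_modc; case: a => a b; case: z => x y; simpc => /=; ring. Qed.

Lemma sqr_modc_lt1 z : modc z < 1 -> 0 < 1 - modc z ^+ 2.
Proof. by move=> z1; rewrite subr_gt0 expr_lt1 ?modc_ge0. Qed.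

Lemma sqr_modc_le1 z : modc z <= 1 -> 0 <= 1 - modc z ^+ 2.
Proof. by move=> z1; rewrite subr_ge0 expr_le1 ?modc_ge0. Qed.

Lemma pkernel_gt0 z w : modc z < 1 -> modc w <= 1 -> 0 < pkernel z w.
Proof.
move=> z1 w1; apply: divr_gt0; first exact: sqr_modc_lt1.
by rewrite exprn_gt0 // modc_gt0 den_neq0.
Qed.

(** Reason for the weight 1 - |a|^2 of a zero in the measure: its share of P(z) is exactly one minus
    the squared pseudo-hyperbolic distance from a to z. Closeness of zeros is always measured
    through this quantity. *)
Lemma sqr_modc_bfac a z : modc a <= 1 -> modc z < 1 ->
  modc (bfac a z) ^+ 2 = 1 - (1 - modc a ^+ 2) * pkernel z a.
Proof.
move=> a1 z1; rewrite modcM modc_bcoef mul1r modc_div expr_div_n /pkernel mulrA -pick_identity.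
have := den_neq0 a1 z1; rewrite -modc_eq0 => d0.
by rewrite mulrBl divff ?expf_neq0 //; ring.
Qed.

Lemma modc_bfac_le1 a z : modc a <= 1 -> modc z < 1 -> modc (bfac a z) <= 1.
Proof.
move=> a1 z1; rewrite -(expr_le1 (n := 2)) ?modc_ge0 // sqr_modc_bfac // gerBl.
by rewrite mulr_ge0 ?sqr_modc_le1 // ltW // pkernel_gt0.
Qed.

Lemma hol_bfac a : modc a <= 1 -> hol (bfac a).
Proof.
move=> a1; apply: holZ; apply: holM; last by apply: hol_geometric; rewrite modc_conj.
by apply: holB; [exact: hol_cst | exact: hol_id].
Qed.

Lemma qd_bfac a z : modc a <= 1 -> modc z < 1 ->
  qd (bfac a) z ((if a == 0 then -1 else `|a| / a) *
                 (- (1 - modc a ^+ 2)%:C / (1 - a^*%C * z) ^+ 2)).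
Proof.
move=> a1 z1; apply: qdZ; have d0 := den_neq0 a1 z1.
have q0 : 0 < 1 - modc z by rewrite subr_gt0.
pose m := modc (1 - a^*%C * z); have m0 : 0 < m by rewrite modc_gt0.
exists ((1 - modc z) / 2), ((1 - modc a ^+ 2) * m^-1 ^+ 2 * ((1 - modc z) / 2)^-1).
split; first by rewrite divr_gt0.
move=> h hh.
have zh : modc (z + h) <= 1 - (1 - modc z) / 2.
  by apply: le_trans (ler_modcD _ _) _; move: hh; lra.
have zh1 : modc (z + h) < 1 by apply: le_lt_trans zh _; rewrite gtrBl divr_gt0.
have d1 := den_neq0 a1 zh1.
have -> : (a - (z + h)) / (1 - a^*%C * (z + h)) - (a - z) / (1 - a^*%C * z) -
   h * (- (1 - modc a ^+ 2)%:C / (1 - a^*%C * z) ^+ 2) =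
   h ^+ 2 * (- ((1 - modc a ^+ 2)%:C * a^*%C) / ((1 - a^*%C * z) ^+ 2 * (1 - a^*%C * (z + h)))).
  rewrite realcB -mul_conjc.
  by move: d0 d1; move: (a^*%C) => x d0 d1; field; rewrite d0 d1.
rewrite modcM modcX mulrC ler_wpM2r ?exprn_ge0 ?modc_ge0 //.
rewrite modc_div modcN !modcM modc_conj modc_real ger0_norm ?sqr_modc_le1 //.
rewrite -[modc (1 - _) * modc (1 - a^*%C * z)]expr2 -/m invfM -exprVn mulrA.
apply: ler_pM; rewrite ?invr_ge0 ?mulr_ge0 ?exprn_ge0 ?invr_ge0 ?modc_ge0 ?sqr_modc_le1 ?(ltW m0) //.
  rewrite ler_wpM2r ?exprn_ge0 ?invr_ge0 ?(ltW m0) //.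
  by rewrite ler_piMr ?sqr_modc_le1.
rewrite lef_pV2 ?posrE ?divr_gt0 ?modc_gt0 //.
apply: le_trans (modc_sub_ge (r := modc (z + h)) _); first by move: zh; lra.
by rewrite modcM modc_conj ler_piMl ?modc_ge0.
Qed.

Lemma derive1_bfac a z : modc a <= 1 -> modc z < 1 ->
  modc (derive1 (bfac a) z) * (1 - modc z ^+ 2) = 1 - modc (bfac a z) ^+ 2.
Proof.
move=> a1 z1; rewrite (qd_derive1 (qd_bfac a1 z1)) modcM modc_bcoef mul1r.
rewrite modc_div modcN modc_real ger0_norm ?sqr_modc_le1 // modcX sqr_modc_bfac //.
by rewrite /pkernel; ring.
Qed.

Lemma derive1_bfac_kap a z : modc a <= 1 -> modc z < 1 -> a != z ->
  (1 - modc z ^+ 2)%:C * derive1 (bfac a) z = - bfac a z * ((1 - modc a ^+ 2)%:C * kap z a).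
Proof.
move=> a1 z1 az; rewrite (qd_derive1 (qd_bfac a1 z1)) /bfac /kap.
have := den_neq0 a1 z1; move: az; rewrite -subr_eq0.
set u := (if _ then _ else _); set A := (1 - modc a ^+ 2)%:C; set Z := (1 - modc z ^+ 2)%:C.
by move: (a^*%C) => x h1 h2; field; rewrite h1 h2.
Qed.

Lemma kap_pkernel z w : modc z < 1 -> modc w <= 1 -> w != z ->
  kap z w = (pkernel z w)%:C * ((1 - w * z^*%C) / (w - z)).
Proof.
move=> z1 w1 wz; have d0 := den_neq0 w1 z1; move: wz; rewrite -subr_eq0 => wz.
rewrite /kap /pkernel realcM realcV -mul_conjc.
have -> : (1 - w^*%C * z)^*%C = 1 - w * z^*%C by rewrite conjcB conjcM conjcK conjc1.
have d1 : 1 - w * z^*%C != 0.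
  have := d0; rewrite -modc_eq0 -modc_conj modc_eq0 conjcB conjcM conjcK conjc1; exact.
by field; rewrite d0 d1 wz.
Qed.

(** For a nonzero, 1 minus the factor equals (1 - |a|) (a + |a| z) / (a (1 - a^* z)). This is where
    the unimodular normalisation of [bfac] is essential, and it turns the Blaschke condition into
    convergence of the product. *)
Lemma one_sub_bfac a z : modc a <= 1 -> modc z < 1 ->
  modc (1 - bfac a z) <= 2 / (1 - modc z) * (1 - modc a).
Proof.
move=> a1 z1; have q0 : 0 < 1 - modc z by rewrite subr_gt0.
have m0 := modc_ge0 z; have [->|a0] := eqVneq a 0.
  rewrite bfac0 modc0 subr0 mulr1; apply: le_trans (ler_modcB _ _) _.
  by rewrite modc1 ler_pdivlMr //; nra.
have d0 := den_neq0 a1 z1.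
have -> : 1 - bfac a z = (1 - modc a)%:C * ((a + `|a| * z) / a / (1 - a^*%C * z)).
  rewrite /bfac (negbTE a0) norm_modc realcB.
  have e : a * a^*%C = (modc a)%:C * (modc a)%:C by rewrite mul_conjc expr2 realcM.
  move: d0 e; move: (a^*%C) (modc a)%:C => x y d0 e.
  have -> : 1 - y / a * ((a - z) / (1 - x * z)) =
            (a - (a * x) * z - y * a + y * z) / (a * (1 - x * z)).
    by field; rewrite a0 d0.
  by rewrite e (_ : 1%:C = 1) //; field; rewrite a0 d0.
rewrite modcM modc_real ger0_norm ?subr_ge0 // mulrC ler_wpM2r ?subr_ge0 //.
rewrite modc_div ler_pM ?modc_ge0 ?invr_ge0 ?modc_ge0 //.
  rewrite mulrDl divff //; apply: le_trans (ler_modcD _ _) _.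
  rewrite modc1 modc_div modcM norm_modc modc_real ger0_norm ?modc_ge0 //.
  by rewrite mulrAC divff ?modc_eq0 // mul1r -[2]/(1 + 1) lerD2l ltW.
rewrite lef_pV2 ?posrE ?modc_gt0 //; apply: modc_sub_ge.
by rewrite modcM modc_conj ler_piMl.
Qed.

End blaschke_factors.

(** * Convergence of Blaschke products with explicit rates *)

Section blaschke_products.
Context {R : realType}.
Local Notation C := (Cx R).
Implicit Types (a z w : C) (alpha : nat -> C) (T : nat -> R).

(** The Blaschke condition with a modulus: [T N] bounds every finite piece of the series starting at
    N. Points of modulus 1 are allowed and weigh nothing. *)
Definition zero_seq alpha T := [/\ (forall n, modc (alpha n) <= 1), T @ \oo --> 0 &
  forall N k, \sum_(i < k) (1 - modc (alpha (N + i)%N)) <= T N].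

Definition bprod alpha N z : C := \prod_(i < N) bfac (alpha i) z.

Definition blaschke alpha z : C := lim ((fun N => bprod alpha N z) @ \oo).

Lemma zero_seq_ge0 alpha T N : zero_seq alpha T -> 0 <= T N.
Proof. by move=> [_ _ /(_ N 0%N)]; rewrite big_ord0. Qed.

Lemma zero_seq_shift alpha T M : zero_seq alpha T ->
  zero_seq (fun n => alpha (M + n)%N) (fun n => T (M + n)%N).
Proof.
move=> [a1 T0 aT]; split=> // [|N k].
  by rewrite (_ : (fun _ => _) = fun n => T (n + M)%N) ?cvg_shiftn //; apply/funext => n; rewrite addnC.
by under eq_bigr do rewrite addnA; exact: aT.
Qed.

Lemma prod_sub1 n (b : nat -> C) : (forall i, modc (b i) <= 1) ->
  modc (\prod_(i < n) b i - 1) <= \sum_(i < n) modc (1 - b i).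
Proof.
move=> b1; elim: n => [|n IH]; first by rewrite !big_ord0 subrr modc0.
rewrite !big_ord_recr /=.
have -> : (\prod_(i < n) b i) * b n - 1 = (\prod_(i < n) b i - 1) * b n + (b n - 1) by ring.
apply: le_trans (ler_modcD _ _) _; rewrite [modc (b n - 1)]modc_distC lerD2r.
by apply: le_trans IH; rewrite modcM ler_piMr ?modc_ge0.
Qed.

Lemma modc_prod_le1 n (b : nat -> C) : (forall i, modc (b i) <= 1) ->
  modc (\prod_(i < n) b i) <= 1.
Proof.
move=> b1; elim: n => [|n IH]; first by rewrite big_ord0 modc1.
by rewrite big_ord_recr modcM mulr_ile1 ?modc_ge0.
Qed.

Lemma bprodD alpha N k z : bprod alpha (N + k) z =
  bprod alpha N z * bprod (fun n => alpha (N + n)%N) k z.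
Proof. by rewrite /bprod big_split_ord. Qed.

Lemma bprod_sub1 alpha T k z : zero_seq alpha T -> modc z < 1 ->
  modc (bprod alpha k z - 1) <= 2 / (1 - modc z) * T 0%N.
Proof.
move=> [a1 _ aT] z1; have q0 : 0 < 1 - modc z by rewrite subr_gt0.
apply: le_trans (@prod_sub1 k (fun i => bfac (alpha i) z) _) _.
  by move=> i; exact: modc_bfac_le1.
apply: (@le_trans _ _ (2 / (1 - modc z) * \sum_(i < k) (1 - modc (alpha i)))).
  by rewrite mulr_sumr; apply: ler_sum => i _; exact: one_sub_bfac.
by rewrite ler_wpM2l ?divr_ge0 ?(ltW q0) //; exact: (aT 0%N k).
Qed.

Lemma bprod_cauchy alpha T N k z : zero_seq alpha T -> modc z < 1 ->
  modc (bprod alpha (N + k) z - bprod alpha N z) <= 2 / (1 - modc z) * T N.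
Proof.
move=> zs z1; rewrite bprodD -{2}[bprod alpha N z]mulr1 -mulrBr modcM.
have := bprod_sub1 k (zero_seq_shift N zs) z1; rewrite addn0; apply: le_trans.
rewrite ler_piMl ?modc_ge0 //; apply: (@modc_prod_le1 N (fun i => bfac (alpha i) z)) => i.
by apply: modc_bfac_le1 => //; case: zs.
Qed.

Lemma cvgC_cauchy (u : nat -> C) T : T @ \oo --> 0 ->
  (forall N k, modc (u (N + k)%N - u N) <= T N) ->
  u @ \oo --> lim (u @ \oo) /\ forall N, modc (lim (u @ \oo) - u N) <= T N.
Proof.
move=> T0 uT.
have cv (v : nat -> R) : (forall N k, `|v (N + k)%N - v N| <= T N) -> cvgn v.
  move=> vT; apply/cauchy_cvgP/cauchy_exP => e e0.
  have /cvgrPdist_lt/(_ e e0)[N _ HN] := T0.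
  have := HN N (leqnn N); rewrite /= sub0r normrN => TN.
  exists (v N); exists N => // i /= Ni; rewrite /ball /= distrC.
  have := vT N (i - N)%N; rewrite subnKC // => h; apply: le_lt_trans h _.
  exact: le_lt_trans (ler_norm _) TN.
have cr : cvgn (fun n => complex.Re (u n)).
  by apply: cv => N k; rewrite -cReN -cReD; apply: le_trans (ler_normRe_modc _) (uT _ _).
have ci : cvgn (fun n => complex.Im (u n)).
  by apply: cv => N k; rewrite -cImN -cImD; apply: le_trans (ler_normIm_modc _) (uT _ _).
set l : C := limn (fun n => complex.Re (u n)) +i* limn (fun n => complex.Im (u n)).
have ul : u @ \oo --> l.
  apply/cvgCP => e e0; have e20 : 0 < e / 2 by rewrite divr_gt0.
  have /cvgrPdist_lt/(_ _ e20) h1 := cr; have /cvgrPdist_lt/(_ _ e20) h2 := ci.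
  apply: filterS2 h1 h2 => n h1 h2; apply: le_lt_trans (ler_modc_ReIm _) _.
  by rewrite cReD cReN cImD cImN [e]splitr ltrD.
have -> : lim (u @ \oo) = l by apply: cvg_lim ul.
split=> // N; rewrite -subr_le0; apply: (@le0_of_small _ _ 1) => e e0.
have /cvgCP/(_ _ e0)[M _ HM] := ul.
have := HM (N + M)%N (leq_addl _ _) => /= h; have := uT N M.
rewrite -(subrK (u (N + M)%N) l) -addrA => h2.
by have := ler_modcD (l - u (N + M)%N) (u (N + M)%N - u N); lra.
Qed.

Lemma cvgC_unique (I : Type) (F : set_system I) (FF : ProperFilter F) (g : I -> C) (l1 l2 : C) :
  g @ F --> l1 -> g @ F --> l2 -> l1 = l2.
Proof. by move=> h1 h2; apply: (cvg_unique _ h1 h2). Qed.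

Lemma cvg_blaschke alpha T z : zero_seq alpha T -> modc z < 1 ->
  (fun N => bprod alpha N z) @ \oo --> blaschke alpha z /\
  forall N, modc (blaschke alpha z - bprod alpha N z) <= 2 / (1 - modc z) * T N.
Proof.
move=> zs z1; apply: cvgC_cauchy; last by move=> N k; exact: bprod_cauchy.
by case: zs => _ T0 _; rewrite -[X in _ --> X](mulr0 (2 / (1 - modc z))); apply: cvgMr.
Qed.

Lemma hol_bprod alpha N : (forall n, modc (alpha n) <= 1) -> hol (bprod alpha N).
Proof. by move=> a1; apply: (@hol_prod _ N (fun i => bfac (alpha i))) => i; exact: hol_bfac. Qed.

Lemma blaschke_uniform alpha T (r e : R) : zero_seq alpha T -> 0 < r < 1 -> 0 < e ->
  exists N, forall n, (N <= n)%N -> forall z, modc z <= r ->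
  modc (bprod alpha n z - blaschke alpha z) <= e.
Proof.
move=> zs /andP[r0 r1] e0; have q0 : 0 < 1 - r by rewrite subr_gt0.
have [_ T0 _] := zs.
have /cvgrPdist_lt/(_ (e * (1 - r) / 2) ltac:(by rewrite !mulr_gt0))[N _ HN] := T0.
exists N => n Nn z zr; have z1 := le_lt_trans zr r1.
have [_ H] := cvg_blaschke zs z1; rewrite modc_distC; apply: le_trans (H n) _.
have := HN n Nn; rewrite /= sub0r normrN => /ltW Tn.
apply: le_trans (_ : 2 / (1 - r) * (e * (1 - r) / 2) <= _); last first.
  by rewrite le_eqVlt; apply/orP; left; apply/eqP; field; rewrite gt_eqF.
apply: ler_pM; rewrite ?divr_ge0 ?subr_ge0 ?(ltW z1) ?(zero_seq_ge0 n zs) //.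
  by rewrite ler_pM2l // lef_pV2 ?posrE ?subr_gt0 // lerD2l lerN2.
exact: le_trans (ler_norm _) Tn.
Qed.

Lemma hol_blaschke alpha T : zero_seq alpha T -> hol (blaschke alpha).
Proof.
move=> zs; apply: hol_lim => r e r01 e0.
have [N H] := blaschke_uniform zs r01 e0; exists (bprod alpha N).
  by apply: hol_bprod; case: zs.
by move=> z zr; rewrite modc_distC; exact: (H N).
Qed.

Lemma blaschke_le1 alpha T z : zero_seq alpha T -> modc z < 1 -> modc (blaschke alpha z) <= 1.
Proof.
move=> zs z1; have [cv _] := cvg_blaschke zs z1; have [a1 _ _] := zs.
rewrite -subr_le0; apply: (@le0_of_small _ _ 1) => e e0.
have /cvgCP/(_ _ e0)[M _ HM] := cv; have := HM M (leqnn M) => /= h.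
have : modc (bprod alpha M z) <= 1.
  by apply: (@modc_prod_le1 M (fun i => bfac (alpha i) z)) => i; exact: modc_bfac_le1.
by have := ler_modc_sub (blaschke alpha z) (bprod alpha M z); lra.
Qed.

Lemma blaschke_split alpha T N z : zero_seq alpha T -> modc z < 1 ->
  blaschke alpha z = bprod alpha N z * blaschke (fun n => alpha (N + n)%N) z.
Proof.
move=> zs z1; have [cv _] := cvg_blaschke (zero_seq_shift N zs) z1.
have [cv' _] := cvg_blaschke zs z1.
have cv2 : (fun n => bprod alpha (n + N) z) @ \oo --> blaschke alpha z.
  exact: (cvg_comp (addn^~ N) (fun n => bprod alpha n z) (cvg_addnr N) cv').
apply: (@cvgC_unique _ _ _ _ _ _ cv2).
rewrite (_ : (fun _ => _) = fun n => bprod alpha N z * bprod (fun n => alpha (N + n)%N) n z).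
  by apply: cvgM; [exact: cvg_cst | exact: cv].
by apply/funext => n; rewrite addnC bprodD.
Qed.

End blaschke_products.

(** * Herglotz transforms of functionals *)

Section herglotz_transforms.
Context {R : realType}.
Local Notation C := (Cx R).
Implicit Types (z w : C) (J : (R -> R) -> R).

Definition hgl J z : C := cfun J (herglotz z).

Lemma herglotzE z t : modc z < 1 -> herglotz z t = 2 * ck z t - 1.
Proof.
move=> z1; rewrite /herglotz /ck; have := ck_neq0 t z1; rewrite -expiV.
move: (expi_neq0 t); move: (expi t : C) => x x0 h.
have h' : x - z != 0.
  by apply: contraNneq h => /eqP; rewrite subr_eq0 => /eqP <-; rewrite divff // subrr.
by field; rewrite h' x0.
Qed.

Lemma cadm_herglotz z : modc z < 1 -> cadm (herglotz z).
Proof.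
move=> z1; rewrite (_ : herglotz z = fun t => 2 * ck z t + -1).
  apply: cadmD; last exact: cadm_cst.
  by apply: cadmZ; exact: cadm_ck.
by apply/funext => t; rewrite herglotzE.
Qed.

Lemma hglE J M z : bounded_functional J M -> modc z < 1 ->
  hgl J z = 2 * cfun J (ck z) - cfun J (fun=> 1).
Proof.
move=> bJ z1; have c1 := cadm_ck z1; rewrite -(cfunZ bJ) // -(cfunB bJ) //.
- by congr (cfun J _); apply/funext => t; rewrite herglotzE.
- exact: cadmZ.
- exact: cadm_cst.
Qed.

Lemma hol_hgl J M : bounded_functional J M -> hol (hgl J).
Proof.
move=> bJ; apply: (@hol_ext _ (fun z => 2 * cfun J (fun t => 1 / (1 - z * (expi t)^*%C)) +
   - cfun J (fun=> 1))).
  move=> z z1; rewrite (hglE bJ) //; congr (2 * cfun J _ + _).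
  by apply/funext => t; rewrite mul1r.
apply: holD; last exact: hol_cst.
by apply: holZ; apply: (hol_cauchy_transform bJ); exact: cadm_cst.
Qed.

Lemma kap_expi z t : modc z < 1 ->
  kap z (expi t) = (1 - modc z ^+ 2)%:C * ((expi t)^*%C * ck z t ^+ 2).
Proof.
move=> z1; rewrite /kap /ck; have := ck_neq0 t z1; rewrite -expiV.
move: (expi_neq0 t); move: (expi t : C) => x x0 h.
have h' : x - z != 0.
  by apply: contraNneq h => /eqP; rewrite subr_eq0 => /eqP <-; rewrite divff // subrr.
by congr (_ * _); field; rewrite h' x0.
Qed.

Lemma cadm_kap z : modc z < 1 -> cadm (fun t => kap z (expi t)).
Proof.
move=> z1; rewrite (_ : (fun _ => _) = fun t => (1 - modc z ^+ 2)%:C *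
  ((expi t)^*%C * (ck z t * ck z t))); last by apply/funext => t; rewrite kap_expi.
apply: cadmZ; apply: cadmM; first by apply: cadm_conj; exact: cadm_expi.
by apply: cadmM; exact: cadm_ck.
Qed.

Lemma adm_pkernel z : modc z < 1 -> adm (fun t => pkernel z (expi t)).
Proof.
move=> z1; rewrite (_ : (fun _ => _) = fun t => (1 - modc z ^+ 2) * (modc (ck z t) * modc (ck z t))).
  by apply: admZ; apply: admM; apply: adm_modc; exact: cadm_ck.
apply/funext => t; rewrite /pkernel /ck modcV.
by rewrite [(expi t)^*%C * z]mulrC -invfM -expr2.
Qed.

Lemma derive1_hgl J M z : bounded_functional J M -> modc z < 1 ->
  (1 - modc z ^+ 2)%:C * derive1 (hgl J) z = 2 * cfun J (fun t => kap z (expi t)).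
Proof.
move=> bJ z1; have c1 := cadm_cst (1 : C).
have q1 : 0 < 1 - modc z by rewrite subr_gt0.
have q := qdD (qdZ 2 (qd_cauchy_transform bJ c1 z1)) (qd_cst (- cfun J (fun=> 1)) z).
have -> : derive1 (hgl J) z = 2 * cfun J (fun t => 1 * ((expi t)^*%C * ck z t ^+ 2)) + 0.
  apply: qd_derive1; apply: (qd_eq q1 _ q) => w wz.
  have w1 : modc w < 1.
    by rewrite -(subrK z w); apply: le_lt_trans (ler_modcD _ _) _; rewrite -ltrBrDr.
  rewrite (hglE bJ w1); congr (2 * cfun J _ + _).
  by apply/funext => t; rewrite mul1r.
rewrite addr0 mulrCA; congr (2 * _); rewrite -(cfunZ bJ); last first.
  exact: (cadmM c1 (cadm_ck_sqr z1)).
by congr (cfun J _); apply/funext => t; rewrite mul1r kap_expi.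
Qed.

Lemma Re_mobius w : w != 0 -> complex.Re (2 * w^-1 - 1) = (1 - modc (1 - w) ^+ 2) / modc w ^+ 2.
Proof.
move=> w0; have : modc w ^+ 2 != 0 by rewrite expf_neq0 // modc_eq0.
rewrite !sqr_modc; case: w {w0} => a b /= h.
by field.
Qed.

Lemma Re_hgl J M z : bounded_functional J M -> modc z < 1 ->
  complex.Re (hgl J z) = J (fun t => pkernel z (expi t)).
Proof.
move=> bJ z1; rewrite /hgl /cfun /=; congr J; apply/funext => t.
rewrite herglotzE // /ck Re_mobius ?ck_neq0 // /pkernel [(expi t)^*%C * z]mulrC.
have -> : 1 - (1 - z * (expi t)^*%C) = z * (expi t)^*%C by ring.
by rewrite modcM modc_conj_expi mulr1.
Qed.

End herglotz_transforms.

(** * Boundary functions of bounded analytic functions *)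

Section boundary_function.
Context {R : realType}.
Local Notation C := (Cx R).
Local Notation leb := (@lebesgue_measure R).
Implicit Types (g f : C -> C) (z w : C) (e r s : R).

Lemma realc_sum (I : Type) (l : seq I) (P : pred I) (G : I -> R) :
  ((\sum_(i <- l | P i) G i)%:C : C) = \sum_(i <- l | P i) (G i)%:C.
Proof. by apply: (big_morph (fun x : R => x%:C : C)) => // x y; rewrite realcD. Qed.

Lemma realcX (x : R) n : ((x ^+ n)%:C : C) = x%:C ^+ n.
Proof. by elim: n => [|n IH]; rewrite ?expr0 // !exprS realcM IH. Qed.

(** By orthogonality the mean is the sum of |p_i|^2 (1 - s^i) s^i. It is the cross term in comparing
    the L2 norms on two concentric circles. *)
Lemma cmean_orth_poly (p : {poly C}) s : 0 <= s <= 1 ->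
  0 <= complex.Re (cmean (fun t => (p.[expi t] - p.[s%:C * expi t]) * (p.[s%:C * expi t])^*%C)).
Proof.
move=> /andP[s0 s1]; have b1 := @bounded_mean01 R.
pose a (i : nat) : C := p`_i * (1 - s%:C ^+ i).
pose b (j : nat) : C := (p`_j)^*%C * s%:C ^+ j.
pose F i j (t : R) : C := a i * b j * (expi t ^+ i * (expi t)^*%C ^+ j).
have cF i j : cadm (F i j) by apply: cadmZ; exact: cadm_orth.
have cG i : cadm (fun t => \sum_(j < size p) F i j t).
  by apply: (@cadm_sum _ (size p) (fun j t => F i j t)).
have -> : (fun t => (p.[expi t] - p.[s%:C * expi t]) * (p.[s%:C * expi t])^*%C) =
   fun t => \sum_(i < size p) \sum_(j < size p) F i j t.
  apply/funext => t; rewrite !horner_coef -sumrB.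
  rewrite (big_morph (fun z : C => z^*%C) (id1 := 0) (op1 := +%R)); last 2 first.
  - by case=> x y; case=> x' y'; simpc; congr (_ +i* _); ring.
  - by rewrite conjc0.
  rewrite mulr_suml; apply: eq_bigr => i _; rewrite mulr_sumr; apply: eq_bigr => j _.
  rewrite /F /a /b !conjcM.
  have -> : ((s%:C * expi t) ^+ j)^*%C = s%:C ^+ j * (expi t)^*%C ^+ j :> C.
    have cs : (s%:C * expi t)^*%C = s%:C * (expi t)^*%C :> C.
      by rewrite conjcM; congr (_ * _); simpc.
    by rewrite -exprMn -cs rmorphXn.
  by rewrite exprMn; ring.
rewrite /cmean (@cfun_sum _ _ _ b1 (size p) (fun i t => \sum_(j < size p) F i j t)) //.
have -> : \sum_(i < size p) cfun mean01 (fun t => \sum_(j < size p) F i j t) =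
   (\sum_(i < size p) (modc p`_i ^+ 2 * ((1 - s ^+ i) * s ^+ i)))%:C.
  rewrite realc_sum; apply: eq_bigr => i _.
  rewrite (@cfun_sum _ _ _ b1 (size p) (fun j t => F i j t)) //.
  rewrite (bigD1 i) //= big1 ?addr0 => [|j ji]; rewrite (cfunZ b1) ?[cfun _ _]cmean_orth; try exact: cadm_orth.
    rewrite eqxx mulr1 /a /b realcM -mul_conjc realcM realcB realcX; ring.
  case: eqP => [ij|_]; last by rewrite mulr0.
  by move/eqP: ji; case; apply/val_inj.
rewrite /= sumr_ge0 // => i _; rewrite mulr_ge0 ?exprn_ge0 ?modc_ge0 // mulr_ge0 ?exprn_ge0 //.
by rewrite subr_ge0 exprn_ile1.
Qed.

Lemma cmean_orth_disc_alg g s : disc_alg g -> 0 <= s <= 1 ->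
  0 <= complex.Re (cmean (fun t => (g (expi t) - g (s%:C * expi t)) * (g (s%:C * expi t))^*%C)).
Proof.
move=> dg s01; have b1 := @bounded_mean01 R.
have [b b0 hb] := disc_alg_bounded dg; have /andP[s0 s1] := s01.
have ms t : modc (s%:C * expi t : C) <= 1 by rewrite modcM modc_real modc_expi mulr1 ger0_norm.
have m1 t : modc (expi t : C) <= 1 by rewrite modc_expi.
have ds (q : C -> C) : disc_alg q -> disc_alg (fun z => q (s%:C * z)).
  move=> dq e /dq[p hp]; exists (p \Po (s%:C *: 'X)) => z z1.
  rewrite horner_comp hornerZ hornerX; apply: hp.
  by rewrite modcM modc_real ger0_norm // mulr_ile1 ?modc_ge0.
have cq (q : C -> C) : disc_alg q -> cadm (fun t => (q (expi t) - q (s%:C * expi t)) * (q (s%:C * expi t))^*%C).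
  move=> dq; apply: cadmM; last by apply: cadm_conj; exact: cadm_disc_alg (ds _ dq).
  rewrite (_ : (fun _ => _) = fun t => q (expi t) + -1 * q (s%:C * expi t)).
    by apply: cadmD; [exact: cadm_disc_alg | apply: cadmZ; exact: cadm_disc_alg (ds _ dq)].
  by apply/funext => t; rewrite mulN1r.
rewrite -oppr_le0; apply: (@le0_of_small _ _ (2 * (4 * b + 2))) => e0 e0_gt0.
(* The replacement error is at most 2 e0 (b + e0) + 2 b e0; for e0 <= 1 this is linear in e0, with
   constant 4b + 2. *)
wlog e1 : e0 e0_gt0 / e0 <= 1 => [H|].
  have [h|h] := leP e0 1; first exact: H.
  by apply: le_trans (H 1 _ _) _ => //; rewrite ler_pM2l ?ltW // mulr_gt0 // ltr_wpDl // mulr_ge0.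
have [p hp] := dg _ e0_gt0.
have h0 := cmean_orth_poly p s01; rewrite -subr_ge0 in h0.
rewrite -subr_ge0 opprK; apply: le_trans h0 _; rewrite subr0.
set X := cmean (fun t => (p.[expi t] - _) * _); set Y := cmean _.
suff : modc (X - Y) <= 2 * (4 * b + 2) * e0.
  by have := ler_Re_modc (X - Y); rewrite cReD cReN; lra.
rewrite /X /Y /cmean -(cfunB b1) //; try (by apply: cq); last exact: (cq _ (disc_alg_poly p)).
have -> : 2 * (4 * b + 2) * e0 = 2 * 1 * ((4 * b + 2) * e0) by ring.
apply: (cfun_le b1).
  rewrite (_ : (fun _ => _) = fun t => (p.[expi t] - p.[s%:C * expi t]) * (p.[s%:C * expi t])^*%C +
    -1 * ((g (expi t) - g (s%:C * expi t)) * (g (s%:C * expi t))^*%C)).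
    by apply: cadmD; [exact: (cq _ (disc_alg_poly p)) | apply: cadmZ; exact: cq].
  by apply/funext => t; rewrite mulN1r.
move=> t _.
have := hp _ (m1 t); have := hp _ (ms t); have := hb _ (m1 t); have := hb _ (ms t).
move: (g (expi t)) (g (s%:C * expi t)) p.[expi t] p.[s%:C * expi t] => g1 g2 p1 p2 g2b g1b d2 d1.
have -> : (p1 - p2) * p2^*%C - (g1 - g2) * g2^*%C =
  - ((g1 - p1) - (g2 - p2)) * p2^*%C - (g1 - g2) * (g2 - p2)^*%C by rewrite conjcB; ring.
apply: le_trans (ler_modcB _ _) _; rewrite !modcM modcN !modc_conj.
have p2b : modc p2 <= b + e0.
  by have := ler_modc_sub p2 g2; rewrite modc_distC; lra.
have h1 := ler_modcB (g1 - p1) (g2 - p2); have h2 := ler_modcB g1 g2.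
have : modc (g1 - p1 - (g2 - p2)) * modc p2 <= (2 * e0) * (b + e0).
  by apply: ler_pM; rewrite ?modc_ge0 //; lra.
have : modc (g1 - g2) * modc (g2 - p2) <= (2 * b) * e0.
  by apply: ler_pM; rewrite ?modc_ge0 //; lra.
by nra.
Qed.

Definition u2 f r : R := mean01 (fun t => modc (f (r%:C * expi t)) ^+ 2).

Lemma adm_sqr_modc (G : R -> C) : cadm G -> adm (fun t => modc (G t) ^+ 2).
Proof. by move=> cG; apply: admM; exact: adm_modc. Qed.

(** Expanding |A|^2 around B leaves |A - B|^2 + |B|^2 plus twice the cross term, whose mean is
    nonnegative by [cmean_orth_disc_alg]. Hence convergence of the increasing norms makes the radial
    functions Cauchy in L2. *)
Lemma L2_increment f s r : hol f -> 0 <= s <= r -> r < 1 ->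
  mean01 (fun t => modc (f (r%:C * expi t) - f (s%:C * expi t)) ^+ 2) <= u2 f r - u2 f s.
Proof.
move=> hf /andP[s0 sr] r1; have b1 := @bounded_mean01 R.
have [r00|rn0] := eqVneq r 0.
  have -> : s = 0 by apply/eqP; rewrite eq_le s0 andbT -r00.
  rewrite r00 subrr (_ : (fun _ => _) = fun=> 0) ?mean01_cst //.
  by apply/funext => t; rewrite subrr modc0 expr0n.
have r0 : 0 < r by rewrite lt0r rn0 (le_trans s0).
have dg : disc_alg (fun z => f (r%:C * z)) by apply: hf; rewrite r0.
have q01 : 0 <= s / r <= 1 by rewrite divr_ge0 ?(ltW r0) //= ler_pdivrMr // mul1r.
have := cmean_orth_disc_alg dg q01.
have E t : r%:C * ((s / r)%:C * expi t) = s%:C * expi t :> C.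
  by rewrite mulrA -realcM mulrCA divff ?mulr1.
set A := fun t : R => f (r%:C * expi t); set B := fun t : R => f (s%:C * expi t).
have -> : (fun t => (f (r%:C * expi t) - f (r%:C * ((s / r)%:C * expi t))) *
   (f (r%:C * ((s / r)%:C * expi t)))^*%C) = fun t => (A t - B t) * (B t)^*%C.
  by apply/funext => t; rewrite E.
have cA : cadm A by apply: (cadm_hol hf); rewrite (ltW r0).
have cB : cadm B by apply: (cadm_hol hf); rewrite s0 (le_lt_trans sr).
have cAB : cadm (fun t => A t - B t).
  rewrite (_ : (fun _ => _) = fun t => A t + -1 * B t); first by apply: cadmD => //; exact: cadmZ.
  by apply/funext => t; rewrite mulN1r.
have cABB : cadm (fun t => (A t - B t) * (B t)^*%C) by apply: cadmM => //; exact: cadm_conj.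
rewrite /u2 -/A -/B => h.
have -> : mean01 (fun t => modc (A t) ^+ 2) = mean01 (fun t => modc (A t - B t) ^+ 2) +
    (mean01 (fun t => modc (B t) ^+ 2) + 2 * complex.Re (cmean (fun t => (A t - B t) * (B t)^*%C))).
  have [JD JZ _] := b1; have [rABB _] := cABB.
  have a1 := adm_sqr_modc cAB; have a2 := adm_sqr_modc cB.
  have a3 := admZ 2 rABB; have a4 := admD a2 a3.
  rewrite /cmean /cfun [complex.Re _]/= -(JZ 2) // -JD // -JD //.
  congr mean01; apply/funext => t; rewrite !sqr_modc.
    by case: (A t) => a b; case: (B t) => c d; simpc => /=; ring.
lra.
Qed.

Lemma u2_nondecreasing f s r : hol f -> 0 <= s <= r -> r < 1 -> u2 f s <= u2 f r.
Proof.
move=> hf sr r1; rewrite -subr_ge0; apply: le_trans (L2_increment hf sr r1).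
apply: positive_mean01 => [|t _]; last by rewrite exprn_ge0 ?modc_ge0.
have /andP[s0 sr'] := sr.
have cA : cadm (fun t => f (r%:C * expi t)) by apply: (cadm_hol hf); rewrite r1 (le_trans s0).
have cB : cadm (fun t => f (s%:C * expi t)) by apply: (cadm_hol hf); rewrite s0 (le_lt_trans sr').
apply: adm_sqr_modc.
rewrite (_ : (fun _ => _) = fun t => f (r%:C * expi t) + -1 * f (s%:C * expi t)).
  by apply: cadmD => //; exact: cadmZ.
by apply/funext => t; rewrite mulN1r.
Qed.

Lemma L2_distance f s r : hol f -> 0 <= s < 1 -> 0 <= r < 1 ->
  mean01 (fun t => modc (f (r%:C * expi t) - f (s%:C * expi t)) ^+ 2) <= `|u2 f r - u2 f s|.
Proof.
move=> hf /andP[s0 s1] /andP[r0 r1]; have [sr|/ltW rs] := leP s r.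
  by apply: le_trans (L2_increment hf _ r1) (ler_norm _); rewrite s0.
rewrite distrC; apply: le_trans (ler_norm _).
have := L2_increment hf (s := r) (r := s); rewrite r0 rs => /(_ isT s1).
by congr (_ <= _); congr mean01; apply/funext => t; rewrite modc_distC.
Qed.

(** [u2] is nondecreasing in the radius and bounded by 1, so radii within 4^-k of its supremum
    exist; raising them to 1 - 1/(k+1) forces them to 1 and keeps the property. The rate is 4^-k
    because its square root has to be summable. *)
Lemma exists_L2_radii f : hol f -> (forall z, modc z < 1 -> modc (f z) <= 1) ->
  exists rho : nat -> R, [/\ forall k, 0 <= rho k < 1, rho @ \oo --> (1 : R) &
    forall k, `|u2 f (rho k.+1) - u2 f (rho k)| <= 4^-1 ^+ k].
Proof.
move=> hf f1.
pose A := [set u2 f r | r in [set r | 0 <= r < 1]].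
have uA : has_ubound A.
  exists 1 => _ [r /andP[r0 r1] <-]; rewrite -[leRHS](mean01_cst 1).
  apply: (positive_functional_le (@bounded_mean01 R) (@positive_mean01 R)).
  - by apply: adm_sqr_modc; apply: (cadm_hol hf); rewrite r0.
  - exact: adm_cst.
  - move=> t _; rewrite expr_le1 ?modc_ge0 // f1 //.
    by rewrite modcM modc_real modc_expi mulr1 ger0_norm.
have sA : has_sup A.
  by split=> //; exists (u2 f 0), 0; rewrite //= lexx ltr01.
have ex k : exists r, [/\ 0 <= r < 1, 1 - k.+1%:R^-1 <= r & sup A - 4^-1 ^+ k <= u2 f r].
  have q0 : 0 < 4^-1 ^+ k :> R by rewrite exprn_gt0 // invr_gt0.
  have [_ [r /andP[r0 r1] <-] hr] := sup_adherent q0 sA.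
  exists (Num.max r (1 - k.+1%:R^-1)); split.
  - by rewrite le_max r0 /= gt_max r1 gtrBl invr_gt0 ltr0n.
  - by rewrite le_max lexx orbT.
  - apply: le_trans (ltW hr) _; apply: u2_nondecreasing => //.
      by rewrite r0 le_max lexx.
    by rewrite gt_max r1 gtrBl invr_gt0 ltr0n.
have [rho hrho] := choice ex; exists rho; split.
- by move=> k; case: (hrho k).
- apply: (@squeeze_cvgr _ _ _ _ (fun k => 1 - k.+1%:R^-1) (fun=> 1)).
  + by apply: nearW => k; case: (hrho k) => /andP[_ /ltW ->] ->.
  + rewrite -[X in _ --> X]subr0; apply: cvgB; first exact: cvg_cst.
    exact: cvg_harmonic.
  + exact: cvg_cst.
- move=> k; have [h1 _ h2] := hrho k; have [h3 _ h4] := hrho k.+1.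
  have u1 : u2 f (rho k) <= sup A by apply: ub_le_sup => //; exists (rho k).
  have u3 : u2 f (rho k.+1) <= sup A by apply: ub_le_sup => //; exists (rho k.+1).
  have : 4^-1 ^+ k.+1 <= 4^-1 ^+ k :> R.
    have : 0 <= 4^-1 ^+ k :> R by rewrite exprn_ge0 // invr_ge0.
    by rewrite exprS; lra.
  by rewrite ler_norml; lra.
Qed.

(** By monotone convergence the sum of the series has integral at most 2, so it is finite almost
    everywhere. *)
Lemma ae_summable (d : nat -> R -> R) :
  (forall k, adm (d k)) -> (forall k t, 0 <= d k t) -> (forall k, mean01 (d k) <= 2^-1 ^+ k) ->
  {ae leb, forall t, I01 t -> cvgn (series (d ^~ t))}.
Proof.
move=> ad d0 dm; have mI := @measurable_I01 R.
have id k : leb.-integrable I01 (EFin \o d k).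
  have := integrable_weighted mI (@subset_refl _ _) integrable_cst1 (ad k).
  by congr (integrable _ _ _); apply/funext => t /=; rewrite mulr1.
pose S t := (\sum_(0 <= k <oo) (d k t)%:E)%E.
have mS : measurable_fun (I01 : set (measurableTypeR R)) S.
  apply: ge0_emeasurable_sum; first by move=> k t _ _; rewrite lee_fin.
  by move=> k _; case: (ad k) => m _; exact/measurable_EFinP.
have iS : leb.-integrable I01 S.
  apply/integrableP; split=> //.
  have -> : (\int[leb]_(t in I01) `|S t| = \int[leb]_(t in I01) S t)%E.
    apply: eq_integral => t _; rewrite gee0_abs //.
    by apply: nneseries_ge0 => k _ _; rewrite lee_fin.
  rewrite /S integral_nneseries //; last 2 first.
  - by move=> k; case: (ad k) => m _; exact/measurable_EFinP.
  - by move=> k t _; rewrite lee_fin.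
  apply: (@le_lt_trans _ _ (\sum_(0 <= k <oo) (2^-1 ^+ k)%:E)%E).
    apply: lee_nneseries => k _; first by move=> _; apply: integral_ge0 => t _; rewrite lee_fin.
    have -> : (\int[leb]_(t in I01) (d k t)%:E = (mean01 (d k))%:E)%E.
      rewrite mean01E /Rintegral fineK //.
      exact: (integrable_fin_num mI (id k)).
    by rewrite lee_fin.
  have h n : \sum_(0 <= k < n) 2^-1 ^+ k = 2 - 2 * 2^-1 ^+ n :> R.
    elim: n => [|n IH]; first by rewrite big_geq // expr0 mulr1 subrr.
    by rewrite big_nat_recr //= IH exprS; field.
  apply: (@le_lt_trans _ _ 2%:E); last exact: ltry.
  apply: lime_le; first by apply: is_cvg_nneseries => n _ _; rewrite lee_fin exprn_ge0 // invr_ge0.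
  by apply: nearW => n; rewrite sumEFin lee_fin h gerBl mulr_ge0 // exprn_ge0 // invr_ge0.
have := integrable_ae mI iS; apply: filterS => t h It.
have {h} := h It; rewrite ge0_fin_numE; last by apply: nneseries_ge0 => k _ _; rewrite lee_fin.
move=> St.
apply: nondecreasing_is_cvgn.
  by apply/nondecreasing_seqP => n; rewrite /series /= big_nat_recr //= lerDl.
exists (fine (S t)) => _ [n _ <-]; rewrite -lee_fin fineK; last first.
  by rewrite ge0_fin_numE //; apply: nneseries_ge0 => k _ _; rewrite lee_fin.
rewrite /series /= -sumEFin; apply: nneseries_lim_ge => k _ _.
by rewrite lee_fin.
Qed.

Lemma ae_imp (P Q : R -> Prop) : {ae leb, forall t, P t} -> (forall t, P t -> Q t) ->
  {ae leb, forall t, Q t}.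
Proof.
move=> [N [mN N0 sub]] PQ; exists N; split=> // t /= nQ; apply: sub => /= Pt.
exact/nQ/PQ.
Qed.

Lemma ae_and (P Q : R -> Prop) : {ae leb, forall t, P t} -> {ae leb, forall t, Q t} ->
  {ae leb, forall t, P t /\ Q t}.
Proof.
move=> hP hQ; apply: negligibleS (negligibleU hP hQ) => t /= nPQ.
have [Pt|nP] := pselect (P t); last by left.
by right => Qt; apply: nPQ.
Qed.

Lemma mean01_dominated (g_ : nat -> R -> R) (g : R -> R) b :
  (forall k, adm (g_ k)) -> adm g -> (forall k t, I01 t -> `|g_ k t| <= b) ->
  {ae leb, forall t, I01 t -> g_ ^~ t @ \oo --> g t} ->
  (fun k => mean01 (g_ k)) @ \oo --> mean01 g.
Proof.
move=> ag_ [mg _] gb gg; have mI := @measurable_I01 R.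
have ib : leb.-integrable I01 (EFin \o (fun=> b)).
  have := integrableZl mI b integrable_cst1.
  by congr (integrable _ _ _); apply/funext => t /=; rewrite mule1.
have mgk k : measurable_fun (I01 : set (measurableTypeR R)) (EFin \o g_ k).
  by case: (ag_ k) => m _; exact/measurable_EFinP.
have mg' : measurable_fun (I01 : set (measurableTypeR R)) (EFin \o g) by exact/measurable_EFinP.
have [] := dominated_convergence mI mgk mg' _ ib.
- apply: (ae_imp gg) => t h It.
  by apply: cvg_EFin; [exact: nearW | exact: h].
- by apply: aeW => t k It; rewrite /= lee_fin gb.
move=> ig _ cv; rewrite (_ : (fun k => mean01 (g_ k)) =
    fine \o (fun k => \int[leb]_(t in I01) (g_ k t)%:E)%E).
  rewrite mean01E; apply: fine_cvg; rewrite /Rintegral fineK //.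
  exact: (integrable_fin_num mI ig).
by apply/funext => k; rewrite mean01E.
Qed.

Lemma hol_continuous f z : hol f -> modc z < 1 -> f w @[w --> (z : C)] --> f z.
Proof.
move=> hf z1; have [dl dl0 [K K0 [_ H]]] := qd_near (hol_qd hf z1).
apply/(@cvgCP _ _ _ (nbhs_filter z)) => e e0.
have d0 : 0 < Num.min dl (e / (K + 1)) by rewrite lt_min dl0 divr_gt0 // ltr_wpDl.
have /cvgCP/(_ _ d0) : (fun w : C => w) @ z --> z by exact: cvg_id.
apply: filterS => w; rewrite lt_min => /andP[h1 h2].
have := H (w - z); rewrite modc_distC (_ : z + (w - z) = w) => [/(_ h1) [_ h3]|]; last by ring.
rewrite modc_distC; apply: le_lt_trans h3 _.
move: h2; rewrite ltr_pdivlMr ?ltr_wpDl // => h2.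
by have := modc_ge0 (z - w); nra.
Qed.

(** Along the radii of [exists_L2_radii] the functions f(rho_k xi) converge almost everywhere. The
    limit is bounded, and dominated convergence in the Poisson formula for f(rho_k z) yields the
    representation. *)
Lemma boundary_function f : hol f -> (forall z, modc z < 1 -> modc (f z) <= 1) ->
  exists F1 F2 : R -> R, [/\ adm F1, adm F2 & forall z, modc z < 1 ->
    f z = mean01 (fun t => pkernel z (expi t) * F1 t) +i*
          mean01 (fun t => pkernel z (expi t) * F2 t)].
Proof.
move=> hf f1; have b1 := @bounded_mean01 R; have p1 := @positive_mean01 R.
have [rho [r01 r1 hr]] := exists_L2_radii hf f1.
pose F k (t : R) : C := f ((rho k)%:C * expi t).
have cF k : cadm (F k) by apply: (cadm_hol hf).
have Fle1 k t : modc (F k t) <= 1.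
  have /andP[r0 rk1] := r01 k.
  by apply: f1; rewrite modcM modc_real modc_expi mulr1 ger0_norm.
pose d k t := 2^-1 * modc (F k.+1 t - F k t).
have ad k : adm (d k).
  apply: admZ; apply: adm_modc.
  rewrite (_ : (fun _ => _) = fun t => F k.+1 t + -1 * F k t).
    by apply: cadmD => //; exact: cadmZ.
  by apply/funext => t; rewrite mulN1r.
have d0 k t : 0 <= d k t by rewrite mulr_ge0 ?invr_ge0 ?modc_ge0.
have dm k : mean01 (d k) <= 2^-1 ^+ k.
  set q := 2^-1 ^+ k : R; have q0 : 0 < q by rewrite exprn_gt0 // invr_gt0.
  have asq : adm (fun t => modc (F k.+1 t - F k t) ^+ 2).
    apply: adm_sqr_modc; rewrite (_ : (fun _ => _) = fun t => F k.+1 t + -1 * F k t).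
      by apply: cadmD => //; exact: cadmZ.
    by apply/funext => t; rewrite mulN1r.
  have L := le_trans (L2_distance hf (r01 k) (r01 k.+1)) (hr k).
  have q4 : 4^-1 ^+ k = q ^+ 2 :> R.
    by rewrite /q exprAC; congr (_ ^+ k); field.
  (* The inequality 2x <= q + x^2/q replaces Cauchy-Schwarz: an L2 bound by q^2 gives an L1 bound of
     order q. *)
  apply: (@le_trans _ _ (mean01 (fun t => 2^-1 * q + 2^-1 * q^-1 * modc (F k.+1 t - F k t) ^+ 2))).
    apply: (positive_functional_le b1 p1) => //.
      by apply: admD; [exact: adm_cst | exact: admZ].
    move=> t _; rewrite /d; set x := modc _.
    have : 0 <= (x - q) ^+ 2 / q by rewrite divr_ge0 ?sqr_ge0 // ltW.
    have -> : (x - q) ^+ 2 / q = q^-1 * x ^+ 2 - 2 * x + q by field; rewrite gt_eqF.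
    by have : 0 <= x := modc_ge0 _; lra.
  have [JD JZ _] := b1.
  have a2 := admZ (2^-1 * q^-1) asq; have a1 : adm (fun _ : R => 2^-1 * q) := adm_cst _.
  rewrite (JD _ _ a1 a2) (JZ _ _ asq) mean01_cst.
  apply: (@le_trans _ _ (2^-1 * q + 2^-1 * q^-1 * q ^+ 2)).
    by rewrite lerD2l ler_wpM2l ?mulr_ge0 ?invr_ge0 ?(ltW q0) // -q4.
  by rewrite le_eqVlt; apply/orP; left; apply/eqP; field; rewrite gt_eqF.
have aeF : {ae leb, forall t, I01 t -> F ^~ t @ \oo --> lim (F ^~ t @ \oo)}.
  apply: (ae_imp (ae_summable ad d0 dm)) => t h It; have {}h := h It.
  set L := limn (series (d ^~ t)) in h.
  have [] := @cvgC_cauchy _ (F ^~ t) (fun N => 2 * (L - series (d ^~ t) N)); last by [].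
    rewrite -[X in _ --> X](mulr0 2) -(subrr L).
    by apply: cvgMr; apply: cvgB; [exact: cvg_cst | exact: h].
  move=> N k.
  have le1 : series (d ^~ t) (N + k)%N <= L.
    apply: nondecreasing_cvgn_le => //.
    by apply/nondecreasing_seqP => n; rewrite /series /= big_nat_recr //= lerDl.
  apply: (@le_trans _ _ (2 * (series (d ^~ t) (N + k)%N - series (d ^~ t) N))); last first.
    by rewrite ler_pM2l // lerD2r.
  elim: k {le1} => [|k IH]; first by rewrite addn0 !subrr modc0 mulr0.
  have -> : F (N + k.+1)%N t - F N t = (F (N + k)%N.+1 t - F (N + k)%N t) + (F (N + k)%N t - F N t).
    by rewrite addnS; ring.
  apply: le_trans (ler_modcD _ _) _.
  have -> : series (d ^~ t) (N + k.+1)%N = d (N + k)%N t + series (d ^~ t) (N + k)%N.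
    by rewrite /series /= addnS big_nat_recr //= addrC.
  rewrite (_ : d (N + k)%N t = 2^-1 * modc (F (N + k)%N.+1 t - F (N + k)%N t)) //.
  move: IH; move: (series _ _) (series _ _) (modc _) (modc _) => x y x' y'; lra.
(* On the null set without convergence the limsup is arbitrary; truncation keeps the boundary
   function admissible there and changes nothing where the limit exists. *)
pose cut (x : R) := Num.max (-1) (Num.min 1 x).
have cutb x : `|cut x| <= 1.
  by rewrite /cut ler_norml le_max lexx /= ge_max ge_min lexx /= andbT; lra.
have cutE x : `|x| <= 1 -> cut x = x.
  rewrite ler_norml => /andP[x1 x2].
  by rewrite /cut min_r // max_r.
have bRe k t : `|complex.Re (F k t)| <= 1 by apply: le_trans (ler_normRe_modc _) (Fle1 k t).
have bIm k t : `|complex.Im (F k t)| <= 1 by apply: le_trans (ler_normIm_modc _) (Fle1 k t).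
have adF (u : nat -> R -> R) : (forall k, adm (u k)) -> (forall k t, `|u k t| <= 1) ->
    adm (fun t => cut (limn_sup (u ^~ t))).
  move=> au u1; split; last by exists 1 => t _; apply: cutb.
  apply: measurable_maxr => //; apply: measurable_minr => //.
  apply: measurable_fun_limn_sup.
  - by move=> t _; exists 1 => _ [k _ <-]; apply: le_trans (ler_norm _) (u1 k t).
  - by move=> t _; exists (-1) => _ [k _ <-]; have := u1 k t; rewrite ler_norml => /andP[].
  - by move=> k; case: (au k).
have cutlim (u : nat -> R) : (forall k, `|u k| <= 1) -> cvgn u -> u @ \oo --> cut (limn_sup u).
  move=> u1 cu; rewrite cvg_limn_supE // cutE //.
  rewrite ler_norml; apply/andP; split.
    by apply: limr_ge => //; apply: nearW => k; have := u1 k; rewrite ler_norml => /andP[].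
  by apply: limr_le => //; apply: nearW => k; have := u1 k; rewrite ler_norml => /andP[].
have aRe k : adm (fun t => complex.Re (F k t)) by case: (cF k).
have aIm k : adm (fun t => complex.Im (F k t)) by case: (cF k).
exists (fun t => cut (limn_sup (fun k => complex.Re (F k t)))),
  (fun t => cut (limn_sup (fun k => complex.Im (F k t)))).
split; [exact: (adF (fun k t => complex.Re (F k t)))|exact: (adF (fun k t => complex.Im (F k t)))|].
move=> z z1; have apk := adm_pkernel z1.
have [_ [b pkb]] := apk.
have cv (p : C -> R) (cp : continuous p) (p1' : forall k t, `|p (F k t)| <= 1)
    (ap : forall k, adm (fun t => p (F k t))) :
    (fun k => mean01 (fun t => pkernel z (expi t) * p (F k t))) @ \oo -->
    mean01 (fun t => pkernel z (expi t) * cut (limn_sup (fun k => p (F k t)))).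
  apply: (@mean01_dominated (fun k t => pkernel z (expi t) * p (F k t)) _ b).
  - by move=> k; exact: admM.
  - by apply: admM => //; exact: (adF (fun k t => p (F k t))).
  - move=> k t It; rewrite normrM -[b]mulr1; apply: ler_pM => //; exact: pkb.
  - apply: (ae_imp aeF) => t h It; apply: cvgM; first exact: cvg_cst.
    apply: cutlim => //; apply/cvg_ex; exists (p (limn (F ^~ t))).
    by apply: continuous_cvg; [exact: cp | exact: h].
have cvz : (fun k => f ((rho k)%:C * z)) @ \oo --> f z.
  apply: (@cvg_comp _ _ _ (fun k => (rho k)%:C * z) f _ (nbhs (z : C))); last exact: hol_continuous.
  apply/cvgCP => e e0; have /cvgrPdist_lt/(_ e e0) := r1.
  apply: filterS => k; apply: le_lt_trans.
  have -> : z - (rho k)%:C * z = (1 - rho k)%:C * z by rewrite realcB; ring.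
  by rewrite modcM modc_real ler_piMr // ltW.
have E k : f ((rho k)%:C * z) = mean01 (fun t => pkernel z (expi t) * complex.Re (F k t)) +i*
    mean01 (fun t => pkernel z (expi t) * complex.Im (F k t)).
  rewrite (poisson_formula (disc_algS hf (r01 k)) z1) /cmean /cfun.
  by congr (mean01 _ +i* mean01 _); apply/funext => t; rewrite -/(F k t) ?cReM ?cImM /=; ring.
apply: (@cvgC_unique _ _ _ _ (fun k => f ((rho k)%:C * z)) _ _ cvz).
apply/cvgCP => e e0.
have e2 : 0 < e / 2 by rewrite divr_gt0.
have /cvgrPdist_lt/(_ _ e2) := cv _ (@continuous_Re R) bRe aRe.
have /cvgrPdist_lt/(_ _ e2) := cv _ (@continuous_Im R) bIm aIm.
apply: filterS2 => k h1 h2; rewrite E.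
apply: le_lt_trans (ler_modc_ReIm _) _; move: h1 h2; simpc => /=; lra.
Qed.

End boundary_function.

(** * Radial convergence of Poisson integrals *)

Section radial_limits.
Context {R : realType}.
Local Notation C := (Cx R).
Local Notation leb := (@lebesgue_measure R).
Implicit Types (g f : C -> C) (z w : C) (h : R -> R) (e r s t : R).

Lemma modc_sub_scaled (D t s : R) : 0 <= D <= 1 ->
  D <= modc (1 - (expi s)^*%C * ((1 - D)%:C * expi t)) /\
  modc (expi t - expi s) <= 2 * modc (1 - (expi s)^*%C * ((1 - D)%:C * expi t) : C).
Proof.
move=> /andP[D0 D1].
have m1 : modc ((expi s)^*%C * ((1 - D)%:C * expi t) : C) = 1 - D.
  by rewrite !modcM modc_conj_expi modc_expi modc_real mul1r mulr1 ger0_norm; lra.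
have h1 : D <= modc (1 - (expi s)^*%C * ((1 - D)%:C * expi t) : C).
  have := @modc_sub_ge _ ((expi s)^*%C * ((1 - D)%:C * expi t)) (1 - D).
  by rewrite m1 lexx => /(_ isT); lra.
split=> //.
have -> : modc (expi t - expi s : C) = modc (1 - (expi s)^*%C * expi t : C).
  rewrite -[RHS]mul1r -(modc_expi s) -modcM mulrBr mulr1 mulrA [_ * (expi s)^*%C]mulrC.
  by rewrite expi_conjM mul1r modc_distC.
have -> : 1 - (expi s)^*%C * expi t = (1 - (expi s)^*%C * ((1 - D)%:C * expi t)) -
    D%:C * ((expi s)^*%C * expi t) :> C.
  by rewrite realcB; ring.
apply: le_trans (ler_modcB _ _) _.
rewrite [modc (D%:C * _)]modcM modc_real [modc (_ * expi t)]modcM modc_conj_expi modc_expi.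
by rewrite !mulr1 ger0_norm //; lra.
Qed.

Lemma pkernel_le_center (D t s : R) : 0 < D <= 1 ->
  pkernel ((1 - D)%:C * expi t : C) (expi s) <= 2 / D.
Proof.
move=> /andP[D0 D1]; have D01 : 0 <= D <= 1 by rewrite ltW.
have [h1 _] := modc_sub_scaled t s D01.
rewrite /pkernel modcM modc_real modc_expi mulr1 ger0_norm ?subr_ge0 //.
rewrite ler_pdivrMr ?exprn_gt0 ?(lt_le_trans D0) //.
apply: (@le_trans _ _ (2 / D * D ^+ 2)).
  by rewrite -mulrA expr2 mulKf ?gt_eqF //; nra.
by rewrite ler_pM2l ?divr_gt0 // lerXn2r ?nnegrE ?modc_ge0 // ltW.
Qed.

Lemma pkernel_le_far (D t s u : R) : 0 < D <= 1 -> 0 < u ->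
  2 * u <= modc (expi t - expi s : C) ->
  pkernel ((1 - D)%:C * expi t : C) (expi s) <= 2 * D / u ^+ 2.
Proof.
move=> /andP[D0 D1] u0 hu; have D01 : 0 <= D <= 1 by rewrite ltW.
have [_ h2] := modc_sub_scaled t s D01.
have h3 : u <= modc (1 - (expi s)^*%C * ((1 - D)%:C * expi t) : C) by lra.
rewrite /pkernel modcM modc_real modc_expi mulr1 ger0_norm ?subr_ge0 //.
rewrite ler_pdivrMr ?exprn_gt0 ?(lt_le_trans u0) //.
apply: (@le_trans _ _ (2 * D / u ^+ 2 * u ^+ 2)).
  by rewrite divfK ?expf_neq0 ?gt_eqF //; nra.
rewrite ler_pM2l ?divr_gt0 ?mulr_gt0 ?exprn_gt0 //.
by rewrite lerXn2r ?nnegrE ?modc_ge0 // ltW.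
Qed.

(** As t keeps distance [dl] from both ends of [0,1], parameters far apart on the line are also far
    apart on the circle: beyond half a turn, a shift of one parameter by 1 gives the short way
    round. *)
Lemma expi_sub_ge_circle (dl t s : R) : 0 < dl -> dl <= t <= 1 - dl -> 0 <= s <= 1 ->
  dl <= `|s - t| -> 2 * dl <= modc (expi t - expi s : C).
Proof.
move=> dl0 /andP[t1 t2] /andP[s0 s1] h.
have [ts|ts] := leP `|t - s| (1 / 2).
  by apply: le_trans (expi_sub_ge ts); rewrite distrC; lra.
have [st|st] := leP s t.
  have := expi_sub_ge (t := t) (s := s + 1%:R); rewrite expi_periodic.
  have -> : `|t - (s + 1%:R)| = 1 - (t - s) by rewrite ler0_norm; lra.
  move: ts h; rewrite ger0_norm ?ler0_norm; lra.
have := expi_sub_ge (t := t + 1%:R) (s := s); rewrite expi_periodic.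
have -> : `|t + 1%:R - s| = 1 - (s - t) by rewrite ger0_norm; lra.
move: ts h; rewrite ler0_norm ?ger0_norm; lra.
Qed.

Lemma dyadic_radius (D dl : R) : 0 < D <= dl -> exists n : nat, D <= dl * 2^-1 ^+ n <= 2 * D.
Proof.
move=> /andP[D0 Dl].
have [n0 hn0] : exists n, dl * 2^-1 ^+ n <= 2 * D.
  have [//|//|n hn] := @exprn_small _ 2^-1 (2 * D / dl).
  - lra.
  - by rewrite divr_gt0 ?mulr_gt0 // (lt_le_trans D0).
  by exists n; rewrite mulrC -ler_pdivlMr // (lt_le_trans D0).
have [m hm mmin] := ex_minnP (ex_intro (fun n => dl * 2^-1 ^+ n <= 2 * D) n0 hn0).
exists m; rewrite hm andbT; case: m hm mmin => [|m] hm mmin; first by rewrite mulr1.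
rewrite leNgt; apply/negP => hD.
suff /mmin : dl * 2^-1 ^+ m <= 2 * D by rewrite ltnn.
by move: hD; rewrite exprS; lra.
Qed.

(* Reduces the radial convergence of Poisson integrals to Lebesgue differentiation. *)
Lemma pkernel_dyadic (D dl t s : R) n : 0 < D <= 1 -> 0 < dl -> dl < t < 1 - dl -> 0 <= s <= 1 ->
  dl * 2^-1 ^+ n <= 2 * D ->
  pkernel ((1 - D)%:C * expi t : C) (expi s) <=
    \sum_(k < n.+1) 8 * D / (dl * 2^-1 ^+ k) ^+ 2 * \1_(ball t (dl * 2^-1 ^+ k)) s +
    2 * D / dl ^+ 2.
Proof.
move=> D01 dl0 /andP[t1 t2] s01 hn; have /andP[D0 D1] := D01.
have t12 : dl <= t <= 1 - dl by rewrite !ltW.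
have term0 k : 0 <= 8 * D / (dl * 2^-1 ^+ k) ^+ 2 * \1_(ball t (dl * 2^-1 ^+ k)) s.
  by rewrite mulr_ge0 ?divr_ge0 ?mulr_ge0 ?exprn_ge0 ?mulr_ge0 ?exprn_ge0 ?invr_ge0 // ltW.
have rho0 k : 0 < dl * 2^-1 ^+ k by rewrite mulr_gt0 // exprn_gt0 // invr_gt0.
have c0 : 0 <= 2 * D / dl ^+ 2 by rewrite divr_ge0 ?exprn_ge0 // ?mulr_ge0 // ltW.
have [far|near] := leP dl `|s - t|.
  apply: le_trans (pkernel_le_far D01 dl0 (expi_sub_ge_circle dl0 t12 s01 far)) _.
  by rewrite lerDr sumr_ge0.
have near' : forall k, `|s - t| < dl * 2^-1 ^+ k -> \1_(ball t (dl * 2^-1 ^+ k)) s = 1 :> R.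
  by move=> k hk; rewrite indicE mem_set // /ball /= distrC.
(* Outside the ball of radius u, half of the k-th radius, the kernel is at most 2D/u^2, which is the
   k-th coefficient 8D over the squared radius. Inside the smallest ball the bound 2/D suffices,
   since that radius is at most 2D. *)
suff H k : (k <= n)%N -> dl * 2^-1 ^+ k.+1 <= `|s - t| ->
   pkernel ((1 - D)%:C * expi t : C) (expi s) <=
    \sum_(k < k.+1) 8 * D / (dl * 2^-1 ^+ k) ^+ 2 * \1_(ball t (dl * 2^-1 ^+ k)) s.
  have [hs|hs] := leP (dl * 2^-1 ^+ n.+1) `|s - t|.
    by apply: le_trans (H n (leqnn _) hs) _; rewrite lerDl.
  apply: le_trans (pkernel_le_center t s D01) _.
  rewrite -[leLHS]addr0 lerD // big_ord_recr /= -[leLHS]add0r lerD ?sumr_ge0 //.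
  rewrite near'; last first.
    apply: lt_trans hs _; rewrite exprS; have := rho0 n; lra.
  rewrite mulr1 ler_pdivlMr ?exprn_gt0 // mulrAC ler_pdivrMr //.
  have : (dl * 2^-1 ^+ n) ^+ 2 <= (2 * D) ^+ 2.
    by rewrite lerXn2r ?nnegrE ?(ltW (rho0 n)) // mulr_ge0 // ltW.
  by rewrite !expr2; lra.
elim: k => [_|k IH kn] hs.
  rewrite big_ord_recr big_ord0 /= add0r near' ?expr0 ?mulr1 //.
  have u0 : 0 < dl / 2 by rewrite divr_gt0.
  have u1 : 2 * (dl / 2) <= modc (expi t - expi s : C).
    apply: expi_sub_ge_circle => //; first by lra.
  apply: le_trans (pkernel_le_far D01 u0 u1) _.
  by rewrite le_eqVlt; apply/orP; left; apply/eqP; field; rewrite gt_eqF.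
rewrite big_ord_recr /=.
have [hk|hk] := leP (dl * 2^-1 ^+ k.+1) `|s - t|.
  apply: le_trans (IH (ltnW kn) hk) _.
  by rewrite lerDl.
rewrite near' // mulr1 -[leLHS]add0r lerD ?sumr_ge0 //.
have u1 : 2 * (dl * 2^-1 ^+ k.+2) <= modc (expi t - expi s : C).
  apply: expi_sub_ge_circle => //.
  have : 2^-1 ^+ k.+2 <= 1 :> R by rewrite exprn_ile1 ?invr_ge0 //; lra.
  by have := rho0 k.+2; nra.
apply: le_trans (pkernel_le_far D01 (rho0 _) u1) _.
have q0 : 0 < 2^-1 ^+ k.+1 :> R by rewrite exprn_gt0 // invr_gt0.
rewrite (exprS _ k.+1) le_eqVlt; apply/orP; left; apply/eqP.
by move: q0; move: (2^-1 ^+ k.+1) => x x0; field; rewrite ?gt_eqF.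
Qed.

Lemma mean01_pkernel z : modc z < 1 -> mean01 (fun t => pkernel z (expi t)) = 1.
Proof.
move=> z1; have := poisson_formula (disc_alg_cst 1) z1.
move/(congr1 (@complex.Re R)); rewrite /cmean /cfun /= => ->.
by congr mean01; apply/funext => t; rewrite mul1r mul0r subr0.
Qed.

Lemma weighted_int_dist h (c : R) (p : R -> R) : leb.-integrable I01 (EFin \o h) ->
  adm p -> (forall t, I01 t -> 0 <= p t) ->
  `|weighted_int leb I01 h p - c * mean01 p| <= weighted_int leb I01 (fun s => `|h s - c|) p.
Proof.
move=> ih ap p0; have mI := @measurable_I01 R.
have i1 := integrable_weighted mI (@subset_refl _ _) ih ap.
have i2 := integrable_weighted mI (@subset_refl _ _) integrable_cst1 (admZ c ap).
have i12 : leb.-integrable I01 (EFin \o (fun t => p t * h t - c * p t * 1)).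
  by have := integrableB mI i1 i2; congr (integrable _ _ _).
have [_ JZ _] := bounded_weighted_int mI (@subset_refl _ _) integrable_cst1.
rewrite /mean01 -(JZ c p ap).
rewrite /weighted_int -RintegralB //.
apply: le_trans (le_normr_Rintegral mI i12) _.
rewrite le_eqVlt; apply/orP; left; apply/eqP; apply: eq_Rintegral => t It.
rewrite -[p t in RHS](ger0_norm (p0 _ _)) -?normrM; last by rewrite -inE.
by congr (`|_|); ring.
Qed.

Lemma integrable_shift_norm h (c : R) : leb.-integrable I01 (EFin \o h) ->
  leb.-integrable I01 (EFin \o (fun s => `|h s - c|)).
Proof.
move=> ih; have mI := @measurable_I01 R.
have ic : leb.-integrable I01 (EFin \o (fun=> c)).
  have := integrableZl mI c integrable_cst1.
  by congr (integrable _ _ _); apply/funext => t /=; rewrite mule1.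
by have := integrable_abse (integrableB mI ih ic); congr (integrable _ _ _).
Qed.

Lemma ball_measurable t e : measurable (ball t e : set (measurableTypeR R)).
Proof. by rewrite ball_itv; exact: measurable_itv. Qed.

(** Lebesgue differentiation for the extension of [h] by zero. Interior t are singled out so that
    small balls stay in [I01], where extension and [h] agree; the denominator of the average is the
    ball's length, twice the radius. *)
Lemma ae_lebesgue_pt h : leb.-integrable I01 (EFin \o h) ->
  {ae leb, forall t, 0 < t < 1 -> forall e, 0 < e -> exists2 dl, 0 < dl & forall rho, 0 < rho < dl ->
    weighted_int leb I01 (fun s => `|h s - h t|) (\1_(ball t rho)) <= e * rho}.
Proof.
move=> ih; have mI := @measurable_I01 R.
have := lebesgue_differentiation (integrable_locally_restrict mI ih).
move=> H; apply: (ae_imp H) => t Lt /andP[t0 t1] e e0.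
have := Lt; rewrite /lebesgue_pt => /fine_cvgP[_ /cvgrPdist_lt/(_ (e / 2))].
rewrite divr_gt0 // => /(_ isT) [dl /= dl0 Hdl].
exists (Num.min dl (Num.min t (1 - t))); first by rewrite !lt_min dl0 t0 subr_gt0.
move=> rho /andP[rho0]; rewrite !lt_min => /and3P[h1 h2 h3].
have := Hdl rho; rewrite /ball_ /= sub0r normrN gtr0_norm // => /(_ h1 rho0).
have It : t \in (I01 : set R) by rewrite inE /I01 /= in_itv /= t1 ltW.
have sub : ball t rho `<=` (I01 : set R).
  move=> s; rewrite ball_itv /= /I01 /= !in_itv /= => /andP[s1 s2]; lra.
have ab : adm (\1_(ball t rho)).
  by apply: adm_indic; apply: measurableI => //; exact: ball_measurable.
have E : (\int[leb]_(s in ball t rho) `|((h \_ I01) s - (h \_ I01) t)%:E| =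
    (weighted_int leb I01 (fun s => `|h s - h t|) (\1_(ball t rho)))%:E)%E.
  have iw := integrable_weighted mI (@subset_refl _ _) (integrable_shift_norm (h t) ih) ab.
  rewrite /weighted_int /Rintegral fineK; last exact: (integrable_fin_num mI iw).
  rewrite -[in LHS](setIidr sub) integral_mkcondr; apply: eq_integral => s Is.
  rewrite !patchE Is It indicE; case: ifP => sb; rewrite ?mul1r ?mul0r //.
rewrite sub0r normrN /davg /iavg lebesgue_measure_ball ?(ltW rho0) // E.
rewrite inver mulrn_eq0 /= gt_eqF // -EFinM /=.
move=> /(le_lt_trans (ler_norm _)).
rewrite mulrC ltr_pdivrMr ?pmulrn_lgt0 // => /ltW; rewrite -[rho *+ 2]mulr_natr.
by have -> : e * rho = e / 2 * (rho * 2) by field.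
Qed.

Lemma poisson_integral_radial h : leb.-integrable I01 (EFin \o h) ->
  {ae leb, forall t, 0 < t < 1 ->
    (fun r => weighted_int leb I01 h (fun s => pkernel (r%:C * expi t) (expi s))) @ 1^'- --> h t}.
Proof.
move=> ih; have mI := @measurable_I01 R.
apply: (ae_imp (ae_lebesgue_pt ih)) => t Ht /andP[t0 t1]; apply/cvgrPdist_lt => e e0.
(* The sum over dyadic scales will be at most 16 times this precision, hence at most e/4. *)
have e1 : 0 < e / (8 * 8) by rewrite divr_gt0.
have t01 : 0 < t < 1 by rewrite t0.
have [dl0 dl00 Hdl] := Ht t01 _ e1.
pose dl := Num.min (dl0 / 2) (Num.min (t / 2) ((1 - t) / 2)).
have dlp : 0 < dl by rewrite !lt_min !divr_gt0 // subr_gt0.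
have [d1 d2 d3] : [/\ dl <= dl0 / 2, dl <= t / 2 & dl <= (1 - t) / 2].
  by rewrite !ge_min !lexx !orbT.
have tdl : dl < t < 1 - dl by apply/andP; split; lra.
have ik := integrable_shift_norm (h t) ih.
have bW := bounded_weighted_int mI (@subset_refl _ _) ik.
have pW : positive_functional (weighted_int leb I01 (fun s => `|h s - h t|)).
  by apply: positive_weighted_int.
set W := weighted_int leb I01 (fun s => `|h s - h t|) in bW pW Hdl.
set M := W (fun=> 1).
have M0 : 0 <= M by apply: pW => //; exact: adm_cst.
(* The second entry makes the constant term of [pkernel_dyadic], integrated against the total mass
   [M], at most e/4. *)
pose D0 := Num.min dl (e * dl ^+ 2 / (8 * (M + 1))).
have D00 : 0 < D0 by rewrite lt_min dlp divr_gt0 ?mulr_gt0 ?exprn_gt0 // ltr_wpDl.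
exists D0 => // r /=; rewrite /ball_ /= => hr r1.
pose D := 1 - r; have D0p : 0 < D by rewrite subr_gt0.
have [Dd De] : D < dl /\ D < e * dl ^+ 2 / (8 * (M + 1)).
  by move: hr; rewrite ger0_norm ?subr_ge0 ?(ltW r1) // lt_min => /andP.
have D1 : 0 < D <= 1 by rewrite D0p /=; lra.
have -> : r = 1 - D by rewrite /D; ring.
set z : C := (1 - D)%:C * expi t.
have z1 : modc z < 1.
  by rewrite modcM modc_real modc_expi mulr1 ger0_norm; lra.
have apk := adm_pkernel z1.
have pk0 s : I01 s -> 0 <= pkernel z (expi s) by rewrite ltW // pkernel_gt0 // modc_expi.
have := weighted_int_dist (h t) ih apk pk0; rewrite mean01_pkernel // mulr1 -/W distrC.
move=> L; apply: le_lt_trans L _.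
have [n /andP[n1 n2]] : exists n, D <= dl * 2^-1 ^+ n <= 2 * D by apply: dyadic_radius; rewrite D0p ltW.
have rho0 k : 0 < dl * 2^-1 ^+ k by rewrite mulr_gt0 // exprn_gt0 // invr_gt0.
have ab k : adm (\1_(ball t (dl * 2^-1 ^+ k))).
  by apply: adm_indic; apply: measurableI => //; exact: ball_measurable.
have abz k : adm (fun s => 8 * D / (dl * 2^-1 ^+ k) ^+ 2 * \1_(ball t (dl * 2^-1 ^+ k)) s) by exact: admZ.
pose S m (s : R) := \sum_(k < m) 8 * D / (dl * 2^-1 ^+ k) ^+ 2 * \1_(ball t (dl * 2^-1 ^+ k)) s.
have SS m : S m.+1 = fun s => S m s + 8 * D / (dl * 2^-1 ^+ m) ^+ 2 * \1_(ball t (dl * 2^-1 ^+ m)) s.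
  by apply/funext => s; rewrite /S big_ord_recr.
have aS m : adm (S m).
  elim: m => [|m IH]; last by rewrite SS; exact: admD.
  rewrite (_ : S 0%N = fun=> 0); first exact: adm_cst.
  by apply/funext => s; rewrite /S big_ord0.
have a2 := admD (aS n.+1) (adm_cst (2 * D / dl ^+ 2)).
have [JD JZ _] := bW.
have W2 : W (fun=> 2 * D / dl ^+ 2) = 2 * D / dl ^+ 2 * M.
  by rewrite /M -JZ; [congr W; apply/funext => s; rewrite mulr1 | exact: adm_cst].
(* The bounds for the successive scales double, so their sum is at most twice the last one. *)
have WS m : W (S m.+1) <= 16 * D * (e / (8 * 8)) / (dl * 2^-1 ^+ m).
  have term k : W (fun s => 8 * D / (dl * 2^-1 ^+ k) ^+ 2 * \1_(ball t (dl * 2^-1 ^+ k)) s) <=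
      8 * D * (e / (8 * 8)) / (dl * 2^-1 ^+ k).
    rewrite JZ //.
    have hk : 0 < dl * 2^-1 ^+ k < dl0.
      rewrite rho0 /=; apply: (@le_lt_trans _ _ dl); last by lra.
      by rewrite ler_piMr ?(ltW dlp) // exprn_ile1 ?invr_ge0 //; lra.
    have q0 : 0 < (dl * 2^-1 ^+ k) ^+ 2 by rewrite exprn_gt0.
    apply: (@le_trans _ _ (8 * D / (dl * 2^-1 ^+ k) ^+ 2 * (e / (8 * 8) * (dl * 2^-1 ^+ k)))).
      by rewrite ler_wpM2l ?Hdl // divr_ge0 ?mulr_ge0 // ltW.
    rewrite le_eqVlt; apply/orP; left; apply/eqP; move: (rho0 k); move: (dl * 2^-1 ^+ k) => x x0.
    by field; rewrite gt_eqF.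
  elim: m => [|m IH].
    rewrite SS (_ : S 0%N = fun=> 0); last by apply/funext => s; rewrite /S big_ord0.
    rewrite (_ : (fun _ => _) = fun s => 8 * D / (dl * 2^-1 ^+ 0) ^+ 2 * \1_(ball t (dl * 2^-1 ^+ 0)) s).
      apply: le_trans (term 0%N) _; rewrite ler_pM2r ?invr_gt0 //.
      by rewrite ler_pM2r //; lra.
    by apply/funext => s; rewrite add0r.
  rewrite SS JD //; apply: le_trans (lerD IH (term _)) _.
  have q0 : 0 < 2^-1 ^+ m :> R by rewrite exprn_gt0 // invr_gt0.
  rewrite le_eqVlt; apply/orP; left; apply/eqP; rewrite (exprS _ m).
  by move: q0; move: (2^-1 ^+ m) => x x0; field; rewrite ?gt_eqF.
have s01 s : I01 s -> 0 <= s <= 1 by rewrite /I01 /= in_itv /= => /andP[-> /ltW ->].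
have : W (fun s => pkernel z (expi s)) <= W (fun s => S n.+1 s + 2 * D / dl ^+ 2).
  apply: (positive_functional_le bW pW) => // s Is.
  by apply: pkernel_dyadic => //; exact: s01.
rewrite JD //; last exact: adm_cst.
rewrite W2 => L; apply: le_lt_trans L _.
have b1 : W (S n.+1) <= e / 4.
  apply: le_trans (WS n) _; rewrite ler_pdivrMr //.
  have : e * D <= e * (dl * 2^-1 ^+ n) by rewrite ler_pM2l.
  lra.
have b2 : 2 * D / dl ^+ 2 * M <= e / 4.
  move: De; rewrite ltr_pdivlMr ?mulr_gt0 ?ltr_wpDl // => De.
  rewrite mulrAC ler_pdivrMr ?exprn_gt0 //.
  have : 0 <= D * M by rewrite mulr_ge0 // ltW.
  nra.
lra.
Qed.

End radial_limits.

(** * Radial behaviour of Blaschke factors and singular functions *)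

Section inner_boundary.
Context {R : realType}.
Local Notation C := (Cx R).
Local Notation leb := (@lebesgue_measure R).
Implicit Types (g f : C -> C) (z w : C) (h : R -> R) (e r s t : R).

Definition radk (k : nat) : R := 1 - k.+1%:R^-1.

Lemma rad01 k : 0 <= radk k < 1.
Proof. by rewrite /radk subr_ge0 invf_le1 ?ltr0n // ler1n /= gtrBl invr_gt0 ltr0n. Qed.

Lemma cvg_rad : radk @ \oo --> (1 : R)^'-.
Proof.
have h1 : radk @ \oo --> (1 : R).
  by rewrite /radk -[X in _ --> X]subr0; apply: cvgB; [exact: cvg_cst | exact: cvg_harmonic].
move=> A [d /= d0 H]; have /cvgrPdist_lt/(_ _ d0) := h1.
by apply: filterS => k hk; apply: H => //; case/andP: (rad01 k).
Qed.

Lemma modc_radius r t : 0 <= r < 1 -> modc (r%:C * expi t : C) < 1.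
Proof. by move=> /andP[r0 r1]; rewrite modcM modc_real modc_expi mulr1 ger0_norm. Qed.

Lemma near_left01 : \forall r \near (1 : R)^'-, 0 <= r < 1.
Proof.
exists 1 => //= r; rewrite /ball_ /= => h r1; rewrite r1 andbT.
by move: h; rewrite ger0_norm; lra.
Qed.

Lemma ae_interior : {ae leb, forall t, I01 t -> 0 < t < 1}.
Proof.
exists [set 0]; split; [exact: measurable_set1 | exact: lebesgue_measure_set1 |].
move=> t /= h; apply: contrapT => t0; apply: h; rewrite /I01 /= in_itv /= => /andP[h1 ->].
by rewrite andbT lt0r h1 andbT; apply/eqP.
Qed.

Lemma adm_integrable h : adm h -> leb.-integrable I01 (EFin \o h).
Proof.
move=> ah; have := integrable_weighted (@measurable_I01 R) (@subset_refl _ _) integrable_cst1 ah.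
by congr (integrable _ _ _); apply/funext => t /=; rewrite mulr1.
Qed.

Lemma bounded_radial_limit f : hol f -> (forall z, modc z < 1 -> modc (f z) <= 1) ->
  exists F1 F2 : R -> R, [/\ adm F1, adm F2 & {ae leb, forall t, I01 t ->
    (fun r => f (r%:C * expi t)) @ 1^'- --> (F1 t +i* F2 t : C)}].
Proof.
move=> hf f1; have [F1 [F2 [a1 a2 Hf]]] := boundary_function hf f1.
exists F1, F2; split=> //.
have H1 := poisson_integral_radial (adm_integrable a1).
have H2 := poisson_integral_radial (adm_integrable a2).
apply: (ae_imp (ae_and ae_interior (ae_and H1 H2))) => t [It [h1 h2]] /It t01.
apply/cvgCP => e e0; have e2 : 0 < e / 2 by rewrite divr_gt0.
have /cvgrPdist_lt/(_ _ e2) := h1 t01; have /cvgrPdist_lt/(_ _ e2) := h2 t01.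
apply: filterS3 near_left01 => r r01 d2 d1.
rewrite Hf; last exact: modc_radius.
apply: le_lt_trans (ler_modc_ReIm _) _; move: d1 d2; rewrite /mean01 /weighted_int.
have E (G : R -> R) : \int[leb]_(s in I01) (pkernel (r%:C * expi t) (expi s) * G s * 1) =
  \int[leb]_(s in I01) (pkernel (r%:C * expi t) (expi s) * G s).
  by apply: eq_Rintegral => s _; rewrite mulr1.
by rewrite !E; simpc => /=; lra.
Qed.

Lemma fstarE f t (L : C) : (fun r => f (r%:C * expi t)) @ 1^'- --> L -> fstar f t = L.
Proof. by move=> h; apply: (cvg_lim (@norm_hausdorff _ _) h). Qed.

Lemma bfac_radial a t : modc a <= 1 ->
  (fun r => modc (bfac a (r%:C * expi t)) ^+ 2) @ 1^'- --> (1 : R).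
Proof.
move=> a1; apply/cvgrPdist_lt => e e0.
pose c := 1 - modc a.
have [c0|cn0] := eqVneq c 0.
  apply: filterS near_left01 => r r01; rewrite sqr_modc_bfac ?modc_radius //.
  have -> : modc a = 1 by move: c0; rewrite /c; lra.
  by rewrite expr1n subrr mul0r subr0 subrr normr0.
have cp : 0 < c by rewrite lt0r cn0 /c subr_ge0.
have d0 : 0 < Num.min 1 (e * c ^+ 2 / 4) by rewrite lt_min ltr01 divr_gt0 ?mulr_gt0 ?exprn_gt0.
exists (Num.min 1 (e * c ^+ 2 / 4)) => //= r; rewrite /ball_ /= => h r1.
move: h; rewrite gtr0_norm ?subr_gt0 // lt_min => /andP[h1 h2].
have r01 : 0 <= r < 1 by rewrite r1 andbT; lra.
rewrite sqr_modc_bfac ?modc_radius // opprB addrC subrK.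
rewrite ger0_norm; last by rewrite mulr_ge0 ?sqr_modc_le1 // ltW // pkernel_gt0 ?modc_radius.
have den : c <= modc (1 - a^*%C * (r%:C * expi t)).
  have := @modc_sub_ge _ (a^*%C * (r%:C * expi t)) (modc a); rewrite modcM modc_conj; apply.
  by rewrite ler_piMr ?modc_ge0 // ltW // modc_radius.
have pk : pkernel (r%:C * expi t) a <= 2 * (1 - r) / c ^+ 2.
  rewrite /pkernel modcM modc_real modc_expi mulr1 ger0_norm ?(andP r01).1 //.
  rewrite ler_pM //; [by nra | by rewrite invr_ge0 exprn_ge0 ?modc_ge0 | by nra |].
  have dp := lt_le_trans cp den.
  by rewrite lef_pV2 ?posrE ?exprn_gt0 // lerXn2r ?nnegrE ?modc_ge0 // ltW.
have : 2 * (1 - r) / c ^+ 2 < e / 2 * 1.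
  rewrite mulr1 ltr_pdivrMr ?exprn_gt0 //; move: h2; rewrite ltr_pdivlMr //; lra.
have a2 : 1 - modc a ^+ 2 <= 1 by rewrite gerBl exprn_ge0 ?modc_ge0.
have : (1 - modc a ^+ 2) * pkernel (r%:C * expi t) a <= 1 * pkernel (r%:C * expi t) a.
  by rewrite ler_pM2r // pkernel_gt0 ?modc_radius.
lra.
Qed.

Lemma bprod_radial alpha N t : (forall n, modc (alpha n) <= 1) ->
  (fun r => modc (bprod alpha N (r%:C * expi t)) ^+ 2) @ 1^'- --> (1 : R).
Proof.
move=> a1; elim: N => [|N IH].
  rewrite (_ : (fun _ => _) = fun=> 1); first exact: cvg_cst.
  by apply/funext => r; rewrite /bprod big_ord0 modc1 expr1n.
rewrite (_ : (fun _ => _) = fun r => modc (bprod alpha N (r%:C * expi t)) ^+ 2 *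
    modc (bfac (alpha N) (r%:C * expi t)) ^+ 2).
  by rewrite -[X in _ --> X](mulr1 1); apply: cvgM => //; exact: bfac_radial.
by apply/funext => r; rewrite /bprod big_ord_recr /= modcM exprMn.
Qed.

Lemma modc_cexp_hgl J M z : bounded_functional J M -> modc z < 1 ->
  modc (cexp (- hgl J z)) = expR (- J (fun t => pkernel z (expi t))).
Proof. by move=> bJ z1; rewrite modc_cexp cReN (Re_hgl bJ). Qed.

(** The points at distance at least 1/(n+1) from the complement of U form closed sets increasing to
    U, so continuity from below applies. It places most of a singular measure at positive distance
    from the points outside a small open set. *)
Lemma open_exhaustion (nu : {measure set (measurableTypeR R) -> \bar R}) (U : set R) e :
  (nu setT < +oo)%E -> open U -> 0 < e ->
  exists (K : set (measurableTypeR R)) (d : R), [/\ measurable K, K `<=` U, 0 < d,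
    (nu (U `\` K) < e%:E)%E & forall s t, K s -> ~ U t -> d <= `|s - t|].
Proof.
move=> nufin oU e0.
pose K n : set R := [set s | forall t, ~ U t -> n.+1%:R^-1 <= `|s - t|].
have Kcl n : closed (K n).
  rewrite (_ : K n = ~` (\bigcup_(t in ~` U) ball t (n.+1%:R^-1 : R))).
    by apply: open_closedC; apply: bigcup_open => t _; exact: ball_open.
  apply/seteqP; split=> [s Ks [t nUt]|s Ks t nUt] /=.
    by rewrite /ball /= distrC => h; have := Ks t nUt; rewrite leNgt h.
  rewrite leNgt; apply/negP => h; apply: Ks; exists t => //.
  by rewrite /ball /= distrC.
have mK n : measurable (K n : set (measurableTypeR R)) by exact: closed_measurable.
have mU : measurable (U : set (measurableTypeR R)) by exact: open_measurable.
have KU n : K n `<=` U.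
  move=> s Ks; apply: contrapT => nUs; have := Ks s nUs.
  by rewrite subrr normr0 leNgt invr_gt0 ltr0n.
have UK : U = \bigcup_n K n.
  apply/seteqP; split=> [s Us|s [n _ /KU]//].
  have [d /= d0 hd] : exists2 d : R, 0 < d & ball s d `<=` U.
    by have := oU s Us; move=> /nbhs_ballP.
  have [n hn] : exists n : nat, d^-1 < n.+1%:R by exists (Num.trunc d^-1); exact: truncnS_gt.
  exists n => // t nUt; rewrite leNgt; apply/negP => h; apply/nUt/hd.
  rewrite /ball /= (lt_trans h) // -[ltRHS]invrK ltf_pV2 ?posrE ?invr_gt0 ?ltr0n //.
have Kmono : {homo K : n m / (n <= m)%N >-> (n <= m)%O}.
  move=> n m nm; apply/subsetPset => s Ks t nUt; apply: le_trans (Ks t nUt).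
  by rewrite lef_pV2 ?posrE ?ltr0n // ler_nat ltnS.
have fin A : measurable A -> nu A \is a fin_num.
  move=> mA; rewrite ge0_fin_numE //; apply: le_lt_trans nufin; apply: le_measure; rewrite ?inE //.
have := @nondecreasing_cvg_mu _ _ _ nu K mK; rewrite -UK => /(_ mU Kmono) cv.
have /fine_cvgP[_ /cvgrPdist_lt/(_ _ e0) [n _ /(_ n (leqnn n)) Hn]] : (nu \o K) @ \oo --> (fine (nu U))%:E.
  by rewrite fineK ?fin.
exists (K n), n.+1%:R^-1; split=> //.
rewrite measureD //; last by rewrite -ge0_fin_numE // fin.
rewrite (setIidr (KU n)).
move: Hn => /= /(le_lt_trans (ler_norm _)).
rewrite -[in X in _ -> X](fineK (fin _ mU)) -[in X in _ -> X](fineK (fin _ (mK n))).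
  by rewrite -EFinB lte_fin.
by move=> s t Ks nUt; exact: Ks.
Qed.

Definition sing_functional (nu : {measure set (measurableTypeR R) -> \bar R}) (D : set R) :=
  weighted_int nu (I01 `&` D) (fun=> 1).

Section singular.
Variable nu : {measure set (measurableTypeR R) -> \bar R}.

Lemma integrable_nu1 (D : set (measurableTypeR R)) : (nu setT < +oo)%E -> measurable D ->
  nu.-integrable D (EFin \o (fun=> 1)).
Proof.
move=> nufin mD; apply/integrableP; split; first exact: measurable_cst.
rewrite (_ : (fun x => _) = cst 1%E); last by apply/funext => t /=; rewrite normr1.
by rewrite integral_cst // mul1e (le_lt_trans _ nufin) // le_measure ?inE.
Qed.

Lemma bounded_sing D : (nu setT < +oo)%E -> measurable (D : set (measurableTypeR R)) ->
  bounded_functional (sing_functional nu D) (\int[nu]_(t in I01 `&` D) `|1|).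
Proof.
move=> nufin mD; have mI := @measurable_I01 R.
apply: bounded_weighted_int; [exact: measurableI | by apply: subIsetl |].
by apply: integrable_nu1 => //; exact: measurableI.
Qed.

Lemma positive_sing D : positive_functional (sing_functional nu D).
Proof. by apply: positive_weighted_int => //; apply: subIsetl. Qed.

Lemma sing_functional1 D : (nu setT < +oo)%E -> measurable (D : set (measurableTypeR R)) ->
  ((sing_functional nu D (fun=> 1))%:E = nu (I01 `&` D))%E.
Proof.
move=> nufin mD; have mID : measurable (I01 `&` D : set (measurableTypeR R)).
  by apply: measurableI => //; exact: measurable_I01.
rewrite /sing_functional /weighted_int /Rintegral (_ : (fun _ => _) = cst 1%E).
  rewrite integral_cst // mul1e fineK // ge0_fin_numE //.
  by apply: le_lt_trans nufin; rewrite le_measure ?inE.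
by apply/funext => t; rewrite mul1r.
Qed.

Lemma sing_functional_split D (g : R -> R) : (nu setT < +oo)%E -> measurable (D : set (measurableTypeR R)) -> adm g ->
  sing_functional nu setT g = sing_functional nu D g + sing_functional nu (~` D) g.
Proof.
move=> nufin mD ag; have mI := @measurable_I01 R.
have mDc : measurable (~` D : set (measurableTypeR R)) by exact: measurableC.
rewrite /sing_functional /weighted_int setIT.
have E : (I01 : set R) = (I01 `&` D) `|` (I01 `&` ~` D) by rewrite -setIUr setUv setIT.
rewrite [in LHS]E Rintegral_setU //; try exact: measurableI.
- rewrite -E; apply: (integrable_weighted mI (@subset_refl _ _)) => //.
  exact: integrable_nu1.
- by apply/disj_setPS => t [[_ h1] [_ h2]].
Qed.

End singular.

Lemma pkernel0 w : pkernel 0 w = 1 :> R.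
Proof. by rewrite /pkernel modc0 expr0n subr0 mulr0 subr0 modc1 expr1n divr1. Qed.

Lemma hol_singular J M : bounded_functional J M -> hol (fun z => cexp (- hgl J z)).
Proof.
move=> bJ; apply: hol_cexp.
by apply: (@hol_ext _ (fun z => -1 * hgl J z)) => [z _|]; [rewrite mulN1r | apply/holZ/(hol_hgl bJ)].
Qed.

(** Seen from a radius that stays away from K, the Poisson kernel on K is O(1 - r), so the Poisson
    integral of that part of [nu] tends to 0. *)
Lemma singular_radial (nu : {measure set (measurableTypeR R) -> \bar R}) (K : set R) (d t : R) :
  (nu setT < +oo)%E -> measurable (K : set (measurableTypeR R)) -> 0 < d ->
  (forall s, K s -> d <= `|s - t|) -> 0 < t < 1 ->
  (fun r => expR (- sing_functional nu K (fun s => pkernel (r%:C * expi t) (expi s)))) @ 1^'- --> (1 : R).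
Proof.
move=> nufin mK d0 Kd /andP[t0 t1].
have bJ := bounded_sing nufin mK; have pJ := @positive_sing nu K.
set J := sing_functional nu K in bJ pJ *.
pose dl := Num.min d (Num.min t (1 - t)).
have dl0 : 0 < dl by rewrite !lt_min d0 t0 subr_gt0.
have [dl1 dl2 dl3] : [/\ dl <= d, dl <= t & dl <= 1 - t] by rewrite !ge_min !lexx !orbT.
have tdl : dl <= t <= 1 - dl by rewrite dl2 /=; lra.
suff H : (fun r => J (fun s => pkernel (r%:C * expi t) (expi s))) @ 1^'- --> (0 : R).
  rewrite -[X in _ --> X]expR0 -[X in expR X]oppr0.
  exact: (cvg_comp _ _ (cvgN H) (@continuous_expR R (- 0))).
set M := J (fun=> 1).
have M0 : 0 <= M by apply: pJ => //; exact: adm_cst.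
apply/cvgrPdist_lt => e e0.
have D0 : 0 < Num.min 1 (e * dl ^+ 2 / (4 * (M + 1))).
  by rewrite lt_min ltr01 divr_gt0 ?mulr_gt0 ?exprn_gt0 // ltr_wpDl.
exists (Num.min 1 (e * dl ^+ 2 / (4 * (M + 1)))) => //= r; rewrite /ball_ /= => h r1.
move: h; rewrite gtr0_norm ?subr_gt0 // lt_min => /andP[h1 h2].
have r01 : 0 <= r < 1 by rewrite r1 andbT; lra.
have z1 := modc_radius t r01.
have apk := adm_pkernel z1.
rewrite sub0r normrN ger0_norm; last first.
  by apply: pJ => // s _; rewrite ltW // pkernel_gt0 // modc_expi.
pose D := 1 - r; have D01 : 0 < D <= 1 by rewrite /D subr_gt0 r1 /=; lra.
have rE : r = 1 - D by rewrite /D; ring.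
have mIK : measurable (I01 `&` (I01 `&` K) : set (measurableTypeR R)).
  by do 2 (apply: measurableI; first exact: measurable_I01).
have aK : adm (\1_(I01 `&` K)) by exact: adm_indic.
(* Comparison under a positive functional needs an inequality on all of [I01], whereas the kernel is
   small only on K; the indicator is therefore inserted first. *)
have E : J (fun s => pkernel (r%:C * expi t) (expi s)) =
    J (fun s => pkernel (r%:C * expi t) (expi s) * \1_(I01 `&` K) s).
  rewrite /J /sing_functional /weighted_int; apply: eq_Rintegral => s.
  by rewrite indicE => ->; rewrite !mulr1.
have L : J (fun s => pkernel (r%:C * expi t) (expi s) * \1_(I01 `&` K) s) <= J (fun=> 2 * D / dl ^+ 2 * 1).
  apply: (positive_functional_le bJ pJ); [exact: admM | exact: adm_cst |] => s Is.
  rewrite indicE; case: (boolP (s \in _)) => sK /=; last first.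
    by rewrite mulr0 mulr1 divr_ge0 ?exprn_ge0 ?mulr_ge0 // ltW //; case/andP: D01.
  rewrite !mulr1 rE; move: sK; rewrite inE => -[_ /Kd sd].
  apply: pkernel_le_far => //; apply: expi_sub_ge_circle => //; last exact: le_trans sd.
  by move: Is; rewrite /I01 /= in_itv /= => /andP[-> /ltW ->].
rewrite E; apply: le_lt_trans L _; have [_ JZ _] := bJ.
rewrite JZ; last exact: adm_cst.
rewrite -/M mulrAC ltr_pdivrMr ?exprn_gt0 //.
move: h2; rewrite ltr_pdivlMr ?mulr_gt0 ?ltr_wpDl // -/D => h2.
have Dp : 0 < D by case/andP: D01.
have := mulr_ge0 (ltW Dp) M0; nra.
Qed.

End inner_boundary.

(** * Inner factors have modulus 1 on the boundary *)

Section inner_modulus.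
Context {R : realType}.
Local Notation C := (Cx R).
Local Notation leb := (@lebesgue_measure R).
Implicit Types (g f : C -> C) (z w : C) (h : R -> R) (e r s t : R).

Lemma bprod_le1 alpha N z : (forall n, modc (alpha n) <= 1) -> modc z < 1 -> modc (bprod alpha N z) <= 1.
Proof. by move=> a1 z1; apply: (@modc_prod_le1 _ N (fun i => bfac (alpha i) z)) => i; apply: modc_bfac_le1. Qed.

(** The inner function splits into a finite Blaschke product, a singular factor whose measure lives
    on K, and a remainder [G2]. The first two tend radially to modulus 1 off an open set U of small
    length carrying [nu] up to a null set; [G2] is close to 1 in modulus at the origin, hence in
    mean by the mean value property. *)
Lemma inner_mean alpha T (nu : {measure set (measurableTypeR R) -> \bar R}) e :
  zero_seq alpha T -> singular_circle_measure nu -> 0 < e ->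
  \forall k \near \oo, 1 - e <= mean01 (fun t => modc (blaschke alpha ((radk k)%:C * expi t) *
    cexp (- hgl (sing_functional nu setT) ((radk k)%:C * expi t)))).
Proof.
move=> zs [nufin [nuI [A [mA [A0 nuA]]]]] e0; have mI := @measurable_I01 R.
have b1 := @bounded_mean01 R; have p1 := @positive_mean01 R.
wlog e1 : e e0 / e <= 1.
  move=> H; have [h|h] := leP e 1; first exact: H.
  have := H 1 ltr01 (lexx _); apply: filterS => k; apply: le_trans; lra.
have e4 : 0 < e / 4 by rewrite divr_gt0.
have [U [oU AU UA]] : exists U : set R, [/\ open U, A `<=` U & (leb (U `\` A) < (e / 4)%:E)%E].
  by apply: lebesgue_regularity_outer => //; rewrite [X in (X < _)%E]A0.
have mU : measurable (U : set (measurableTypeR R)) by exact: open_measurable.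
have lU : (leb (U : set (measurableTypeR R)) <= (e / 4)%:E)%E.
  have -> : U = (U `\` A) `|` A.
    by rewrite setUC setDUK.
  apply: le_trans (measureU2 _ _ _) _ => //; first exact: measurableD.
  by rewrite [X in (_ + X)%E]A0 adde0 ltW.
have [K [d [mK KU d0 nuUK Kd]]] := open_exhaustion nufin oU e4.
have nuK : (nu (I01 `&` ~` K) <= (e / 4)%:E)%E.
  have sub : I01 `&` ~` K `<=` (U `\` K) `|` ~` A.
    move=> s [_ nKs]; have [As|nAs] := pselect (A s); last by right.
    by left; split=> //; exact: AU.
  have m1 : measurable (U `\` K : set (measurableTypeR R)) by exact: measurableD.
  have m2 : measurable (~` A : set (measurableTypeR R)) by exact: measurableC.
  have h : (nu (I01 `&` ~` K) <= nu ((U `\` K) `|` ~` A))%E.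
    apply: le_measure; rewrite ?inE //; last exact: measurableU.
    by apply: measurableI => //; exact: measurableC.
  apply: le_trans h _; apply: le_trans (measureU2 _ m1 m2) _.
  by rewrite [X in (_ + X)%E]nuA adde0 ltW.
have [N HN] : exists N, T N <= e / 8.
  have [_ T0 _] := zs; have /cvgrPdist_lt/(_ (e / 8)) := T0; rewrite divr_gt0 // => /(_ isT).
  move=> [N _ /(_ N (leqnn N))]; rewrite /= sub0r normrN => h; exists N.
  by apply: ltW; apply: le_lt_trans (ler_norm _) h.
have zsN := zero_seq_shift N zs.
set alphaN := fun n => alpha (N + n)%N in zsN.
have mKc : measurable (~` K : set (measurableTypeR R)) by exact: measurableC.
have bJ := bounded_sing nufin measurableT.
have bJ1 := bounded_sing nufin mK; have bJ2 := bounded_sing nufin mKc.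
set J := sing_functional nu setT in bJ *.
set J1 := sing_functional nu K in bJ1; set J2 := sing_functional nu (~` K) in bJ2.
have pJ1 : positive_functional J1 := @positive_sing _ nu K.
have pJ2 : positive_functional J2 := @positive_sing _ nu (~` K).
pose G2 z := blaschke alphaN z * cexp (- hgl J2 z).
have hG2 : hol G2 by apply: holM; [exact: hol_blaschke zsN | exact: hol_singular bJ2].
have S_le1 J' M' z : bounded_functional J' M' -> positive_functional J' -> modc z < 1 ->
    modc (cexp (- hgl J' z)) <= 1.
  move=> bJ' pJ' z1; rewrite (modc_cexp_hgl bJ') // -expR0 ler_expR oppr_le0.
  by apply: pJ' => [|t _]; [exact: adm_pkernel | rewrite ltW // pkernel_gt0 // modc_expi].
have G2le1 z : modc z < 1 -> modc (G2 z) <= 1.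
  move=> z1; rewrite modcM mulr_ile1 ?modc_ge0 ?(blaschke_le1 zsN) //.
  exact: (S_le1 _ _ _ bJ2 pJ2).
have m0 : modc (0 : C) < 1 by rewrite modc0.
(* At the origin the tail of the Blaschke product costs 2 T N <= e/4, and the mass of [nu] off K
   costs at most e/4. *)
have G20 : 1 - e / 2 <= modc (G2 0).
  rewrite modcM (modc_cexp_hgl bJ2) // (_ : (fun _ => _) = fun=> 1); last first.
    by apply/funext => t; rewrite pkernel0.
  have x1 : 1 - e / 4 <= modc (blaschke alphaN 0).
    have [_ /(_ 0%N)] := cvg_blaschke zsN m0; rewrite /bprod big_ord0 modc0 subr0 divr1 addn0 => h.
    have := ler_modc_sub 1 (blaschke alphaN 0); rewrite modc1 modc_distC; lra.
  have x2 : 1 - e / 4 <= expR (- J2 (fun=> 1)).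
    apply: le_trans (expR_ge1Dx _).
    have : ((J2 (fun=> 1))%:E <= (e / 4)%:E)%E by rewrite /J2 sing_functional1.
    rewrite lee_fin; lra.
  have : (1 - e / 4) * (1 - e / 4) <= modc (blaschke alphaN 0) * expR (- J2 (fun=> 1)).
    by apply: ler_pM => //; lra.
  nra.
(* Squared because radial limits of [bprod] are known for the squared modulus; as that modulus is at
   most 1, the square is a lower bound for it. *)
pose q k t := modc (bprod alpha N ((radk k)%:C * expi t)) ^+ 2 * modc (cexp (- hgl J1 ((radk k)%:C * expi t))).
have [al1 _ _] := zs.
have q01 k t : 0 <= q k t <= 1.
  have z1 := modc_radius t (rad01 k).
  rewrite mulr_ge0 ?exprn_ge0 ?modc_ge0 //= mulr_ile1 ?exprn_ge0 ?modc_ge0 ?(S_le1 _ _ _ bJ1) //.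
  by rewrite exprn_ile1 ?modc_ge0 // bprod_le1.
have aq k : adm (q k).
  apply: admM; first by apply: adm_sqr_modc; apply: (cadm_hol (hol_bprod _ al1)); exact: rad01.
  by apply: adm_modc; apply: (cadm_hol (hol_singular bJ1)); exact: rad01.
have aU : adm (\1_U) by apply: adm_indic; exact: measurableI.
have aUc : adm (\1_(~` U)) by apply: adm_indic; apply: measurableI => //; exact: measurableC.
pose phi k t := \1_(~` U) t * (1 - q k t).
have aphi k : adm (phi k).
  by apply: admM => //; apply: admD; [exact: adm_cst | exact: admN].
have phi_cv : (fun k => mean01 (phi k)) @ \oo --> (0 : R).
  rewrite -[X in _ --> X](mean01_cst 0).
  apply: (@mean01_dominated _ phi _ 1) => //; first exact: adm_cst.
    move=> k t _; have := q01 k t; rewrite /phi indicE; case: (_ \in _); rewrite /= ?mul1r ?mul0r ?normr0 //.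
    by move=> /andP[h1 h2]; rewrite ger0_norm; lra.
  apply: (ae_imp ae_interior) => t It /It t01.
  rewrite /phi indicE; case: (boolP (t \in _)) => tU /=; last first.
    rewrite (_ : (fun _ => _) = fun=> 0); first exact: cvg_cst.
    by apply/funext => k; rewrite mul0r.
  rewrite inE in tU.
  rewrite (_ : (fun _ => _) = fun k => 1 - q k t); last by apply/funext => k; rewrite mul1r.
  rewrite -[X in _ --> X](subrr 1); apply: cvgB; first exact: cvg_cst.
  rewrite -[X in _ --> X](mulr1 1); apply: cvgM.
    exact: (cvg_comp _ _ cvg_rad (bprod_radial N t al1)).
  rewrite (_ : (fun k => modc (cexp _)) = (fun r => expR (- J1 (fun s => pkernel (r%:C * expi t) (expi s)))) \o radk).
    apply: (cvg_comp _ _ cvg_rad); apply: (singular_radial nufin mK d0 _ t01) => s Ks; exact: Kd.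
  by apply/funext => k /=; rewrite (modc_cexp_hgl bJ1) //; exact: modc_radius (rad01 k).
have e8 : 0 < e / 8 by rewrite divr_gt0.
have /cvgrPdist_lt/(_ _ e8) := phi_cv; apply: filterS => k; rewrite sub0r normrN => hk.
have {}hk := le_lt_trans (ler_norm _) hk.
have cG2 : cadm (fun t => G2 ((radk k)%:C * expi t)) by apply: cadm_hol => //; exact: rad01.
have aG2 := adm_modc cG2.
have hm : 1 - e / 2 <= mean01 (fun t => modc (G2 ((radk k)%:C * expi t))).
  apply: le_trans G20 _; rewrite (mean_value hG2 (rad01 k)).
  exact: (modc_cfun_le b1 p1 cG2).
have mUe : mean01 (\1_U) <= e / 4.
  rewrite mean01E -lee_fin /Rintegral fineK; last first.
    by apply: (integrable_fin_num mI); exact: adm_integrable.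
  rewrite integral_indic //; apply: le_trans lU; apply: le_measure; rewrite ?inE //.
  exact: measurableI.
have aR := admD aG2 (admN (admD aU (aphi k))).
have [JD JZ _] := b1.
have -> : mean01 (fun t => modc (blaschke alpha ((radk k)%:C * expi t) *
    cexp (- hgl J ((radk k)%:C * expi t)))) = mean01 (fun t => modc (bprod alpha N ((radk k)%:C * expi t)) *
      modc (cexp (- hgl J1 ((radk k)%:C * expi t))) * modc (G2 ((radk k)%:C * expi t))).
  congr mean01; apply/funext => t; have z1 := modc_radius t (rad01 k).
  rewrite (blaschke_split N zs) // /G2 !modcM (modc_cexp_hgl bJ) // (modc_cexp_hgl bJ1) // (modc_cexp_hgl bJ2) //.
  rewrite /J (sing_functional_split nufin mK (adm_pkernel z1)) -/J1 -/J2 opprD expRD; ring.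
have ab : adm (fun t => modc (bprod alpha N ((radk k)%:C * expi t))).
  by apply: adm_modc; apply: (cadm_hol (hol_bprod _ al1)); exact: rad01.
have aS : adm (fun t => modc (cexp (- hgl J1 ((radk k)%:C * expi t)))).
  by apply: adm_modc; apply: (cadm_hol (hol_singular bJ1)); exact: rad01.
(* Off U, replacing the first two factors by 1 costs at most 1 - q, which is [phi]; on U the
   subtracted 1 makes the bound trivial. The total loss is e/2 + e/4 + e/8. *)
apply: (@le_trans _ _ (mean01 (fun t => modc (G2 ((radk k)%:C * expi t)) + - (\1_U t + phi k t)))).
  rewrite JD //; last by apply: admN; exact: admD.
  rewrite (_ : (fun t => - _) = fun t => -1 * (\1_U t + phi k t)); last by apply/funext => t; rewrite mulN1r.
  rewrite JZ; last exact: admD.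
  by rewrite JD //; lra.
apply: (positive_functional_le b1 p1) => //; first by apply: admM => //; exact: admM.
move=> t It; have z1 := modc_radius t (rad01 k).
have := G2le1 _ z1; have := q01 k t; rewrite /phi !indicE in_setC.
have : q k t <= modc (bprod alpha N ((radk k)%:C * expi t)) * modc (cexp (- hgl J1 ((radk k)%:C * expi t))).
  rewrite /q ler_wpM2r ?modc_ge0 // expr2 ler_piMl ?modc_ge0 //.
  exact: bprod_le1.
have := modc_ge0 (G2 ((radk k)%:C * expi t)).
move: (modc (G2 _)) (q k t) (modc (bprod _ _ _) * modc _) => x y y' x0 h1 /andP[h2 h3] h4.
by case: (t \in U) => /=; rewrite ?mul1r ?mul0r; nra.
Qed.

Lemma ae_eq_mean01 (a : R -> R) : adm a -> (forall t, I01 t -> a t <= 1) -> 1 <= mean01 a ->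
  {ae leb, forall t, I01 t -> a t = 1}.
Proof.
move=> aa a1 ma; have mI := @measurable_I01 R.
have ab : adm (fun t => 1 + -1 * a t) by apply: admD; [exact: adm_cst | exact: admZ].
have [JD JZ _] := @bounded_mean01 R.
have m0 : mean01 (fun t => 1 + -1 * a t) = 0.
  apply/eqP; rewrite eq_le; apply/andP; split.
    by rewrite JD ?JZ ?mean01_cst; [lra | | exact: adm_cst | exact: admZ].
  by apply: positive_mean01 => // t It; have := a1 t It; lra.
have mb : measurable_fun (I01 : set (measurableTypeR R)) (EFin \o (fun t => 1 + -1 * a t)).
  by case: ab => m _; exact/measurable_EFinP.
have [h _] := @ae_eq_integral_abs _ _ _ leb I01 mI _ mb.
have {h}H : ae_eq leb I01 (EFin \o (fun t => 1 + -1 * a t)) (cst 0%E).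
  apply: h; transitivity ((mean01 (fun t => 1 + -1 * a t))%:E); last by rewrite m0.
  rewrite mean01E /Rintegral fineK; last by apply: (integrable_fin_num mI); exact: adm_integrable.
  apply: eq_integral => t; rewrite inE => It /=; rewrite ger0_norm //.
  by have := a1 t It; lra.
apply: (ae_imp H) => t Ht It; have := Ht It; rewrite /= => -[]; lra.
Qed.

(** Let F be the radial limit of [f]. The inner factor has radial modulus |F| exp(-h) at almost
    every point; this is at most 1, while [inner_mean] makes its mean at least 1, so it equals 1
    almost everywhere. Then h <= 0 because |F| <= 1. *)
Lemma boundary_modulus f h alpha T (nu : {measure set (measurableTypeR R) -> \bar R}) (c : C) :
  hol f -> (forall z, modc z < 1 -> modc (f z) <= 1) -> modc c = 1 ->
  leb.-integrable I01 (EFin \o h) -> zero_seq alpha T -> singular_circle_measure nu ->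
  (forall z, modc z < 1 -> f z = c * cexp (hgl (weighted_int leb I01 h) z) *
     (blaschke alpha z * cexp (- hgl (sing_functional nu setT) z))) ->
  {ae leb, forall t, I01 t -> modc (fstar f t) = expR (h t) /\ h t <= 0}.
Proof.
move=> hf f1 c1 ih zs snu fE; have mI := @measurable_I01 R.
have [F1 [F2 [a1 a2 HF]]] := bounded_radial_limit hf f1.
have bJ := bounded_weighted_int mI (@subset_refl _ _) ih.
set J := weighted_int leb I01 h in bJ fE.
set Jn := sing_functional nu setT in fE.
have [nufin _] := snu; have bJn : bounded_functional Jn _ := bounded_sing nufin measurableT.
pose G z := blaschke alpha z * cexp (- hgl Jn z).
have hG : hol G by apply: holM; [exact: hol_blaschke zs | exact: hol_singular bJn].
pose F t : C := F1 t +i* F2 t.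
have cF : cadm F by split.
have G1 z : modc z < 1 -> modc (G z) <= 1.
  move=> z1; rewrite modcM mulr_ile1 ?modc_ge0 ?(blaschke_le1 zs) //.
  rewrite (modc_cexp_hgl bJn) // -expR0 ler_expR oppr_le0.
  by apply: positive_sing => [|t _]; [exact: adm_pkernel | rewrite ltW // pkernel_gt0 // modc_expi].
have GE z : modc z < 1 -> modc (G z) = modc (f z) * expR (- J (fun s => pkernel z (expi s))).
  move=> z1; rewrite fE // -/(G z) modcM [modc (c * _)]modcM c1 mul1r modc_cexp (Re_hgl bJ) //.
  by rewrite mulrAC -expRD subrr expR0 mul1r.
(* The minimum only makes the function bounded everywhere; where the radial limits exist it is
   inactive. *)
pose a t := Num.min 1 (modc (F t) * expR (- h t)).
have mh : measurable_fun (I01 : set (measurableTypeR R)) h.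
  by apply/measurable_EFinP; exact: measurable_int ih.
have aa : adm a.
  split.
    apply: measurable_minr => //; apply: measurable_funM; first by case: (adm_modc cF).
    by apply: measurableT_comp; [exact: measurable_expR | exact: measurable_funN].
  exists 1 => t _; rewrite ger0_norm /a ?ge_min ?lexx // le_min ler01 /=.
  by rewrite mulr_ge0 ?modc_ge0 // expR_ge0.
have AE : {ae leb, forall t, I01 t -> [/\ fstar f t = F t, modc (F t) <= 1 &
    (fun k => modc (G ((radk k)%:C * expi t))) @ \oo --> modc (F t) * expR (- h t)]}.
  apply: (ae_imp (ae_and ae_interior (ae_and HF (poisson_integral_radial ih)))).
  move=> t [It [h1 h2]] It'; have t01 := It It'; have {}h1 := h1 It'; have {}h2 := h2 t01.
  have cv : (fun k => modc (f ((radk k)%:C * expi t))) @ \oo --> modc (F t).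
    apply/cvgrPdist_le => e e0; have /cvgCP/(_ _ e0) := cvg_comp _ _ cvg_rad h1.
    apply: filterS => k /= /ltW; apply: le_trans.
    rewrite ler_norml; apply/andP; split; last exact: ler_modc_sub.
    by have := ler_modc_sub (f ((radk k)%:C * expi t)) (F t); rewrite modc_distC; lra.
  split; first exact: fstarE h1.
    apply: (cvgr_to_le cv); apply: nearW => k; apply: f1; exact: modc_radius (rad01 k).
  rewrite (_ : (fun _ => _) = fun k => modc (f ((radk k)%:C * expi t)) *
     expR (- J (fun s => pkernel ((radk k)%:C * expi t) (expi s)))); last first.
    by apply/funext => k; rewrite GE //; exact: modc_radius (rad01 k).
  apply: cvgM => //.
  apply: (@cvg_comp _ _ _ (fun k => - J (fun s => pkernel ((radk k)%:C * expi t) (expi s))) expR _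
    (nbhs (- h t))); last exact: continuous_expR.
  by apply: cvgN; exact: (cvg_comp _ _ cvg_rad h2).
have cG k : cadm (fun t => G ((radk k)%:C * expi t)) by apply: (cadm_hol hG); exact: rad01.
have cv : (fun k => mean01 (fun t => modc (G ((radk k)%:C * expi t)))) @ \oo --> mean01 a.
  apply: (@mean01_dominated _ (fun k t => modc (G ((radk k)%:C * expi t))) _ 1) => //.
  - by move=> k; exact: adm_modc.
  - move=> k t _; rewrite ger0_norm ?modc_ge0 //; apply: G1; exact: modc_radius (rad01 k).
  - apply: (ae_imp AE) => t Ht It; have [_ _ cvt] := Ht It.
    rewrite /a min_r //; apply: (cvgr_to_le cvt).
    by apply: nearW => k; apply: G1; exact: modc_radius (rad01 k).
have ma : 1 <= mean01 a.
  rewrite -subr_le0; apply: (@le0_of_small _ _ 1) => e e0; rewrite mul1r.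
  rewrite lerBlDr -lerBlDl; apply: (cvgr_to_ge cv).
  exact: (inner_mean zs snu e0).
have a1' t : I01 t -> a t <= 1 by move=> _; rewrite /a ge_min lexx.
apply: (ae_imp (ae_and AE (ae_eq_mean01 aa a1' ma))) => t [H1 H2] It.
have [-> Fle cvt] := H1 It; have := H2 It; rewrite /a min_r; last first.
  by apply: (cvgr_to_le cvt); apply: nearW => k; apply: G1; exact: modc_radius (rad01 k).
move=> E; have E2 : modc (F t) = expR (h t).
  by rewrite -[LHS]mulr1 -expR0 -(addNr (h t)) expRD mulrA E mul1r.
by split=> //; rewrite -ler_expR expR0 -E2.
Qed.

End inner_modulus.

(** * Integrals up to null sets, and the factors in normal form *)

Section factorization.
Context {R : realType}.
Local Notation C := (Cx R).
Local Notation leb := (@lebesgue_measure R).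
Implicit Types (f : C -> C) (z w : C) (h : R -> R) (e r s t : R).

Import HBNNSimple.

(** The supremum to which the integral unfolds on positive and negative parts. Arguing on it
    directly allows integrands that are not measurable. *)
Definition nnint d (T : measurableType d) (m : {measure set T -> \bar R}) (g : T -> \bar R) : \bar R :=
  ereal_sup [set sintegral m k | k in [set k : {nnsfun T >-> R} | forall x, ((k x)%:E <= g x)%E]].

(* No measurability is required: [fstar f] is only known to agree almost everywhere with a
   measurable function. *)
Lemma nnint_ae_le d (T : measurableType d) (m : {measure set T -> \bar R}) (N : set T)
    (g1 g2 : T -> \bar R) :
  measurable N -> m N = 0%E -> (forall x, 0 <= g2 x)%E -> (forall x, ~ N x -> g1 x <= g2 x)%E ->
  (nnint m g1 <= nnint m g2)%E.
Proof.
move=> mN N0 g20 g12; apply: ub_ereal_sup => _ [k kg1 <-].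
pose k' := proj_nnsfun k (measurableC mN).
have -> : sintegral m k = sintegral m k'.
  rewrite -!integralT_nnsfun; apply: ge0_ae_eq_integral => //.
  - by apply/measurable_EFinP; exact: measurable_funPT.
  - by apply/measurable_EFinP; exact: measurable_funPT.
  - by move=> x _; rewrite lee_fin.
  - by move=> x _; rewrite lee_fin.
  exists N; split=> // x /= h; apply: contrapT => nNx; apply: h => _.
  by rewrite /= mindicE mem_set ?mulr1.
apply: ereal_sup_ubound; exists k' => // x /=.
rewrite mindicE; case: (boolP (x \in ~` N)) => [|_]; last by rewrite mulr0.
by rewrite inE mulr1 => nNx; apply: le_trans (kg1 x) (g12 x nNx).
Qed.

Lemma integral_eq_ae d (T : measurableType d) (m : {measure set T -> \bar R}) (D : set T)
    (g1 g2 : T -> \bar R) :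
  {ae m, forall x, D x -> g1 x = g2 x} -> (\int[m]_(x in D) g1 x = \int[m]_(x in D) g2 x)%E.
Proof.
move=> [N [mN N0 sN]].
have E x : ~ N x -> (g1 \_ D) x = (g2 \_ D) x.
  move=> nNx; rewrite !patchE; case: ifP => // xD.
  by have := contra_not (sN x) nNx => /contrapT; apply; rewrite -inE.
have H (k1 k2 : T -> \bar R) : (forall x, ~ N x -> k1 x = k2 x) -> (forall x, 0 <= k1 x)%E ->
    (forall x, 0 <= k2 x)%E -> nnint m k1 = nnint m k2.
  move=> k12 k10 k20; apply/eqP; rewrite eq_le; apply/andP; split;
    apply: (nnint_ae_le mN N0) => // x nNx; rewrite k12 //.
have IE (g : T -> \bar R) : (\int[m]_(x in D) g x = nnint m (g \_ D)^\+ - nnint m (g \_ D)^\-)%E by [].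
rewrite !IE; congr (_ - _)%E; apply: H => // x nNx.
- by rewrite !funeposE E.
- by rewrite !funenegE E.
Qed.

Lemma zero_seq_of_bound (alpha : nat -> C) (V : R) : (forall n, modc (alpha n) <= 1) ->
  (forall N, \sum_(i < N) (1 - modc (alpha i)) <= V) -> exists T, zero_seq alpha T.
Proof.
move=> a1 hV; pose u n := 1 - modc (alpha n).
have su N : series u N = \sum_(i < N) u i by rewrite /series /= big_mkord.
have u0 n : 0 <= u n by rewrite subr_ge0.
have nd : nondecreasing_seq (series u).
  by apply/nondecreasing_seqP => n; rewrite /series /= big_nat_recr //= lerDl.
have cv : cvgn (series u).
  by apply: nondecreasing_is_cvgn => //; exists V => _ [n _ <-]; rewrite su.
exists (fun N => limn (series u) - series u N); split=> //.
  by rewrite -[X in _ --> X](subrr (limn (series u))); apply: cvgB => //; exact: cvg_cst.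
move=> N k; have := nondecreasing_cvgn_le nd cv (N + k)%N.
by rewrite !su big_split_ord /= => h; rewrite lerBrDl.
Qed.

Lemma blaschke_factorization B : is_blaschke B -> exists (c : C) (alpha : nat -> C) (T : nat -> R),
  [/\ modc c = 1, zero_seq alpha T & forall z, modc z < 1 -> B z = c * blaschke alpha z].
Proof.
move=> [c [k [a [c1 [a1 [sa HB]]]]]].
(* Two conventions meet: in [is_blaschke] the value 0 is padding and zeros at the origin sit in z^k,
   whereas in [zero_seq] the value 0 is a genuine zero and 1 is padding. *)
pose alpha n : C := if (n < k)%N then 0 else if a (n - k)%N == 0 then 1 else a (n - k)%N.
have al1 n : modc (alpha n) <= 1.
  rewrite /alpha; case: ifP => _; first by rewrite modc0.
  by case: ifP => _; [rewrite modc1 | rewrite ltW // -norm_lt1].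
pose v n := if a n == 0 then 0 else 1 - modc (a n).
have v0 n : 0 <= v n by rewrite /v; case: ifP => // _; rewrite subr_ge0 ltW // -norm_lt1.
have [V hV] : exists V, forall N, \sum_(i < N) v i <= V.
  exists (fine (\sum_(0 <= n <oo) (v n)%:E)%E) => N.
  have E : (\sum_(0 <= n <oo) (v n)%:E)%E = (\sum_(0 <= n <oo) (if a n == 0 then 0 else 1 - modc (a n))%:E)%E by [].
  rewrite -lee_fin fineK; last first.
    by rewrite E ge0_fin_numE //; apply: nneseries_ge0 => n _ _; rewrite lee_fin; exact: v0.
  by rewrite -sumEFin -(big_mkord xpredT (fun i => (v i)%:E)); apply: nneseries_lim_ge => n _ _; rewrite lee_fin.
have hal N : \sum_(i < N) (1 - modc (alpha i)) <= k%:R + V.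
  apply: (@le_trans _ _ (\sum_(i < k + N) (1 - modc (alpha i)))).
    rewrite addnC big_split_ord /= lerDl sumr_ge0 // => i _; by rewrite subr_ge0.
  rewrite big_split_ord /= lerD //.
    rewrite (eq_bigr (fun=> 1)) ?sumr_const ?card_ord // => i _.
    by rewrite /alpha ltn_ord modc0 subr0.
  apply: le_trans (hV N); apply: ler_sum => i _.
  rewrite /alpha /v ltnNge leq_addr /= addKn; case: ifP => // _.
  by rewrite modc1 subrr.
have [T zs] := zero_seq_of_bound al1 hal.
exists c, alpha, T; split=> //; first by apply: norm_eq1.
move=> z z1; have /HB h : `|z| < 1 by rewrite norm_lt1.
have [cv _] := cvg_blaschke zs z1.
apply: (@cvgC_unique _ _ _ _ _ _ _ h).
have E N : c * z ^+ k * \prod_(n < N) bfactor (a n) z = c * bprod alpha (N + k) z.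
  rewrite /bprod addnC big_split_ord /= -mulrA; congr (_ * (_ * _)).
    rewrite (eq_bigr (fun=> z)) ?prodr_const ?card_ord // => i _.
    by rewrite /alpha ltn_ord bfac0.
  apply: eq_bigr => i _; rewrite /alpha ltnNge leq_addr /= addKn.
  case: ifP => [/eqP ->|/negbT a0]; last by rewrite bfac_bfactor.
  by rewrite bfac1 // /bfactor eqxx.
rewrite (_ : (fun N => _) = fun N => c * bprod alpha (N + k) z); last by apply/funext => N; exact: E.
by apply: cvgM; [exact: cvg_cst | rewrite (cvg_shiftn k (fun N => bprod alpha N z))].
Qed.

Lemma cint_cfun (mm : {measure set (measurableTypeR R) -> \bar R}) (g : R -> C) h :
  cint mm (fun t => g t * (h t)%:C) = cfun (weighted_int mm I01 h) g.
Proof.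
rewrite /cint /cfun /weighted_int; congr (_ +i* _); apply: eq_Rintegral => t _.
  by rewrite cReM /= mulr0 subr0.
by rewrite cImM /= mulr0 add0r.
Qed.

Lemma factorization f E B (nu : {measure set (measurableTypeR R) -> \bar R}) :
  is_outer E -> is_blaschke B -> singular_circle_measure nu ->
  (forall z, `|z| < 1 -> f z = E z * B z * sing_inner nu z) ->
  exists (c : C) (h : R -> R) (alpha : nat -> C) (T : nat -> R),
  [/\ modc c = 1, leb.-integrable I01 (EFin \o h), zero_seq alpha T &
    forall z, modc z < 1 -> f z = c * cexp (hgl (weighted_int leb I01 h) z) *
     (blaschke alpha z * cexp (- hgl (sing_functional nu setT) z))].
Proof.
move=> [c1 [h [c11 [ih HE]]]] /blaschke_factorization[c2 [alpha [T [c21 zs HB]]]] [nufin _] Hf.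
exists (c1 * c2), h, alpha, T; split=> //.
  by rewrite modcM c21 mulr1; apply/norm_eq1.
move=> z z1; have z1' : `|z| < 1 by rewrite norm_lt1.
rewrite Hf // HE // HB // /sing_inner cint_cfun -/(hgl _ z).
have -> : cint nu (herglotz z) = hgl (sing_functional nu setT) z.
  rewrite /hgl /sing_functional setIT -cint_cfun; congr cint; apply/funext => t.
  by rewrite mulr1.
by ring.
Qed.

End factorization.

(** * Zeros with multiplicity versus the sequence of zeros *)

Section zeros.
Context {R : realType}.
Local Notation C := (Cx R).
Local Notation leb := (@lebesgue_measure R).
Implicit Types (f g b : C -> C) (z w : C) (e r s t : R) (alpha : nat -> C) (T : nat -> R).

(** Induction on m for all F and g at once: the derivative of b^(m+1) g is b^m g1 with g1 = (m+1) b'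
    g + b g', and g1 does not vanish at z because b does while b' and g do not. *)
Lemma iter_derive1_power b m : hol b -> forall F g z, modc z < 1 -> hol g ->
  b z = 0 -> derive1 b z != 0 -> g z != 0 ->
  (forall w, modc w < 1 -> F w = b w ^+ m * g w) ->
  (forall j, (j < m)%N -> iter j (fun q : C -> C => derive1 q) F z = 0) /\
  iter m (fun q : C -> C => derive1 q) F z != 0.
Proof.
move=> hb; elim: m => [|m IH] F g z z1 hg bz dbz gz HF.
  by split=> //=; rewrite HF // expr0 mul1r.
pose g1 w := m.+1%:R * (derive1 b w * g w) + b w * derive1 g w.
have hg1 : hol g1.
  apply: holD; first by apply: holZ; apply: holM => //; exact: hol_derive1.
  by apply: holM => //; exact: hol_derive1.
have g1z : g1 z != 0 by rewrite /g1 bz mul0r addr0 !mulf_neq0 // pnatr_eq0.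
have qdX w n : modc w < 1 -> qd (fun w => b w ^+ n.+1) w (n.+1%:R * b w ^+ n * derive1 b w).
  move=> w1; elim: n => [|n IHn]; first by rewrite expr0 !mul1r; exact: hol_qd.
  rewrite (_ : (fun w => _) = fun w => b w * b w ^+ n.+1); last by apply/funext => u; rewrite exprS.
  have := qdM (hol_qd hb w1) IHn; congr (qd _ _ _).
  by rewrite !exprS -[n.+2]addn1 natrD; ring.
have HF1 w : modc w < 1 -> derive1 F w = b w ^+ m * g1 w.
  move=> w1; apply: qd_derive1.
  have r0 : 0 < 1 - modc w by rewrite subr_gt0.
  apply: (qd_eq r0 (f := fun w => b w ^+ m.+1 * g w)).
    move=> u hu; rewrite HF //; have := ler_modcD (u - w) w; rewrite subrK; lra.
  have := qdM (qdX w m w1) (hol_qd hg w1); congr (qd _ _ _).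
  rewrite /g1 exprS; move: (b w ^+ m) (b w) (derive1 b w) (g w) (derive1 g w) (m.+1%:R : C).
  by move=> y0 y1 y2 y3 y4 y5; ring.
have [H1 H2] := IH _ _ _ z1 hg1 bz dbz g1z HF1.
split; last by rewrite iterSr.
case=> [_|j jm] /=; first by rewrite HF // bz expr0n mul0r.
by rewrite -iterS iterSr; apply: H1.
Qed.

Lemma esum_finite_nat (P : pred nat) N (w : R) : 0 <= w -> (forall n, P n -> (n < N)%N) ->
  esum [set n | P n] (fun=> w%:E) = ((\sum_(i < N) (P i)%:R) * w)%:E.
Proof.
move=> w0 PN; rewrite esum_mkcond -nneseries_esumT; last first.
  by move=> n; case: ifP => // _; rewrite lee_fin.
rewrite (@nneseries_split _ _ 0 N); last by move=> n _; case: ifP => // _; rewrite lee_fin.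
rewrite eseries0 ?adde0; last first.
  move=> n; rewrite add0n => Nn _; case: ifP => //; rewrite inE /= => /PN.
  by rewrite ltnNge Nn.
rewrite add0n big_mkord mulr_suml -sumEFin; apply: eq_bigr => i _.
have -> : (val i \in [set n | P n]) = P i by apply/idP/idP; rewrite inE.
by case: (P i); rewrite ?mul1r ?mul0r.
Qed.

Lemma zmult_power F b g z m : hol b -> hol g -> modc z < 1 -> b z = 0 -> derive1 b z != 0 ->
  g z != 0 -> (forall w, modc w < 1 -> F w = b w ^+ m * g w) -> zmult F z = (m%:R)%:E.
Proof.
move=> hb hg z1 bz dbz gz HF.
have [H1 H2] := @iter_derive1_power b m hb F g z z1 hg bz dbz gz HF.
rewrite /zmult (_ : [set k | _] = [set k | (k < m)%N]).
  rewrite (@esum_finite_nat (fun k => (k < m)%N) m) // mulr1.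
  by rewrite (eq_bigr (fun=> 1)) ?sumr_const ?card_ord // => i _; rewrite ltn_ord.
apply/seteqP; split=> k /=.
  move=> h; rewrite ltnNge; apply/negP => /h; apply/eqP => //.
by move=> km j jk; apply: H1; exact: leq_ltn_trans km.
Qed.

Lemma derive1_bfac_neq0 z : modc z < 1 -> derive1 (bfac z) z != 0.
Proof.
move=> z1; have z1' := ltW z1; have := derive1_bfac z1' z1.
have -> : bfac z z = 0 by rewrite /bfac subrr mul0r mulr0.
rewrite modc0 expr0n subr0 => h; rewrite -modc_eq0; apply/eqP => h0.
by move: h; rewrite h0 mul0r => /esym/eqP; rewrite oner_eq0.
Qed.

Lemma bfac_neq0 a z : modc a <= 1 -> modc z < 1 -> a != z -> bfac a z != 0.
Proof.
move=> a1 z1 az; rewrite /bfac !mulf_neq0 ?invr_eq0 ?den_neq0 ?subr_eq0 //.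
case: (eqVneq a 0) => [_|a0]; first by rewrite oppr_eq0 oner_neq0.
by rewrite mulf_neq0 ?invr_eq0 ?normr_eq0.
Qed.

(** A term equal to z with index at least N would alone contribute 1 - |z| to the tail. *)
Lemma tail_neq alpha T N n z : zero_seq alpha T -> T N < 1 - modc z -> (N <= n)%N -> alpha n != z.
Proof.
move=> [a1 _ h] TN Nn; apply/eqP => az.
have := h N (n - N).+1; rewrite big_ord_recr /= subnKC // az.
have : 0 <= \sum_(i < n - N) (1 - modc (alpha (N + i)%N)).
  by apply: sumr_ge0 => i _; rewrite subr_ge0.
lra.
Qed.

Lemma blaschke_neq0 alpha T z : zero_seq alpha T -> modc z < 1 ->
  2 / (1 - modc z) * T 0%N < 1 -> blaschke alpha z != 0.
Proof.
move=> zs z1 h; have [_ /(_ 0%N)] := cvg_blaschke zs z1.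
rewrite /bprod big_ord0 => h2; rewrite -modc_eq0; apply/eqP => h0.
have := ler_modc_sub 1 (blaschke alpha z); rewrite modc1 h0 modc_distC; lra.
Qed.

Lemma small_tail alpha T e : zero_seq alpha T -> 0 < e -> exists N, T N < e.
Proof.
move=> [_ T0 _] e0; have /cvgrPdist_lt/(_ _ e0) [N _ /(_ N (leqnn N))] := T0.
rewrite /= sub0r normrN => h; exists N; exact: le_lt_trans (ler_norm _) h.
Qed.

Section inner_outer.
Variables (f : C -> C) (alpha : nat -> C) (T : nat -> R) (J : (R -> R) -> R) (M : R) (c : C).
Hypotheses (zs : zero_seq alpha T) (bJ : bounded_functional J M) (c1 : modc c = 1).
Hypothesis fE : forall z, modc z < 1 -> f z = c * blaschke alpha z * cexp (- hgl J z).

Lemma zmult_count z : modc z < 1 -> exists N : nat, (forall n, alpha n = z -> (n < N)%N) /\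
  zmult f z = (\sum_(i < N) (alpha i == z)%:R)%:E.
Proof.
move=> z1; have z1' : 0 < 1 - modc z by rewrite subr_gt0.
(* A tail below this bound serves twice: it contains no term equal to z, and by [blaschke_neq0] its
   product does not vanish at z. *)
have e0 : 0 < (1 - modc z) / 2 by rewrite divr_gt0.
have [N TN] := small_tail zs e0.
have TN1 : T N < 1 - modc z by lra.
exists N; split.
  by move=> n az; rewrite ltnNge; apply/negP => Nn; have := tail_neq zs TN1 Nn; rewrite az eqxx.
have zsN := zero_seq_shift N zs.
have nz : blaschke (fun n => alpha (N + n)%N) z != 0.
  apply: (blaschke_neq0 zsN z1); rewrite addn0 mulrAC ltr_pdivrMr //; lra.
(* The factors vanishing at z are removed here and collected into a power of [bfac z]. *)
pose q (i : nat) w := if alpha i == z then 1 else bfac (alpha i) w.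
pose g w := c * ((\prod_(i < N) q i w) * blaschke (fun n => alpha (N + n)%N) w * cexp (- hgl J w)).
have [a1 _ _] := zs.
have hq i : hol (q i).
  by rewrite /q; case: (alpha i == z); [exact: hol_cst | exact: hol_bfac].
have hg : hol g.
  apply: holZ; apply: holM; last exact: hol_singular bJ.
  apply: holM; last exact: hol_blaschke zsN.
  exact: (hol_prod N hq).
have gz : g z != 0.
  rewrite !mulf_neq0 ?cexp_neq0 // -?modc_eq0 ?c1 ?oner_eq0 //.
  rewrite modc_eq0 prodf_seq_neq0; apply/allP => i _ /=; rewrite /q.
  by have [_|az] := eqVneq (alpha i) z; [exact: oner_neq0 | exact: bfac_neq0].
have HF w : modc w < 1 -> f w = bfac z w ^+ (\sum_(i < N) (alpha i == z)) * g w.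
  move=> w1; rewrite fE // (blaschke_split N zs w1) /g.
  have -> : bprod alpha N w = bfac z w ^+ (\sum_(i < N) (alpha i == z)) * \prod_(i < N) q i w.
    rewrite /bprod; elim: N {TN TN1 zsN nz g hg gz} => [|N IH].
      by rewrite !big_ord0 mulr1.
    rewrite !big_ord_recr /= IH exprD {3}/q; case: eqP => [->|_].
      by rewrite expr1; ring.
    by rewrite expr0; ring.
  by ring.
rewrite (zmult_power (hol_bfac (ltW z1)) hg z1 _ (derive1_bfac_neq0 z1) gz HF).
  by rewrite natr_sum.
by rewrite /bfac subrr mul0r mulr0.
Qed.

Lemma f_zero_alpha n : modc (alpha n) < 1 -> f (alpha n) = 0.
Proof.
move=> z1; rewrite fE // (blaschke_split n.+1 zs z1) /bprod big_ord_recr /=.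
by rewrite /bfac subrr !(mul0r, mulr0).
Qed.

(** The multiplicity of a zero z is the number of indices n with [alpha n] = z, so the sum over
    zeros is a double sum over pairs (z, n), reindexed by n. Indices with |alpha n| = 1 have weight
    0. *)
Lemma zero_partE (g : C -> R) : (forall w, modc w <= 1 -> 0 <= g w) ->
  zero_part f g = (\sum_(0 <= n <oo) ((1 - modc (alpha n) ^+ 2) * g (alpha n))%:E)%E.
Proof.
move=> g0; have [a1 _ _] := zs; rewrite /zero_part.
set Z := [set z | _].
have w0 z : modc z <= 1 -> 0 <= (1 - modc z ^+ 2) * g z by move=> z1; rewrite mulr_ge0 ?g0 ?sqr_modc_le1.
pose J' z := [set n : nat | alpha n == z].
(* Exchanging sums asks for nonnegative terms at every z, also outside the disc; the absolute value
   provides this and is invisible inside. *)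
pose w' (z : C) (n : nat) : \bar R := (`|(1 - modc z ^+ 2) * g z|)%:E.
transitivity (\esum_(z in Z) \esum_(n in J' z) w' z n).
  apply: eq_esum => z [z1 _]; rewrite norm_lt1 in z1.
  have [N [HN ->]] := zmult_count z1.
  have h0 := w0 _ (ltW z1).
  rewrite /J' /w' (@esum_finite_nat (fun n => alpha n == z) N) ?EFinM //.
    by rewrite ger0_norm.
  by move=> n /eqP; exact: HN.
rewrite esum_esum; last by move=> *; rewrite lee_fin.
rewrite (@reindex_esum _ _ _ [set n | modc (alpha n) < 1] _ (fun n => (alpha n, n))); last first.
  split.
  - move=> n /= n1; split=> //=; last by rewrite /J' /=.
    by rewrite /Z /= norm_lt1 f_zero_alpha.
  - by move=> n m _ _ [].
  - move=> [z n] [/= [z1 _] /eqP az]; exists n; rewrite /= ?az //.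
    by rewrite -norm_lt1.
rewrite esum_mkcond nneseries_esumT; last by move=> n; rewrite lee_fin w0.
apply: eq_esum => n _ /=; case: ifP => h; rewrite /w' /=; first by rewrite ger0_norm ?w0.
have -> : modc (alpha n) = 1.
  apply/eqP; rewrite eq_le a1 leNgt /=; apply/negP => h2.
  by move: h; rewrite mem_set.
by rewrite expr1n subrr mul0r.
Qed.

End inner_outer.

End zeros.

(** * The measure of the theorem in terms of the canonical form of [f] *)

Section riesz_measure.
Context {R : realType}.
Local Notation C := (Cx R).
Local Notation leb := (@lebesgue_measure R).
Implicit Types (f : C -> C) (z w : C) (e r s t : R) (alpha : nat -> C) (T : nat -> R).
Implicit Types (nu : {measure set (measurableTypeR R) -> \bar R}) (g : C -> R).

Definition zsum alpha g : R := limn (series (fun n => (1 - modc (alpha n) ^+ 2) * g (alpha n))).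

(* Integration against the measure [mu] of the theorem: [alpha] lists the zeros of [f] (padded by 1)
   and [J] integrates against the part of [mu / 2] carried by the circle. *)
Definition Lam alpha (J : (R -> R) -> R) g : R := zsum alpha g + 2 * J (g \o expi).

Definition mass nu (k : R -> R) (g : R -> R) : R :=
  sing_functional nu setT g + weighted_int leb I01 k g.

Lemma LamE alpha J g : ((Lam alpha J g)%:E = (zsum alpha g)%:E + 2%:E * (J (g \o expi))%:E)%E.
Proof. by rewrite /Lam EFinD EFinM. Qed.

Lemma zsum_cvg alpha T g (b : R) : zero_seq alpha T -> (forall w, modc w <= 1 -> 0 <= g w <= b) ->
  series (fun n => (1 - modc (alpha n) ^+ 2) * g (alpha n)) @ \oo --> zsum alpha g.
Proof.
move=> [a1 _ hT] gb.
have u0 n : 0 <= (1 - modc (alpha n) ^+ 2) * g (alpha n).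
  by rewrite mulr_ge0 ?sqr_modc_le1 //; case/andP: (gb _ (a1 n)).
apply: nondecreasing_is_cvgn.
  by apply/nondecreasing_seqP => n; rewrite /series /= big_nat_recr //= lerDl.
exists (2 * b * T 0%N) => _ [n _ <-]; rewrite /series /= big_mkord.
apply: (@le_trans _ _ (\sum_(i < n) 2 * b * (1 - modc (alpha i)))).
  apply: ler_sum => i _; have /andP[g0 gb'] := gb _ (a1 i).
  have h0 := modc_ge0 (alpha i); have h1 := a1 i.
  have -> : 2 * b * (1 - modc (alpha i)) = (2 * (1 - modc (alpha i))) * b by ring.
  apply: ler_pM => //; first exact: sqr_modc_le1.
  by rewrite expr2; nra.
have b0 : 0 <= b by have := gb 0; rewrite modc0 ler01 => /(_ isT) /andP[/le_trans h /h].
rewrite -mulr_sumr ler_wpM2l ?mulr_ge0 //.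
exact: (hT 0%N n).
Qed.

Lemma zsum_EFin alpha T g (b : R) : zero_seq alpha T -> (forall w, modc w <= 1 -> 0 <= g w <= b) ->
  (\sum_(0 <= n <oo) ((1 - modc (alpha n) ^+ 2) * g (alpha n))%:E)%E = (zsum alpha g)%:E.
Proof.
move=> zs gb; have cv := zsum_cvg zs gb.
rewrite -EFin_lim; last by apply/cvg_ex; exists (zsum alpha g).
by congr (limn _); apply/funext => n; rewrite /= /series /= sumEFin.
Qed.

Lemma pkernel_bound z w : modc z < 1 -> modc w <= 1 -> 0 <= pkernel z w <= (1 - modc z) ^- 2.
Proof.
move=> z1 w1; rewrite ltW ?pkernel_gt0 //= /pkernel.
have h0 := modc_ge0 z; have d0 : 0 < 1 - modc z by rewrite subr_gt0.
have h : 1 - modc z <= modc (1 - w^*%C * z).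
  by apply: modc_sub_ge; rewrite modcM modc_conj ler_piMl.
rewrite -[leRHS]mul1r ler_pM ?invr_ge0 ?exprn_ge0 ?modc_ge0 ?sqr_modc_le1 ?(ltW z1) //.
  by rewrite gerBl exprn_ge0.
have hp := lt_le_trans d0 h.
by rewrite lef_pV2 ?posrE ?exprn_gt0 // lerXn2r ?nnegrE ?(ltW d0) ?(ltW hp).
Qed.

Section canonical.
Variables (f : C -> C) (nu : {measure set (measurableTypeR R) -> \bar R}).
Variables (alpha : nat -> C) (T : nat -> R) (k : R -> R) (c : C).
Hypotheses (nufin : (nu setT < +oo)%E) (zs : zero_seq alpha T).
Hypotheses (ik : leb.-integrable I01 (EFin \o k)) (k0 : forall t, 0 <= k t).

Lemma bounded_mass : bounded_functional (mass nu k)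
  (\int[nu]_(t in I01 `&` setT) `|1| + \int[leb]_(t in I01) `|k t|).
Proof.
apply: bounded_functionalD; first exact: bounded_sing.
by apply: bounded_weighted_int => //; exact: measurable_I01.
Qed.

Lemma positive_mass : positive_functional (mass nu k).
Proof.
move=> g ag g0; apply: addr_ge0; first exact: positive_sing.
have pJ : positive_functional (weighted_int leb I01 k) by apply: positive_weighted_int.
exact: pJ.
Qed.

Hypothesis c1 : modc c = 1.
Hypothesis fE : forall z, modc z < 1 -> f z = c * blaschke alpha z * cexp (- hgl (mass nu k) z).
Hypothesis fk : {ae leb, forall t, I01 t -> - ln (modc (fstar f t)) = k t}.

Lemma integral_mass g : adm (g \o expi) ->
  (\int[nu]_(t in I01) (g (expi t))%:E + \int[leb]_(t in I01) (g (expi t) * - ln (modc (fstar f t)))%:E =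
   (mass nu k (g \o expi))%:E)%E.
Proof.
move=> ag; have mI := @measurable_I01 R.
rewrite EFinD /sing_functional /weighted_int /Rintegral setIT !fineK; last 2 first.
- by apply: (integrable_fin_num mI); exact: (integrable_weighted mI).
- apply: (integrable_fin_num mI); apply: (integrable_weighted mI) => //.
  exact: integrable_nu1.
congr (_ + _)%E; first by apply: eq_integral => t _; rewrite mulr1.
by apply: (@integral_eq_ae _ _ _ leb); apply: (ae_imp fk) => t h It; rewrite h.
Qed.

Lemma PmuE z : modc z < 1 -> Pmu f nu z = (Lam alpha (mass nu k) (pkernel z))%:E.
Proof.
move=> z1; have pb w (w1 : modc w <= 1) := pkernel_bound z1 w1.
rewrite /Pmu (zero_partE zs bounded_mass c1 fE); last by move=> w /pb /andP[].
rewrite (zsum_EFin zs pb) LamE -addeA -ge0_muleDr; first last.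
- rewrite (@integral_eq_ae _ _ _ leb _ _ (fun t => (pkernel z (expi t) * k t)%:E)).
    by apply: integral_ge0 => t _; rewrite lee_fin mulr_ge0 // ltW // pkernel_gt0 // modc_expi.
  by apply: (ae_imp fk) => t h It; rewrite h.
- by apply: integral_ge0 => t _; rewrite lee_fin ltW // pkernel_gt0 // modc_expi.
by rewrite -integral_mass //; exact: adm_pkernel.
Qed.

Lemma muE (A : set C) : measurable (I01 `&` (expi @^-1` A) : set (measurableTypeR R)) ->
  mu f nu A = (Lam alpha (mass nu k) (\1_A))%:E.
Proof.
move=> mA; have mI := @measurable_I01 R.
have gb w : modc w <= 1 -> 0 <= (\1_A w : R) <= 1.
  by move=> _; rewrite indicE; case: (_ \in _); rewrite /= ?lexx ?ler01.
rewrite /mu (zero_partE zs bounded_mass c1 fE); last by move=> w /gb /andP[].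
have E : (\1_A \o expi : R -> R) = \1_(expi @^-1` A).
  by apply/funext => t; rewrite /= !indicE /in_mem /= /mem_set; congr (_%:R).
have aA : adm (\1_A \o expi : R -> R) by rewrite E; exact: adm_indic.
have Ek : (\int[leb]_(t in I01 `&` expi @^-1` A) (- ln (modc (fstar f t)))%:E =
    \int[leb]_(t in I01) ((\1_A \o expi) t * - ln (modc (fstar f t)))%:E)%E.
  rewrite integral_mkcondr; apply: eq_integral => t _; rewrite patchE E indicE.
  by case: ifP => _ /=; rewrite ?mul1r ?mul0r.
rewrite (zsum_EFin zs gb) LamE -addeA -ge0_muleDr //; last first.
  rewrite Ek (@integral_eq_ae _ _ _ leb _ _ (fun t => ((\1_A \o expi) t * k t)%:E)).
    by apply: integral_ge0 => t _; rewrite lee_fin mulr_ge0.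
  by apply: (ae_imp fk) => t h It; rewrite h.
rewrite -integral_mass // Ek; congr (_ + _ * (_ + _))%E.
have -> : (\int[nu]_(t in I01) (\1_A (expi t))%:E = \int[nu]_(t in I01) (\1_(I01 `&` expi @^-1` A) t)%:E)%E.
  apply: eq_integral => t It; congr EFin; have := congr1 (fun q => q t) E; rewrite /= => ->.
  by rewrite !indicE in_setI It.
rewrite integral_indic //; congr (nu _).
by rewrite [RHS]setIC setIA setIid.
Qed.

End canonical.

(** From here on [f] is known only through these data: outer and singular factors merge into a
    single exponential of a Herglotz transform of a positive functional, and the radial limits enter
    only through [k]. *)
Lemma canonical_form f E B nu : analytic_self_map f ->
  is_outer E -> is_blaschke B -> singular_circle_measure nu ->
  (forall z, `|z| < 1 -> f z = E z * B z * sing_inner nu z) ->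
  exists (c : C) (alpha : nat -> C) (T : nat -> R) (k : R -> R),
  [/\ modc c = 1, zero_seq alpha T, leb.-integrable I01 (EFin \o k) /\ (forall t, 0 <= k t),
    (forall z, modc z < 1 -> f z = c * blaschke alpha z * cexp (- hgl (mass nu k) z)) &
    {ae leb, forall t, I01 t -> - ln (modc (fstar f t)) = k t}].
Proof.
move=> af oE bB snu fE; have mI := @measurable_I01 R.
have [c [h [alpha [T [c1 ih zs HE]]]]] := factorization oE bB snu fE.
have [nufin _] := snu.
have bJh := bounded_weighted_int mI (@subset_refl _ _) ih.
have bJn := bounded_sing nufin measurableT.
have hf : hol f.
  apply: (hol_ext (g1 := fun z => c * cexp (hgl (weighted_int leb I01 h) z) *
     (blaschke alpha z * cexp (- hgl (sing_functional nu setT) z)))).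
    by move=> z z1; rewrite HE.
  apply: holM; last by apply: holM; [exact: hol_blaschke zs | exact: hol_singular bJn].
  by apply: holZ; apply: hol_cexp; exact: hol_hgl bJh.
have f1 z : modc z < 1 -> modc (f z) <= 1.
  by move=> z1; have [_] := af z (etrans (norm_lt1 z) z1); rewrite norm_lt1 => /ltW.
have bm := boundary_modulus hf f1 c1 ih zs snu HE.
(* [boundary_modulus] gives h <= 0 only almost everywhere; positivity of the functional is easier to
   use when the density is nonnegative everywhere. *)
pose k t := Num.max 0 (- h t).
have k0 t : 0 <= k t by rewrite /k le_max lexx.
have hk : {ae leb, forall t, I01 t -> h t = - k t}.
  apply: (ae_imp bm) => t H It; have [_ h0] := H It.
  by rewrite /k max_r ?opprK // oppr_ge0.
have ik : leb.-integrable I01 (EFin \o k).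
  apply: (le_integrable mI _ _ ih).
    apply/measurable_EFinP; apply: measurable_maxr => //; apply: measurable_funN.
    by apply/measurable_EFinP; exact: measurable_int ih.
  move=> t It /=; rewrite lee_fin ger0_norm // /k ge_max normr_ge0 /=.
  by rewrite -normrN ler_norm.
have bJk := bounded_weighted_int mI (@subset_refl _ _) ik.
exists c, alpha, T, k; split=> //.
  move=> z z1; rewrite HE //.
  have Jhk (g : R -> R) : adm g -> weighted_int leb I01 h g = - weighted_int leb I01 k g.
    move=> ag; have [_ JZ _] := bJk.
    rewrite -[RHS]mulN1r -JZ // /weighted_int /Rintegral; congr fine.
    by apply: (@integral_eq_ae _ _ _ leb); apply: (ae_imp hk) => t H It; rewrite H // mulN1r mulrN mulNr.
  have [cR cI] := cadm_herglotz z1.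
  have -> : hgl (weighted_int leb I01 h) z = - hgl (weighted_int leb I01 k) z.
    by rewrite /hgl /cfun !Jhk //; simpc.
  have -> : - hgl (mass nu k) z = - hgl (weighted_int leb I01 k) z + - hgl (sing_functional nu setT) z.
    by rewrite /hgl /cfun /mass; simpc; congr (_ +i* _); ring.
  by rewrite cexpD; ring.
apply: (ae_imp (ae_and bm hk)) => t [H1 H2] It; have [-> _] := H1 It.
by rewrite expRK H2 // opprK.
Qed.

End riesz_measure.

(** * Linearity, monotonicity and truncation of [Lam] *)

Section functional.
Context {R : realType}.
Local Notation C := (Cx R).
Variables (alpha : nat -> C) (T : nat -> R) (J : (R -> R) -> R) (M : R).
Hypotheses (zs : zero_seq alpha T) (bJ : bounded_functional J M) (pJ : positive_functional J).
Implicit Types (z w : C) (g : C -> R).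

(** Inside the disc a function enters [Lam] only through its values along [alpha], so measurability
    is asked of its trace on the circle alone. *)
Definition adC g := adm (g \o expi) /\ exists b, forall w, modc w <= 1 -> `|g w| <= b.

Lemma adC_cst (a : R) : adC (fun=> a).
Proof. by split; [exact: adm_cst | exists `|a|]. Qed.

Lemma adCD g1 g2 : adC g1 -> adC g2 -> adC (fun w => g1 w + g2 w).
Proof.
move=> [a1 [b1 h1]] [a2 [b2 h2]]; split; first exact: (admD a1 a2).
exists (b1 + b2) => w w1; apply: le_trans (ler_normD _ _) _.
by rewrite lerD ?h1 ?h2.
Qed.

Lemma adCM g1 g2 : adC g1 -> adC g2 -> adC (fun w => g1 w * g2 w).
Proof.
move=> [a1 [b1 h1]] [a2 [b2 h2]]; split; first exact: (admM a1 a2).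
by exists (b1 * b2) => w w1; rewrite normrM ler_pM ?h1 ?h2.
Qed.

Lemma adCZ (a : R) g : adC g -> adC (fun w => a * g w).
Proof. exact: adCM (adC_cst a). Qed.

Lemma adC_pkernel z : modc z < 1 -> adC (pkernel z).
Proof.
move=> z1; split; first exact: adm_pkernel.
exists ((1 - modc z) ^- 2) => w w1; have /andP[h1 h2] := pkernel_bound z1 w1.
by rewrite ger0_norm.
Qed.

Definition LamN N g : R := \sum_(i < N) (1 - modc (alpha i) ^+ 2) * g (alpha i) + 2 * J (g \o expi).

Lemma zsum_cvg_bounded g b : (forall w, modc w <= 1 -> `|g w| <= b) ->
  series (fun n => (1 - modc (alpha n) ^+ 2) * g (alpha n)) @ \oo --> zsum alpha g.
Proof.
move=> gb; have b0 : 0 <= b by apply: le_trans (gb 0 _); rewrite ?modc0.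
(* Adding the constant b reduces convergence to two series of nonnegative terms. *)
have g1 w : modc w <= 1 -> 0 <= g w + b <= 2 * b.
  by move=> /gb; rewrite ler_norml => /andP[h1 h2]; lra.
have g2 w : modc w <= 1 -> 0 <= b <= b by rewrite b0 lexx.
have h1 := zsum_cvg zs g1; have h2 := zsum_cvg zs g2.
have E : series (fun n => (1 - modc (alpha n) ^+ 2) * g (alpha n)) =
    fun N => series (fun n => (1 - modc (alpha n) ^+ 2) * (g (alpha n) + b)) N -
             series (fun n => (1 - modc (alpha n) ^+ 2) * b) N.
  by apply/funext => N; rewrite /series /= -sumrB; apply: eq_bigr => i _; ring.
apply: (cvgP (zsum alpha (fun w => g w + b) - zsum alpha (fun=> b))).
by rewrite E; exact: cvgB h1 h2.
Qed.

Lemma LamN_cvg g : adC g -> LamN ^~ g @ \oo --> Lam alpha J g.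
Proof.
move=> [_ [b gb]]; apply: cvgD; last exact: cvg_cst.
rewrite (_ : (fun N => _) = series (fun n => (1 - modc (alpha n) ^+ 2) * g (alpha n))).
  exact: zsum_cvg_bounded gb.
by apply/funext => N; rewrite /series /= big_mkord.
Qed.

Lemma LamN_le N g1 g2 : adm (g1 \o expi) -> adm (g2 \o expi) ->
  (forall i, (i < N)%N -> g1 (alpha i) <= g2 (alpha i)) ->
  (forall t, g1 (expi t) <= g2 (expi t)) -> LamN N g1 <= LamN N g2.
Proof.
move=> a1 a2 h1 h2; apply: lerD; last first.
  by rewrite ler_pM2l //; apply: (positive_functional_le bJ pJ) => // t _; exact: h2.
apply: ler_sum => i _; rewrite ler_wpM2l ?h1 //.
by apply: sqr_modc_le1; case: zs.
Qed.

Lemma LamND N g1 g2 : adm (g1 \o expi) -> adm (g2 \o expi) ->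
  LamN N (fun w => g1 w + g2 w) = LamN N g1 + LamN N g2.
Proof.
move=> a1 a2; have [JD _ _] := bJ.
rewrite /LamN (_ : (fun w => g1 w + g2 w) \o expi = fun t => (g1 \o expi) t + (g2 \o expi) t) // JD //.
rewrite (eq_bigr (fun i : 'I_N => (1 - modc (alpha i) ^+ 2) * g1 (alpha i) + (1 - modc (alpha i) ^+ 2) * g2 (alpha i))).
  by rewrite big_split /=; ring.
by move=> i _; ring.
Qed.

Lemma LamNZ N (a : R) g : adm (g \o expi) -> LamN N (fun w => a * g w) = a * LamN N g.
Proof.
move=> ag; have [_ JZ _] := bJ.
rewrite /LamN (_ : (fun w => a * g w) \o expi = fun t => a * (g \o expi) t) // JZ //.
rewrite (eq_bigr (fun i : 'I_N => a * ((1 - modc (alpha i) ^+ 2) * g (alpha i)))).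
  by rewrite -mulr_sumr; ring.
by move=> i _; ring.
Qed.

Lemma Lam_le g1 g2 : adC g1 -> adC g2 -> (forall w, modc w <= 1 -> g1 w <= g2 w) ->
  Lam alpha J g1 <= Lam alpha J g2.
Proof.
move=> a1 a2 h; have [al1 _ _] := zs.
apply: (ler_cvg_to (LamN_cvg a1) (LamN_cvg a2)); apply: nearW => N.
apply: LamN_le; [by case: a1 | by case: a2 | by move=> i _; exact: h |].
by move=> t; apply: h; rewrite modc_expi.
Qed.

Lemma LamD g1 g2 : adC g1 -> adC g2 ->
  Lam alpha J (fun w => g1 w + g2 w) = Lam alpha J g1 + Lam alpha J g2.
Proof.
move=> a1 a2; apply: (cvg_unique (@norm_hausdorff _ _) (LamN_cvg (adCD a1 a2))).
rewrite (_ : LamN ^~ _ = fun N => LamN N g1 + LamN N g2).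
  by apply: cvgD; exact: LamN_cvg.
by apply/funext => N; rewrite LamND //; [case: a1 | case: a2].
Qed.

Lemma LamZ (a : R) g : adC g -> Lam alpha J (fun w => a * g w) = a * Lam alpha J g.
Proof.
move=> ag; apply: (cvg_unique (@norm_hausdorff _ _) (LamN_cvg (adCZ a ag))).
rewrite (_ : LamN ^~ _ = fun N => a * LamN N g).
  by apply: cvgM; [exact: cvg_cst | exact: LamN_cvg].
by apply/funext => N; rewrite LamNZ //; case: ag.
Qed.

Lemma LamN_le_Lam N g : adC g -> (forall w, modc w <= 1 -> 0 <= g w) -> LamN N g <= Lam alpha J g.
Proof.
move=> ag g0; have [al1 _ _] := zs.
have nd : nondecreasing_seq (LamN ^~ g).
  apply/nondecreasing_seqP => n; rewrite /LamN big_ord_recr /= lerD2r lerDl.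
  by rewrite mulr_ge0 ?g0 ?sqr_modc_le1.
have cv := LamN_cvg ag; rewrite -(cvg_lim (@norm_hausdorff _ _) cv).
by apply: nondecreasing_cvgn_le => //; apply/cvg_ex; exists (Lam alpha J g).
Qed.

Lemma LamN_ge0 N g : adm (g \o expi) -> (forall w, modc w <= 1 -> 0 <= g w) -> 0 <= LamN N g.
Proof.
move=> ag g0; have [al1 _ _] := zs; apply: addr_ge0.
  by apply: sumr_ge0 => i _; rewrite mulr_ge0 ?g0 ?sqr_modc_le1.
by rewrite mulr_ge0 //; apply: pJ => // t _; apply: g0; rewrite modc_expi.
Qed.

Lemma term_le_Lam n g : adC g -> (forall w, modc w <= 1 -> 0 <= g w) ->
  (1 - modc (alpha n) ^+ 2) * g (alpha n) <= Lam alpha J g.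
Proof.
move=> ag g0; have [al1 _ _] := zs; have [adg _] := ag.
apply: le_trans (LamN_le_Lam n.+1 ag g0).
have := LamN_ge0 n adg g0.
by rewrite /LamN big_ord_recr /=; lra.
Qed.

Lemma Lam_ge0 g : adC g -> (forall w, modc w <= 1 -> 0 <= g w) -> 0 <= Lam alpha J g.
Proof. by move=> ag g0; apply: le_trans (LamN_le_Lam 0 ag g0); apply: LamN_ge0 => //; case: ag. Qed.

End functional.

(** * Size of [f] and of its logarithmic derivative *)

Section log_derivative.
Context {R : realType}.
Local Notation C := (Cx R).
Variables (alpha : nat -> C) (T : nat -> R) (J : (R -> R) -> R) (M : R) (c : C).
Hypotheses (zs : zero_seq alpha T) (bJ : bounded_functional J M) (pJ : positive_functional J).
Hypothesis c1 : modc c = 1.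
Implicit Types (z w u : C) (g : C -> R).

Definition inner_form z : C := c * blaschke alpha z * cexp (- hgl J z).
Definition inner_part N z : C := c * bprod alpha N z * cexp (- hgl J z).
Local Notation F := inner_form.
Local Notation FN := inner_part.
Local Notation P z := (Lam alpha J (pkernel z)).

Let al1 n : modc (alpha n) <= 1. Proof. by case: zs. Qed.

Lemma modc_singular_le1 z : modc z < 1 -> modc (cexp (- hgl J z)) <= 1.
Proof.
move=> z1; rewrite (modc_cexp_hgl bJ) // -expR0 ler_expR oppr_le0.
by apply: pJ => [|t _]; [exact: adm_pkernel | rewrite ltW // pkernel_gt0 // modc_expi].
Qed.

Lemma hol_inner_part N : hol (FN N).
Proof.
apply: holM; last exact: hol_singular bJ.
by apply: holZ; apply: hol_bprod.
Qed.

Lemma hol_inner_form : hol F.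
Proof.
apply: holM; last exact: hol_singular bJ.
by apply: holZ; apply: hol_blaschke zs.
Qed.

Lemma inner_part_cvg z : modc z < 1 -> FN ^~ z @ \oo --> F z.
Proof.
move=> z1; have [/cvgCP h _] := cvg_blaschke zs z1.
apply/cvgCP => e e0; apply: filterS (h e e0) => N; apply: le_lt_trans.
have -> : F z - FN N z = c * (blaschke alpha z - bprod alpha N z) * cexp (- hgl J z).
  by rewrite /inner_part /inner_form; ring.
by rewrite !modcM c1 mul1r ler_piMr ?modc_ge0 ?modc_singular_le1.
Qed.

Lemma cvg_modc (u_ : nat -> C) (l : C) : u_ @ \oo --> l -> (fun n => modc (u_ n)) @ \oo --> modc l.
Proof.
move=> /cvgCP h; apply/cvgrPdist_lt => e e0; apply: filterS (h e e0) => n; apply: le_lt_trans.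
rewrite ler_norml; apply/andP; split; last exact: ler_modc_sub.
by have := ler_modc_sub (u_ n) l; rewrite modc_distC; lra.
Qed.

Lemma derive1_inner_part_cvg z : modc z < 1 -> (fun N => derive1 (FN N) z) @ \oo --> derive1 F z.
Proof.
move=> z1; apply: (derive1_cvg hol_inner_part hol_inner_form) => // r e r01 e0.
have [N HN] := blaschke_uniform zs r01 e0; exists N => n Nn w wr.
have w1 : modc w < 1 by apply: le_lt_trans wr _; case/andP: r01.
have -> : FN n w - F w = c * (bprod alpha n w - blaschke alpha w) * cexp (- hgl J w).
  by rewrite /inner_part /inner_form; ring.
rewrite !modcM c1 mul1r; apply: le_trans (HN n Nn w wr).
by rewrite ler_piMr ?modc_ge0 ?modc_singular_le1.
Qed.

Lemma prod_one_sub (s : nat -> R) N : (forall i, 0 <= s i <= 1) ->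
  1 - \sum_(i < N) s i <= \prod_(i < N) (1 - s i) <= expR (- \sum_(i < N) s i).
Proof.
move=> s01; elim: N => [|N /andP[IH1 IH2]]; first by rewrite !big_ord0 subr0 oppr0 expR0 !lexx.
rewrite !big_ord_recr /=; have /andP[h1 h2] := s01 N.
have p0 : 0 <= \prod_(i < N) (1 - s i) by rewrite prodr_ge0 // => i _; case/andP: (s01 i) => _; lra.
have p1 : \prod_(i < N) (1 - s i) <= 1.
  by rewrite prodr_ile1 // => i _; case/andP: (s01 i) => *; apply/andP; split; lra.
apply/andP; split; first by nra.
rewrite opprD expRD ler_pM //; first by lra.
by apply: le_trans (expR_ge1Dx _); lra.
Qed.

Lemma weight01 z n : modc z < 1 -> 0 <= (1 - modc (alpha n) ^+ 2) * pkernel z (alpha n) <= 1.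
Proof.
move=> z1; apply/andP; split; first by rewrite mulr_ge0 ?sqr_modc_le1 // ltW // pkernel_gt0.
by rewrite -subr_ge0 -sqr_modc_bfac // exprn_ge0 ?modc_ge0.
Qed.

(** Writing s_i for the share of the i-th zero in P(z) and j for the functional applied to the
    kernel, the squared modulus is the product of the 1 - s_i times exp(-2j). Each factor 1 - s lies
    below exp(-s), and a product of numbers 1 - s in [0,1] is at least one minus the sum of the
    s. *)
Lemma sqr_modc_inner_part N z : modc z < 1 ->
  1 - LamN alpha J N (pkernel z) <= modc (FN N z) ^+ 2 <= expR (- LamN alpha J N (pkernel z)).
Proof.
move=> z1; rewrite !modcM c1 mul1r exprMn (modc_cexp_hgl bJ) //.
set j := J _; have j0 : 0 <= j.
  by apply: pJ => [|t _]; [exact: adm_pkernel | rewrite ltW // pkernel_gt0 // modc_expi].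
have -> : expR (- j) ^+ 2 = expR (- (2 * j)) by rewrite expr2 -expRD; congr expR; ring.
have -> : modc (bprod alpha N z) ^+ 2 = \prod_(i < N) (1 - (1 - modc (alpha i) ^+ 2) * pkernel z (alpha i)).
  rewrite /bprod; elim: N => [|N IH]; first by rewrite !big_ord0 modc1 expr1n.
  by rewrite !big_ord_recr /= modcM exprMn IH sqr_modc_bfac.
have /andP[h1 h2] := prod_one_sub N (fun i => weight01 i z1).
rewrite /LamN -/j; set S := \sum_(i < N) _ in h1 h2 *; set p := \prod_(i < N) _ in h1 h2 *.
have p0 : 0 <= p by rewrite prodr_ge0 // => i _; case/andP: (weight01 i z1) => _; lra.
have p1 : p <= 1.
  by rewrite prodr_ile1 // => i _; case/andP: (weight01 i z1) => *; apply/andP; split; lra.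
apply/andP; split; last by rewrite opprD expRD ler_wpM2r ?expR_ge0.
have e1 : 1 - 2 * j <= expR (- (2 * j)) by apply: le_trans (expR_ge1Dx _).
have e2 : expR (- (2 * j)) <= 1 by rewrite -expR0 ler_expR oppr_le0 mulr_ge0.
by nra.
Qed.

Lemma sqr_modc_inner_form z : modc z < 1 -> 1 - P z <= modc (F z) ^+ 2 <= expR (- P z).
Proof.
move=> z1; have cvL := LamN_cvg (J := J) zs (adC_pkernel z1).
have cvF : (fun N => modc (FN N z) ^+ 2) @ \oo --> modc (F z) ^+ 2.
  by have h := cvg_modc (inner_part_cvg z1); apply: cvgM.
apply/andP; split.
  have cvB : (fun N => 1 - LamN alpha J N (pkernel z)) @ \oo --> 1 - P z.
    by apply: cvgB => //; exact: cvg_cst.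
  apply: (ler_cvg_to cvB cvF); apply: nearW => N.
  by case/andP: (sqr_modc_inner_part N z1).
have cvE : (fun N => expR (- LamN alpha J N (pkernel z))) @ \oo --> expR (- P z).
  apply: (@cvg_comp _ _ _ (fun N => - LamN alpha J N (pkernel z)) expR _ (nbhs (- P z))); last exact: continuous_expR.
  exact: cvgN.
apply: (ler_cvg_to cvF cvE); apply: nearW => N.
by case/andP: (sqr_modc_inner_part N z1).
Qed.

Definition kapN N z : C := \sum_(i < N) (1 - modc (alpha i) ^+ 2)%:C * kap z (alpha i) +
  2 * cfun J (fun t => kap z (expi t)).

Lemma derive1_inner_part N z : modc z < 1 -> (forall i, alpha i != z) ->
  (1 - modc z ^+ 2)%:C * derive1 (FN N) z = - FN N z * kapN N z.
Proof.
move=> z1 az.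
have qb n : qd (bprod alpha n) z (derive1 (bprod alpha n) z) by apply: hol_qd => //; exact: hol_bprod.
have hb n : (1 - modc z ^+ 2)%:C * derive1 (bprod alpha n) z =
    - bprod alpha n z * \sum_(i < n) (1 - modc (alpha i) ^+ 2)%:C * kap z (alpha i).
  elim: n => [|n IH].
    have -> : derive1 (bprod alpha 0) z = 0.
      apply: qd_derive1; rewrite (_ : bprod alpha 0 = fun=> 1); first exact: qd_cst.
      by apply/funext => w; rewrite /bprod big_ord0.
    by rewrite big_ord0 !mulr0.
  have -> : derive1 (bprod alpha n.+1) z = derive1 (bprod alpha n) z * bfac (alpha n) z +
      bprod alpha n z * derive1 (bfac (alpha n)) z.
    apply: qd_derive1; rewrite (_ : bprod alpha n.+1 = fun w => bprod alpha n w * bfac (alpha n) w).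
      by apply: qdM => //; apply: hol_qd => //; exact: hol_bfac.
    by apply/funext => w; rewrite /bprod big_ord_recr.
  have -> : bprod alpha n.+1 z = bprod alpha n z * bfac (alpha n) z by rewrite /bprod big_ord_recr.
  have hn := derive1_bfac_kap (al1 n) z1 (az n).
  rewrite big_ord_recr /=; move: IH hn.
  move: (derive1 (bprod alpha n) z) (derive1 (bfac (alpha n)) z) (\sum_(i < n) _) (kap _ _) => x1 x2 x3 x4.
  move: (bprod alpha n z) (bfac (alpha n) z) ((1 - modc z ^+ 2)%:C) ((1 - modc (alpha n) ^+ 2)%:C) => x5 x6 x7 x8 h1 h2.
  transitivity ((x7 * x1) * x6 + x5 * (x7 * x2)); first by ring.
  by rewrite h1 h2; ring.
have qh := hol_qd (hol_hgl bJ) z1.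
have qN : qd (fun w => - hgl J w) z (- derive1 (hgl J) z).
  rewrite (_ : (fun w => _) = fun w => -1 * hgl J w); last by apply/funext => w; rewrite mulN1r.
  by have := qdZ (-1) qh; rewrite mulN1r.
have -> : derive1 (FN N) z = c * derive1 (bprod alpha N) z * cexp (- hgl J z) +
    c * bprod alpha N z * (cexp (- hgl J z) * - derive1 (hgl J) z).
  by have q1 := qdM (qdZ c (qb N)) (qd_cexp qN); apply: qd_derive1; exact: q1.
have hh := derive1_hgl bJ z1; have hN := hb N.
rewrite /kapN /inner_part; move: hh hN.
move: (derive1 (bprod alpha N) z) (derive1 (hgl J) z) (\sum_(i < N) _) (cfun J _) => x1 x2 x3 x4.
move: (bprod alpha N z) (cexp _) ((1 - modc z ^+ 2)%:C) => x5 x6 x7 h1 h2.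
transitivity (c * (x7 * x1) * x6 - c * x5 * x6 * (x7 * x2)); first by ring.
by rewrite h1 h2; ring.
Qed.

Lemma Re_kapN N z u : modc z < 1 ->
  complex.Re (u * kapN N z) = LamN alpha J N (fun w => complex.Re (u * kap z w)).
Proof.
move=> z1; have ck := cadm_kap z1.
have -> : u * kapN N z = \sum_(i < N) (1 - modc (alpha i) ^+ 2)%:C * (u * kap z (alpha i)) +
    2%:R%:C * cfun J (fun t => u * kap z (expi t)).
  rewrite (cfunZ bJ) // /kapN mulrDr mulr_sumr; congr (_ + _).
    by apply: eq_bigr => i _; ring.
  have -> : (2%:R%:C : C) = 2 by rewrite (_ : 2%:R = 1 + 1) // realcD.
  by ring.
rewrite cReD /LamN; congr (_ + _); last by rewrite cReM /= mul0r subr0.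
elim: N => [|N IH]; first by rewrite !big_ord0.
rewrite !big_ord_recr /= cReD IH; congr (_ + _).
by rewrite cReM /= mul0r subr0.
Qed.

Lemma adm_Re_kap z u : modc z < 1 -> adm (fun t => complex.Re (u * kap z (expi t))).
Proof. by move=> z1; have [] := cadmZ u (cadm_kap z1). Qed.

Lemma modc_derive1_inner_part N z : modc z < 1 -> (forall i, alpha i != z) ->
  (1 - modc z ^+ 2) * modc (derive1 (FN N) z) = modc (FN N z) * modc (kapN N z).
Proof.
move=> z1 az; have := congr1 (@modc R) (derive1_inner_part N z1 az).
by rewrite modcM [modc (- _ * _)]modcM modcN modc_real ger0_norm // sqr_modc_le1 // ltW.
Qed.

Lemma derive1_inner_form_cvg z : modc z < 1 ->
  (fun N => (1 - modc z ^+ 2) * modc (derive1 (FN N) z)) @ \oo --> (1 - modc z ^+ 2) * modc (derive1 F z).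
Proof.
move=> z1; apply: cvgM; first exact: cvg_cst.
exact: cvg_modc (derive1_inner_part_cvg z1).
Qed.

(** In a fixed direction u the real part of the logarithmic derivative is an integral against the
    measure. The bound is proved for finite products and passes to the limit with [LamN], so no
    infinite version of [kapN] is needed. *)
Lemma derive1_inner_form_ge g u z : modc z < 1 -> modc u = 1 -> adC g -> (forall i, alpha i != z) ->
  (forall i, g (alpha i) <= complex.Re (u * kap z (alpha i))) ->
  (forall t, g (expi t) <= complex.Re (u * kap z (expi t))) ->
  modc (F z) * Lam alpha J g <= (1 - modc z ^+ 2) * modc (derive1 F z).
Proof.
move=> z1 u1 ag az h1 h2.
have cvF : (fun N => modc (FN N z) * LamN alpha J N g) @ \oo --> modc (F z) * Lam alpha J g.
  by apply: cvgM; [exact: cvg_modc (inner_part_cvg z1) | exact: (LamN_cvg (J := J) zs ag)].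
apply: (ler_cvg_to cvF (derive1_inner_form_cvg z1)); apply: nearW => N.
rewrite modc_derive1_inner_part // ler_wpM2l ?modc_ge0 //.
apply: (@le_trans _ _ (complex.Re (u * kapN N z))).
  rewrite Re_kapN //; apply: (LamN_le zs bJ pJ); [by case: ag | exact: adm_Re_kap | by move=> i _ |].
  by move=> t; exact: h2.
by apply: le_trans (ler_Re_modc _) _; rewrite modcM u1 mul1r.
Qed.

(** The direction making [kapN] real and positive varies with N, hence a majorant is asked for every
    unimodular u, with a common bound b. Nonnegativity of the majorant lets its truncated integral
    be bounded by the full one. *)
Lemma derive1_inner_form_le b z : modc z < 1 -> (forall i, alpha i != z) ->
  (forall u, modc u = 1 -> exists g, [/\ adC g, forall w, modc w <= 1 -> 0 <= g w, Lam alpha J g <= b,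
    (forall i, complex.Re (u * kap z (alpha i)) <= g (alpha i)) &
    (forall t, complex.Re (u * kap z (expi t)) <= g (expi t))]) ->
  (1 - modc z ^+ 2) * modc (derive1 F z) <= modc (F z) * b.
Proof.
move=> z1 az H.
have cvF : (fun N => modc (FN N z) * b) @ \oo --> modc (F z) * b.
  by apply: cvgM; [exact: cvg_modc (inner_part_cvg z1) | exact: cvg_cst].
apply: (ler_cvg_to (derive1_inner_form_cvg z1) cvF); apply: nearW => N.
rewrite modc_derive1_inner_part // ler_wpM2l ?modc_ge0 //.
have [k0|kn0] := eqVneq (kapN N z) 0.
  have [g [ag g0 gb _ _]] := H 1 (@modc1 R).
  by rewrite k0 modc0; apply: le_trans gb; exact: (Lam_ge0 zs pJ).
set w := (kapN N z)^*%C / (modc (kapN N z))%:C.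
have w1 : modc w = 1.
  by rewrite modc_div modc_conj modc_real ger0_norm ?modc_ge0 // divff // modc_eq0.
have hw : modc (kapN N z) = complex.Re (w * kapN N z).
  have -> : w * kapN N z = (modc (kapN N z))%:C.
    rewrite /w mulrAC [_^*%C * _]mulrC mul_conjc expr2 realcM mulfK //.
    by rewrite realc_neq0 // modc_eq0.
  by [].
have [g [ag g0 gb h1 h2]] := H w w1.
rewrite hw Re_kapN //; apply: le_trans gb.
apply: (@le_trans _ _ (LamN alpha J N g)); last exact: (LamN_le_Lam J zs N ag g0).
by apply: (LamN_le zs bJ pJ); [exact: adm_Re_kap | by case: ag | by move=> i _; exact: h1 |].
Qed.

End log_derivative.

(** * The direction [rho], Harnack inequalities and Carleson boxes *)

Section geometry.
Context {R : realType}.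
Local Notation C := (Cx R).
Implicit Types (z w u : C) (e r s t l : R).

Definition rho z w : C := (1 - w * z^*%C) / (w - z).

Lemma kap_rho z w : modc z < 1 -> modc w <= 1 -> w != z -> kap z w = (pkernel z w)%:C * rho z w.
Proof. exact: kap_pkernel. Qed.

(** The modulus of [rho] is the reciprocal of that of the Blaschke factor of w at z, so it is close
    to 1 for zeros with a small share of P(z). *)
Lemma modc_rho z w : modc z < 1 -> modc w <= 1 -> w != z ->
  modc (rho z w) ^+ 2 * (1 - (1 - modc w ^+ 2) * pkernel z w) = 1.
Proof.
move=> z1 w1 wz; rewrite -sqr_modc_bfac // -exprMn.
have d0 := den_neq0 w1 z1.
suff -> : modc (rho z w) * modc (bfac w z) = 1 by rewrite expr1n.
have h1 : modc (1 - w * z^*%C) = modc (1 - w^*%C * z).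
  by rewrite -modc_conj conjcB conjcM conjcK conjc1.
rewrite /rho /bfac modc_div h1 modcM modc_div.
have -> : modc (if w == 0 then -1 else `|w| / w : C) = 1.
  have [_|w0] := eqVneq w 0; first by rewrite modcN modc1.
  by rewrite norm_modc modc_div modc_real ger0_norm ?modc_ge0 // divff // modc_eq0.
have e1 : modc (w - z) != 0 by rewrite modc_eq0 subr_eq0.
have e2 : modc (1 - w^*%C * z) != 0 by rewrite modc_eq0.
by rewrite mul1r; field; rewrite e1 e2.
Qed.

Lemma expi_neq z t : modc z < 1 -> expi t != z.
Proof. by move=> z1; apply/eqP => h; move: z1; rewrite -h modc_expi ltxx. Qed.

Lemma modc_rho_expi z t : modc z < 1 -> modc (rho z (expi t)) = 1.
Proof.
move=> z1; have := @modc_rho z (expi t) z1; rewrite modc_expi lexx expr1n subrr mul0r subr0 mulr1.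
move=> /(_ isT (expi_neq t z1)) h; apply/eqP.
by rewrite -(eqrXn2 (n := 2)) ?modc_ge0 // h expr1n.
Qed.

Lemma modc_kap_expi z t : modc z < 1 -> modc (kap z (expi t)) = pkernel z (expi t).
Proof.
move=> z1; rewrite kap_rho ?modc_expi ?expi_neq // modcM modc_rho_expi // mulr1 modc_real.
by rewrite ger0_norm // ltW // pkernel_gt0 // modc_expi.
Qed.

Lemma rho_sub z w1 w2 : w1 != z -> w2 != z ->
  rho z w1 - rho z w2 = (w2 - w1) * (1 - modc z ^+ 2)%:C / ((w1 - z) * (w2 - z)).
Proof.
move=> n1 n2; have h1 : w1 - z != 0 by rewrite subr_eq0.
have h2 : w2 - z != 0 by rewrite subr_eq0.
rewrite /rho realcB -mul_conjc; move: (z^*%C) => x.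
by field; rewrite h1 h2.
Qed.

(** The denominators satisfy |1 - w^* z| <= |1 - w^* z'| + |z - z'|, and |1 - w^* z'| >= 1 - |z'|
    makes the second term relative to the first. *)
Lemma harnack z z' w : modc z < 1 -> modc z' < 1 -> modc w <= 1 ->
  pkernel z' w <= (1 - modc z' ^+ 2) / (1 - modc z ^+ 2) * (1 + modc (z - z') / (1 - modc z')) ^+ 2 *
    pkernel z w.
Proof.
move=> z1 z1' w1; have s0 := sqr_modc_lt1 z1; have s0' := sqr_modc_lt1 z1'.
have d0 : 0 < modc (1 - w^*%C * z) by rewrite modc_gt0 den_neq0.
have d0' : 0 < modc (1 - w^*%C * z') by rewrite modc_gt0 den_neq0.
have q0 : 0 < 1 - modc z' by rewrite subr_gt0.
have q1 : 1 - modc z' <= modc (1 - w^*%C * z').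
  by apply: modc_sub_ge; rewrite modcM modc_conj ler_piMl ?modc_ge0.
have q2 : modc (1 - w^*%C * z) <= modc (1 - w^*%C * z') + modc (z - z').
  have -> : 1 - w^*%C * z = (1 - w^*%C * z') - w^*%C * (z - z') by ring.
  apply: le_trans (ler_modcB _ _) _; rewrite lerD2l modcM modc_conj ler_piMl ?modc_ge0 //.
have q3 : modc (1 - w^*%C * z) <= modc (1 - w^*%C * z') * (1 + modc (z - z') / (1 - modc z')).
  apply: le_trans q2 _; rewrite mulrDr mulr1 lerD2l mulrCA -[leLHS]mulr1 ler_wpM2l ?modc_ge0 //.
  by rewrite ler_pdivlMr // mul1r.
rewrite /pkernel; set K := 1 + modc (z - z') / (1 - modc z') in q3 *; set a := modc _ in d0 q3 *; set b := modc _ in d0' q3 *.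
have K0 : 0 <= K by rewrite addr_ge0 // divr_ge0 ?modc_ge0 // ltW.
have -> : (1 - modc z' ^+ 2) / (1 - modc z ^+ 2) * K ^+ 2 * ((1 - modc z ^+ 2) / a ^+ 2) =
   (1 - modc z' ^+ 2) * (K ^+ 2 / a ^+ 2).
  by field; rewrite !gt_eqF // exprn_gt0.
rewrite ler_pM2l // ler_pdivlMr ?exprn_gt0 // mulrC ler_pdivrMr ?exprn_gt0 //.
by rewrite -exprMn lerXn2r ?nnegrE ?(ltW d0) ?mulr_ge0 ?(ltW d0') // mulrC.
Qed.

Definition ray (a t : R) : C := (1 - a)%:C * expi t.

Lemma modc_ray a t : 0 < a <= 1 -> modc (ray a t) = 1 - a.
Proof. by move=> /andP[a0 a1]; rewrite modcM modc_real modc_expi mulr1 ger0_norm // subr_ge0. Qed.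

Lemma modc_ray_lt1 a t : 0 < a <= 1 -> modc (ray a t) < 1.
Proof. by move=> h; rewrite modc_ray //; case/andP: h => *; lra. Qed.

Lemma modc_ray_sub a b t : a <= b -> modc (ray a t - ray b t) = b - a.
Proof.
move=> ab; rewrite /ray -mulrBl -realcB modcM modc_real modc_expi mulr1.
by rewrite ger0_norm; lra.
Qed.

Lemma harnack_ray_up a b t w : 0 < a <= b -> b <= 1 -> modc w <= 1 ->
  pkernel (ray a t) w <= 2 * b / a * pkernel (ray b t) w.
Proof.
move=> /andP[a0 ab] b1 w1; have b0 := lt_le_trans a0 ab.
have ha : 0 < a <= 1 by rewrite a0 (le_trans ab).
have hb : 0 < b <= 1 by rewrite b0.
have pb : 0 < pkernel (ray b t) w by rewrite pkernel_gt0 // modc_ray_lt1.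
have := harnack (modc_ray_lt1 t hb) (modc_ray_lt1 t ha) w1; rewrite !modc_ray //.
rewrite modc_distC modc_ray_sub // => /le_trans; apply; rewrite ler_pM2r //.
have -> : 1 + (b - a) / (1 - (1 - a)) = b / a by field; rewrite gt_eqF // ; lra.
have -> : (1 - (1 - a) ^+ 2) / (1 - (1 - b) ^+ 2) * (b / a) ^+ 2 = (2 - a) / (2 - b) * (b / a).
  by field; apply/andP; split; [|apply/andP; split]; rewrite gt_eqF //; [lra|nra].
rewrite -[leRHS]mulrA ler_pM2r ?divr_gt0 // ler_pdivrMr; lra.
Qed.

Lemma harnack_ray_down a b t w : 0 < a <= b -> b <= 1 -> modc w <= 1 ->
  pkernel (ray b t) w <= 8 * b / a * pkernel (ray a t) w.
Proof.
move=> /andP[a0 ab] b1 w1; have b0 := lt_le_trans a0 ab.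
have ha : 0 < a <= 1 by rewrite a0 (le_trans ab).
have hb : 0 < b <= 1 by rewrite b0.
have pa : 0 < pkernel (ray a t) w by rewrite pkernel_gt0 // modc_ray_lt1.
have := harnack (modc_ray_lt1 t ha) (modc_ray_lt1 t hb) w1; rewrite !modc_ray //.
rewrite modc_ray_sub // => /le_trans; apply; rewrite ler_pM2r //.
have k1 : 1 + (b - a) / (1 - (1 - b)) <= 2.
  have -> : 1 - (1 - b) = b by ring.
  have : (b - a) / b <= 1 by rewrite ler_pdivrMr //; lra.
  lra.
have k0 : 0 <= 1 + (b - a) / (1 - (1 - b)).
  by rewrite addr_ge0 // divr_ge0 //; lra.
have k2 : (1 + (b - a) / (1 - (1 - b))) ^+ 2 <= 2 ^+ 2 by rewrite lerXn2r ?nnegrE.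
have k3 : (1 - (1 - b) ^+ 2) / (1 - (1 - a) ^+ 2) <= 2 * b / a.
  have e : 1 - (1 - a) ^+ 2 = a * (2 - a) by ring.
  rewrite e ler_pdivrMr; last by nra.
  rewrite mulrA divfK ?gt_eqF //.
  have -> : 1 - (1 - b) ^+ 2 = b * (2 - b) by ring.
  by nra.
have -> : 8 * b / a = 2 * b / a * 2 ^+ 2 by ring.
apply: ler_pM => //; last by rewrite exprn_ge0.
by rewrite divr_ge0 //; nra.
Qed.

(** Choosing the parameter within half a turn of t0 makes the chord bound [expi_sub_ge]
    applicable. *)
Lemma arc_param (t0 : R) (v : C) : modc v = 1 -> exists2 s, `|s - t0| <= 1 / 2 & v = expi s.
Proof.
move=> v1; have [|s sI h] := @expi_surj _ (v * (expi (t0 - 1 / 2))^*%C).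
  by rewrite modcM modc_conj v1 modc_expi mulr1.
move: sI; rewrite in_itv /= => /andP[s0 s1]; exists (s + (t0 - 1 / 2)).
  by rewrite ler_norml; lra.
by rewrite expiD -h -mulrA [_^*%C * _]expi_conjM mulr1.
Qed.

Lemma cbox_closure_near (t0 l : R) w : 0 < l <= 1 -> modc w <= 1 -> modc (w - expi t0) < l / 2 ->
  cbox_closure t0 l w.
Proof.
move=> /andP[l0 l1] w1 wl.
have wm : 1 - l / 2 < modc w.
  have := ler_modc_sub (expi t0) w; rewrite modc_expi modc_distC; lra.
have w0 : 0 < modc w by lra.
have wn0 : w != 0 by rewrite -modc_gt0.
(* A box lies in the open disc while w may be on the circle, so w is approached radially from
   inside. The factor is at least 1 - l/2 and |w| > 1 - l/2, which keeps the depth of these points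
   at most l. *)
pose u n : C := (1 - (n.+1%:R^-1 * (l / 2)))%:C * w.
have cu : u @ \oo --> w.
  apply/cvgCP => e e0; have h : (fun n => n.+1%:R^-1 : R) @ \oo --> (0 : R) by exact: cvg_harmonic.
  have /cvgrPdist_lt/(_ _ e0) := h; apply: filterS => n; rewrite sub0r normrN ger0_norm ?invr_ge0 // => hn.
  have -> : w - u n = (n.+1%:R^-1 * (l / 2))%:C * w by rewrite /u realcB; ring.
  have i0 : 0 <= n.+1%:R^-1 :> R by rewrite invr_ge0.
  rewrite modcM modc_real ger0_norm; last by rewrite mulr_ge0 // divr_ge0 // ltW.
  apply: le_lt_trans hn; rewrite -mulrA ler_piMr //.
  by nra.
move=> B /cu [n _ /(_ n (leqnn n)) Bn]; exists (u n); split=> //.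
have i01 : 0 < (n.+1%:R^-1 : R) <= 1 by rewrite invr_gt0 ltr0n /= invf_le1 ?ltr0n // ler1n.
have /andP[i0 i1] := i01.
set q := 1 - n.+1%:R^-1 * (l / 2) in Bn *.
have p0 : 0 < n.+1%:R^-1 * (l / 2) by rewrite mulr_gt0 // divr_gt0.
have p1 : n.+1%:R^-1 * (l / 2) <= l / 2 by rewrite ler_piMl // divr_ge0 // ltW.
have [q0 q1 q2] : [/\ 1 / 2 <= q, q < 1 & 1 - l / 2 <= q].
  by rewrite /q; move: (_ * (l / 2)) p0 p1 => p p0 p1; split; lra.
have q00 : 0 < q by apply: lt_le_trans q0; lra.
have mun : modc (u n) = q * modc w by rewrite (_ : u n = q%:C * w) // modcM modc_real gtr0_norm.
have un0 : u n != 0 by rewrite -modc_gt0 mun mulr_gt0.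
split; [|split; [|split]] => //.
- rewrite norm_lt1 mun; apply: le_lt_trans q1; rewrite ler_piMr //; lra.
- have : (1 - l / 2) * (1 - l / 2) <= q * modc w by apply: ler_pM; lra.
  by rewrite mun; have : 0 <= l ^+ 2 := sqr_ge0 l; rewrite expr2; lra.
have -> : u n / `|u n| = w / (modc w)%:C.
  rewrite norm_modc mun realcM /u -/q.
  have qn0 : q%:C != 0 :> C by rewrite realc_neq0 // gt_eqF.
  have mn0 : (modc w)%:C != 0 :> C by rewrite realc_neq0 // gt_eqF.
  by field; rewrite qn0 mn0.
have v1 : modc (w / (modc w)%:C) = 1.
  by rewrite modc_div modc_real ger0_norm ?modc_ge0 // divff // gt_eqF.
have [s hs vE] := arc_param t0 v1.
exists s; last by rewrite vE.
have d1 : modc (w / (modc w)%:C - w) = 1 - modc w.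
  have -> : w / (modc w)%:C - w = (w / (modc w)%:C) * (1 - modc w)%:C.
    have mn0 : (modc w)%:C != 0 :> C by rewrite realc_neq0 // gt_eqF.
    by rewrite realcB; field.
  by rewrite modcM v1 mul1r modc_real ger0_norm // subr_ge0.
have d2 : modc (expi s - expi t0) < l.
  rewrite -vE; have -> : w / (modc w)%:C - expi t0 = (w / (modc w)%:C - w) + (w - expi t0) by ring.
  apply: le_lt_trans (ler_modcD _ _) _; rewrite d1.
  have := ler_modc_sub (expi t0) w; rewrite modc_expi modc_distC; lra.
have := expi_sub_ge hs; rewrite /= in_itv /= => h3.
have : `|s - t0| < l / 2 by lra.
by rewrite ltr_norml => /andP[hs1 hs2]; apply/andP; split; lra.
Qed.

Lemma closure_le (A : set C) (v : C) (b : R) : (forall w, A w -> modc (w - v) <= b) ->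
  forall w, closure A w -> modc (w - v) <= b.
Proof.
move=> h w cw; rewrite leNgt; apply/negP => hb.
have e0 : 0 < modc (w - v) - b by rewrite subr_gt0.
have /cvgCP/(_ _ e0) hn : (fun x : C => x) @ (w : C) --> w by exact: cvg_id.
have [x [Ax hx]] := cw _ hn.
have := ler_modcD (w - x) (x - v); rewrite addrA subrK.
by have := h x Ax; move: hx => /=; lra.
Qed.

(** The constant 5 is 1 for the radial extent plus 4 for the half arc l/2 under the Lipschitz
    constant 8 of [expi]. *)
Lemma cbox_closure_bounds (t0 l : R) w : 0 < l <= 1 -> cbox_closure t0 l w ->
  [/\ modc w <= 1, 1 - l <= modc w & modc (w - expi t0) <= 5 * l].
Proof.
move=> /andP[l0 l1] cw.
have h1 : modc w <= 1.
  rewrite -[w]subr0; apply: (closure_le _ cw) => x [x1 _].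
  by rewrite subr0 ltW // -norm_lt1.
have h2 : 1 - l <= modc w.
  rewrite leNgt; apply/negP => hb; have e0 : 0 < 1 - l - modc w by rewrite subr_gt0.
  have /cvgCP/(_ _ e0) hn : (fun x : C => x) @ (w : C) --> w by exact: cvg_id.
  have [x [[_ [_ [xl _]]] hx]] := cw _ hn.
  have := ler_modc_sub x w; rewrite modc_distC; move: hx => /=; lra.
split=> //; apply: (closure_le _ cw) => x [x1 [x0 [xl [s /=]]]].
rewrite in_itv /= => /andP[s1 s2] hs.
have xm : 0 < modc x by rewrite modc_gt0.
have x1' : modc x < 1 by rewrite -norm_lt1.
have d1 : modc (x - x / `|x|) = 1 - modc x.
  have -> : x - x / `|x| = - ((x / `|x|) * (1 - modc x)%:C).
    have mn0 : (modc x)%:C != 0 :> C by rewrite realc_neq0 // gt_eqF.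
    by rewrite norm_modc realcB; field.
  by rewrite modcN modcM -hs modc_expi mul1r modc_real ger0_norm // subr_ge0 ltW.
have -> : x - expi t0 = (x - x / `|x|) + (expi s - expi t0) by rewrite hs; ring.
apply: le_trans (ler_modcD _ _) _; rewrite d1.
have := expi_lipschitz s t0; have : `|s - t0| <= l / 2 by rewrite ler_norml; lra.
lra.
Qed.

Lemma zQ_ray (t0 l : R) : zQ t0 l = ray l t0. Proof. by []. Qed.

Lemma measurable_expi_closure (A : set C) : measurable (I01 `&` (expi @^-1` closure A) : set (measurableTypeR R)).
Proof.
apply: measurableI; first exact: measurable_I01.
apply: closed_measurable; apply: closed_comp; last exact: closed_closure.
by move=> t _; exact: continuous_expi.
Qed.

End geometry.

(** The product of 1 - q/8 and 1 - q/4 exceeds 1 - 3q/8, leaving room above the contraction constant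
    1 - q. *)
Lemma near_one {R : realFieldType} (q y : R) : 0 < q <= 1 -> 1 - q / 8 <= y -> 1 - q < y * (1 - q / 4).
Proof.
move=> /andP[q0 q1] hy; apply: lt_le_trans (_ : (1 - q / 8) * (1 - q / 4) <= _); first by nra.
by rewrite ler_wpM2r //; lra.
Qed.

(** * Contractive functions satisfy the box condition *)

Section necessity.
Context {R : realType}.
Local Notation C := (Cx R).
Variables (alpha : nat -> C) (T : nat -> R) (J : (R -> R) -> R) (M : R) (c : C).
Hypotheses (zs : zero_seq alpha T) (bJ : bounded_functional J M) (pJ : positive_functional J).
Hypothesis c1 : modc c = 1.
Implicit Types (z w u : C) (g : C -> R).

Local Notation F := (inner_form alpha J c).
Local Notation P z := (Lam alpha J (pkernel z)).
Local Notation Q t0 l := (\1_(cbox_closure t0 l) : C -> R).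

Lemma pkernel_le_radius z w : modc z < 1 -> modc w <= 1 -> pkernel z w <= 2 / (1 - modc z).
Proof.
move=> z1 w1; have d0 : 0 < 1 - modc z by rewrite subr_gt0.
have h : 1 - modc z <= modc (1 - w^*%C * z).
  by apply: modc_sub_ge; rewrite modcM modc_conj ler_piMl ?modc_ge0.
have hp := lt_le_trans d0 h; have z0 := modc_ge0 z.
rewrite /pkernel ler_pdivrMr ?exprn_gt0 //.
apply: (@le_trans _ _ (2 / (1 - modc z) * (1 - modc z) ^+ 2)).
  rewrite expr2 [in leRHS]expr2 mulrA divfK ?gt_eqF //; nra.
by rewrite ler_pM2l ?divr_gt0 // lerXn2r ?nnegrE ?(ltW d0) ?(ltW hp).
Qed.

Lemma adC_box t0 l : adC (Q t0 l).
Proof.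
split; last first.
  by exists 1 => w _; rewrite indicE; case: (_ \in _); rewrite /= ?normr1 ?normr0.
rewrite (_ : _ \o _ = \1_(expi @^-1` cbox_closure t0 l)).
  by apply: adm_indic; exact: measurable_expi_closure.
by apply/funext => t; rewrite /= !indicE /in_mem /= /mem_set; congr (_%:R).
Qed.

Lemma box_ge0 t0 l w : 0 <= Q t0 l w.
Proof. by rewrite indicE. Qed.

Lemma P_ge0 z : modc z < 1 -> 0 <= P z.
Proof.
move=> z1; apply: (Lam_ge0 zs pJ); first exact: adC_pkernel.
by move=> w w1; rewrite ltW // pkernel_gt0.
Qed.

Lemma P_le (K : R) z z' : modc z < 1 -> modc z' < 1 ->
  (forall w, modc w <= 1 -> pkernel z' w <= K * pkernel z w) -> P z' <= K * P z.
Proof.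
move=> z1 z1' h; rewrite -(LamZ zs bJ K (adC_pkernel z1)).
by apply: (Lam_le zs bJ pJ) => //; [exact: adC_pkernel | apply: adCZ; exact: adC_pkernel].
Qed.

Lemma weight_le z n : modc z < 1 -> (1 - modc (alpha n) ^+ 2) * pkernel z (alpha n) <= P z.
Proof.
move=> z1; apply: (term_le_Lam zs pJ); first exact: adC_pkernel.
by move=> w w1; rewrite ltW // pkernel_gt0.
Qed.

Lemma alpha_neq z n : modc z < 1 -> (1 - modc (alpha n) ^+ 2) * pkernel z (alpha n) < 1 -> alpha n != z.
Proof.
move=> z1 h; apply/eqP => az; have [a1 _ _] := zs; have := sqr_modc_bfac (a1 n) z1.
have -> : bfac (alpha n) z = 0 by rewrite az /bfac subrr mul0r mulr0.
by rewrite modc0 expr0n /=; lra.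
Qed.

Lemma rho_far dl l t0 w : 0 < dl <= l / 4 -> l <= 1 -> modc w <= 1 -> l / 2 <= modc (w - expi t0) ->
  modc (rho (ray dl t0) w + (expi t0)^*%C) <= 8 * dl / l.
Proof.
move=> /andP[d0 dl4] l1 w1 far; have l0 : 0 < l by lra.
have hd : modc (expi t0 - ray dl t0) = dl.
  have -> : expi t0 - ray dl t0 = dl%:C * expi t0 by rewrite /ray realcB; ring.
  by rewrite modcM modc_real modc_expi mulr1 gtr0_norm.
have wz : l / 4 <= modc (w - ray dl t0).
  have := ler_modcB (w - ray dl t0) (expi t0 - ray dl t0).
  have -> : w - ray dl t0 - (expi t0 - ray dl t0) = w - expi t0 by ring.
  by rewrite hd; lra.
have wz0 : w - ray dl t0 != 0 by rewrite -modc_gt0; lra.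
have -> : rho (ray dl t0) w + (expi t0)^*%C = dl%:C * (1 + w * (expi t0)^*%C) / (w - ray dl t0).
  rewrite /rho /ray conjcM; have -> : ((1 - dl)%:C)^*%C = 1 - dl%:C :> C by rewrite -realcB; simpc.
  rewrite realcB; have := expi_conjM t0; move: wz0; rewrite /ray realcB.
  move: (expi t0) ((expi t0)^*%C) => x y h1 h2.
  apply: (mulIf h1); rewrite mulrDl !divfK //.
  transitivity (1 - w * ((1 - dl%:C) * y) + (y * w - (1 - dl%:C) * (y * x))); first by ring.
  by rewrite h2; ring.
rewrite modc_div modcM modc_real gtr0_norm // ler_pdivrMr ?modc_gt0 //.
have h2 : modc (1 + w * (expi t0)^*%C) <= 2.
  apply: le_trans (ler_modcD _ _) _; rewrite modc1 modcM modc_conj_expi; lra.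
apply: (@le_trans _ _ (8 * dl / l * (l / 4))).
  have -> : 8 * dl / l * (l / 4) = dl * 2 by field; rewrite gt_eqF.
  by rewrite ler_pM2l.
by rewrite ler_pM2l // divr_gt0 // mulr_gt0.
Qed.

(** Off the box [rho_far] fixes the direction. On the box only |rho| <= 2 is available, and
    subtracting 4 kernels brings the left side below -2 times the kernel. *)
Lemma Re_kap_ge dl l t0 w : 0 < dl <= l / 4 -> l <= 1 -> modc w <= 1 -> w != ray dl t0 ->
  modc (rho (ray dl t0) w) <= 2 ->
  (1 - 8 * dl / l) * pkernel (ray dl t0) w + -4 * (pkernel (ray dl t0) w * Q t0 l w) <=
  complex.Re (- expi t0 * kap (ray dl t0) w).
Proof.
move=> d4 l1 w1 wz r2; have /andP[d0 dl4] := d4; have l0 : 0 < l by lra.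
have z1 : modc (ray dl t0) < 1 by apply: modc_ray_lt1; lra.
have pk0 := pkernel_gt0 z1 w1; rewrite kap_rho //.
set p := pkernel _ _ in pk0 *; set r := rho _ _ in r2 *.
have -> : complex.Re (- expi t0 * (p%:C * r)) = p * complex.Re (- expi t0 * r).
  have -> : - expi t0 * (p%:C * r) = p%:C * (- expi t0 * r) by ring.
  by rewrite cReM /= mul0r subr0.
suff : 1 - 8 * dl / l - 4 * Q t0 l w <= complex.Re (- expi t0 * r) by move=> h; nra.
rewrite indicE; case: (boolP (w \in _)) => wQ.
  have := ler_Re_modc (expi t0 * r); rewrite modcM modc_expi mul1r mulNr cReN /=.
  have : 0 <= 8 * dl / l by rewrite divr_ge0 ?mulr_ge0 // ltW.
  lra.
have far : l / 2 <= modc (w - expi t0).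
  rewrite leNgt; apply/negP => near; move/negP: wQ; apply; rewrite inE.
  by apply: cbox_closure_near => //; rewrite l0.
have := rho_far d4 l1 w1 far; rewrite -/r => hr.
have -> : - expi t0 * r = 1 - expi t0 * (r + (expi t0)^*%C).
  by have := expi_conjM t0; rewrite mulrDr [expi t0 * _^*%C]mulrC => ->; ring.
have := ler_Re_modc (expi t0 * (r + (expi t0)^*%C)).
by rewrite modcM modc_expi mul1r cReD cReN /=; lra.
Qed.

Hypothesis F1 : forall z, modc z < 1 -> modc (F z) < 1.

Lemma contractive_box (k : R) : k < 1 -> (forall z, modc z < 1 -> Dh F z <= k) ->
  exists C0 : R, 0 < C0 /\ forall t0 l, 0 < l <= 1 -> P (ray l t0) <= C0 ->
    C0 * P (ray l t0) <= Lam alpha J (Q t0 l) / l.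
Proof.
wlog k0 : k / 0 <= k.
  move=> H k1 hk; have [h|/ltW h] := leP 0 k; first exact: H h k1 hk.
  by apply: (H 0) => // z z1; exact: le_trans (hk z z1) h.
move=> k1 hk; pose q := 1 - k; have q0 : 0 < q by rewrite subr_gt0.
have q1 : q <= 1 by rewrite /q; lra.
(* With dl = e l the directional loss 8 dl / l is q/8. *)
pose e := q / (8 * 8); have e0 : 0 < e by rewrite divr_gt0.
have e1 : e <= 1 / (8 * 8) by rewrite /e; lra.
(* For a violating box, the kernel bound 2/dl and the Harnack factor 8/e make the box contribute at
   most 16 C0 / e^2 = q/32 of P(z). The same constant makes P(z) at most q/8. *)
pose C0 := q * e ^+ 2 / (16 * 32).
have C00 : 0 < C0 by rewrite divr_gt0 ?mulr_gt0 ?exprn_gt0.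
exists C0; split=> // t0 l l01 PC; have /andP[l0 l1] := l01.
rewrite leNgt; apply/negP => viol.
pose dl := e * l; have d0 : 0 < dl by rewrite mulr_gt0.
have dl4 : 0 < dl <= l / 4.
  rewrite d0 /dl /=; have : e * l <= 1 / (8 * 8) * l by rewrite ler_pM2r.
  lra.
have dll : 0 < dl <= l by case/andP: dl4 => *; apply/andP; split; lra.
have d1 : 0 < dl <= 1 by case/andP: dll => *; apply/andP; split; lra.
set z := ray dl t0; have z1 : modc z < 1 by exact: modc_ray_lt1.
have zQ1 : modc (ray l t0) < 1 by exact: modc_ray_lt1.
have L0 : 0 <= Lam alpha J (Q t0 l).
  by apply: (Lam_ge0 zs pJ); [exact: adC_box | move=> w _; exact: box_ge0].
have up : P z <= 2 / e * P (ray l t0).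
  apply: P_le => // w w1; have := harnack_ray_up t0 dll l1 w1.
  by have -> : 2 * l / dl = 2 / e by rewrite /dl; field; rewrite !gt_eqF.
have down : P (ray l t0) <= 8 / e * P z.
  apply: P_le => // w w1; have := harnack_ray_down t0 dll l1 w1.
  by have -> : 8 * l / dl = 8 / e by rewrite /dl; field; rewrite !gt_eqF.
have Pz0 := P_ge0 z1.
have PQpos : 0 < P (ray l t0).
  have : 0 < C0 * P (ray l t0) by apply: le_lt_trans viol; rewrite divr_ge0 // ltW.
  by rewrite pmulr_rgt0.
have Ppos : 0 < P z.
  by have := lt_le_trans PQpos down; rewrite pmulr_rgt0 // divr_gt0.
have Psmall : P z <= q / 8.
  apply: le_trans up _; apply: (@le_trans _ _ (2 / e * C0)).
    by rewrite ler_pM2l // divr_gt0.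
  have -> : 2 / e * C0 = q * (e / (16 * 16)) by rewrite /C0; field; rewrite gt_eqF.
  by rewrite ler_pM2l //; lra.
have wl n : (1 - modc (alpha n) ^+ 2) * pkernel z (alpha n) <= 1 / 8.
  by apply: le_trans (weight_le n z1) _; lra.
have az n : alpha n != z by apply: alpha_neq => //; apply: le_lt_trans (wl n) _; lra.
have [a1 _ _] := zs.
have r2 n : modc (rho z (alpha n)) <= 2.
  have := modc_rho z1 (a1 n) (az n); have := wl n.
  set s := _ * pkernel _ _ => hs hr.
  rewrite -(ler_pXn2r (n := 2)) ?nnegrE ?modc_ge0 //.
  have : 0 <= modc (rho z (alpha n)) ^+ 2 by rewrite exprn_ge0 ?modc_ge0.
  by move: hr; move: (modc _ ^+ 2) => x hr x0; nra.
pose g w := (1 - 8 * dl / l) * pkernel z w + -4 * (pkernel z w * Q t0 l w).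
have ag1 : adC (fun w => pkernel z w * Q t0 l w) by apply: adCM; [exact: adC_pkernel | exact: adC_box].
have ag : adC g by apply: adCD; apply: adCZ => //; exact: adC_pkernel.
have u1 : modc (- expi t0 : C) = 1 by rewrite modcN modc_expi.
have h1 i : g (alpha i) <= complex.Re (- expi t0 * kap z (alpha i)) by exact: Re_kap_ge.
have h2 t : g (expi t) <= complex.Re (- expi t0 * kap z (expi t)).
  apply: Re_kap_ge => //; rewrite ?modc_expi ?modc_rho_expi ?expi_neq //; lra.
have low := derive1_inner_form_ge zs bJ pJ c1 z1 u1 ag az h1 h2.
have LgE : Lam alpha J g = (1 - 8 * e) * P z - 4 * Lam alpha J (fun w => pkernel z w * Q t0 l w).
  have ag0 := adC_pkernel z1.
  have agp := adCZ (1 - 8 * dl / l) ag0; have agq := adCZ (- 4) ag1.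
  rewrite /g (LamD zs bJ agp agq) (LamZ zs bJ _ ag0) (LamZ zs bJ _ ag1).
  have -> : 8 * dl / l = 8 * e by rewrite /dl; field; rewrite gt_eqF.
  by rewrite mulNr.
have LQ : Lam alpha J (fun w => pkernel z w * Q t0 l w) <= 2 / dl * Lam alpha J (Q t0 l).
  rewrite -(LamZ zs bJ); last exact: adC_box.
  apply: (Lam_le zs bJ pJ) => //; first by apply: adCZ; exact: adC_box.
  move=> w w1; rewrite ler_wpM2r ?box_ge0 //.
  by have := pkernel_le_radius z1 w1; rewrite modc_ray // opprB addrC subrK.
have LQ2 : Lam alpha J (fun w => pkernel z w * Q t0 l w) <= q / 32 * P z.
  apply: le_trans LQ _; move: viol; rewrite ltr_pdivrMr // => /ltW viol.
  apply: (@le_trans _ _ (2 / dl * (C0 * P (ray l t0) * l))).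
    by rewrite ler_pM2l // divr_gt0.
  apply: (@le_trans _ _ (2 / dl * (C0 * (8 / e * P z) * l))).
    by rewrite ler_pM2l ?divr_gt0 // ler_pM2r // ler_pM2l.
  by rewrite le_eqVlt; apply/orP; left; apply/eqP; rewrite /C0 /dl; field; rewrite !gt_eqF.
have LgP : (1 - q / 4) * P z <= Lam alpha J g.
  rewrite LgE; have -> : 8 * e = q / 8 by rewrite /e; field.
  lra.
have /andP[F2 _] := sqr_modc_inner_form zs bJ pJ c1 z1.
have fz := F1 z1; have f0 := modc_ge0 (F z).
have den : 0 < 1 - modc (F z) ^+ 2 by rewrite subr_gt0 exprn_ilt1.
have := hk z z1; rewrite /Dh ler_pdivrMr // => hDh.
have fl : 1 - q / 8 <= modc (F z).
  have : modc (F z) ^+ 2 <= modc (F z) by rewrite expr2 ler_piMr // ltW.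
  lra.
have b2 : k * (1 - modc (F z) ^+ 2) <= k * P z by rewrite ler_wpM2l //; lra.
(* Dividing by P(z) > 0 leaves |F(z)| (1 - q/4) <= 1 - q, impossible because |F(z)| >= 1 - q/8. *)
have b3 : modc (F z) * ((1 - q / 4) * P z) <= k * P z.
  apply: le_trans b2; apply: le_trans (le_trans low hDh).
  by rewrite ler_wpM2l.
have : modc (F z) * (1 - q / 4) <= k.
  by rewrite -(ler_pM2r Ppos) -mulrA.
have kq : k = 1 - q by rewrite /q; ring.
by rewrite kq leNgt near_one ?q0.
Qed.

End necessity.

(** * Schwarz-Pick by products, removal of a zero, pseudo-hyperbolic Harnack *)

Section schwarz_pick.
Context {R : realType}.
Local Notation C := (Cx R).
Variables (J : (R -> R) -> R) (M : R) (c : C).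
Hypotheses (bJ : bounded_functional J M) (pJ : positive_functional J).
Hypothesis c1 : modc c = 1.
Implicit Types (z w u : C) (g : C -> R) (alpha : nat -> C) (T : nat -> R).

Lemma exp_pick (j : R) : 0 <= j -> expR (- j) * (2 * j) <= 1 - expR (- j) ^+ 2.
Proof.
move=> j0; have := sinh_ge j0.
have q0 : 0 <= j ^+ 4 / (4 * (1 + j + j ^+ 2 / 2)).
  by rewrite divr_ge0 ?exprn_ge0 // mulr_ge0 // !addr_ge0 // divr_ge0 // exprn_ge0.
have e0 := expR_gt0 (- j); have e1 : expR j * expR (- j) = 1 by rewrite -expRD subrr expR0.
move=> h; have h2 : 2 * j <= expR j - expR (- j) by lra.
have : expR (- j) * (2 * j) <= expR (- j) * (expR j - expR (- j)) by rewrite ler_pM2l.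
by rewrite mulrBr [expR (- j) * expR j]mulrC e1 expr2.
Qed.

(** The Schwarz-Pick bound is stable under products: (1 - x^2) y + (1 - y^2) x = (x + y) (1 - xy),
    and x + y <= 1 + xy on the unit square. *)
Lemma pick_product (x y dx dy s : R) : 0 <= x <= 1 -> 0 <= y <= 1 ->
  s * dx <= 1 - x ^+ 2 -> s * dy <= 1 - y ^+ 2 -> s * (dx * y + x * dy) <= 1 - (x * y) ^+ 2.
Proof.
move=> /andP[x0 x1] /andP[y0 y1] h1 h2.
have e1 : s * dx * y <= (1 - x ^+ 2) * y by rewrite ler_wpM2r.
have e2 : s * dy * x <= (1 - y ^+ 2) * x by rewrite ler_wpM2r.
have e3 : (1 - x ^+ 2) * y + (1 - y ^+ 2) * x = (x + y) * (1 - x * y) by ring.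
have e4 : 1 - (x * y) ^+ 2 = (1 + x * y) * (1 - x * y) by ring.
have e5 : (x + y) * (1 - x * y) <= (1 + x * y) * (1 - x * y).
  rewrite ler_wpM2r ?subr_ge0 ?mulr_ile1 //; nra.
have -> : s * (dx * y + x * dy) = s * dx * y + s * dy * x by ring.
lra.
Qed.

(** Factor by factor: the exponential satisfies it by [exp_pick], each Blaschke factor with
    equality, and [pick_product] combines them. No hypothesis on z relative to the zeros is needed
    this way. *)
Lemma schwarz_pick_part alpha T N z : zero_seq alpha T -> modc z < 1 ->
  (1 - modc z ^+ 2) * modc (derive1 (inner_part alpha J c N) z) <= 1 - modc (inner_part alpha J c N z) ^+ 2.
Proof.
move=> zs z1; have [a1 _ _] := zs.
have S1 : modc (cexp (- hgl J z)) <= 1 := modc_singular_le1 bJ pJ z1.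
have FN1 n : 0 <= modc (inner_part alpha J c n z) <= 1.
  by rewrite modc_ge0 !modcM c1 mul1r mulr_ile1 ?modc_ge0 ?bprod_le1.
have Z0 := sqr_modc_le1 (ltW z1).
elim: N => [|N IH].
  (* The logarithmic derivative formula requires that no listed zero equals z; with N = 0 the
     sequence can be replaced by pure padding. *)
  have zs1 : zero_seq (fun=> 1 : C) (fun=> 0).
    split; [by move=> n; rewrite modc1 | exact: cvg_cst |].
    by move=> n k; rewrite big1 // => i _; rewrite modc1 subrr.
  have -> : inner_part alpha J c 0 = inner_part (fun=> 1) J c 0.
    by apply/funext => w; rewrite /inner_part /bprod !big_ord0.
  have az (i : nat) : (1 : C) != z by apply/eqP => h; move: z1; rewrite -h modc1 ltxx.
  rewrite (modc_derive1_inner_part c zs1 bJ) //.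
  have -> : modc (inner_part (fun=> 1) J c 0 z) = expR (- J (fun t => pkernel z (expi t))).
    by rewrite !modcM c1 mul1r /bprod big_ord0 modc1 mul1r (modc_cexp_hgl bJ).
  set j := J _; have j0 : 0 <= j.
    by apply: pJ => [|t _]; [exact: adm_pkernel | rewrite ltW // pkernel_gt0 // modc_expi].
  apply: le_trans (exp_pick j0); rewrite ler_wpM2l ?expR_ge0 //.
  rewrite /kapN big_ord0 add0r modcM.
  have -> : modc (2 : C) = 2.
    have -> : (2 : C) = (1 + 1 : R)%:C by rewrite realcD.
    by rewrite modc_real ger0_norm.
  rewrite ler_pM2l //; apply: le_trans (modc_cfun_le bJ pJ (cadm_kap z1)) _.
  rewrite /j (_ : (fun t => modc _) = fun t => pkernel z (expi t)) //.
  by apply/funext => t; rewrite modc_kap_expi.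
have E : inner_part alpha J c N.+1 = fun w => inner_part alpha J c N w * bfac (alpha N) w.
  by apply/funext => w; rewrite /inner_part /bprod big_ord_recr /=; ring.
have q1 := hol_qd (hol_inner_part c zs bJ N) z1.
have q2 := hol_qd (hol_bfac (a1 N)) z1.
have -> : derive1 (inner_part alpha J c N.+1) z = derive1 (inner_part alpha J c N) z * bfac (alpha N) z +
    inner_part alpha J c N z * derive1 (bfac (alpha N)) z.
  by rewrite E; apply: qd_derive1; exact: qdM.
have b01 : 0 <= modc (bfac (alpha N) z) <= 1 by rewrite modc_ge0 modc_bfac_le1.
have hb : (1 - modc z ^+ 2) * modc (derive1 (bfac (alpha N)) z) <= 1 - modc (bfac (alpha N) z) ^+ 2.
  by rewrite mulrC derive1_bfac.
have := pick_product (FN1 N) b01 IH hb.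
rewrite E modcM; apply: le_trans; rewrite ler_wpM2l //.
by apply: le_trans (ler_modcD _ _) _; rewrite !modcM.
Qed.

Lemma schwarz_pick alpha T z : zero_seq alpha T -> modc z < 1 ->
  (1 - modc z ^+ 2) * modc (derive1 (inner_form alpha J c) z) <= 1 - modc (inner_form alpha J c z) ^+ 2.
Proof.
move=> zs z1.
have cvF : (fun N => 1 - modc (inner_part alpha J c N z) ^+ 2) @ \oo --> 1 - modc (inner_form alpha J c z) ^+ 2.
  apply: cvgB; first exact: cvg_cst.
  by have h := cvg_modc (inner_part_cvg zs bJ pJ c1 z1); apply: cvgM.
apply: (ler_cvg_to (derive1_inner_form_cvg zs bJ pJ c1 z1) cvF); apply: nearW => N.
exact: (schwarz_pick_part _ zs).
Qed.

(** The removed zero is overwritten by the padding value 1, so indices and the tail bound [T] stay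
    the same. *)
Definition drop_zero alpha (m : nat) : nat -> C := fun n => if n == m then 1 else alpha n.

Lemma zero_seq_drop alpha T m : zero_seq alpha T -> zero_seq (drop_zero alpha m) T.
Proof.
move=> [a1 T0 hT]; split=> // [n|N k].
  by rewrite /drop_zero; case: ifP => // _; rewrite modc1.
apply: le_trans (hT N k); apply: ler_sum => i _; rewrite /drop_zero; case: ifP => // _.
by rewrite modc1 subrr subr_ge0.
Qed.

Lemma bprod_drop alpha m N z : (m < N)%N -> modc z < 1 ->
  bprod alpha N z = bfac (alpha m) z * bprod (drop_zero alpha m) N z.
Proof.
move=> mN z1; rewrite /bprod (bigD1 (Ordinal mN)) //= [in RHS](bigD1 (Ordinal mN)) //=.
rewrite {1}/drop_zero eqxx bfac1 // mul1r; congr (_ * _).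
by apply: eq_bigr => i im; rewrite /drop_zero (_ : (i == m :> nat) = false) //; apply/negbTE.
Qed.

Lemma inner_form_drop alpha T m z : zero_seq alpha T -> modc z < 1 ->
  inner_form alpha J c z = bfac (alpha m) z * inner_form (drop_zero alpha m) J c z.
Proof.
move=> zs z1; have zs' := zero_seq_drop m zs.
have E : blaschke alpha z = bfac (alpha m) z * blaschke (drop_zero alpha m) z; last first.
  by rewrite /inner_form E; ring.
have [cv _] := cvg_blaschke zs z1; have [/cvgCP cv' _] := cvg_blaschke zs' z1.
apply: (@cvgC_unique _ _ _ _ _ _ _ cv); apply/cvgCP => e e0.
have [N0 _ HN] := cv' e e0; exists (maxn N0 m.+1) => // N /=; rewrite geq_max => /andP[h1 h2].
rewrite (bprod_drop _ h2 z1) -mulrBr modcM; apply: le_lt_trans (HN N h1).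
by rewrite ler_piMl ?modc_ge0 // modc_bfac_le1 //; case: zs.
Qed.

Lemma Lam_drop alpha T m g : zero_seq alpha T -> adC g ->
  Lam alpha J g = Lam (drop_zero alpha m) J g + (1 - modc (alpha m) ^+ 2) * g (alpha m).
Proof.
move=> zs ag; have zs' := zero_seq_drop m zs.
have cv := LamN_cvg (J := J) zs ag; have cv' := LamN_cvg (J := J) zs' ag.
apply: (cvg_unique (@norm_hausdorff _ _) cv).
have cv2 : (fun N => LamN (drop_zero alpha m) J N g + (1 - modc (alpha m) ^+ 2) * g (alpha m)) @ \oo -->
    Lam (drop_zero alpha m) J g + (1 - modc (alpha m) ^+ 2) * g (alpha m).
  by apply: cvgD => //; exact: cvg_cst.
apply: cvg_trans cv2; apply: near_eq_cvg; exists m.+1 => // N /= mN.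
rewrite /LamN (bigD1 (Ordinal mN)) //= [in RHS](bigD1 (Ordinal mN)) //=.
rewrite {1 2}/drop_zero eqxx modc1 expr1n subrr mul0r add0r.
rewrite (eq_bigr (fun i : 'I_N => (1 - modc (alpha i) ^+ 2) * g (alpha i))); first by ring.
by move=> i im; rewrite /drop_zero (_ : (i == m :> nat) = false) //; apply/negbTE.
Qed.

(** The hypothesis bounds the pseudo-hyperbolic distance of a and z away from 1. It forces their
    depths to be comparable, with ratio of 1 - |a|^2 to 1 - |z|^2 at most 4/s, and makes 1 + |z -
    a|/(1 - |a|) at most 5/s; these enter [harnack] as 4/s times (5/s)^2. *)
Lemma harnack_pseudo a z w (s : R) : modc a < 1 -> modc z < 1 -> modc w <= 1 -> 0 < s <= 1 ->
  s <= (1 - modc a ^+ 2) * pkernel z a -> pkernel a w <= 4 * 25 / s ^+ 3 * pkernel z w.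
Proof.
move=> a1 z1 w1 /andP[s0 s1] hs; have pk0 := pkernel_gt0 z1 w1.
have A0 := sqr_modc_lt1 a1; have Z0 := sqr_modc_lt1 z1.
apply: le_trans (harnack z1 a1 w1) _; rewrite ler_pM2r //.
have D0 : 0 < modc (1 - a^*%C * z) by rewrite modc_gt0 den_neq0 // ltW.
have za : modc (z - a) <= modc (1 - a^*%C * z).
  have := pick_identity a z; rewrite modc_distC -(ler_pXn2r (n := 2)) ?nnegrE ?modc_ge0 //.
  by have := mulr_ge0 (ltW A0) (ltW Z0); lra.
have Da : 1 - modc a <= modc (1 - a^*%C * z).
  by apply: modc_sub_ge; rewrite modcM modc_conj ler_piMr ?modc_ge0 // ltW.
have Dz : 1 - modc z <= modc (1 - a^*%C * z).
  by apply: modc_sub_ge; rewrite modcM modc_conj ler_piMl ?modc_ge0 // ltW.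
have a0 := modc_ge0 a; have z0 := modc_ge0 z.
have A2 : 1 - modc a ^+ 2 <= 2 * (1 - modc a) by rewrite expr2; nra.
have Z2 : 1 - modc z ^+ 2 <= 2 * (1 - modc z) by rewrite expr2; nra.
have q0 : 0 < 1 - modc a by rewrite subr_gt0.
move: hs; rewrite /pkernel mulrA ler_pdivlMr ?exprn_gt0 //.
have dd0 := modc_ge0 (z - a).
move: za Da Dz A2 Z2 A0 Z0 D0 q0 dd0.
move: (1 - modc a ^+ 2) (1 - modc z ^+ 2) (1 - modc a) (1 - modc z) (modc (1 - a^*%C * z)) (modc (z - a)).
move=> A Z p q D dd za Da Dz A2 Z2 A0 Z0 D0 p0 dd0 hs.
have h1 : A / Z <= 4 / s.
  rewrite ler_pdivrMr // mulrAC ler_pdivlMr //.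
  have AA : s * A ^+ 2 <= s * (2 * D) ^+ 2.
    by rewrite ler_pM2l // lerXn2r ?nnegrE //; lra.
  have : A * (A * s) <= A * (4 * Z) by move: AA hs; rewrite !expr2; lra.
  by rewrite ler_pM2l.
have h2 : D <= 2 * A / s.
  rewrite ler_pdivlMr //.
  have hZ : s * Z <= 4 * A.
    have ZZ : s * Z ^+ 2 <= s * (2 * D) ^+ 2.
      by rewrite ler_pM2l // lerXn2r ?nnegrE //; lra.
    have : Z * (s * Z) <= Z * (4 * A) by move: ZZ hs; rewrite !expr2; lra.
    by rewrite ler_pM2l.
  have n1 : 0 <= D * s by rewrite mulr_ge0 // ltW.
  have n2 : 0 <= 2 * A by rewrite mulr_ge0 // ltW.
  rewrite -(ler_pXn2r (n := 2)) ?nnegrE //.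
  have e1 : s * (s * D ^+ 2) <= s * (A * Z) by rewrite ler_pM2l.
  have e2 : A * (s * Z) <= A * (4 * A) by rewrite ler_pM2l.
  by move: e1 e2; rewrite !expr2; lra.
have h3 : 1 + dd / p <= 5 / s.
  have : dd / p <= 4 / s.
    rewrite ler_pdivrMr //; apply: le_trans za (le_trans h2 _).
    have -> : 2 * A / s = s^-1 * (2 * A) by ring.
    have -> : 4 / s * p = s^-1 * (4 * p) by ring.
    by rewrite ler_pM2l ?invr_gt0 //; lra.
  have : 1 <= 1 / s by rewrite ler_pdivlMr // mul1r.
  lra.
have -> : 4 * 25 / s ^+ 3 = 4 / s * (5 / s) ^+ 2 by field; rewrite gt_eqF.
have k0 : 0 <= 1 + dd / p by rewrite addr_ge0 // divr_ge0 ?(ltW p0).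
apply: ler_pM => //; [by rewrite divr_ge0 // ltW | by rewrite exprn_ge0 |].
by rewrite lerXn2r ?nnegrE // (le_trans k0).
Qed.

End schwarz_pick.

(** * Points close to a zero *)

Section near_zero.
Context {R : realType}.
Local Notation C := (Cx R).
Variables (alpha : nat -> C) (T : nat -> R) (J : (R -> R) -> R) (M : R) (c : C).
Hypotheses (zs : zero_seq alpha T) (bJ : bounded_functional J M) (pJ : positive_functional J).
Hypothesis c1 : modc c = 1.
Implicit Types (z w u : C) (g : C -> R).

Local Notation F := (inner_form alpha J c).
Local Notation P z := (Lam alpha J (pkernel z)).
Local Notation Q t0 l := (\1_(cbox_closure t0 l) : C -> R).
Local Notation weight n z := ((1 - modc (alpha n) ^+ 2) * pkernel z (alpha n)).

Lemma den_ray_le d t w : 0 <= d -> modc w <= 1 ->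
  modc (1 - w^*%C * ray d t) <= modc (w - expi t) + d.
Proof.
move=> d0 w1.
have -> : 1 - w^*%C * ray d t = expi t * (expi t - w)^*%C + d%:C * (w^*%C * expi t).
  rewrite conjcB mulrBr [expi t * (expi t)^*%C]mulrC expi_conjM /ray realcB; ring.
apply: le_trans (ler_modcD _ _) _.
rewrite !modcM modc_expi modc_conj modc_distC mul1r modc_real ger0_norm // modc_conj mulr1.
by rewrite lerD2l ler_piMr.
Qed.

Lemma pkernel_ray_ge d t w (b : R) : 0 < d <= 1 -> modc w <= 1 -> modc (w - expi t) + d <= b ->
  d / b ^+ 2 <= pkernel (ray d t) w.
Proof.
move=> d01 w1 hb; have /andP[d0 d1] := d01.
have z1 := modc_ray_lt1 t d01.
have D0 : 0 < modc (1 - w^*%C * ray d t) by rewrite modc_gt0 den_neq0.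
have Db := le_trans (den_ray_le t (ltW d0) w1) hb.
have b0 := lt_le_trans D0 Db.
rewrite /pkernel modc_ray //; apply: ler_pM; [exact: ltW | by rewrite invr_ge0 exprn_ge0 // ltW | |].
  by rewrite expr2; nra.
by rewrite lef_pV2 ?posrE ?exprn_gt0 // lerXn2r ?nnegrE ?(ltW D0) ?(ltW b0).
Qed.

Lemma polar (a : C) : modc a < 1 -> exists t, a = ray (1 - modc a) t.
Proof.
move=> a1; have [->|a0] := eqVneq a 0.
  by exists 0; rewrite modc0 subr0 /ray subrr mul0r.
have am : 0 < modc a by rewrite modc_gt0.
have an0 : (modc a)%:C != 0 :> C by rewrite realc_neq0 // gt_eqF.
have [|t _ h] := @expi_surj _ (a / (modc a)%:C).
  by rewrite modc_div modc_real ger0_norm ?modc_ge0 // divff // gt_eqF.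
exists t; rewrite /ray -h opprB addrC subrK.
by rewrite mulrC divfK.
Qed.

Lemma pkernel_ray_ray (l d t : R) : 0 < l <= 1 -> 0 < d <= 1 ->
  pkernel (ray l t) (ray d t) = (1 - (1 - l) ^+ 2) / (d + l - d * l) ^+ 2.
Proof.
move=> l01 d01; rewrite /pkernel modc_ray //; congr (_ / _ ^+ 2).
have -> : 1 - (ray d t)^*%C * ray l t = (d + l - d * l)%:C.
  rewrite /ray conjcM; have -> : ((1 - d)%:C)^*%C = (1 - d)%:C :> C by simpc.
  transitivity (1 - (1 - d)%:C * (1 - l)%:C * ((expi t)^*%C * expi t)); first by ring.
  by rewrite expi_conjM mulr1 -realcM -realcB; congr (_ +i* _); ring.
rewrite modc_real ger0_norm //; case/andP: l01 => l0 l1; case/andP: d01 => d0 d1; nra.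
Qed.

(** The quotient is at most (x + y)/(1 + xy) = 1 - (1 - x)(1 - y)/(1 + xy), and 1 + xy <= 2: both
    factors being away from 1 gives a definite gain. *)
Lemma pick_quotient (x y s : R) : 0 <= x < 1 -> 0 <= y <= 1 -> s <= (1 - x ^+ 2) * y + x * (1 - y ^+ 2) ->
  s / (1 - (x * y) ^+ 2) <= 1 - (1 - x) * (1 - y) / 2.
Proof.
move=> /andP[x0 x1] /andP[y0 y1] hs.
have xy1 : x * y < 1 by nra.
have xy0 : 0 <= x * y by rewrite mulr_ge0.
have den : 0 < 1 - (x * y) ^+ 2 by rewrite subr_gt0 exprn_ilt1.
rewrite ler_pdivrMr //; apply: le_trans hs _.
have e1 : 1 - (x * y) ^+ 2 = (1 + x * y) * (1 - x * y) by ring.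
have e2 : (1 - x ^+ 2) * y + x * (1 - y ^+ 2) = (x + y) * (1 - x * y) by ring.
rewrite e1 e2 mulrA ler_wpM2r ?subr_ge0 ?(ltW xy1) //.
have : 0 <= (1 - x) * (1 - y) by rewrite mulr_ge0 // subr_ge0 // ltW.
set m := (1 - x) * (1 - y) => m0.
have -> : x + y = 1 + x * y - m by rewrite /m; ring.
nra.
Qed.

Variable C0 : R.
Hypothesis C01 : 0 < C0 <= 1.
Hypothesis Hbox : forall t0 l, 0 < l <= 1 -> P (ray l t0) <= C0 ->
  C0 * P (ray l t0) <= Lam alpha J (Q t0 l) / l.

(** From depth e d on the radius of a zero at depth d, its share of P is comparable to e: large
    enough to feed the box condition, small enough not to account for all of a mass of size several
    e. *)
Lemma ray_weight_bounds (e d t : R) : 0 < e <= 1 -> 0 < d <= 1 ->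
  e / 4 <= (1 - modc (ray d t) ^+ 2) * pkernel (ray (e * d) t) (ray d t) <= 4 * e.
Proof.
move=> /andP[e0 e1] d01; have /andP[d0 d1] := d01.
have [l lE] : exists l, l = e * d by exists (e * d).
have l0 : 0 < l by rewrite lE mulr_gt0.
have ld : l <= d by rewrite lE ler_piMl // ltW.
have l01 : 0 < l <= 1 by rewrite l0 (le_trans ld).
rewrite -lE pkernel_ray_ray // modc_ray // mulrA.
have den1 : d <= d + l - d * l by nra.
have den2 : d + l - d * l <= 2 * d by nra.
have dp : 0 < d + l - d * l by lra.
have a1 : d <= 1 - (1 - d) ^+ 2 <= 2 * d by apply/andP; split; nra.
have a2 : l <= 1 - (1 - l) ^+ 2 <= 2 * l by apply/andP; split; nra.
move: den1 den2 dp a1 a2; move: (d + l - d * l) (1 - (1 - d) ^+ 2) (1 - (1 - l) ^+ 2) => x y y' den1 den2 dp.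
move=> /andP[y1 y2] /andP[y1' y2'].
apply/andP; split.
  rewrite ler_pdivlMr ?exprn_gt0 //.
  apply: (@le_trans _ _ (e / 4 * (2 * d) ^+ 2)).
    by rewrite ler_pM2l ?divr_gt0 // lerXn2r ?nnegrE ?(ltW dp) // mulr_ge0 // ltW.
  have -> : e / 4 * (2 * d) ^+ 2 = d * l by rewrite lE; field.
  by apply: ler_pM => //; exact: ltW.
rewrite ler_pdivrMr ?exprn_gt0 //.
apply: (@le_trans _ _ (4 * e * d ^+ 2)); last first.
  by rewrite ler_pM2l ?mulr_gt0 // lerXn2r ?nnegrE ?(ltW d0) ?(ltW dp).
have -> : 4 * e * d ^+ 2 = (2 * d) * (2 * l) by rewrite lE; ring.
by apply: ler_pM => //; lra.
Qed.

(** Here p is the full mass, w0 the share of the zero and pg the rest. If p > C1, the zero takes at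
    most C1/2 and the rest keeps C1/2; otherwise the box condition applies, and p >= w0 >= C1/32
    bounds the box mass m from below. *)
Lemma mass_arith (C1 B p pg m w0 K l : R) : 0 < C1 -> 0 < l -> 0 <= K -> p = pg + w0 -> 0 <= pg ->
  C1 / 8 / 4 <= w0 -> w0 <= 4 * (C1 / 8) -> B <= C1 / 2 -> B <= K * (C1 * (C1 / 8 / 4) * l) ->
  (p <= C1 -> C1 * p <= m / l) -> K * m <= pg -> B <= pg.
Proof.
clear; move=> C10 l0 K0 PE pg0 wl wu B1 B2 hb lowQ.
have [small|big] := leP p C1; last by lra.
apply: le_trans B2 (le_trans _ lowQ); apply: ler_wpM2l => //.
rewrite -ler_pdivlMr //; apply: le_trans (hb small).
by rewrite ler_pM2l //; lra.
Qed.

(** The zero at depth d lies above the box of size l < d, so all mass of that box belongs to the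
    other zeros and the circle. Points of the box are within 5l of its centre on the circle, which
    gives the kernel bound with 6l. *)
Lemma rest_mass_below n t l d (B : R) : alpha n = ray d t -> 0 < d <= 1 -> l = C0 / 8 * d ->
  B <= C0 / 2 -> B <= l / (6 * l) ^+ 2 * (C0 * (C0 / 8 / 4) * l) ->
  B <= Lam (drop_zero alpha n) J (pkernel (ray l t)).
Proof.
move=> an d01 lE B1 B2; have /andP[C00 C1] := C01; have /andP[d0 d1] := d01.
have e0 : 0 < C0 / 8 by rewrite divr_gt0.
have e1 : C0 / 8 <= 1 by lra.
have e01 : 0 < C0 / 8 <= 1 by rewrite e0.
have l0 : 0 < l by rewrite lE mulr_gt0.
have ld : l <= d / 8.
  rewrite lE; have : C0 / 8 * d <= 1 / 8 * d by rewrite ler_pM2r //; lra.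
  lra.
have l01 : 0 < l <= 1 by rewrite l0 /=; lra.
have e6 : 5 * l + l = 6 * l by ring.
have ldlt : 1 - d < 1 - l by lra.
have := ray_weight_bounds t e01 d01; rewrite -lE -an => /andP[wl wu].
have z1 := modc_ray_lt1 t l01.
have zs' := zero_seq_drop n zs.
have ag := adC_pkernel z1.
have PE := Lam_drop J n zs ag.
have Pg0 := P_ge0 zs' pJ z1.
have Qa : Q t l (alpha n) = 0.
  rewrite indicE memNset //= => /(cbox_closure_bounds l01)[_ h _].
  by move: h; rewrite an modc_ray // leNgt ldlt.
have LQ := Lam_drop J n zs (adC_box t l); rewrite Qa mulr0 addr0 in LQ.
have hb := @Hbox t l l01.
have lowQ : l / (6 * l) ^+ 2 * Lam (drop_zero alpha n) J (Q t l) <= Lam (drop_zero alpha n) J (pkernel (ray l t)).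
  rewrite -(LamZ zs' bJ _ (adC_box t l)).
  apply: (Lam_le zs' bJ pJ (adCZ _ (adC_box t l)) ag) => w w1.
  have pkw := pkernel_gt0 z1 w1.
  have [wQ|wQ] := pselect (cbox_closure t l w); last first.
    have -> : Q t l w = 0 by rewrite indicE memNset.
    by rewrite mulr0 ltW.
  have -> : Q t l w = 1 by rewrite indicE mem_set.
  have [_ _ h] := cbox_closure_bounds l01 wQ; rewrite mulr1.
  by apply: (pkernel_ray_ge l01 w1); rewrite -e6 lerD2r.
have K0 : 0 <= l / (6 * l) ^+ 2.
  by apply: divr_ge0; [exact: ltW | apply: exprn_ge0; apply: mulr_ge0; [exact: ler0n | exact: ltW]].
rewrite {}LQ in hb.
exact: (mass_arith C00 l0 K0 PE Pg0 wl wu B1 B2 hb lowQ).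
Qed.

Hypothesis F1 : forall z, modc z < 1 -> modc (F z) < 1.

Lemma close_zero_bound (s : R) : 0 < s <= 1 -> exists k : R, k < 1 /\
  forall z n, modc z < 1 -> s <= weight n z -> Dh F z <= k.
Proof.
move=> s01; have /andP[s0 s1] := s01; have /andP[C00 C1] := C01.
set e := C0 / 8; have e0 : 0 < e by rewrite divr_gt0.
(* The lower bound for the remaining mass at depth e d, divided by the Harnack factor 2/e up to the
   zero and by the factor 4 * 25 / s^3 from the zero to z. *)
pose dlt := C0 * e / (4 * (6 * 6)) * (e / 2) * (s ^+ 3 / (4 * 25)).
have dlt0 : 0 < dlt by rewrite !mulr_gt0 // ?exprn_gt0 // ?divr_gt0 // ?invr_gt0 ?mulr_gt0.
have E1 : expR (- dlt) < 1 by rewrite -expR0 ltr_expR oppr_lt0.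
(* The Blaschke factor has x^2 <= 1 - s, so 1 - x >= s/2; the remaining factor has y^2 <= exp(-dlt),
   so 1 - y is at least half of 1 - exp(-dlt). These enter [pick_quotient]. *)
exists (1 - (s / 2) * ((1 - expR (- dlt)) / 2) / 2); split.
  by rewrite gtrBl !mulr_gt0 // ?invr_gt0 // ?subr_gt0 // divr_gt0 // subr_gt0.
move=> z n z1 hw; have [a1 _ _] := zs.
have an1 : modc (alpha n) < 1.
  rewrite lt_neqAle a1 andbT; apply/eqP => h.
  by move: hw; rewrite h expr1n subrr mul0r; lra.
have [t at_] := polar an1; set d := 1 - modc (alpha n) in at_.
have d01 : 0 < d <= 1 by rewrite subr_gt0 an1 /= /d gerBl modc_ge0.
have /andP[d0 d1] := d01.
have zs' := zero_seq_drop n zs.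
pose l := e * d; have l0 : 0 < l by rewrite mulr_gt0.
have e1 : e <= 1 / 8 by rewrite /e; lra.
have ld : 0 < l <= d.
  rewrite l0 /l /=; have : e * d <= 1 / 8 * d by rewrite ler_pM2r.
  lra.
have l01 : 0 < l <= 1 by rewrite l0 /=; case/andP: ld => _ h; lra.
have low : C0 * e / (4 * (6 * 6)) <= Lam (drop_zero alpha n) J (pkernel (ray l t)).
  apply: (rest_mass_below at_ d01 (erefl : l = C0 / 8 * d)).
    have h : C0 * e <= C0 * (1 / 8) by rewrite ler_pM2l.
    rewrite ler_pdivrMr ?mulr_gt0 //; apply: le_trans h _.
    rewrite -mulrA ler_pM2l //; lra.
  by rewrite le_eqVlt; apply/orP; left; apply/eqP; rewrite /e; field; rewrite gt_eqF.
set P' := fun z => Lam (drop_zero alpha n) J (pkernel z) in low.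
have zl1 := modc_ray_lt1 t l01; have zd1 := modc_ray_lt1 t d01.
have up1 : P' (ray l t) <= 2 / e * P' (ray d t).
  apply: (P_le zs' bJ pJ) => // w w1; have := harnack_ray_up t ld d1 w1.
  by have -> : 2 * d / l = 2 / e by rewrite /l; field; rewrite !gt_eqF.
have up2 : P' (ray d t) <= 4 * 25 / s ^+ 3 * P' z.
  by apply: (P_le zs' bJ pJ) => // w w1; rewrite -at_; apply: harnack_pseudo.
have low2 : dlt <= P' z.
  have h1 : C0 * e / (4 * (6 * 6)) <= 2 / e * (4 * 25 / s ^+ 3 * P' z).
    by apply: le_trans low _; apply: le_trans up1 _; rewrite ler_pM2l ?divr_gt0.
  have q0 : 0 < e / 2 * (s ^+ 3 / (4 * 25)) by rewrite mulr_gt0 // divr_gt0 // ?exprn_gt0 // mulr_gt0.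
  have := ler_wpM2r (ltW q0) h1.
  have -> : 2 / e * (4 * 25 / s ^+ 3 * P' z) * (e / 2 * (s ^+ 3 / (4 * 25))) = P' z.
    by field; rewrite !gt_eqF.
  by have -> : dlt = C0 * e / (4 * (6 * 6)) * (e / 2 * (s ^+ 3 / (4 * 25))) by rewrite /dlt [in RHS]mulrA.
pose x := modc (bfac (alpha n) z); pose y := modc (inner_form (drop_zero alpha n) J c z).
have x2 : x ^+ 2 <= 1 - s by rewrite /x sqr_modc_bfac // lerD2l lerN2.
have x0 : 0 <= x := modc_ge0 _.
have x1 : x < 1 by rewrite -(ltr_pXn2r (n := 2)) ?nnegrE // expr1n; lra.
have /andP[_ y2] := sqr_modc_inner_form zs' bJ pJ c1 z1; rewrite -/(P' z) -/y in y2.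
have {}y2 : y ^+ 2 <= expR (- dlt) by apply: le_trans y2 _; rewrite ler_expR lerN2.
have y0 : 0 <= y := modc_ge0 _.
have y1 : y <= 1 by rewrite -(ler_pXn2r (n := 2)) ?nnegrE // expr1n; lra.
have FE w : modc w < 1 -> F w = bfac (alpha n) w * inner_form (drop_zero alpha n) J c w.
  by move=> w1; exact: (inner_form_drop J c n zs w1).
have q1 := hol_qd (hol_bfac (a1 n)) z1.
have q2 := hol_qd (hol_inner_form c zs' bJ) z1.
have dE : derive1 F z = derive1 (bfac (alpha n)) z * inner_form (drop_zero alpha n) J c z +
    bfac (alpha n) z * derive1 (inner_form (drop_zero alpha n) J c) z.
  apply: qd_derive1; have r0 : 0 < 1 - modc z by rewrite subr_gt0.
  apply: (qd_eq r0 _ (qdM q1 q2)) => w hw2; rewrite FE //.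
  by have := ler_modcD (w - z) z; rewrite subrK; lra.
have Z0 := sqr_modc_le1 (ltW z1).
have hd : (1 - modc z ^+ 2) * modc (derive1 F z) <= (1 - x ^+ 2) * y + x * (1 - y ^+ 2).
  have sp := schwarz_pick bJ pJ c1 zs' z1; rewrite -/y in sp.
  have hb : (1 - modc z ^+ 2) * modc (derive1 (bfac (alpha n)) z) = 1 - x ^+ 2.
    by rewrite mulrC derive1_bfac.
  rewrite dE; apply: (@le_trans _ _ ((1 - modc z ^+ 2) * (modc (derive1 (bfac (alpha n)) z) * y +
     x * modc (derive1 (inner_form (drop_zero alpha n) J c) z)))).
    by rewrite ler_wpM2l // /x /y -!modcM; exact: ler_modcD.
  rewrite mulrDr mulrA hb lerD2l mulrCA ler_wpM2l //.
rewrite /Dh FE // modcM -/x -/y.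
have x01 : 0 <= x < 1 by rewrite x0.
have y01 : 0 <= y <= 1 by rewrite y0.
apply: le_trans (pick_quotient x01 y01 hd) _.
rewrite lerD2l lerN2 ler_pM2r ?invr_gt0 //; apply: ler_pM.
- by rewrite divr_ge0 // ltW.
- by rewrite divr_ge0 // subr_ge0 ltW.
- by nra.
- by nra.
Qed.

End near_zero.

(** * Numerical inequalities for the small parameter e *)

Section arithmetic.
Context {R : realType}.
Implicit Types e s x y P : R.

Lemma tiny_le e : 0 < e -> (32 * 32 * 32) * e <= 1 -> 16 * e <= 1 /\ e <= 1 / 16.
Proof. by move=> e0 e1; split; lra. Qed.

(** A separation of 1/16 in direction lowers the real part by 1/512; the variation 20 e of [rho]
    over a box is less than half of that. *)
Lemma box_re_arith e x y : (32 * 32 * 32) * e <= 1 -> x <= 1 - (1 / 16) ^+ 2 / 2 -> y <= 20 * e ->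
  x + y <= 1 - 1 / (32 * 32).
Proof. by move=> e1 hx hy; lra. Qed.

Lemma sides_arith e : 0 < e -> e <= 1 / 16 -> 2 * (e + 3) ^+ 2 <= 32.
Proof. by move=> e0 e1; nra. Qed.

Lemma gain_le1 e x : 0 < e -> (32 * 32 * 32) * e <= 1 -> 0 < x <= 1 ->
  x * e ^+ 2 / (16 * 32) / (32 * 32) <= 1.
Proof.
move=> e0 e1 /andP[x0 x1].
have e21 : e ^+ 2 <= 1 by apply: exprn_ile1; lra.
have : x * e ^+ 2 <= 1 by rewrite -[leRHS]mulr1; apply: ler_pM => //; rewrite ?exprn_ge0 // ltW.
lra.
Qed.

End arithmetic.

(** * Points far from all zeros, and sufficiency of the box condition *)

Section far_zeros.
Context {R : realType}.
Local Notation C := (Cx R).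
Variables (alpha : nat -> C) (T : nat -> R) (J : (R -> R) -> R) (M : R) (c : C).
Hypotheses (zs : zero_seq alpha T) (bJ : bounded_functional J M) (pJ : positive_functional J).
Hypothesis c1 : modc c = 1.
Implicit Types (z w u : C) (g : C -> R).

Local Notation F := (inner_form alpha J c).
Local Notation P z := (Lam alpha J (pkernel z)).
Local Notation Q t0 l := (\1_(cbox_closure t0 l) : C -> R).
Local Notation weight n z := ((1 - modc (alpha n) ^+ 2) * pkernel z (alpha n)).

(** By [modc_rho] the squared modulus is at most 1/(1 - s), and (1 + s)^2 (1 - s) = 1 + s (1 - s -
    s^2) is at least 1 for s <= 1/2. *)
Lemma modc_rho_le z w (s : R) : modc z < 1 -> modc w <= 1 -> w != z -> 0 <= s <= 1 / 2 ->
  (1 - modc w ^+ 2) * pkernel z w <= s -> modc (rho z w) <= 1 + s.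
Proof.
move=> z1 w1 wz /andP[s0 s2] hs; have := modc_rho z1 w1 wz.
move: hs; set a := _ * pkernel _ _ => hs h.
have r0 : 0 <= modc (rho z w) := modc_ge0 _.
rewrite -(ler_pXn2r (n := 2)) ?nnegrE ?addr_ge0 //.
have x0 : 0 <= modc (rho z w) ^+ 2 by rewrite exprn_ge0.
move: h x0; move: (modc _ ^+ 2) => x h x0.
have h2 : x * (1 - s) <= 1 by rewrite -[leRHS]h ler_wpM2l // lerD2l lerN2.
have h3 : 1 <= (1 + s) ^+ 2 * (1 - s) by rewrite expr2; nra.
have s1 : 0 < 1 - s by lra.
by rewrite -(ler_pM2r s1); exact: le_trans h2 h3.
Qed.

Lemma Re_mul_kap u z w : modc z < 1 -> modc w <= 1 -> w != z ->
  complex.Re (u * kap z w) = pkernel z w * complex.Re (u * rho z w).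
Proof.
move=> z1 w1 wz; rewrite kap_rho //.
have -> : u * ((pkernel z w)%:C * rho z w) = (pkernel z w)%:C * (u * rho z w) by ring.
by move: (pkernel z w) (u * _) => p v; rewrite cReM /= mul0r subr0.
Qed.

(** For unimodular numbers |u^* - v|^2 = 2 - 2 Re(u v). *)
Lemma Re_unit_far (u v : C) (e : R) : modc u = 1 -> modc v = 1 -> e <= modc (u^*%C - v) -> 0 <= e ->
  complex.Re (u * v) <= 1 - e ^+ 2 / 2.
Proof.
move=> u1 v1 he e0.
have h : modc (u^*%C - v) ^+ 2 = 2 - 2 * complex.Re (u * v).
  apply: complexI; rewrite -mul_conjc.
  move: u1 v1 => /(congr1 (fun x => (x ^+ 2)%:C)) + /(congr1 (fun x => (x ^+ 2)%:C)).
  rewrite -!mul_conjc; case: u v {he} => [a b] [x y] /= h1 h2.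
  move: h1 h2; simpc => /= -[h1 _] [h2 _].
  apply/eqP; rewrite eq_complex /=; apply/andP; split; apply/eqP; last by ring.
  move: h1 h2; rewrite expr1n; lra.
have : e ^+ 2 <= modc (u^*%C - v) ^+ 2 by rewrite lerXn2r ?nnegrE ?modc_ge0.
rewrite h; lra.
Qed.

Lemma harnack_dist z z' w (a b D : R) : modc z < 1 -> modc z' < 1 -> modc w <= 1 ->
  1 - modc z = a -> 1 - modc z' = b -> modc (z - z') <= D ->
  pkernel z' w <= 2 * b / a * (1 + D / b) ^+ 2 * pkernel z w.
Proof.
move=> z1 z1' w1 ha hb hD; have a0 : 0 < a by rewrite -ha subr_gt0.
have b0 : 0 < b by rewrite -hb subr_gt0.
have D0 : 0 <= D := le_trans (modc_ge0 _) hD.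
have pk0 := pkernel_gt0 z1 w1.
apply: le_trans (harnack z1 z1' w1) _; rewrite ler_pM2r // hb.
have q0 : 0 < 1 - modc z ^+ 2 by rewrite sqr_modc_lt1.
have q0' : 0 < 1 - modc z' ^+ 2 by rewrite sqr_modc_lt1.
have m0 := modc_ge0 z; have m0' := modc_ge0 z'.
apply: ler_pM.
- by rewrite divr_ge0 // ltW.
- by rewrite exprn_ge0 // addr_ge0 // divr_ge0 ?modc_ge0 // ltW.
- apply: ler_pM.
  + exact: ltW.
  + by rewrite invr_ge0 ltW.
  + by move: hb m0' z1'; move: (modc z') => x; rewrite expr2; nra.
  + rewrite lef_pV2 ?posrE //.
    by move: ha m0 z1; move: (modc z) => x; rewrite expr2; nra.
- by rewrite lerXn2r ?nnegrE ?addr_ge0 ?divr_ge0 ?modc_ge0 ?(ltW b0) // lerD2l ler_pM2r ?invr_gt0.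
Qed.

(** In [rho_sub] the numerator is at most 5 l times 2 d, while both distances to the ray point are
    at least d/2 and d because the box is much thinner than d. *)
Lemma rho_box (d t0 t1 l : R) w : 0 < d <= 1 -> 0 < l -> 16 * l <= d ->
  cbox_closure t1 l w -> modc (rho (ray d t0) w - rho (ray d t0) (expi t1)) <= 20 * (l / d).
Proof.
move=> d01 l0 ld wQ; have /andP[d0 d1] := d01.
have l01 : 0 < l <= 1 by rewrite l0; lra.
have [w1 wl wc] := cbox_closure_bounds l01 wQ.
have z1 := modc_ray_lt1 t0 d01.
have zm := modc_ray t0 d01.
have wzd : d / 2 <= modc (w - ray d t0).
  have := ler_modc_sub w (ray d t0); rewrite zm; lra.
have xzd : d <= modc (expi t1 - ray d t0).
  have := ler_modc_sub (expi t1) (ray d t0); rewrite modc_expi zm; lra.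
have wz : w != ray d t0.
  apply/eqP => h; move: wzd; rewrite h subrr modc0; lra.
have s0 : 0 < 1 - modc (ray d t0) ^+ 2 by rewrite sqr_modc_lt1.
have s2 : 1 - modc (ray d t0) ^+ 2 <= 2 * d by rewrite zm; nra.
move: wzd xzd wz s0 s2 z1; move: (ray d t0) => z wzd xzd wz s0 s2 z1.
rewrite rho_sub ?expi_neq // modc_div !modcM modc_real modc_distC.
rewrite ger0_norm; last exact: ltW.
have p0 : 0 < modc (w - z) * modc (expi t1 - z) by rewrite mulr_gt0 //; lra.
rewrite ler_pdivrMr //.
apply: (@le_trans _ _ (5 * l * (2 * d))).
  by apply: ler_pM => //; [exact: modc_ge0 | exact: ltW].
apply: (@le_trans _ _ (20 * (l / d) * (d / 2 * d))).
  by rewrite le_eqVlt; apply/orP; left; apply/eqP; field; rewrite gt_eqF.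
rewrite ler_pM2l ?mulr_gt0 ?divr_gt0 ?invr_gt0 //; apply: ler_pM => //; lra.
Qed.

(** In [rho_sub] the chord is at least d/2, 1 - |z|^2 is at least d, and both denominators are at
    most 2d. Consequently any direction u^* is at distance at least 1/16 from one of the two values,
    which drives the cancellation. *)
Lemma rho_sides (d t0 : R) : 0 < d <= 1 ->
  1 / 8 <= modc (rho (ray d t0) (expi (t0 - d / 8)) - rho (ray d t0) (expi (t0 + d / 8))).
Proof.
move=> d01; have /andP[d0 d1] := d01.
have z1 := modc_ray_lt1 t0 d01; have zm := modc_ray t0 d01.
have near s : `|s - t0| <= d / 8 -> modc (expi s - ray d t0) <= 2 * d.
  move=> hs; have h1 := expi_lipschitz s t0.
  have -> : expi s - ray d t0 = (expi s - expi t0) + (ray 0 t0 - ray d t0).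
    by rewrite /ray subr0 mul1r; ring.
  apply: le_trans (ler_modcD _ _) _; rewrite (modc_ray_sub _ (ltW d0)); lra.
have xm : modc (expi (t0 - d / 8) - ray d t0) <= 2 * d.
  by apply: near; rewrite addrC addKr normrN ger0_norm // divr_ge0 // ltW.
have xp : modc (expi (t0 + d / 8) - ray d t0) <= 2 * d.
  by apply: near; rewrite addrC addKr ger0_norm // divr_ge0 // ltW.
have ch : d / 2 <= modc (expi (t0 + d / 8) - expi (t0 - d / 8)).
  have := @expi_sub_ge R (t0 + d / 8) (t0 - d / 8).
  have -> : t0 + d / 8 - (t0 - d / 8) = d / 4 by field.
  by rewrite ger0_norm ?divr_ge0 ?(ltW d0) //; lra.
have s2 : d <= 1 - modc (ray d t0) ^+ 2 by rewrite zm; nra.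
move: xm xp s2 z1; move: (ray d t0) => z xm xp s2 z1.
rewrite rho_sub ?expi_neq // modc_div !modcM modc_real.
rewrite ger0_norm; last by lra.
have nz s : 0 < modc (expi s - z) by rewrite modc_gt0 subr_eq0 expi_neq.
rewrite ler_pdivlMr ?mulr_gt0 //.
apply: (@le_trans _ _ (1 / 8 * (2 * d * (2 * d)))).
  by rewrite ler_pM2l ?divr_gt0 //; apply: ler_pM => //; exact: ltW.
apply: (@le_trans _ _ (d / 2 * d)); last by apply: ler_pM => //; lra.
by rewrite le_eqVlt; apply/orP; left; apply/eqP; field.
Qed.

(** By [sinh_ge] the relative gain is at least j^3 / (8 (1 + j + j^2/2)). For x0 <= 1 and j >= x0
    this is at least x0^3/20, with 20 = 8 (1 + 1 + 1/2). *)
Lemma sinh_gap (x0 j : R) : 0 < x0 <= 1 -> x0 <= j ->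
  (1 + x0 ^+ 3 / 20) * (expR (- j) * (2 * j)) <= 1 - expR (- j) ^+ 2.
Proof.
move=> /andP[x00 x01] xj; have j0 : 0 < j by lra.
have D0 : 0 < 4 * (1 + j + j ^+ 2 / 2) by nra.
have h1 : x0 ^+ 3 / 20 * (2 * j) <= j ^+ 4 / (4 * (1 + j + j ^+ 2 / 2)).
  rewrite ler_pdivlMr //.
  have h2 : x0 ^+ 3 * (2 * (1 + j + j ^+ 2 / 2)) <= 5 * j ^+ 3.
    have x2 : x0 ^+ 2 <= 1 by nra.
    have x3 : x0 ^+ 2 <= j ^+ 2 by nra.
    have x4 : x0 ^+ 3 <= j ^+ 3 by rewrite ler_pXn2r ?nnegrE // ltW.
    have x5 : x0 ^+ 3 * j <= j ^+ 3.
      have -> : j ^+ 3 = j ^+ 2 * j by ring.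
      rewrite ler_pM2r //; have -> : x0 ^+ 3 = x0 ^+ 2 * x0 by ring.
      by apply: le_trans x3; rewrite ler_piMr // exprn_ge0 // ltW.
    have x6 : x0 ^+ 3 * j ^+ 2 <= j ^+ 3.
      have -> : j ^+ 3 = j * j ^+ 2 by ring.
      rewrite ler_pM2r ?exprn_gt0 //; have -> : x0 ^+ 3 = x0 ^+ 2 * x0 by ring.
      by apply: le_trans xj; rewrite ler_piMl // ltW.
    lra.
  have -> : x0 ^+ 3 / 20 * (2 * j) * (4 * (1 + j + j ^+ 2 / 2)) =
     x0 ^+ 3 * (2 * (1 + j + j ^+ 2 / 2)) * (j / 5) by field.
  have -> : j ^+ 4 = 5 * j ^+ 3 * (j / 5) by field.
  by rewrite ler_pM2r // divr_gt0.
have := sinh_ge (ltW j0).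
have e0 := expR_gt0 (- j); have e1 : expR j * expR (- j) = 1 by rewrite -expRD subrr expR0.
move=> h; have h2 : (1 + x0 ^+ 3 / 20) * (2 * j) <= expR j - expR (- j) by rewrite mulrDl mul1r; lra.
have : expR (- j) * ((1 + x0 ^+ 3 / 20) * (2 * j)) <= expR (- j) * (expR j - expR (- j)) by rewrite ler_pM2l.
by rewrite mulrBr [expR (- j) * expR j]mulrC e1 expr2 mulrCA.
Qed.

Hypothesis F1 : forall z, modc z < 1 -> modc (F z) < 1.

(** Here a is the available gain in 2j exp(-j) <= 1 - exp(-2j) at j = P/2, and b a P bounds the
    logarithmic derivative. The bound |F| <= exp(-P/2) then serves both in the numerator and in the
    denominator of D_h. *)
Lemma Dh_gap z (a b : R) : modc z < 1 -> 0 <= a ->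
  a * (expR (- (P z / 2)) * P z) <= 1 - expR (- (P z / 2)) ^+ 2 ->
  (1 - modc z ^+ 2) * modc (derive1 F z) <= modc (F z) * (b * (a * P z)) -> 0 <= b -> Dh F z <= b.
Proof.
move=> z1 a0 ha hb b0; have fz := F1 z1; have y0 := modc_ge0 (F z).
have den : 0 < 1 - modc (F z) ^+ 2 by rewrite subr_gt0 exprn_ilt1.
rewrite /Dh ler_pdivrMr //; apply: le_trans hb _; rewrite mulrCA ler_wpM2l //.
have P0 := P_ge0 zs pJ z1.
have /andP[_ y2] := sqr_modc_inner_form zs bJ pJ c1 z1.
have e0 : 0 <= expR (- (P z / 2)) by rewrite ltW // expR_gt0.
have e2 : expR (- (P z / 2)) ^+ 2 = expR (- P z) by rewrite expr2 -expRD; congr expR; field.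
have ye : modc (F z) <= expR (- (P z / 2)).
  by rewrite -(ler_pXn2r (n := 2)) ?nnegrE // e2.
apply: (@le_trans _ _ (1 - expR (- (P z / 2)) ^+ 2)); last by rewrite lerD2l lerN2 e2.
apply: le_trans ha; rewrite mulrCA ler_wpM2l // ler_wpM2r //.
Qed.

Lemma Re_kap_le u z n (s : R) : modc z < 1 -> modc u = 1 -> 0 <= s <= 1 / 2 -> weight n z <= s ->
  complex.Re (u * rho z (alpha n)) <= 1 + s.
Proof.
move=> z1 u1 s01 ws; have [a1 _ _] := zs.
have az : alpha n != z by apply: (alpha_neq zs z1); apply: le_lt_trans ws _; case/andP: s01; lra.
apply: le_trans (ler_Re_modc _) _; rewrite modcM u1 mul1r.
exact: modc_rho_le ws.
Qed.

Lemma large_mass_bound z (p0 s : R) : modc z < 1 -> 0 < p0 <= 2 -> p0 <= P z -> 0 <= s <= 1 / 2 ->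
  (forall n, weight n z <= s) -> Dh F z <= (1 + s) / (1 + (p0 / 2) ^+ 3 / 20).
Proof.
move=> z1 /andP[p00 p2] hp s01 ws; have /andP[s0 s1] := s01; have [a1 _ _] := zs.
have x0 : 0 < p0 / 2 <= 1 by apply/andP; split; [rewrite divr_gt0 | lra].
have t0 : 0 < 1 + (p0 / 2) ^+ 3 / 20.
  by have /andP[h _] := x0; rewrite addr_gt0 // divr_gt0 // exprn_gt0.
apply: (Dh_gap z1 (ltW t0)).
- have h : p0 / 2 <= P z / 2 by lra.
  by have := sinh_gap x0 h; have -> : 2 * (P z / 2) = P z by field.
- have -> : (1 + s) / (1 + (p0 / 2) ^+ 3 / 20) * ((1 + (p0 / 2) ^+ 3 / 20) * P z) = (1 + s) * P z.
    by move: t0; set q := 1 + _ => q0; field; rewrite gt_eqF.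
  have ag := adC_pkernel z1.
  have az i : alpha i != z by apply: (alpha_neq zs z1); apply: le_lt_trans (ws i) _; lra.
  apply: (derive1_inner_form_le zs bJ pJ c1 z1 az) => u u1.
  exists (fun w => (1 + s) * pkernel z w); split.
  + exact: adCZ.
  + by move=> w w1; rewrite mulr_ge0 ?addr_ge0 // ltW // pkernel_gt0.
  + by rewrite (LamZ zs bJ).
  + move=> i; rewrite Re_mul_kap // mulrC ler_wpM2r ?(ltW (pkernel_gt0 z1 (a1 i))) //.
    exact: Re_kap_le.
  + move=> t; have pk := pkernel_gt0 z1 (_ : modc (expi t) <= 1).
    rewrite Re_mul_kap ?modc_expi ?expi_neq // mulrC ler_wpM2r ?(ltW (pk _)) ?modc_expi //.
    apply: le_trans (ler_Re_modc _) _; rewrite modcM u1 mul1r modc_rho_expi //; lra.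
- by apply: divr_ge0; [exact: addr_ge0 | exact: ltW].
Qed.

(** The two points are at distance at most 3d. Harnack then gives 2 (e + 3)^2 / e in one direction
    and (2/e) times 16 in the other, both at most 32/e. *)
Lemma P_sides (d t0 t1 e : R) : 0 < d <= 1 -> 0 < e <= 1 / 16 -> modc (expi t1 - expi t0) <= d ->
  P (ray (e * d) t1) <= 32 / e * P (ray d t0) /\ P (ray d t0) <= 32 / e * P (ray (e * d) t1).
Proof.
move=> d01 /andP[e0 e1] ht; have /andP[d0 d1] := d01.
have l0 : 0 < e * d by rewrite mulr_gt0.
have ld : e * d <= d / 16 by move: (ler_wpM2r (ltW d0) e1); lra.
have l01 : 0 < e * d <= 1 by rewrite l0; lra.
have z1 := modc_ray_lt1 t0 d01; have q1 := modc_ray_lt1 t1 l01.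
have ds : modc (ray d t0 - ray (e * d) t1) <= 3 * d.
  have -> : ray d t0 - ray (e * d) t1 = (ray d t0 - ray 0 t0) + (expi t0 - expi t1) + (ray 0 t1 - ray (e * d) t1).
    by rewrite /ray subr0 !mul1r; ring.
  apply: le_trans (ler_modcD _ _) _; rewrite (modc_ray_sub _ (ltW l0)).
  have := ler_modcD (ray d t0 - ray 0 t0) (expi t0 - expi t1).
  rewrite modc_distC (modc_ray_sub _ (ltW d0)) [modc (expi t0 - _)]modc_distC; lra.
have zE : 1 - modc (ray d t0) = d by rewrite modc_ray //; ring.
have qE : 1 - modc (ray (e * d) t1) = e * d by rewrite modc_ray //; ring.
have P0 := P_ge0 zs pJ z1; have P1 := P_ge0 zs pJ q1.
have en : 0 < e <= 1 / 16 by rewrite e0.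
split.
  have h w (w1 : modc w <= 1) := harnack_dist z1 q1 w1 zE qE ds.
  apply: le_trans (P_le zs bJ pJ z1 q1 h) _.
  rewrite ler_wpM2r //.
  have -> : 2 * (e * d) / d * (1 + 3 * d / (e * d)) ^+ 2 = 2 * (e + 3) ^+ 2 / e.
    by field; rewrite !gt_eqF.
  by rewrite ler_pM2r ?invr_gt0 // sides_arith.
rewrite modc_distC in ds.
have h w (w1 : modc w <= 1) := harnack_dist q1 z1 w1 qE zE ds.
apply: le_trans (P_le zs bJ pJ q1 z1 h) _.
rewrite ler_wpM2r //.
have -> : 2 * d / (e * d) * (1 + 3 * d / d) ^+ 2 = 32 / e by field; rewrite !gt_eqF.
exact: lexx.
Qed.

Variable C0 : R.
Hypothesis C01 : 0 < C0 <= 1.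
Hypothesis Hbox : forall t0 l, 0 < l <= 1 -> P (ray l t0) <= C0 ->
  C0 * P (ray l t0) <= Lam alpha J (Q t0 l) / l.

(** Smallness of P at depth d carries over to the apex of the side box through [P_sides], so the box
    condition is available there. The kernel is at least d/(4d)^2 on the box, the apex has at least
    e/32 of the mass and the box has size e d, whence the factor e^2/(16 * 32). *)
Lemma side_mass (d t0 t1 e : R) : 0 < d <= 1 -> 0 < e <= 1 / 16 -> modc (expi t1 - expi t0) <= d ->
  P (ray d t0) <= C0 * e / 32 ->
  C0 * e ^+ 2 / (16 * 32) * P (ray d t0) <= Lam alpha J (fun w => pkernel (ray d t0) w * Q t1 (e * d) w).
Proof.
move=> d01 e01 ht hP; have /andP[d0 d1] := d01; have /andP[e0 e1] := e01; have /andP[C00 C1] := C01.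
have [h1 h2] := P_sides d01 e01 ht.
have l0 : 0 < e * d by rewrite mulr_gt0.
have ld : e * d <= d / 16 by move: (ler_wpM2r (ltW d0) e1); lra.
have l01 : 0 < e * d <= 1 by rewrite l0; lra.
have z1 := modc_ray_lt1 t0 d01.
have hC : P (ray (e * d) t1) <= C0.
  apply: le_trans h1 _; apply: (@le_trans _ _ (32 / e * (C0 * e / 32))).
    by rewrite ler_pM2l ?divr_gt0.
  by rewrite le_eqVlt; apply/orP; left; apply/eqP; field; rewrite gt_eqF.
have hb := Hbox l01 hC; rewrite ler_pdivlMr // in hb.
have aq := adC_box t1 (e * d).
have low : d / (4 * d) ^+ 2 * Lam alpha J (Q t1 (e * d)) <= Lam alpha J (fun w => pkernel (ray d t0) w * Q t1 (e * d) w).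
  rewrite -(LamZ zs bJ) //; apply: (Lam_le zs bJ pJ).
  - exact: adCZ.
  - by apply: adCM => //; exact: adC_pkernel.
  - move=> w w1; have [wQ|wQ] := pselect (cbox_closure t1 (e * d) w); last first.
      have -> : Q t1 (e * d) w = 0 by rewrite indicE memNset.
      by rewrite !mulr0.
    have -> : Q t1 (e * d) w = 1 by rewrite indicE mem_set.
    rewrite !mulr1; have [_ _ h] := cbox_closure_bounds l01 wQ.
    apply: pkernel_ray_ge => //.
    have -> : w - expi t0 = (w - expi t1) + (expi t1 - expi t0) by ring.
    have := ler_modcD (w - expi t1) (expi t1 - expi t0); lra.
apply: le_trans low.
have k0 : 0 < d / (4 * d) ^+ 2 by rewrite divr_gt0 ?exprn_gt0 ?mulr_gt0.
apply: (@le_trans _ _ (d / (4 * d) ^+ 2 * (C0 * (e / 32 * P (ray d t0)) * (e * d)))).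
  by rewrite le_eqVlt; apply/orP; left; apply/eqP; field; rewrite gt_eqF.
rewrite ler_pM2l //; apply: le_trans hb; rewrite ler_pM2r // ler_pM2l //.
rewrite mulrAC ler_pdivrMr //; move: h2; rewrite mulrAC ler_pdivlMr //.
by move: (P _) (P _) => a b; rewrite [e * _]mulrC [_ * 32]mulrC.
Qed.

Lemma box_re (d t0 t1 e : R) u w : 0 < d <= 1 -> 0 < e -> (32 * 32 * 32) * e <= 1 -> modc u = 1 ->
  1 / 16 <= modc (u^*%C - rho (ray d t0) (expi t1)) -> cbox_closure t1 (e * d) w ->
  complex.Re (u * rho (ray d t0) w) <= 1 - 1 / (32 * 32).
Proof.
move=> d01 e0 e1 u1 far wQ; have /andP[d0 d1] := d01.
have z1 := modc_ray_lt1 t0 d01.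
have [e16 _] := tiny_le e0 e1.
have ld : 16 * (e * d) <= d by rewrite mulrA ler_piMl // ltW.
have := rho_box t0 d01 (mulr_gt0 e0 d0) ld wQ; rewrite mulfK ?gt_eqF // => h.
have h16 : 0 <= 1 / 16 :> R by rewrite divr_ge0.
have hf := Re_unit_far u1 (modc_rho_expi t1 z1) far h16.
have -> : u * rho (ray d t0) w = u * rho (ray d t0) (expi t1) + u * (rho (ray d t0) w - rho (ray d t0) (expi t1)).
  by ring.
rewrite cReD; have := ler_Re_modc (u * (rho (ray d t0) w - rho (ray d t0) (expi t1))).
rewrite modcM u1 mul1r => /le_trans/(_ h).
exact: box_re_arith.
Qed.

(** The majorant is (1 + s) times the kernel, lowered on the side box by 1/1024 of the kernel,
    because there [rho] is nearly constant and points away from u^*. [side_mass] turns this into a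
    saving proportional to P, with a constant independent of u. *)
Lemma box_test (d t0 t1 e s : R) u : 0 < d <= 1 -> 0 < e -> (32 * 32 * 32) * e <= 1 -> modc u = 1 ->
  modc (expi t1 - expi t0) <= d -> 1 / 16 <= modc (u^*%C - rho (ray d t0) (expi t1)) ->
  P (ray d t0) <= C0 * e / 32 -> 0 <= s <= 1 / 2 -> (forall n, weight n (ray d t0) <= s) ->
  exists g, [/\ adC g, forall w, modc w <= 1 -> 0 <= g w,
    Lam alpha J g <= (1 + s - (C0 * e ^+ 2 / (16 * 32)) / (32 * 32)) * P (ray d t0),
    (forall i, complex.Re (u * kap (ray d t0) (alpha i)) <= g (alpha i)) &
    (forall t, complex.Re (u * kap (ray d t0) (expi t)) <= g (expi t))].
Proof.
move=> d01 e0 e1 u1 ht far hP s01 ws; have /andP[s0 s1] := s01; have [a1 _ _] := zs.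
have e01 : 0 < e <= 1 / 16 by rewrite e0; have [] := tiny_le e0 e1.
have sm := side_mass d01 e01 ht hP.
have br w := @box_re d t0 t1 e u w d01 e0 e1 u1 far.
have z1 := modc_ray_lt1 t0 d01.
move: sm br z1 ws; move: (ray d t0) => z sm br z1 ws.
pose k : R := 1 / (32 * 32).
have k01 : 0 <= k <= 1 by rewrite /k; apply/andP; split; lra.
rewrite -/k in br.
have ag := adC_pkernel z1; have aq : adC (fun w => pkernel z w * Q t1 (e * d) w).
  by apply: adCM => //; exact: adC_box.
have key w : modc w <= 1 -> w != z -> complex.Re (u * rho z w) <= 1 + s ->
    complex.Re (u * kap z w) <= (1 + s) * pkernel z w + - k * (pkernel z w * Q t1 (e * d) w).
  move=> w1 wz hr; have pk := pkernel_gt0 z1 w1; rewrite Re_mul_kap //.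
  have -> : (1 + s) * pkernel z w + - k * (pkernel z w * Q t1 (e * d) w) =
    pkernel z w * (1 + s - k * Q t1 (e * d) w) by ring.
  rewrite ler_pM2l //; have [wQ|wQ] := pselect (cbox_closure t1 (e * d) w); last first.
    have -> : Q t1 (e * d) w = 0 by rewrite indicE memNset.
    by rewrite mulr0 subr0.
  have -> : Q t1 (e * d) w = 1 by rewrite indicE mem_set.
  by apply: le_trans (br w wQ) _; rewrite mulr1 lerD2r lerDl.
exists (fun w => (1 + s) * pkernel z w + - k * (pkernel z w * Q t1 (e * d) w)); split.
- by apply: adCD; apply: adCZ.
- move=> w w1; have pk := pkernel_gt0 z1 w1; case/andP: k01 => k0 k1.
  have -> : (1 + s) * pkernel z w + - k * (pkernel z w * Q t1 (e * d) w) =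
    pkernel z w * (1 + s - k * Q t1 (e * d) w) by ring.
  rewrite mulr_ge0 ?(ltW pk) // indicE; case: (_ \in _) => /=; lra.
- rewrite (LamD zs bJ (adCZ _ ag) (adCZ _ aq)) (LamZ zs bJ _ ag) (LamZ zs bJ _ aq).
  case/andP: k01 => k0 _; have := ler_wpM2l k0 sm.
  have -> : C0 * e ^+ 2 / (16 * 32) / (32 * 32) = k * (C0 * e ^+ 2 / (16 * 32)).
    by rewrite /k mul1r mulrC.
  move: (C0 * _ / _) => A h.
  have -> : (1 + s - k * A) * P z = (1 + s) * P z - k * (A * P z) by ring.
  by rewrite mulNr lerD2l lerN2.
- move=> i; apply: key => //; last exact: Re_kap_le.
  by apply: (alpha_neq zs z1); apply: le_lt_trans (ws i) _; lra.
- move=> t; apply: key; rewrite ?modc_expi ?expi_neq //.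
  apply: le_trans (ler_Re_modc _) _; rewrite modcM u1 mul1r modc_rho_expi //; lra.
Qed.

Lemma small_mass_bound z (s e : R) : modc z < 1 -> 0 < e -> (32 * 32 * 32) * e <= 1 ->
  P z <= C0 * e / 32 -> 0 <= s <= 1 / 2 -> (forall n, weight n z <= s) ->
  Dh F z <= 1 + s - (C0 * e ^+ 2 / (16 * 32)) / (32 * 32).
Proof.
move=> z1 e0 e1 hP s01 ws; have /andP[s0 s1] := s01; have /andP[C00 C1] := C01.
have az i : alpha i != z by apply: (alpha_neq zs z1); apply: le_lt_trans (ws i) _; lra.
have [t0 zE] := polar z1; set d := 1 - modc z in zE.
have d01 : 0 < d <= 1 by rewrite subr_gt0 z1 /= /d gerBl modc_ge0.
have /andP[d0 d1] := d01; clearbody d.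
have side (x : R) : `|x| <= d / 8 -> modc (expi (t0 + x) - expi t0) <= d.
  by move=> hx; have := expi_lipschitz (t0 + x) t0; rewrite [t0 + x - t0]addrC addKr; lra.
have hd : `|d / 8| <= d / 8 by rewrite ger0_norm // divr_ge0 // ltW.
have hn : `|- (d / 8)| <= d / 8 by rewrite normrN.
pose q := C0 * e ^+ 2 / (16 * 32) / (32 * 32).
have q1 : q <= 1 by exact: gain_le1.
have P0 := P_ge0 zs pJ z1.
apply: (@Dh_gap z 1) => //; last by rewrite -/q; lra.
  have hp : 0 <= P z / 2 by rewrite divr_ge0.
  by rewrite mul1r; have := exp_pick hp; have -> : 2 * (P z / 2) = P z by field.
rewrite [1 * P z]mul1r; apply: (derive1_inner_form_le zs bJ pJ c1 z1 az) => u u1.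
move: z1 hP ws; rewrite zE => z1 hP ws.
(* Whatever u is, it cannot be aligned with both sides; the box on the side that is at least 1/16
   away is used. *)
have sep : 1 / 8 <= modc (u^*%C - rho (ray d t0) (expi (t0 + d / 8))) + modc (u^*%C - rho (ray d t0) (expi (t0 - d / 8))).
  apply: le_trans (rho_sides t0 d01) _.
  have -> : rho (ray d t0) (expi (t0 - d / 8)) - rho (ray d t0) (expi (t0 + d / 8)) =
    (u^*%C - rho (ray d t0) (expi (t0 + d / 8))) - (u^*%C - rho (ray d t0) (expi (t0 - d / 8))) by ring.
  by apply: le_trans (ler_modcD _ _) _; rewrite modcN.
have [h|h] := leP (1 / 16) (modc (u^*%C - rho (ray d t0) (expi (t0 + d / 8)))).
  exact: (box_test d01 e0 e1 u1 (side _ hd) h hP s01 ws).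
have h2 : 1 / 16 <= modc (u^*%C - rho (ray d t0) (expi (t0 - d / 8))).
  move: sep h; move: (modc _) (modc _) => x y; lra.
exact: (box_test d01 e0 e1 u1 (side _ hn) h2 hP s01 ws).
Qed.

Lemma box_contractive : exists k : R, k < 1 /\ forall z, modc z < 1 -> Dh F z <= k.
Proof.
have /andP[C00 C1] := C01.
have [e e0 e1] : exists2 e : R, 0 < e & 32 * 32 * 32 * e <= 1.
  by exists (32 * 32 * 32)^-1; rewrite ?invr_gt0 ?mulr_gt0 // mulfV // !mulf_neq0 // pnatr_eq0.
(* [p0] separates small from large mass; [q] is the gain by cancellation below it and [th] the gain
   of [sinh_gap] above it. *)
pose p0 := C0 * e / 32; pose q := C0 * e ^+ 2 / (16 * 32) / (32 * 32); pose th := (p0 / 2) ^+ 3 / 20.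
have p00 : 0 < p0 by rewrite divr_gt0 ?mulr_gt0.
have p02 : p0 <= 2.
  have [_ e16] := tiny_le e0 e1.
  have : C0 * e <= 1 by rewrite -[leRHS]mulr1; apply: ler_pM => //; [exact: ltW | exact: ltW | lra].
  by rewrite /p0; move: (C0 * e) => x; lra.
have q0 : 0 < q by rewrite !divr_gt0 ?mulr_gt0 ?exprn_gt0.
have th0 : 0 < th by rewrite divr_gt0 // exprn_gt0 // divr_gt0.
(* Fixed last: the loss s due to far zeros must be beaten by both gains, and the bound near zeros is
   available for every positive s. *)
pose s := Num.min (1 / 2) (Num.min (q / 2) (th / 2)).
have s0 : 0 < s by rewrite !lt_min; apply/and3P; split; apply: divr_gt0.
have [s2 sq st] : [/\ s <= 1 / 2, s <= q / 2 & s <= th / 2].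
  by rewrite /s !ge_min !lexx ?orbT.
have s1 : 0 < s <= 1 by rewrite s0 /=; lra.
have s02 : 0 <= s <= 1 / 2 by rewrite ltW.
have [k0 [k01 hk0]] := close_zero_bound zs bJ pJ c1 C01 Hbox s1.
exists (Num.max k0 (Num.max ((1 + s) / (1 + th)) (1 + s - q))); split.
  rewrite !gt_max k01 /= ltr_pdivrMr; last by lra.
  by apply/andP; split; lra.
move=> z z1; rewrite !le_max.
have [[n hn]|hw] := pselect (exists n, s <= weight n z).
  by rewrite (hk0 z n).
have ws n : weight n z <= s by rewrite leNgt; apply/negP => h; apply: hw; exists n; exact: ltW.
have [h|/ltW h] := leP p0 (P z).
  by rewrite (large_mass_bound z1 _ h) ?p00 ?orbT.
by rewrite (small_mass_bound z1 e0 e1 h) ?orbT.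
Qed.

End far_zeros.

(** * Assembly of the equivalence *)

Section assembly.
Context {R : realType}.
Local Notation C := (Cx R).
Implicit Types (f : C -> C) (z : C).

(** Nonnegativity of [Dh] keeps the supremum from being minus infinity, so that together with the
    bound below 1 it is finite and serves as the real constant. *)
Lemma contractiveP f : (forall z, modc z < 1 -> 0 <= Dh f z) ->
  contractive f <-> exists k : R, k < 1 /\ forall z, modc z < 1 -> Dh f z <= k.
Proof.
move=> D0; split => [|[k [k1 hk]]]; last first.
  rewrite /contractive; apply: (@le_lt_trans _ _ k%:E); last by rewrite lte_fin.
  apply: ge_ereal_sup => _ [z z1 <-]; rewrite lee_fin; apply: hk.
  by rewrite -norm_lt1.
rewrite /contractive; set S := [set _ | _ in _]; move=> S1.
have ub z : modc z < 1 -> ((Dh f z)%:E <= ereal_sup S)%E.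
  by move=> z1; apply: ereal_sup_ubound; exists z => //=; rewrite norm_lt1.
have z0 : modc (0 : C) < 1 by rewrite modc0.
have h0 : (0 <= ereal_sup S)%E.
  by apply: le_trans (ub 0 z0); rewrite lee_fin; exact: D0.
have fS : ereal_sup S \is a fin_num by rewrite ge0_fin_numE //; apply: lt_le_trans S1 _; rewrite leey.
exists (fine (ereal_sup S)); split; first by rewrite -lte_fin fineK.
by move=> z z1; rewrite -lee_fin fineK //; exact: ub.
Qed.

Lemma Dh_eq f g z : (forall w, modc w < 1 -> f w = g w) -> hol g -> modc z < 1 -> Dh f z = Dh g z.
Proof.
move=> fg hg z1; suff dE : derive1 f z = derive1 g z by rewrite /Dh dE fg.
have r0 : 0 < 1 - modc z by rewrite subr_gt0.
apply: qd_derive1; apply: (qd_eq r0 _ (hol_qd hg z1)) => w hw; rewrite fg //.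
by have := ler_modcD (w - z) z; rewrite subrK; lra.
Qed.

End assembly.

Theorem theorem2 (R : realType) (f E B : Cx R -> Cx R)
    (nu : {measure set (measurableTypeR R) -> \bar R}) :
  analytic_self_map f ->
  is_outer E -> is_blaschke B -> singular_circle_measure nu ->
  (forall z : Cx R, `|z| < 1 -> f z = E z * B z * sing_inner nu z) ->
  (contractive f <->
   exists C : R, 0 < C /\
     forall t0 l : R, 0 < l <= 1 ->
       (Pmu f nu (zQ t0 l) <= C%:E)%E ->
       (C%:E * Pmu f nu (zQ t0 l) <= mu f nu (cbox_closure t0 l) * (l^-1)%:E)%E).
Proof.
move=> fa fE fB nus ffac; have [nufin _] := nus.
have [c [alpha [T [k [c1 zs [ik k0] fF fk]]]]] := canonical_form fa fE fB nus ffac.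
have bJ := bounded_mass nufin ik; have pJ := positive_mass nu k0.
set J := mass nu k in bJ pJ fF.
have F1 z : modc z < 1 -> modc (inner_form alpha J c z) < 1.
  by move=> z1; rewrite -[inner_form _ _ _ _]fF // -norm_lt1; apply: (fa z _).2; rewrite norm_lt1.
have hF := hol_inner_form c zs bJ.
have DE z : modc z < 1 -> Dh f z = Dh (inner_form alpha J c) z.
  by move=> z1; apply: Dh_eq.
have D0 z : modc z < 1 -> 0 <= Dh f z.
  move=> z1; rewrite DE // /Dh mulr_ge0 // ?invr_ge0 ?subr_ge0 ?mulr_ge0 ?modc_ge0 ?subr_ge0 //.
    by rewrite exprn_ile1 ?modc_ge0 // ltW.
  by rewrite exprn_ile1 ?modc_ge0 // ltW // F1.
have PE t0 l : 0 < l <= 1 -> Pmu f nu (zQ t0 l) = (Lam alpha J (pkernel (ray l t0)))%:E.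
  by move=> l01; rewrite zQ_ray; apply: (PmuE nufin zs ik k0 c1 fF fk); exact: modc_ray_lt1.
have ME t0 l : mu f nu (cbox_closure t0 l) = (Lam alpha J (\1_(cbox_closure t0 l)))%:E.
  by apply: (muE nufin zs ik k0 c1 fF fk); exact: measurable_expi_closure.
split.
  move/(contractiveP D0) => [q [q1 hq]].
  have hq' z : modc z < 1 -> Dh (inner_form alpha J c) z <= q by move=> z1; rewrite -DE //; exact: hq.
  have [C0 [C00 H]] := contractive_box zs bJ pJ c1 F1 q1 hq'.
  exists C0; split=> // t0 l l01; rewrite PE // ME !lee_fin => hP.
  exact: H.
move=> [C [C0 H]]; apply/(contractiveP D0).
(* The condition in (b) weakens when the constant decreases: fewer boxes are tested and less mass is
   demanded of each. Hence the constant may be taken at most 1. *)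
pose C1 := Num.min C 1; have C01 : 0 < C1 <= 1 by rewrite lt_min C0 ltr01 ge_min lexx orbT.
have C1C : C1 <= C by rewrite ge_min lexx.
have Hb t0 l : 0 < l <= 1 -> Lam alpha J (pkernel (ray l t0)) <= C1 ->
    C1 * Lam alpha J (pkernel (ray l t0)) <= Lam alpha J (\1_(cbox_closure t0 l)) / l.
  move=> l01 hP; have := H t0 l l01; rewrite PE // ME !lee_fin => /(_ (le_trans hP C1C)).
  apply: le_trans; rewrite ler_wpM2r //; apply: (P_ge0 zs pJ); exact: modc_ray_lt1.
have [q [q1 hq]] := box_contractive zs bJ pJ c1 F1 C01 Hb.
by exists q; split=> // z z1; rewrite DE //; exact: hq.
Qed.
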